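(* Let $\mathbb{Z}$ denote the constant sheaf of integers on $\Gamma\backslash D$. Then $$H^k(\Gamma\backslash D;\mathbb{Z})=\begin{cases}\mathbb{Z}& k=0,2,\\ 0& k=1\text{ or }k\ge3.\end{cases}$$
   Context: Let $H=\begin{pmatrix}0&0&i\\0&-1&0\\-i&0&0\end{pmatrix}$, $G=\mathrm{SU}(2,1)=\{g\in \mathrm{SL}(3,\mathbb{C}) : g^*Hg=H\}$, $\Gamma=G\cap\mathrm{SL}_3(\mathbb{Z}[i])$, $K=\{g\in G:(g^* )^{-1}=g\}$, $D=G/K$ the associated symmetric space, on which $\Gamma$ acts by left multiplication. *)

(* Defs.v *)
From HB Require Import structures.
From mathcomp Require Import all_boot all_order all_algebra complex.
From mathcomp Require Import all_classical all_reals all_analysis.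

Set Implicit Arguments.
Unset Strict Implicit.
Unset Printing Implicit Defensive.

Import GRing.Theory Num.Theory.
Import numFieldNormedType.Exports.

Local Open Scope classical_set_scope.
Local Open Scope quotient_scope.
Local Open Scope ring_scope.

Definition dprod (I : Type) (A : I -> zmodType) : Type := forall i, A i.

Section Dprod.
Variables (I : Type) (A : I -> zmodType).

HB.instance Definition _ := gen_eqMixin (dprod A).
HB.instance Definition _ := gen_choiceMixin (dprod A).

Let dpzero : dprod A := fun=> 0.
Let dpopp (f : dprod A) : dprod A := fun i => - f i.
Let dpadd (f g : dprod A) : dprod A := fun i => f i + g i.

Let dpaddA : associative dpadd.
Proof. by move=> f g h; apply/functional_extensionality_dep => i; apply: addrA. Qed.

Let dpaddC : commutative dpadd.
Proof. by move=> f g; apply/functional_extensionality_dep => i; apply: addrC. Qed.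

Let dpadd0 : left_id dpzero dpadd.
Proof. by move=> f; apply/functional_extensionality_dep => i; apply: add0r. Qed.

Let dpaddN : left_inverse dpzero dpopp dpadd.
Proof. by move=> f; apply/functional_extensionality_dep => i; apply: addNr. Qed.

HB.instance Definition _ :=
  GRing.isZmodule.Build (dprod A) dpaddA dpaddC dpadd0 dpaddN.

End Dprod.

Section Image.
Variables (A B : zmodType) (f : {additive A -> B}).

Definition im_pred : {pred B} := fun y => `[< exists x, f x = y >].

Fact im_zmod_closed : zmod_closed im_pred.
Proof.
split; first by apply/asboolP; exists 0; rewrite raddf0.
move=> _ _ /asboolP[x <-] /asboolP[y <-].
by apply/asboolP; exists (x - y); rewrite raddfB.
Qed.

HB.instance Definition _ := GRing.isZmodClosed.Build B im_pred im_zmod_closed.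

Definition coker : zmodType := Quotient.quot im_pred.

Definition coker_pi (y : B) : coker := \pi_coker y.

Fact coker_pi_additive : zmod_morphism coker_pi.
Proof. by move=> x y; rewrite /coker_pi Quotient.pi_add Quotient.pi_opp. Qed.

HB.instance Definition _ := GRing.isZmodMorphism.Build B coker coker_pi
  coker_pi_additive.

End Image.

Section CokerMap.
Variables (A B A' B' : zmodType).
Variables (f : {additive A -> B}) (f' : {additive A' -> B'}).
Variable g : {additive B -> B'}.
Hypothesis gf : forall x, exists x', g (f x) = f' x'.

Definition coker_map of (forall x, exists x', g (f x) = f' x') :=
  fun y : coker f => coker_pi f' (g (repr y)).

Lemma coker_piP (y z : B) : coker_pi f y = coker_pi f z <-> exists x, f x = y - z.
Proof.
rewrite /coker_pi; split=> [/eqP|yz].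
  by rewrite -Quotient.idealrBE => /asboolP.
by apply/eqP; rewrite -Quotient.idealrBE; apply/asboolP.
Qed.

Lemma coker_mapE y : coker_map gf (coker_pi f y) = coker_pi f' (g y).
Proof.
rewrite /coker_map; set z := repr _.
have /coker_piP[x xE] : coker_pi f z = coker_pi f y by rewrite /z /coker_pi reprK.
apply/eqP; rewrite -subr_eq0 -raddfB -raddfB -xE; have [x' ->] := gf x.
rewrite -[0](raddf0 (coker_pi f')) /coker_pi -Quotient.idealrBE subr0.
by apply/asboolP; exists x'.
Qed.

Fact coker_map_additive : zmod_morphism (coker_map gf).
Proof.
move=> x y; rewrite -[x]reprK -[y]reprK -!/(coker_pi f _) -raddfB !coker_mapE.
by rewrite !raddfB.
Qed.

HB.instance Definition _ := GRing.isZmodMorphism.Build (coker f) (coker f')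
  (coker_map gf) coker_map_additive.

End CokerMap.

Section Homology.
Variables (A B C : zmodType) (d' : {additive A -> B}) (d : {additive B -> C}).

Definition ker_pred : {pred B} := fun y => d y == 0.

Fact ker_zmod_closed : zmod_closed ker_pred.
Proof.
split; first by rewrite unfold_in raddf0.
by move=> x y; rewrite !unfold_in raddfB => /eqP-> /eqP->; rewrite subr0.
Qed.

HB.instance Definition _ := GRing.isZmodClosed.Build B ker_pred ker_zmod_closed.

Record cycle := Cycle { cycle_val : B; cycleP : cycle_val \in ker_pred }.

HB.instance Definition _ := [isSub for cycle_val].
HB.instance Definition _ := [Choice of cycle by <:].
HB.instance Definition _ := [SubChoice_isSubZmodule of cycle by <:].

Definition boundary_pred : {pred cycle} :=
  fun z => `[< exists x, d' x = cycle_val z >].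

Fact boundary_zmod_closed : zmod_closed boundary_pred.
Proof.
split; first by apply/asboolP; exists 0; rewrite !raddf0.
move=> y z /asboolP[x xy] /asboolP[w wz].
by apply/asboolP; exists (x - w); rewrite !raddfB xy wz.
Qed.

HB.instance Definition _ :=
  GRing.isZmodClosed.Build cycle boundary_pred boundary_zmod_closed.

Definition homology : zmodType := Quotient.quot boundary_pred.

End Homology.

Record opens (X : topologicalType) := Opens {
  oset :> set X ;
  open_oset : open oset
}.

Record presheaf (X : topologicalType) := Presheaf {
  sec : opens X -> zmodType ;
  res : forall U V : opens X, V `<=` U -> {additive sec U -> sec V} ;
  res_id : forall (U : opens X) (h : U `<=` U) s, res h s = s ;
  res_comp : forall (U V W : opens X) (h : V `<=` U) (h' : W `<=` V)
    (h'' : W `<=` U) s, res h' (res h s) = res h'' s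
}.

Record presheaf_hom (X : topologicalType) (F G : presheaf X) := PresheafHom {
  app : forall U, {additive sec F U -> sec G U} ;
  app_res : forall (U V : opens X) (h : V `<=` U) s,
    app V (res F h s) = res G h (app U s)
}.

Lemma resC (X : topologicalType) (F : presheaf X) (U V W : opens X)
  (h : V `<=` U) (h' : W `<=` V) (h'' : W `<=` U) (s : sec F U) :
  res F h' (res F h s) = res F h'' s.
Proof. exact: res_comp. Qed.

Section Opens.
Variable X : topologicalType.

Definition opensT : opens X := Opens openT.
Definition opensI (U V : opens X) : opens X :=
  Opens (openI (open_oset U) (open_oset V)).

Lemma opensIl (U V : opens X) : opensI U V `<=` U.
Proof. exact: subIsetl. Qed.

Lemma opensIr (U V : opens X) : opensI U V `<=` V.
Proof. exact: subIsetr. Qed.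

End Opens.

Section Stalk.
Variables (X : topologicalType) (F : presheaf X) (x : X).

Record germ_rep := GermRep {
  germ_nbhd : opens X ;
  germ_mem : oset germ_nbhd x ;
  germ_sec : sec F germ_nbhd
}.

HB.instance Definition _ := gen_eqMixin germ_rep.
HB.instance Definition _ := gen_choiceMixin germ_rep.

Definition germ_eq_on (a b : germ_rep) (W : opens X) :=
  exists (ha : W `<=` germ_nbhd a) (hb : W `<=` germ_nbhd b),
    res F ha (germ_sec a) = res F hb (germ_sec b).

Definition germ_eq (a b : germ_rep) : bool :=
  `[< exists W : opens X, oset W x /\ germ_eq_on a b W >].

Lemma germ_eq_onW (a b : germ_rep) (W W' : opens X) :
  W' `<=` W -> germ_eq_on a b W -> germ_eq_on a b W'.
Proof.
move=> h [ha [hb e]]; exists (subset_trans h ha), (subset_trans h hb).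
by rewrite -(resC ha h) e (resC _ _ (subset_trans h hb)).
Qed.

Fact germ_eq_equiv : equiv_class_of germ_eq.
Proof.
split=> [a|a b|b a c].
- apply/asboolP; exists (germ_nbhd a); split; first exact: germ_mem.
  by exists (@subset_refl _ _), (@subset_refl _ _).
- by apply/asboolP/asboolP => -[W [Wx [ha [hb e]]]]; exists W; split=> //;
    exists hb, ha.
- move=> /asboolP[W [Wx e]] /asboolP[W' [W'x e']]; apply/asboolP.
  exists (opensI W W'); split=> //.
  have [ha [hb eab]] := germ_eq_onW (@opensIl _ W W') e.
  have [hb' [hc ebc]] := germ_eq_onW (@opensIr _ W W') e'.
  by exists ha, hc; rewrite eab -ebc (Prop_irrelevance hb hb').
Qed.

Canonical germ_eq_rel := EquivRelPack germ_eq_equiv.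

Definition stalk := {eq_quot germ_eq}.

HB.instance Definition _ := Choice.on stalk.

Definition germ (U : opens X) (Ux : oset U x) (s : sec F U) : stalk :=
  \pi_stalk (GermRep Ux s).

Lemma germP (U V : opens X) (Ux : oset U x) (Vx : oset V x) (s : sec F U) (t : sec F V) :
  germ Ux s = germ Vx t <->
  exists W : opens X, oset W x /\
    exists (hU : W `<=` U) (hV : W `<=` V), res F hU s = res F hV t.
Proof.
split=> [/eqP|st]; first by rewrite piE => /asboolP.
by apply/eqP; rewrite piE; apply/asboolP.
Qed.

Lemma germ_res (U V : opens X) (h : V `<=` U) (Ux : oset U x) (Vx : oset V x) (s : sec F U) :
  germ Vx (res F h s) = germ Ux s.
Proof.
apply/germP; exists V; split=> //.
by exists (@subset_refl _ _), h; rewrite res_id.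
Qed.

Lemma germ_surj (p : stalk) :
  exists (U : opens X) (Ux : oset U x) (s : sec F U), p = germ Ux s.
Proof.
by rewrite -[p]reprK; case: (repr p) => U Ux s; exists U, Ux, s.
Qed.

Definition stalk_zero : stalk := germ (U := opensT X) I 0.

Definition stalk_opp (p : stalk) : stalk :=
  germ (germ_mem (repr p)) (- germ_sec (repr p)).

Definition stalk_add (p q : stalk) : stalk :=
  let a := repr p in let b := repr q in
  germ (U := opensI (germ_nbhd a) (germ_nbhd b))
       (conj (germ_mem a) (germ_mem b))
       (res F (@opensIl _ _ _) (germ_sec a) + res F (@opensIr _ _ _) (germ_sec b)).

Lemma germ_repr (p : stalk) : germ (germ_mem (repr p)) (germ_sec (repr p)) = p.
Proof. by rewrite -[RHS]reprK; case: (repr p). Qed.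

Lemma stalk_oppE (U : opens X) (Ux : oset U x) (s : sec F U) :
  stalk_opp (germ Ux s) = germ Ux (- s).
Proof.
rewrite /stalk_opp; set a := repr _.
have /germP[W [Wx [hU [hV e]]]] := germ_repr (germ Ux s).
by apply/germP; exists W; split=> //; exists hU, hV; rewrite !raddfN e.
Qed.

Lemma stalk_addE (U : opens X) (Ux : oset U x) (s t : sec F U) :
  stalk_add (germ Ux s) (germ Ux t) = germ Ux (s + t).
Proof.
rewrite /stalk_add; set a := repr (germ Ux s); set b := repr (germ Ux t).
have /germP[W [Wx [hU [hV e]]]] := germ_repr (germ Ux s).
have /germP[W' [W'x [hU' [hV' e']]]] := germ_repr (germ Ux t).
apply/germP; exists (opensI W W'); split=> //.
have h1 : opensI W W' `<=` W by exact: opensIl.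
have h2 : opensI W W' `<=` W' by exact: opensIr.
have h : opensI W W' `<=` opensI (germ_nbhd a) (germ_nbhd b).
  by move=> y [Wy W'y]; split; [apply: (hU y) | apply: (hU' y)].
exists h, (subset_trans h1 hV); rewrite !raddfD.
rewrite !(resC _ h (subset_trans h1 hU)).
rewrite !(resC _ h (subset_trans h2 hU')).
rewrite -(resC hU h1) e -(resC hU' h2) e'.
by congr (_ + _); apply: res_comp.
Qed.

Lemma germ_surj2 (p q : stalk) :
  exists (U : opens X) (Ux : oset U x) (s t : sec F U), p = germ Ux s /\ q = germ Ux t.
Proof.
have [U [Ux [s ->]]] := germ_surj p; have [V [Vx [t ->]]] := germ_surj q.
have hU : opensI U V `<=` U by exact: opensIl.
have hV : opensI U V `<=` V by exact: opensIr.
exists (opensI U V), (conj Ux Vx), (res F hU s), (res F hV t).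
by rewrite !germ_res.
Qed.

Fact stalk_addA : associative stalk_add.
Proof.
move=> p q r; have [U [Ux [s [t [-> ->]]]]] := germ_surj2 p q.
have [V [Vx [w ->]]] := germ_surj r.
have hU : opensI U V `<=` U by exact: opensIl.
have hV : opensI U V `<=` V by exact: opensIr.
have UVx : oset (opensI U V) x by split.
rewrite -(germ_res hU Ux UVx s) -(germ_res hU Ux UVx t) -(germ_res hV Vx UVx w).
by rewrite !stalk_addE addrA.
Qed.

Fact stalk_addC : commutative stalk_add.
Proof.
move=> p q; have [U [Ux [s [t [-> ->]]]]] := germ_surj2 p q.
by rewrite !stalk_addE addrC.
Qed.

Lemma stalk_zeroE (U : opens X) (Ux : oset U x) : germ Ux 0 = stalk_zero.
Proof.
have h : U `<=` opensT X by [].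
by rewrite /stalk_zero -(germ_res h I Ux) raddf0.
Qed.

Fact stalk_add0 : left_id stalk_zero stalk_add.
Proof.
move=> p; have [U [Ux [s ->]]] := germ_surj p.
by rewrite -(stalk_zeroE Ux) stalk_addE add0r.
Qed.

Fact stalk_addN : left_inverse stalk_zero stalk_opp stalk_add.
Proof.
move=> p; have [U [Ux [s ->]]] := germ_surj p.
by rewrite stalk_oppE stalk_addE addNr stalk_zeroE.
Qed.

HB.instance Definition _ :=
  GRing.isZmodule.Build stalk stalk_addA stalk_addC stalk_add0 stalk_addN.

Fact germ_additive (U : opens X) (Ux : oset U x) : zmod_morphism (@germ U Ux).
Proof. by move=> s t; rewrite -stalk_addE -stalk_oppE. Qed.

HB.instance Definition _ (U : opens X) (Ux : oset U x) :=
  GRing.isZmodMorphism.Build (sec F U) stalk (@germ U Ux) (germ_additive Ux).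

End Stalk.

(* H^k(X; F) is defined as in Godement's book: it is the k-th cohomology group of
   the global sections of the canonical flabby resolution 0 -> F -> C^0 -> C^1 ->
   ..., valid for an arbitrary topological space X. *)

Section Godement.
Variable X : topologicalType.

Section Sections.
Variable F : presheaf X.

Definition god_sec (U : opens X) : zmodType :=
  dprod (fun x : {x | oset U x} => stalk F (sval x)).

Definition god_res_fun (U V : opens X) (h : V `<=` U) (s : god_sec U) : god_sec V :=
  fun x => s (exist _ (sval x) (h _ (svalP x))).

Fact god_res_additive (U V : opens X) (h : V `<=` U) :
  zmod_morphism (god_res_fun h).
Proof. by []. Qed.

HB.instance Definition _ (U V : opens X) (h : V `<=` U) :=
  GRing.isZmodMorphism.Build (god_sec U) (god_sec V) (god_res_fun h)
    (god_res_additive h).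

Definition god_res (U V : opens X) (h : V `<=` U) :
  {additive god_sec U -> god_sec V} := god_res_fun h.

Fact god_res_id (U : opens X) (h : U `<=` U) s : god_res h s = s.
Proof.
apply/functional_extensionality_dep => -[x Ux] /=; rewrite /god_res_fun /=.
by rewrite (Prop_irrelevance (h x _) Ux).
Qed.

Fact god_res_comp (U V W : opens X) (h : V `<=` U) (h' : W `<=` V)
  (h'' : W `<=` U) s : god_res h' (god_res h s) = god_res h'' s.
Proof.
apply/functional_extensionality_dep => -[x Wx]; rewrite /= /god_res_fun /=.
by rewrite (Prop_irrelevance (h x _) (h'' x (svalP (exist _ x Wx)))).
Qed.

(* U |-> \prod_(x in U) F_x, the discontinuous sections of F *)
Definition godement : presheaf X := Presheaf god_res_id god_res_comp.

Definition god_unit_fun (U : opens X) (s : sec F U) : sec godement U :=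
  fun x => germ (svalP x) s.

Fact god_unit_additive (U : opens X) : zmod_morphism (@god_unit_fun U).
Proof.
move=> s t; apply/functional_extensionality_dep => x.
by rewrite /god_unit_fun raddfB.
Qed.

HB.instance Definition _ (U : opens X) :=
  GRing.isZmodMorphism.Build (sec F U) (sec godement U) (@god_unit_fun U)
    (@god_unit_additive U).

Fact god_unit_res (U V : opens X) (h : V `<=` U) s :
  god_unit_fun (res F h s) = res godement h (god_unit_fun s).
Proof.
apply/functional_extensionality_dep => -[x Vx].
exact: germ_res.
Qed.

Definition god_unit : presheaf_hom F godement :=
  @PresheafHom X F godement (fun U => @god_unit_fun U) god_unit_res.

End Sections.

Section Cokernel.
Variables (F G : presheaf X) (f : presheaf_hom F G).

Fact psh_coker_subproof (U V : opens X) (h : V `<=` U) :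
  forall s, exists t, res G h (app f U s) = app f V t.
Proof. by move=> s; exists (res F h s); rewrite app_res. Qed.

Definition psh_coker_res (U V : opens X) (h : V `<=` U) :
  {additive coker (app f U) -> coker (app f V)} :=
  coker_map (psh_coker_subproof h).

Fact psh_coker_resE (U V : opens X) (h : V `<=` U) s :
  psh_coker_res h (coker_pi (app f U) s) = coker_pi (app f V) (res G h s).
Proof. exact: coker_mapE. Qed.

Fact psh_coker_res_id (U : opens X) (h : U `<=` U) s : psh_coker_res h s = s.
Proof. by rewrite -[s]reprK -/(coker_pi _ _) psh_coker_resE res_id. Qed.

Fact psh_coker_res_comp (U V W : opens X) (h : V `<=` U) (h' : W `<=` V)
  (h'' : W `<=` U) s :
  psh_coker_res h' (psh_coker_res h s) = psh_coker_res h'' s.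
Proof.
rewrite -[s]reprK -/(coker_pi _ _) !psh_coker_resE.
by rewrite (resC _ _ h'').
Qed.

Definition psh_coker : presheaf X :=
  Presheaf psh_coker_res_id psh_coker_res_comp.

End Cokernel.

Variable F : presheaf X.

(* F = Z^0 and Z^(n+1) = C^n / Z^n, where C^n = godement Z^n.  The quotient is
   not sheafified: godement only depends on stalks, which a presheaf shares with
   its sheafification, so the C^n and the maps C^n -> C^(n+1) are unaffected. *)
Fixpoint god_syz (n : nat) : presheaf X :=
  if n is m.+1 then psh_coker (god_unit (god_syz m)) else F.

Definition god_res_sheaf (n : nat) : presheaf X := godement (god_syz n).

Definition god_diff (n : nat) (U : opens X) :
  {additive sec (god_res_sheaf n) U -> sec (god_res_sheaf n.+1) U} :=
  app (god_unit (god_syz n.+1)) U \o coker_pi (app (god_unit (god_syz n)) U).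

Lemma god_diffK (n : nat) (U : opens X) s :
  god_diff n.+1 U (god_diff n U s) = 0.
Proof.
rewrite /god_diff /=; set t := coker_pi _ s.
suff -> : coker_pi (app (god_unit (god_syz n.+1)) U)
    (app (god_unit (god_syz n.+1)) U t) = 0 by rewrite raddf0.
rewrite -[RHS](raddf0 (coker_pi (app (god_unit (god_syz n.+1)) U))).
by apply/coker_piP; exists t; rewrite subr0.
Qed.

Definition sheaf_cohomology (k : nat) : zmodType :=
  if k is j.+1 then homology (god_diff j (opensT X))
                               (god_diff j.+1 (opensT X))
  else homology (\0 : {additive sec (god_res_sheaf 0) (opensT X) -> _})
                (god_diff 0 (opensT X)).

End Godement.

Section ConstantSheaf.
Variables (X : topologicalType) (A : zmodType).

Definition locally_constant (U : opens X) : {pred {x | oset U x} -> A} :=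
  fun f => `[< forall x, \forall y \near sval x,
                 forall Uy : oset U y, f (exist _ y Uy) = f x >].

Fact locally_constant_zmod_closed (U : opens X) :
  zmod_closed (@locally_constant U).
Proof.
split; first by apply/asboolP => x; exact: nearW.
move=> f g /asboolP fc /asboolP gc; apply/asboolP => x.
by apply: filterS2 (fc x) (gc x) => y fy gy Uy; congr (_ - _); [exact: fy | exact: gy].
Qed.

HB.instance Definition _ (U : opens X) :=
  GRing.isZmodClosed.Build ({x | oset U x} -> A) (@locally_constant U)
    (locally_constant_zmod_closed U).

Record const_sec (U : opens X) := ConstSec {
  const_fun : {x | oset U x} -> A ;
  const_funP : const_fun \in @locally_constant U
}.

HB.instance Definition _ (U : opens X) := [isSub for @const_fun U].
HB.instance Definition _ (U : opens X) := [Choice of const_sec U by <:].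
HB.instance Definition _ (U : opens X) :=
  [SubChoice_isSubZmodule of const_sec U by <:].

Definition const_restr (U V : opens X) (h : V `<=` U)
    (f : {x | oset U x} -> A) : {x | oset V x} -> A :=
  fun x => f (exist _ (sval x) (h _ (svalP x))).

Fact const_restr_lc (U V : opens X) (h : V `<=` U) (s : const_sec U) :
  const_restr h (const_fun s) \in @locally_constant V.
Proof.
apply/asboolP => x; have /asboolP fc := const_funP s.
by apply: filterS (fc (exist _ (sval x) (h _ (svalP x)))) => y fy Vy; exact: fy.
Qed.

Definition const_res_fun (U V : opens X) (h : V `<=` U) (s : const_sec U) :
  const_sec V := ConstSec (const_restr_lc h s).

Fact const_res_additive (U V : opens X) (h : V `<=` U) :
  zmod_morphism (const_res_fun h).
Proof. by move=> s t; apply/val_inj. Qed.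

HB.instance Definition _ (U V : opens X) (h : V `<=` U) :=
  GRing.isZmodMorphism.Build (const_sec U) (const_sec V) (const_res_fun h)
    (const_res_additive h).

Definition const_res (U V : opens X) (h : V `<=` U) :
  {additive const_sec U -> const_sec V} := const_res_fun h.

Fact const_res_id (U : opens X) (h : U `<=` U) s : const_res h s = s.
Proof.
apply/val_inj/funext => -[x Ux]; rewrite /= /const_restr /=.
by congr (const_fun s (exist _ _ _)); exact: Prop_irrelevance.
Qed.

Fact const_res_comp (U V W : opens X) (h : V `<=` U) (h' : W `<=` V)
  (h'' : W `<=` U) s : const_res h' (const_res h s) = const_res h'' s.
Proof.
apply/val_inj/funext => -[x Wx]; rewrite /= /const_restr /=.
by congr (const_fun s (exist _ _ _)); exact: Prop_irrelevance.
Qed.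

Definition constant_sheaf : presheaf X := Presheaf const_res_id const_res_comp.

End ConstantSheaf.

(* The library gives an abstract numFieldType its norm topology, but not R[i]. *)
HB.instance Definition _ (R : realType) := PseudoMetric.copy R[i] (R[i])^o.

Section PicardModularGroup.
Local Open Scope complex_scope.
Variable R : realType.
Local Notation C := R[i].

Definition adjoint (g : 'M[C]_3) : 'M[C]_3 := map_mx Num.conj g^T.

Definition hermH : 'M[C]_3 :=
  \matrix_(i, j) nth 0 (nth [::] [:: [:: 0;   0;  'i];
                                     [:: 0;  -1;  0];
                                     [:: -'i; 0;  0]] i) j.

Definition SU21 : set 'M[C]_3 :=
  [set g | \det g = 1 /\ adjoint g *m hermH *m g = hermH].

Definition gaussian_integer (z : C) : Prop :=
  exists a b : int, z = a%:~R +i* b%:~R.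

Definition Gamma : set 'M[C]_3 :=
  [set g | SU21 g /\ forall i j, gaussian_integer (g i j)].

Definition maxK : set 'M[C]_3 := [set g | SU21 g /\ invmx (adjoint g) = g].

Lemma adjointM g h : adjoint (g *m h) = adjoint h *m adjoint g.
Proof. by rewrite /adjoint trmx_mul map_mxM. Qed.

Lemma adjoint1 : adjoint 1%:M = 1%:M.
Proof. by rewrite /adjoint trmx1 map_mx1. Qed.

Lemma SU21_unit g : SU21 g -> g \in unitmx.
Proof. by case=> d _; rewrite unitmxE d unitr1. Qed.

Lemma SU21_1 : SU21 1%:M.
Proof. by split; rewrite ?det1 // adjoint1 mul1mx mulmx1. Qed.

Lemma SU21_mul g h : SU21 g -> SU21 h -> SU21 (g *m h).
Proof.
move=> [dg eg] [dh eh]; split; first by rewrite det_mulmx dg dh mulr1.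
rewrite adjointM (mulmxA _ g h) -(mulmxA (adjoint h) (adjoint g)).
by rewrite -(mulmxA (adjoint h) _ g) eg.
Qed.

Lemma SU21_inv g : SU21 g -> SU21 (invmx g).
Proof.
move=> gG; have gu := SU21_unit gG; case: gG => dg eg.
split; first by rewrite det_inv dg invr1.
rewrite -[in LHS]eg !mulmxA -adjointM mulmxV // adjoint1 mul1mx.
by rewrite -mulmxA mulmxV // mulmx1.
Qed.

Lemma hermHK : hermH *m hermH = 1%:M.
Proof.
apply/matrixP => i j; rewrite !mxE !big_ord_recl big_ord0 !mxE.
case: i => -[|[|[|//]]] Hi; case: j => -[|[|[|//]]] Hj;
  rewrite /= ?(mul0r, mulr0, add0r, addr0, mulrN, mulNr, opprK, mulr1, oppr0) //;
  by rewrite -expr2 sqr_i opprK.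
Qed.

Lemma SU21_invE g : SU21 g -> invmx g = hermH *m adjoint g *m hermH.
Proof.
move=> gG; have gu := SU21_unit gG; case: gG => _ eg.
apply: (can_inj (mulmxK gu)).
by rewrite mulVmx // -(mulmxA hermH) -(mulmxA hermH) eg hermHK.
Qed.

Lemma maxK_1 : maxK 1%:M.
Proof. by split; [exact: SU21_1 | rewrite adjoint1 invmx1]. Qed.

Lemma adjoint_unit g : g \in unitmx -> adjoint g \in unitmx.
Proof. by rewrite /adjoint map_unitmx unitmx_tr. Qed.

Lemma adjointV g : adjoint (invmx g) = invmx (adjoint g).
Proof. by rewrite /adjoint trmx_inv map_invmx. Qed.

Lemma invmxM (g h : 'M[C]_3) : g \in unitmx -> h \in unitmx ->
  invmx (g *m h) = invmx h *m invmx g.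
Proof.
move=> ug uh; have ugh : g *m h \in unitmx by rewrite unitmx_mul ug.
apply: (can_inj (mulmxK ugh)).
by rewrite mulVmx // mulmxA -(mulmxA (invmx h)) mulVmx // mulmx1 mulVmx.
Qed.

Lemma maxK_mul g h : maxK g -> maxK h -> maxK (g *m h).
Proof.
move=> [gG eg] [hG eh]; split; first exact: SU21_mul.
by rewrite adjointM invmxM ?eg ?eh // adjoint_unit // SU21_unit.
Qed.

Lemma maxK_inv g : maxK g -> maxK (invmx g).
Proof. by move=> [gG eg]; split; [exact: SU21_inv | rewrite adjointV eg]. Qed.

Lemma gaussian0 : gaussian_integer 0.
Proof. by exists 0, 0. Qed.

Lemma gaussianD z w :
  gaussian_integer z -> gaussian_integer w -> gaussian_integer (z + w).
Proof.
move=> [a [b ->]] [c [d ->]]; exists (a + c), (b + d).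
by rewrite !intrD.
Qed.

Lemma gaussianM z w :
  gaussian_integer z -> gaussian_integer w -> gaussian_integer (z * w).
Proof.
move=> [a [b ->]] [c [d ->]]; exists (a * c - b * d), (a * d + b * c).
by rewrite intrB intrD !intrM.
Qed.

Definition gaussian_mx (g : 'M[C]_3) := forall i j, gaussian_integer (g i j).

Lemma gaussian_mxM g h : gaussian_mx g -> gaussian_mx h -> gaussian_mx (g *m h).
Proof.
move=> gZ hZ i j; rewrite mxE; apply: (big_ind gaussian_integer).
- exact: gaussian0.
- exact: gaussianD.
- by move=> k _; apply: gaussianM.
Qed.

Lemma gaussian_adjoint g : gaussian_mx g -> gaussian_mx (adjoint g).
Proof.
move=> gZ i j; rewrite !mxE; have [a [b ->]] := gZ j i.
by exists a, (- b); rewrite mulrNz.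
Qed.

Lemma gaussian_1 : gaussian_mx 1%:M.
Proof.
by move=> i j; rewrite mxE; case: (i == j); [exists 1, 0 | exact: gaussian0].
Qed.

Lemma gaussian_hermH : gaussian_mx hermH.
Proof.
move=> i j; rewrite mxE; case: i => -[|[|[|//]]] Hi; case: j => -[|[|[|//]]] Hj;
  rewrite /=; try exact: gaussian0.
- by exists 0, 1.
- by exists (-1), 0; apply/eqP; rewrite eq_complex /= oppr0 !eqxx.
- by exists 0, (-1); apply/eqP; rewrite eq_complex /= oppr0 !eqxx.
Qed.

Lemma Gamma_1 : Gamma 1%:M.
Proof. by split; [exact: SU21_1 | exact: gaussian_1]. Qed.

Lemma Gamma_mul g h : Gamma g -> Gamma h -> Gamma (g *m h).
Proof.
by move=> [gG gZ] [hG hZ]; split; [exact: SU21_mul | exact: gaussian_mxM].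
Qed.

Lemma Gamma_inv g : Gamma g -> Gamma (invmx g).
Proof.
move=> [gG gZ]; split; first exact: SU21_inv.
rewrite SU21_invE //; apply: gaussian_mxM gaussian_hermH.
exact: gaussian_mxM gaussian_hermH (gaussian_adjoint gZ).
Qed.

Definition groupG := set_type SU21.

Definition G_mk (g : 'M[C]_3) (gG : SU21 g) : groupG := exist _ g (mem_set gG).

Lemma G_valP (g : groupG) : SU21 (\val g).
Proof. exact: set_valP. Qed.

Definition G_mul (g h : groupG) : groupG :=
  G_mk (SU21_mul (G_valP g) (G_valP h)).

Lemma G_mulE g h : \val (G_mul g h) = \val g *m \val h.
Proof. by []. Qed.

Definition rcosetK (g h : groupG) : bool :=
  `[< exists2 k, maxK k & \val h = \val g *m k >].

Fact rcosetK_equiv : equiv_class_of rcosetK.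
Proof.
split=> [g|g h|h g l].
- by apply/asboolP; exists 1%:M; [exact: maxK_1 | rewrite mulmx1].
- apply/asboolP/asboolP => -[k kK e]; exists (invmx k); try exact: maxK_inv;
    by rewrite e mulmxK // SU21_unit //; case: kK.
- move=> /asboolP[k kK ek] /asboolP[m mK em]; apply/asboolP.
  by exists (k *m m); [exact: maxK_mul | rewrite em ek mulmxA].
Qed.

Canonical rcosetK_rel := EquivRelPack rcosetK_equiv.

Definition symD := quotient_topology {eq_quot rcosetK}.

Definition symD_act (g : groupG) (x : symD) : symD :=
  \pi_symD (G_mul g (repr x)).

Lemma symD_actE g h : symD_act g (\pi_symD h) = \pi_symD (G_mul g h).
Proof.
rewrite /symD_act; set h' := repr _.
have : h' = h %[mod symD] by rewrite /h' reprK.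
move=> /eqmodP/asboolP[k kK e].
apply/eqmodP/asboolP; exists k => //.
by rewrite !G_mulE e mulmxA.
Qed.

Definition Gamma_orbit (x y : symD) : bool :=
  `[< exists2 g : groupG, Gamma (\val g) & y = symD_act g x >].

Fact Gamma_orbit_equiv : equiv_class_of Gamma_orbit.
Proof.
have act1 x (g : groupG) : \val g = 1%:M -> symD_act g x = x.
  move=> g1; rewrite -[x]reprK symD_actE; congr (\pi_symD _).
  by apply/val_inj; rewrite G_mulE g1 mul1mx.
have actM g h x : symD_act g (symD_act h x) = symD_act (G_mul g h) x.
  rewrite -[x]reprK (symD_actE h) !symD_actE; congr (\pi_symD _).
  by apply/val_inj; rewrite !G_mulE mulmxA.
have sym x y : Gamma_orbit x y -> Gamma_orbit y x.
  move=> /asboolP[g gG ->]; apply/asboolP.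
  have gG' := Gamma_inv gG; exists (G_mk (proj1 gG')) => //.
  by rewrite actM act1 // G_mulE mulVmx // SU21_unit //; case: gG.
split=> [x|x y|y x z]; last 2 first.
- by apply/idP/idP; apply: sym.
- move=> /asboolP[g gG ->] /asboolP[h hG ->]; apply/asboolP.
  by exists (G_mul h g); [exact: Gamma_mul | rewrite actM].
- by apply/asboolP; exists (G_mk SU21_1); [exact: Gamma_1 | rewrite act1].
Qed.

Canonical Gamma_orbit_rel := EquivRelPack Gamma_orbit_equiv.

Definition GammaD := quotient_topology {eq_quot Gamma_orbit}.

End PicardModularGroup.

(* Main.v *)
From HB Require Import structures.
From mathcomp Require Import all_boot all_order all_algebra.
From mathcomp Require Import all_classical all_reals all_analysis.
From mathcomp Require Import complex ring lra zify.
Require Import Defs.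

(* The form H has signature (2, 1), so D is the Siegel domain 2 Im z > |w|^2, and X = Gamma \ D is a
   cohomological sphere: X is the union of a tube U around the image of the mirror w = 0 and of the
   complement V of that image. An invariant function zeta, essentially w^12, maps U to the plane and
   vanishes exactly on the mirror. The planes slit along the negative and the positive real axis cut
   U n V into P u Q, where P n Q is the union of the preimages A, B of the upper and lower half planes.
   All these sets are acyclic, and a double Mayer-Vietoris descent turns a 2-cocycle into the
   difference of two integers, one on A and one on B.
   Acyclicity is proved on compact sets by Leray's argument: if an invariant continuous function with
   values in an interval has acyclic fibres, then its source is acyclic. Reduction theory provides
   explicit fundamental domains, with invariant functions for which the last fibres are finitely many
   rectangles meeting along common sides or corners. *)

Set Implicit Arguments.
Unset Strict Implicit.
Unset Printing Implicit Defensive.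

Import Order.TTheory GRing.Theory Num.Theory.
Import numFieldNormedType.Exports.

Local Open Scope classical_set_scope.
Local Open Scope ring_scope.

(** * Germs of cocycles along subsets *)

(** Gamma has torsion and X is not compact, so neither a covering argument nor a finite
    triangulation is at hand: acyclicity is proved for germs along compact sets, which can be glued,
    and passes to open sets by exhaustion. The fibres are tractable because the coordinates are
    rigid. Away from the mirror the domain consists of points for which w = 0 is a nearest mirror;
    an identification between such points preserves the coordinate t (t = 0 on the mirror, t = 1
    where another mirror is equally near) and the height h above a floor. If it occurs at some (t,
    h) with t positive, it persists wherever at least the same sides t = 1, h = 0 are met. So above
    one class of the remaining two coordinates lie copies of a single rectangle, glued along whole
    sides or at the corner. The charts used near the mirror behave in the same way. The exponent 12
    is the largest order of a group of rotations of w at a point of the mirror: 4 for the units of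
    Z[i], times 3 for the vertex of the modular domain. The tube radius is chosen so small that only
    elements preserving the mirror can identify two of its points. *)

Section Cochains.
Variables (X : topologicalType) (S : nat -> X -> zmodType).
Notation T n := (dprod (S n)).

Definition eq_on (W : set X) n (s t : T n) := forall x, W x -> s x = t x.

(* The global cochains of the Godement resolution, as families of germs; only the locality of the
   differential is kept, so that cochains near a subset need no sheaf on that subset. *)
Record cochain_system := CochainSystem {
  diff : forall n, {additive T n -> T n.+1} ;
  aug : {additive int -> T 0} ;
  diff_local : forall n (s t : T n) W, open W -> eq_on W s t ->
    eq_on W (diff n s) (diff n t) ;
  diffK : forall n (s : T n), diff n.+1 (diff n s) = 0 ;
  diff_aug : forall c, diff 0 (aug c) = 0 ;
  aug_inj : forall c x, aug c x = 0 -> c = 0 ;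
  diff_exact : forall n (s : T n.+1) W x, open W -> W x ->
    eq_on W (diff n.+1 s) 0 ->
    exists V (t : T n), [/\ open V, V x & eq_on V (diff n t) s] ;
  aug_exact : forall (s : T 0) W x, open W -> W x -> eq_on W (diff 0 s) 0 ->
    exists V c, [/\ open V, V x & eq_on V s (aug c)]
}.

Arguments diff_local c {n s t W} : rename.
Arguments diff_exact c {n s W x} : rename.
Arguments aug_exact c {s W x} : rename.
Arguments diffK c {n} : rename.

Variable M : cochain_system.
Notation d := (diff M).

Lemma diff_eq n (s t : T n) W x : open W -> eq_on W s t -> W x -> d n s x = d n t x.
Proof. by move=> oW e; exact: diff_local e x. Qed.

(** Vanishing of the reduced cohomology of K, computed as a colimit over open neighbourhoods: a
    cocycle near K may have to shrink its domain before it becomes a coboundary or a constant. For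
    open K the neighbourhood can be K itself. *)
Definition acyclic (K : set X) := [/\ K !=set0,
  (forall n (s : T n.+1) W, open W -> K `<=` W -> eq_on W (d n.+1 s) 0 ->
    exists V (t : T n), [/\ open V, K `<=` V & eq_on V (d n t) s]) &
  (forall (s : T 0) W, open W -> K `<=` W -> eq_on W (d 0 s) 0 ->
    exists V c, [/\ open V, K `<=` V & eq_on V s (aug M c)])].

Lemma eq_onS W W' n (s t : T n) : W' `<=` W -> eq_on W s t -> eq_on W' s t.
Proof. by move=> h e x /h; apply: e. Qed.

Lemma dprodDE n (s t : T n) x : (s + t) x = s x + t x. Proof. by []. Qed.
Lemma dprodNE n (s : T n) x : (- s) x = - s x. Proof. by []. Qed.
Lemma dprod0E n x : (0 : T n) x = 0. Proof. by []. Qed.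
Definition dprodE := (dprodDE, dprodNE, dprod0E).

Lemma eq_on_diffB W n (s s' : T n) (t : T n.+1) :
  eq_on W (d n s) t -> eq_on W (d n s') t -> eq_on W (d n (s - s')) 0.
Proof.
by move=> h h' x Wx; rewrite raddfB !dprodE h // h' // subrr.
Qed.

Lemma aug_eq c c' x : aug M c x = aug M c' x -> c = c'.
Proof.
move=> e; apply/eqP; rewrite -subr_eq0; apply/eqP/(@aug_inj M _ x).
by rewrite raddfB !dprodE e subrr.
Qed.

Lemma acyclic_point x : acyclic [set x].
Proof.
split; first by exists x.
- move=> n s W oW xW ds; have [V [t [oV Vx e]]] := diff_exact M oW (xW _ erefl) ds.
  by exists V, t; split=> // _ ->.
- move=> s W oW xW ds; have [V [c [oV Vx e]]] := aug_exact M oW (xW _ erefl) ds.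
  by exists V, c; split=> // _ ->.
Qed.

(** Cochains are arbitrary families of germs, so they can be glued by cases with no condition: this
    is the flabbiness of the resolution. *)
Definition splice (W : set X) n (s t : T n) : T n :=
  fun x => if `[< W x >] then s x else t x.

Lemma spliceT W n (s t : T n) : eq_on W (splice W s t) s.
Proof. by move=> x Wx; rewrite /splice asboolT. Qed.

Lemma spliceF W n (s t : T n) x : ~ W x -> splice W s t x = t x.
Proof. by move=> Wx; rewrite /splice asboolF. Qed.

Lemma spliceE V1 V2 n (s t : T n) : eq_on (V1 `&` V2) s t ->
  eq_on V2 (splice V1 s t) t.
Proof.
move=> e x V2x; have [V1x|nV1] := pselect (V1 x); last by rewrite spliceF.
by rewrite spliceT // e.
Qed.

(** What gluing needs: once two primitives agree near the intersection, the neighbourhoods of K1 and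
    K2 can be shrunk until they overlap only where the primitives agree. *)
Definition separated_near (K1 K2 : set X) := forall W, open W -> K1 `&` K2 `<=` W ->
  exists V1 V2, [/\ open V1, open V2, K1 `<=` V1, K2 `<=` V2 & V1 `&` V2 `<=` W].

(* A class which is a coboundary near K1 and near K2 is a coboundary near their
   union as soon as the two primitives can be corrected along K1 /\ K2. *)
Lemma glue_primitives n (s : T n.+1) K1 K2 V1 V2 t1 t2 :
  separated_near K1 K2 -> acyclic (K1 `&` K2) ->
  open V1 -> open V2 -> K1 `<=` V1 -> K2 `<=` V2 ->
  eq_on V1 (d n t1) s -> eq_on V2 (d n t2) s ->
  exists V t, [/\ open V, K1 `|` K2 `<=` V & eq_on V (d n t) s].
Proof.
move=> sep [ne exn ex0] oV1 oV2 K1V1 K2V2 e1 e2.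
have oV12 : open (V1 `&` V2) by exact: openI.
have K12 : K1 `&` K2 `<=` V1 `&` V2 by move=> x [] /K1V1 ? /K2V2.
have c12 : eq_on (V1 `&` V2) (d n (t1 - t2)) 0.
  by apply: (@eq_on_diffB _ _ _ _ s) => // x [V1x V2x]; [apply: e1|apply: e2].
(* The correction of t2 is the differential of a global cochain, or a global constant, so t2' is
   still a primitive on all of V2. *)
have [W [t2' [oW KW eW e2']]] : exists W t2', [/\ open W, K1 `&` K2 `<=` W,
    eq_on W t1 t2' & eq_on V2 (d n t2') s].
  case: n => [|n] in s t1 t2 e1 e2 c12 *.
    have [W [c [oW KW e]]] := ex0 _ _ oV12 K12 c12.
    exists W, (t2 + aug M c); split=> //.
      by move=> x Wx; rewrite dprodE -(e x Wx) !dprodE addrC subrK.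
    by move=> x V2x; rewrite raddfD diff_aug addr0 e2.
  have [W [u [oW KW e]]] := exn _ _ _ oV12 K12 c12.
  exists W, (t2 + d n u); split=> //.
    by move=> x Wx; rewrite dprodE (e x Wx) !dprodE addrC subrK.
  by move=> x V2x; rewrite raddfD diffK addr0 e2.
have [U1 [U2 [oU1 oU2 KU1 KU2 U12]]] := sep _ oW KW.
exists ((U1 `&` V1) `|` (U2 `&` V2)), (splice (U1 `&` V1) t1 t2'); split.
- by apply: openU; apply: openI.
- by move=> x [Kx|Kx]; [left|right]; split; auto.
- have o1 : open (U1 `&` V1) by exact: openI.
  have o2 : open (U2 `&` V2) by exact: openI.
  move=> x [Ux|Ux].
    by rewrite (diff_eq o1 (@spliceT _ _ _ _) Ux) e1 //; case: Ux.
  have e : eq_on (U1 `&` V1 `&` (U2 `&` V2)) t1 t2'.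
    by move=> y [[U1y _] [U2y _]]; apply: eW; apply: U12.
  by rewrite (diff_eq o2 (spliceE e) Ux) e2' //; case: Ux.
Qed.

Lemma glue_constants (s : T 0) K1 K2 V1 V2 c1 c2 : K1 `&` K2 !=set0 ->
  open V1 -> open V2 -> K1 `<=` V1 -> K2 `<=` V2 ->
  eq_on V1 s (aug M c1) -> eq_on V2 s (aug M c2) ->
  exists V c, [/\ open V, K1 `|` K2 `<=` V & eq_on V s (aug M c)].
Proof.
move=> [x [K1x K2x]] oV1 oV2 h1 h2 e1 e2.
have e : c1 = c2 by apply: (@aug_eq _ _ x); rewrite -e1 ?e2; auto.
exists (V1 `|` V2), c1; split; first exact: openU.
  by move=> y [/h1|/h2]; [left|right].
by move=> y [/e1//|/e2]; rewrite e.
Qed.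

Lemma acyclicU K1 K2 : separated_near K1 K2 -> acyclic K1 -> acyclic K2 ->
  acyclic (K1 `&` K2) -> acyclic (K1 `|` K2).
Proof.
move=> sep [[x K1x] e1 c1] [_ e2 c2] a12; split; first by exists x; left.
- move=> n s W oW KW ds.
  have [V1 [t1 [oV1 KV1 h1]]] := e1 _ _ _ oW (subset_trans (@subsetUl _ _ _) KW) ds.
  have [V2 [t2 [oV2 KV2 h2]]] := e2 _ _ _ oW (subset_trans (@subsetUr _ _ _) KW) ds.
  exact: (glue_primitives sep a12 oV1 oV2 KV1 KV2 h1 h2).
- move=> s W oW KW ds; have [ne _ _] := a12.
  have [V1 [k1 [oV1 KV1 h1]]] := c1 _ _ oW (subset_trans (@subsetUl _ _ _) KW) ds.
  have [V2 [k2 [oV2 KV2 h2]]] := c2 _ _ oW (subset_trans (@subsetUr _ _ _) KW) ds.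
  exact: (glue_constants ne oV1 oV2 KV1 KV2 h1 h2).
Qed.

Lemma In_map (A B : Type) (f : A -> B) (s : seq A) y :
  List.In y [seq f x | x <- s] -> exists2 x, List.In x s & y = f x.
Proof.
elim: s => [//|a s IH] /= [<-|/IH[x xs ->]]; first by exists a => //; left.
by exists x => //; right.
Qed.

Lemma bigsetU_setI (K : set X) (L : seq (set X)) :
  foldr setU set0 L `&` K = foldr setU set0 [seq L' `&` K | L' <- L].
Proof. by elim: L => [|L0 L IH] /=; rewrite ?set0I // setIUl IH. Qed.

(** Induction on the number of pieces: the first piece meets the union of the others in a union of
    one piece fewer, whose members are again in C. Acyclic sets being nonempty, all intersections
    are nonempty. *)
Lemma acyclic_bigU (C : set (set X)) (Ks : seq (set X)) :
  (forall K1 K2, C K1 -> C K2 -> C (K1 `&` K2)) ->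
  (forall K, C K -> acyclic K) ->
  (forall K1 K2, C K1 -> (exists2 L : seq (set X),
     (forall K, List.In K L -> C K) & K2 = foldr setU set0 L) ->
     separated_near K2 K1) ->
  (forall K, List.In K Ks -> C K) -> Ks <> [::] ->
  acyclic (foldr setU set0 Ks).
Proof.
move=> CI Cac sep; move: {2}(size Ks) (leqnn (size Ks)) => m.
elim: m Ks => [|m IH] [|K Ks] //= szK CK _.
have CK' L : List.In L Ks -> C L by move=> ?; apply: CK; right.
case: Ks => [|L Ks] in CK CK' szK *; first by rewrite /= setU0; apply: Cac; apply: CK; left.
set Kt := L :: Ks in CK CK' szK *.
rewrite setUC; apply: acyclicU.
- by apply: sep; [apply: CK; left|exists Kt].
- exact: IH.
- by apply: Cac; apply: CK; left.
- have -> : foldr setU set0 Kt `&` K = foldr setU set0 [seq L' `&` K | L' <- Kt].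
    exact: bigsetU_setI.
  apply: IH; [by rewrite size_map| |by []].
  move=> K0 hK0; have [L0 L0in ->] := In_map hK0.
  by apply: CI; [apply: CK'|apply: CK; left].
Qed.

(** * Union of an exhaustion *)

(** No derived limit appears: two primitives near K_(j+1) differ by a coboundary or a constant, so a
    primitive near K_(j+2) can be corrected to agree on O_j with the one already chosen near
    K_(j+1). *)
Lemma acyclic_exhaust (U : set X) (K O : nat -> set X) :
  (forall j, K j `<=` O j) -> (forall j, O j `<=` K j.+1) ->
  (forall j, open (O j)) -> \bigcup_j K j = U -> (forall j, acyclic (K j)) ->
  acyclic U.
Proof.
move=> KO OK oO UE aK.
have KS j i : (j <= i)%N -> K j `<=` K i.
  move=> /subnK <-; elim: (i - j)%N => [//|m IH]; rewrite addSn.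
  by move=> x /IH /KO /OK.
have OS j i : (j <= i)%N -> O j `<=` O i.
  rewrite leq_eqVlt => /predU1P[->//|ji] x /OK /(KS _ _ ji); exact: KO.
have oU : open U.
  have -> : U = \bigcup_j O j.
    rewrite -UE; apply/seteqP; split=> x [j _ h].
      by exists j => //; apply: KO.
    by exists j.+1 => //; apply: OK.
  exact: bigcup_open.
have UK x : U x -> exists j, K j x by rewrite -UE => -[j _ h]; exists j.
have KU j : K j `<=` U by rewrite -UE => x h; exists j.
split.
- by have [[x Kx] _ _] := aK 0%N; exists x; apply: (KU 0%N).
- move=> n s W oW UW ds.
  pose good j (t : T n) := exists V, [/\ open V, K j `<=` V & eq_on V (d n t) s].
  have step j t : good j.+1 t -> exists t', good j.+2 t' /\ eq_on (O j) t t'.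
    case=> V [oV KV eV].
    have [_ ex _] := aK j.+2.
    have [V' [t' [oV' KV' eV']]] :=
      ex _ _ _ oW (subset_trans (KU _) UW) ds.
    pose N := V `&` V'.
    have oN : open N by exact: openI.
    have KN : K j.+1 `<=` N.
      by move=> x Kx; split; [apply: KV|apply/KV'/(KS _ _ (leqnSn _))].
    have cN : eq_on N (d n (t - t')) 0.
      by apply: (@eq_on_diffB _ _ _ _ s) => // x [? ?]; [apply: eV|apply: eV'].
    have [_ exn ex0] := aK j.+1.
    case: n => [|n] in s ds t t' good eV eV' cN *.
      have [V2 [c [oV2 KV2 e2]]] := ex0 _ _ oN KN cN.
      exists (t' + aug M c); split.
        exists V'; split=> // x V'x; rewrite raddfD diff_aug addr0; exact: eV'.
      by move=> x Ox; rewrite dprodE -e2 ?dprodE; [rewrite addrC subrK|apply/KV2/OK].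
    have [V2 [u [oV2 KV2 e2]]] := exn _ _ _ oN KN cN.
    exists (t' + d n u); split.
      exists V'; split=> // x V'x; rewrite raddfD diffK addr0; exact: eV'.
    by move=> x Ox; rewrite dprodE e2 ?dprodE; [rewrite addrC subrK|apply/KV2/OK].
  have [t0 g0] : exists t, good 1%N t.
    have [_ ex _] := aK 1%N.
    have [V [t [oV KV eV]]] := ex _ _ _ oW (subset_trans (KU _) UW) ds.
    by exists t, V.
  (* The next primitive is chosen for every pair (j, t); for a t that is not a primitive the value
     is irrelevant. *)
  have /choice[nxt nxtP] : forall jt : nat * T n, exists t',
      good jt.1.+1 jt.2 -> good jt.1.+2 t' /\ eq_on (O jt.1) jt.2 t'.
    move=> [j t] /=; have [/step[t' ht']|ng] := pselect (good j.+1 t); first by exists t'.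
    by exists t.
  pose F := fix F j := if j is i.+1 then nxt (i, F i) else t0.
  have gF j : good j.+1 (F j).
    by elim: j => [//|j IH] /=; have [] := nxtP (j, F j) IH.
  have eF j : eq_on (O j) (F j) (F j.+1).
    by have [] := nxtP (j, F j) (gF j).
  have eF' j i : (j <= i)%N -> eq_on (O j) (F j) (F i).
    move=> /subnK <-; elim: (i - j)%N => [//|m IH] x Ox; rewrite addSn.
    by rewrite -eF; [exact: IH|apply: (OS j) => //; apply: leq_addl].
  (* Any stage containing x will do, since later primitives agree with earlier ones on O_j. *)
  pose J x := xget 0%N [set j | K j x].
  have JP x : U x -> K (J x) x by move=> /UK[j h]; exact: (@xgetI _ 0%N [set j | K j x] j h).
  exists U, (fun x => F (J x) x); split=> // x Ux.
  have Ox : O (J x) x by exact/KO/JP.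
  have e : eq_on (O (J x)) (fun y => F (J y) y) (F (J x)).
    move=> y Oy; case: (leqP (J x) (J y)) => h; first by rewrite (eF' _ _ h y Oy).
    by rewrite (eF' _ _ (ltnW h)) //; apply/KO/JP/KU/OK/Oy.
  rewrite (diff_eq (oO _) e Ox); have [V [_ KV ->//]] := gF (J x).
  exact/KV/(KS _ _ (leqnSn _))/JP.
- move=> s W oW UW ds.
  have ex j : exists c, eq_on (K j) s (aug M c).
    have [_ _ ex] := aK j.
    have [V [c [oV KV eV]]] := ex _ _ oW (subset_trans (KU _) UW) ds.
    by exists c => x /KV; apply: eV.
  have [c ec] := ex 0%N; exists U, c; split=> // x /UK[j Kx].
  have [c' ec'] := ex j; rewrite ec' //; congr (aug M _ x).
  have [[y Ky] _ _] := aK 0%N.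
  by apply: (@aug_eq _ _ y); rewrite -ec' ?ec //; apply: (KS 0%N).
Qed.

End Cochains.

(** * Acyclicity of fibrations over an interval *)

Section Separation.
Variable X : topologicalType.

Lemma compact_point_separated (x : X) (K : set X) : hausdorff_space X ->
  compact K -> ~ K x -> exists2 A, nbhs x A & forall y, K y -> nbhs y (~` A).
Proof.
move=> hX /compact_near_coveringP cK nKx.
have [|A [A1 A2 [A0 A10]] A3] := cK _ (powerset_filter_from (nbhs x))
    (fun A y => nbhs y (~` A)) _.
- move=> y Ky; have xy : x != y by apply/eqP => xy; apply: nKx; rewrite xy.
  move: hX; rewrite open_hausdorff => /(_ _ _ xy)[[A B]] /=.
  move=> [/set_mem Ax /set_mem By] [oA oB /eqP AB0].
  exists (B, [set C | nbhs x C /\ C `<=` A]).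
    split; first exact: open_nbhs_nbhs.
    by apply: powerset_filter_fromP; exact: open_nbhs_nbhs.
  case=> y' C [By' [xC CA]]; apply: filterS (open_nbhs_nbhs (conj oB By')) => z Bz Cz.
  by have : (A `&` B) z by [split; [apply: CA|]]; rewrite AB0.
- by exists A0; [exact: A1|exact: A3].
Qed.

Lemma compact_disjoint_separated (K1 K2 : set X) : hausdorff_space X ->
  compact K1 -> compact K2 -> K1 `&` K2 = set0 ->
  exists O1 O2, [/\ open O1, open O2, K1 `<=` O1, K2 `<=` O2 & O1 `&` O2 = set0].
Proof.
move=> hX cK1 cK2 K12.
(* G is the filter of neighbourhoods of K2; it is proper only when K2 is nonempty, hence the case
   distinction. *)
pose G := [set B : set X | forall y, K2 y -> nbhs y B].
have FG : Filter G.
  split; first by move=> y _; exact: filterT.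
  - by move=> P Q hP hQ y Ky; apply: filterI; auto.
  - by move=> P Q PQ hP y Ky; apply: filterS PQ (hP y Ky).
have [[y0 Ky0]|K20] := pselect (K2 !=set0); last first.
  exists setT, set0; split=> //; rewrite ?setI0//; [exact: openT|exact: open0|].
  by move=> y Ky; apply: K20; exists y.
have PG : ProperFilter G.
  by split=> // G0; have := nbhs_singleton (G0 _ Ky0).
move: (cK1) => /compact_near_coveringP cK1'.
have [|B [B1 B2 [B0 B10]] B3] := cK1' _ (powerset_filter_from G)
    (fun B y => nbhs y (~` B)) (powerset_filter_from_filter _).
- move=> x K1x; have nK2 : ~ K2 x.
    by move=> K2x; have : (K1 `&` K2) x by []; rewrite K12.
  have [A xA KA] := compact_point_separated hX cK2 nK2.
  exists (A°, [set B | G B /\ B `<=` ~` A]).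
    by split; [exact: nbhs_interior|exact: powerset_filter_fromP].
  case=> x' B [/= Ax' [GB BA]]; apply: filterS Ax' => z Az Bz.
  exact: (BA z).
- exists (~` B0)°, B0°; split; rewrite ?open_interior//; try exact: open_interior.
  + by move=> x K1x; exact: B3.
  + by move=> y K2y; exact: (B1 _ B10).
  + by rewrite -interiorI setICl interior0.
Qed.

(** The parts of K1 and K2 outside W are disjoint and compact; W is then added to separating
    neighbourhoods of these parts. *)
Lemma compact_separated_near (K1 K2 : set X) : hausdorff_space X ->
  compact K1 -> compact K2 -> separated_near K1 K2.
Proof.
move=> hX cK1 cK2 W oW KW.
have cC : closed (~` W) by exact: open_closedC.
have c1 : compact (K1 `&` ~` W) by exact: compact_closedI.
have c2 : compact (K2 `&` ~` W) by exact: compact_closedI.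
have [|U1 [U2 [oU1 oU2 KU1 KU2 U12]]] := compact_disjoint_separated hX c1 c2.
  by apply/seteqP; split=> // x [[K1x nWx] [K2x _]]; apply: nWx; apply: KW.
exists (U1 `|` W), (U2 `|` W); split; try exact: openU.
- by move=> x Kx; have [Wx|nW] := pselect (W x); [right|left; apply: KU1].
- by move=> x Kx; have [Wx|nW] := pselect (W x); [right|left; apply: KU2].
- move=> x [[U1x|//] [U2x|//]].
  by have : (U1 `&` U2) x by []; rewrite U12.
Qed.

End Separation.

(** The supremum of the b with Q lo b is attained and cannot lie below hi. Gluing is only asked at
    points of [lo, hi], because only there are the fibres known to be acyclic, while the local
    hypothesis reaches past both ends. *)
Lemma interval_induction (R : realType) (Q : R -> R -> Prop) (lo hi : R) :
  lo <= hi ->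
  (forall a b a' b', Q a b -> a <= a' -> b' <= b -> Q a' b') ->
  (forall a b c, lo <= b <= hi -> a <= b -> b <= c -> Q a b -> Q b c -> Q a c) ->
  (forall c, lo <= c <= hi -> exists2 e, 0 < e & Q (c - e) (c + e)) ->
  Q lo hi.
Proof.
move=> lohi mono glue loc.
pose A := [set b | lo <= b <= hi /\ Q lo b].
have Alo : A lo.
  split; first by rewrite lexx.
  have [|e e0 q] := loc lo; first by rewrite lexx.
  by apply: mono q _ _; rewrite ?lerDl ?gerBl ltW.
have hA : has_sup A.
  by split; [exists lo|exists hi => b [/andP[]]].
set m := sup A.
have mlo : lo <= m by apply: sup_upper_bound.
have mhi : m <= hi by apply: ge_sup; [exists lo|move=> b [/andP[]]].
have [|e e0 q] := loc m; first by rewrite mlo.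
have [b Ab mb] := sup_adherent e0 hA; have [/andP[lob bhi] Qb] := Ab.
have Qe : Q lo (m + e).
  apply: (glue _ b) => //; first by rewrite lob.
    by apply: (@le_trans _ _ m); [exact: sup_upper_bound|rewrite lerDl ltW].
  by apply: mono q _ _ => //; exact: ltW.
have [h|h] := leP hi (m + e); first exact: mono Qe _ _.
have : A (m + e).
  by split=> //; rewrite (ltW h) (le_trans mlo) // lerDl ltW.
by move/(sup_upper_bound hA); rewrite gerDl leNgt e0.
Qed.

Section Leray.
Variables (X : topologicalType) (S : nat -> X -> zmodType) (M : cochain_system S).
Hypothesis hX : hausdorff_space X.
Notation d := (diff M).

Section Fibration.
Variables (R : realType) (B : topologicalType) (phi : B -> X) (F : B -> R).
Variables (D : set B) (lo hi : R).
Hypotheses (phi_cont : continuous phi) (F_cont : continuous F) (D_compact : compact D).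
Hypothesis F_range : forall b, D b -> lo <= F b <= hi.
Hypothesis F_phi : forall b b', D b -> D b' -> phi b = phi b' -> F b = F b'.
Hypothesis lohi : lo <= hi.
Hypothesis fib : forall c, lo <= c <= hi -> acyclic M (phi @` (D `&` [set b | F b = c])).

Let slab a b := phi @` (D `&` [set x | a <= F x <= b]).

Lemma compact_slab a b : compact (slab a b).
Proof.
apply: continuous_compact; first exact: continuous_subspaceT.
apply: compact_closedI => //.
have -> : [set x | a <= F x <= b] = F @^-1` `[a, b].
  by apply/seteqP; split=> x; rewrite /= in_itv.
by apply: preimage_closed; [move=> x _; exact: F_cont|exact: interval_closed].
Qed.

(** Tube lemma: the part of D mapped outside W is compact, so its F-values form a closed set that
    misses c. Halving the radius passes from an open ball to a closed slab. *)
Lemma slab_nbhs c W : open W -> phi @` (D `&` [set b | F b = c]) `<=` W ->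
  exists2 e, 0 < e & slab (c - e) (c + e) `<=` W.
Proof.
move=> oW KW.
pose D' := D `&` phi @^-1` (~` W).
have cD' : compact D'.
  apply: compact_closedI => //; apply: preimage_closed.
    by move=> x _; exact: phi_cont.
  exact: open_closedC.
have cF : compact (F @` D').
  by apply: continuous_compact => //; exact: continuous_subspaceT.
have clF : closed (F @` D') by apply: compact_closed => //; exact: Rhausdorff.
have nc : (~` (F @` D')) c.
  move=> [x [Dx nW] Fx]; apply: nW; apply: KW; by exists x.
have oC : open (~` (F @` D')) by exact: closed_openC.
have /nbhs_ballP[e /= e0 be] := open_nbhs_nbhs (conj oC nc).
exists (e / 2); first by rewrite divr_gt0.
move=> _ [x [Dx /= /andP[x1 x2]] <-]; apply: contrapT => nWx.
apply: (be (F x)); last by exists x.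
rewrite /ball /= ltr_norml; lra.
Qed.

Lemma slabS a b a' b' : a <= a' -> b' <= b -> slab a' b' `<=` slab a b.
Proof.
move=> aa bb _ [x [Dx /andP[x1 x2]] <-]; exists x => //; split=> //=.
by rewrite (le_trans aa x1) (le_trans x2 bb).
Qed.

Lemma slabU a b c : a <= b -> b <= c -> slab a c `<=` slab a b `|` slab b c.
Proof.
move=> ab bc _ [x [Dx /andP[x1 x2]] <-]; have [h|h] := leP (F x) b.
  by left; exists x => //; split=> //=; rewrite x1 h.
by right; exists x => //; split=> //=; rewrite x2 ltW.
Qed.

Lemma slabI a b c : a <= b -> b <= c ->
  slab a b `&` slab b c = phi @` (D `&` [set x | F x = b]).
Proof.
move=> ab bc; apply/seteqP; split.
  move=> y [[x [Dx /= /andP[x1 x2]] <-] [x' [Dx' /= /andP[x1' x2']] e]].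
  exists x => //; split=> //=; apply/eqP; rewrite eq_le x2 /=.
  by rewrite -(F_phi Dx' Dx e).
move=> _ [x [Dx /= e] <-]; split; exists x => //; split=> //=; rewrite e lexx ?ab ?bc //.
Qed.

Lemma slabE : slab lo hi = phi @` D.
Proof.
apply/seteqP; split=> [_ [x [Dx _] <-]|_ [x Dx <-]]; exists x => //.
by split=> //=; exact: F_range.
Qed.

(** A primitive near the fibre over c is one near a slab around c, and by [F_phi] two slabs with a
    common end meet exactly in a fibre, along which primitives can be matched; interval induction
    then goes from lo to hi. *)
Lemma acyclic_fibration : acyclic M (phi @` D).
Proof.
split.
- have [|[_ [b [Db _] _]] _ _] := fib (c := lo); first by rewrite lexx.
  by exists (phi b), b.
- move=> n s W oW KW ds; rewrite -slabE.
  pose Q a b := exists V t, [/\ open V, slab a b `<=` V & eq_on V (d n t) s].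
  apply: (@interval_induction _ Q) => //.
  + move=> a b a' b' [V [t [oV KV e]]] aa bb; exists V, t; split=> //.
    exact: subset_trans (slabS aa bb) KV.
  + move=> a b c bI ab bc [V1 [t1 [oV1 KV1 e1]]] [V2 [t2 [oV2 KV2 e2]]].
    have sep := compact_separated_near hX (compact_slab (a := a) (b := b))
      (compact_slab (a := b) (b := c)).
    have [|V [t [oV KV e]]] := glue_primitives sep _ oV1 oV2 KV1 KV2 e1 e2.
      by rewrite slabI //; exact: fib.
    by exists V, t; split=> //; apply: subset_trans (slabU ab bc) KV.
  + move=> c cI; have [_ ex _] := fib cI.
    have [|V [t [oV KV e]]] := ex _ s W oW _ ds.
      by apply: subset_trans KW => _ [x [Dx _] <-]; exists x.
    have [e' e0 h] := slab_nbhs oV KV.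
    by exists e' => //; exists V, t.
- move=> s W oW KW ds; rewrite -slabE.
  pose Q a b := exists V c, [/\ open V, slab a b `<=` V & eq_on V s (aug M c)].
  apply: (@interval_induction _ Q) => //.
  + move=> a b a' b' [V [t [oV KV e]]] aa bb; exists V, t; split=> //.
    exact: subset_trans (slabS aa bb) KV.
  + move=> a b c bI ab bc [V1 [t1 [oV1 KV1 e1]]] [V2 [t2 [oV2 KV2 e2]]].
    have [|V [t [oV KV e]]] := glue_constants _ oV1 oV2 KV1 KV2 e1 e2.
      by rewrite slabI //; have [] := fib bI.
    by exists V, t; split=> //; apply: subset_trans (slabU ab bc) KV.
  + move=> c cI; have [_ _ ex] := fib cI.
    have [|V [t [oV KV e]]] := ex s W oW _ ds.
      by apply: subset_trans KW => _ [x [Dx _] <-]; exists x.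
    have [e' e0 h] := slab_nbhs oV KV.
    by exists e' => //; exists V, t.
Qed.

End Fibration.

End Leray.

Section Charts.
Variables (R : realType) (X : topologicalType) (S : nat -> X -> zmodType) (M : cochain_system S).
Hypothesis hX : hausdorff_space X.

Lemma continuous_image_compact (B : topologicalType) (phi : B -> X) (D : set B) :
  (forall b, D b -> {for b, continuous phi}) -> compact D -> compact (phi @` D).
Proof.
move=> cphi cD; apply: continuous_compact => //.
by apply: continuous_in_subspaceT => b /set_mem; exact: cphi.
Qed.

(** Continuity is needed only at points of D: the fibration lemma is applied to the subspace D in
    place of B. *)
Lemma acyclic_leray (B : topologicalType) (phi : B -> X) (F : B -> R) (D : set B) lo hi :
  (forall b, D b -> {for b, continuous phi}) -> (forall b, D b -> {for b, continuous F}) ->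
  compact D -> (forall b, D b -> lo <= F b <= hi) ->
  (forall b b', D b -> D b' -> phi b = phi b' -> F b = F b') -> lo <= hi ->
  (forall c, lo <= c <= hi -> acyclic M (phi @` (D `&` [set b | F b = c]))) ->
  acyclic M (phi @` D).
Proof.
move=> cphi cF cD Fr Fi lohi fib.
apply: (@acyclic_fibration X S M hX R (subspace D) phi F D lo hi) => //.
- by apply: continuous_in_subspaceT => b /set_mem; exact: cphi.
- by apply: continuous_in_subspaceT => b /set_mem; exact: cF.
- by rewrite -[D in compact D]setIid; apply/compact_subspaceIP; rewrite setIid.
Qed.

Lemma compact_box (a b c d : R) : compact [set p : R * R | a <= p.1 <= b /\ c <= p.2 <= d].
Proof.
have -> : [set p : R * R | a <= p.1 <= b /\ c <= p.2 <= d] = `[a, b]%classic `*` `[c, d]%classic.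
  by apply/seteqP; split=> p /=; rewrite !in_itv.
by apply: compact_setX; exact: segment_compact.
Qed.

Lemma acyclic_box (phi : R * R -> X) (D : set (R * R)) (a b c d : R) : a <= b -> c <= d ->
  D = [set p : R * R | a <= p.1 <= b /\ c <= p.2 <= d] ->
  (forall p, D p -> {for p, continuous phi}) ->
  (forall p p', D p -> D p' -> phi p = phi p' -> p = p') -> acyclic M (phi @` D).
Proof.
move=> ab cd -> {D}; set D := [set p | _] => cphi inj.
apply: (@acyclic_leray (R * R)%type phi fst D a b).
- exact: cphi.
- by move=> p _; exact: cvg_fst.
- exact: compact_box.
- by move=> p [].
- by move=> p p' Dp Dp' /(inj _ _ Dp Dp')->.
- exact: ab.
move=> x abx; apply: (@acyclic_leray (R * R)%type phi snd (D `&` [set p | p.1 = x]) c d).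
- by move=> p [Dp _]; exact: cphi.
- by move=> p _; exact: cvg_snd.
- have -> : D `&` [set p | p.1 = x] = [set p | x <= p.1 <= x /\ c <= p.2 <= d].
    apply/seteqP; split=> p /=; first by move=> [[_ ?] ->]; rewrite lexx.
    move=> [/andP[h1 h2] ?]; have e : p.1 = x by apply/eqP; rewrite eq_le h1 h2.
    by split=> //; split=> //; rewrite e.
  exact: compact_box.
- by move=> p [[]].
- by move=> p p' [Dp _] [Dp' _] /(inj _ _ Dp Dp')->.
- exact: cd.
move=> y cdy.
have -> : phi @` (D `&` [set p | p.1 = x] `&` [set p | p.2 = y]) = [set phi (x, y)].
  apply/seteqP; split=> [_ [p [[_ /= p1] p2] <-]|_ ->]; first by case: p p1 p2 => ? ? /= -> ->.
  by exists (x, y) => //; split.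
exact: acyclic_point.
Qed.

(** * Copies of one piece glued along two sides meeting in a corner *)

Section Cross.
Variables (P : topologicalType) (I : Type) (s : seq I) (ch : I -> P -> X).
Variables (Q : set P) (alpha beta : pred P).
Hypothesis s_neq0 : s <> [::].
Hypothesis Q_compact : compact Q.
Hypotheses (alpha_closed : closed [set p | alpha p]) (beta_closed : closed [set p | beta p]).
Hypothesis ch_cts : forall i p, List.In i s -> Q p -> {for p, continuous (ch i)}.
Hypothesis ch_disj : forall i j p p', List.In i s -> List.In j s -> Q p -> Q p' ->
  ch i p = ch j p' -> p = p'.
Hypothesis ch_spread : forall i j p p', List.In i s -> List.In j s -> Q p -> Q p' ->
  (alpha p ==> alpha p') -> (beta p ==> beta p') -> ch i p = ch j p -> ch i p' = ch j p'.
Hypothesis ch_corner : forall i j p, List.In i s -> List.In j s -> Q p ->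
  alpha p -> beta p -> ch i p = ch j p.
Hypothesis acQ : forall i, List.In i s -> acyclic M (ch i @` Q).
Hypothesis acA : forall i, List.In i s -> acyclic M (ch i @` (Q `&` [set p | alpha p])).
Hypothesis acB : forall i, List.In i s -> acyclic M (ch i @` (Q `&` [set p | beta p])).
Hypothesis acAB : forall i, List.In i s ->
  acyclic M (ch i @` (Q `&` [set p | alpha p && beta p])).

Let part (f : bool -> bool -> bool) := Q `&` [set p | f (alpha p) (beta p)].
Let mono (f : bool -> bool -> bool) := f true true /\
  forall x y x' y', (x ==> x') -> (y ==> y') -> f x y -> f x' y'.

(** The upward closed conditions on the pair (in alpha, in beta) that hold at the corner are five in
    number. *)
Let part_cases f : mono f -> [\/ part f = Q, part f = (Q `&` [set p | alpha p]) `|` (Q `&` [set p | beta p]),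
  
  part f = Q `&` [set p | alpha p] |
  part f = Q `&` [set p | beta p] \/ part f = Q `&` [set p | alpha p && beta p]].
Proof.
move=> [tt mf]; have [ff|nff] := boolP (f false false).
  constructor 1; apply/seteqP; split=> p; first by case.
  by move=> Qp; split=> //=; apply: mf ff.
have [tf|ntf] := boolP (f true false); have [ft|nft] := boolP (f false true).
- constructor 2; apply/seteqP; split=> p.
    move=> [Qp /=]; case: (alpha p) (beta p) (erefl (alpha p)) (erefl (beta p)) => [] [] ea eb // h;
      by [left|right|rewrite h in nff].
  by case=> [[Qp /= e]|[Qp /= e]]; split=> //=; rewrite e; [case: (beta p)|case: (alpha p)].
- constructor 3; apply/seteqP; split=> p.
    move=> [Qp /=]; case: (alpha p) (beta p) (erefl (alpha p)) (erefl (beta p)) => [] [] ea eb // h;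
      by [rewrite h in nft|rewrite h in nff].
  by move=> [Qp /= e]; split=> //=; rewrite e; case: (beta p).
- constructor 4; left; apply/seteqP; split=> p.
    move=> [Qp /=]; case: (alpha p) (beta p) (erefl (alpha p)) (erefl (beta p)) => [] [] ea eb // h;
      by [rewrite h in ntf|rewrite h in nff].
  by move=> [Qp /= e]; split=> //=; rewrite e; case: (alpha p).
- constructor 4; right; apply/seteqP; split=> p.
    by move=> [Qp /= h]; split=> //=; case: (alpha p) (beta p) h => [] []; rewrite ?(negbTE ntf) ?(negbTE nft) ?(negbTE nff).
  by move=> [Qp /= /andP[e1 e2]]; split=> //=; rewrite e1 e2.
Qed.

Let cAlpha : compact (Q `&` [set p | alpha p]). Proof. exact: compact_closedI. Qed.
Let cBeta : compact (Q `&` [set p | beta p]). Proof. exact: compact_closedI. Qed.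
Let cAB : compact (Q `&` [set p | alpha p && beta p]).
Proof.
have -> : Q `&` [set p | alpha p && beta p] = (Q `&` [set p | alpha p]) `&` [set p | beta p].
  by apply/seteqP; split=> p /= => [[? /andP[]]|[[? ?] ?]]; split=> //; apply/andP.
exact: compact_closedI.
Qed.

Let part_compact f : mono f -> compact (part f).
Proof.
by move=> /part_cases[->|->|->|[->|->]] //; apply: compactU.
Qed.

Let part_acyclic i f : List.In i s -> mono f -> acyclic M (ch i @` part f).
Proof.
move=> si /part_cases[->|->|->|[->|->]]; [exact: acQ| |exact: acA|exact: acB|exact: acAB].
rewrite image_setU; apply: acyclicU; [|exact: acA|exact: acB|].
  apply: compact_separated_near => //; apply: continuous_image_compact => // p [Qp _];
    exact: ch_cts.
rewrite (_ : _ `&` _ = ch i @` (Q `&` [set p | alpha p && beta p])); first exact: acAB.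
apply/seteqP; split=> [x [[p [Qp /= ap] <-] [p' [Qp' /= bp] e]]|_ [p [Qp /= /andP[ap bp]] <-]].
  have pe := ch_disj si si Qp' Qp e; rewrite pe in bp.
  by exists p => //; split=> //=; rewrite ap.
by split; exists p.
Qed.

(** By [ch_spread] the locus where two charts agree depends only on the sides met, and it contains
    the corner by [ch_corner]. So the images of parts form a family stable under intersection, made
    of acyclic sets, to which [acyclic_bigU] applies. *)
Lemma acyclic_cross : acyclic M (foldr setU set0 [seq ch i @` Q | i <- s]).
Proof.
pose C := [set K : set X | exists i f, [/\ List.In i s, mono f & K = ch i @` part f]].
have mT : mono (fun _ _ => true) by split.
have QE : Q = part (fun _ _ => true) by apply/seteqP; split=> p; [split|case].
have vertex : exists p, [/\ Q p, alpha p & beta p].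
  case: s s_neq0 acAB => // i l _ /(_ i (or_introl erefl)) [[_ [p [Qp /= /andP[ap bp]] _]] _ _].
  by exists p.
have cC K : C K -> compact K.
  move=> [i [f [si mf ->]]]; apply: continuous_image_compact; last exact: part_compact.
  by move=> p [Qp _]; exact: ch_cts.
apply: (acyclic_bigU (C := C)).
- move=> _ _ [i [f [si [ft mf] ->]]] [j [g [sj [gt mg] ->]]].
  (* The charts i and j agree on a side type as soon as they agree at one point meeting no more
     sides. *)
  pose e x y := `[< exists p, [/\ Q p, ch i p = ch j p, alpha p ==> x & beta p ==> y] >].
  exists i, (fun x y => [&& f x y, g x y & e x y]); split=> //.
    split.
      rewrite ft gt /=; apply/asboolP; have [p [Qp ap bp]] := vertex.
      by exists p; split; rewrite ?implybT //; exact: ch_corner.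
    move=> x y x' y' xx yy /and3P[h1 h2 /asboolP[p [Qp pe px py]]].
    rewrite (mf _ _ _ _ xx yy h1) (mg _ _ _ _ xx yy h2) /=; apply/asboolP; exists p; split=> //.
      by apply/implyP => /(implyP px) /(implyP xx).
    by apply/implyP => /(implyP py) /(implyP yy).
  apply/seteqP; split=> x.
    move=> [[p [Qp /= fp] <-] [q [Qq /= gq] E]]; exists p => //; split=> //=.
    have pq := ch_disj sj si Qq Qp E; rewrite pq in gq E; rewrite fp gq /=; apply/asboolP.
    by exists p; rewrite !implybb; split.
  move=> [p [Qp /= /and3P[fp gp /asboolP[q [Qq qe qa qb]]]] <-].
  split; first by exists p.
  by exists p => //; apply/esym/(ch_spread si sj Qq Qp qa qb qe).
- by move=> _ [i [f [si mf ->]]]; exact: part_acyclic.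
- move=> K1 K2 CK1 [L CL ->]; apply: compact_separated_near => //; last exact: cC.
  elim: L CL => [|K L IH] CL /=; first exact: compact0.
  by apply: compactU; [apply: cC; apply: CL; left|apply: IH => K' ?; apply: CL; right].
- have : forall l, (forall i, List.In i l -> List.In i s) ->
      forall K, List.In K [seq ch i @` Q | i <- l] -> C K.
    elim=> [|i l IH] //= h K [<-|Kl]; last by apply: IH => // j jl; apply: h; right.
    by exists i, (fun _ _ => true); split=> //; [apply: h; left|rewrite -QE].
  by apply.
- by case: s s_neq0.
Qed.

End Cross.
End Charts.

(** * Cohomology of a space covered like a sphere *)

Lemma subr_cancel (V : zmodType) (a b c : V) : (a - c) - (b - c) = a - b.
Proof. by rewrite opprD opprK addrACA addNr addr0. Qed.

Section SphereCover.
Variables (X : topologicalType) (S : nat -> X -> zmodType) (M : cochain_system S).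
Notation T n := (dprod (S n)).
Notation d := (diff M).
Notation acyclic := (acyclic M).

Lemma acyclic_open_exact U n (s : T n.+1) : open U -> acyclic U ->
  eq_on U (d n.+1 s) 0 -> exists t, eq_on U (d n t) s.
Proof.
move=> oU [_ ex _] /(ex _ _ _ oU (@subset_refl _ _))[V [t [_ UV e]]].
by exists t; exact: eq_onS e.
Qed.

Lemma acyclic_open_aug U (s : T 0) : open U -> acyclic U ->
  eq_on U (d 0 s) 0 -> exists c, eq_on U s (aug M c).
Proof.
move=> oU [_ _ ex] /(ex _ _ oU (@subset_refl _ _))[V [t [_ UV e]]].
by exists t; exact: eq_onS e.
Qed.

Lemma eq_on_splice U V n (t1 t2 : T n) : eq_on (U `&` V) t1 t2 ->
  exists t, eq_on U t t1 /\ eq_on V t t2.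
Proof. by move=> e; exists (splice U t1 t2); split; [exact: spliceT|exact: spliceE]. Qed.

Lemma eq_on_sym W n (s t : T n) : eq_on W s t -> eq_on W t s.
Proof. by move=> e x /e. Qed.

Lemma eq_on_trans W n (s t u : T n) : eq_on W s t -> eq_on W t u -> eq_on W s u.
Proof. by move=> e e' x Wx; rewrite e // e'. Qed.

Lemma eq_onU W W' n (s t : T n) : eq_on W s t -> eq_on W' s t -> eq_on (W `|` W') s t.
Proof. by move=> e e' x [/e|/e']. Qed.

Lemma eq_on_subB W n (s t u : T n) : eq_on W (s - t) u -> eq_on W s (t + u).
Proof. by move=> e x Wx; rewrite dprodDE -e // !dprodE addrC subrK. Qed.

Lemma eq_on_diff W n (s t : T n) : open W -> eq_on W s t -> eq_on W (d n s) (d n t).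
Proof. by move=> oW e x Wx; apply: diff_eq e Wx. Qed.

Lemma eq_on_diffD W n (s u : T n) (t : T n.+1) :
  eq_on W (d n s) t -> eq_on W (d n u) 0 -> eq_on W (d n (s + u)) t.
Proof. by move=> e e' x Wx; rewrite raddfD dprodDE e // e' // addr0. Qed.

Lemma eq_on_diffBB W n (s s' : T n) (t t' : T n.+1) :
  eq_on W (d n s) t -> eq_on W (d n s') t' -> eq_on W (d n (s - s')) (t - t').
Proof. by move=> e e' x Wx; rewrite (raddfB (d n)) !dprodE e // e'. Qed.

Lemma eq_on_augB W (s s' : T 0) c c' :
  eq_on W s (aug M c) -> eq_on W s' (aug M c') -> eq_on W (s - s') (aug M (c - c')).
Proof. by move=> e e' x Wx; rewrite (raddfB (aug M)) !dprodE e // e'. Qed.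

Lemma diff_diff0 W n (s : T n) : eq_on W (d n.+1 (d n s)) 0.
Proof. by rewrite diffK. Qed.

Lemma diff_aug0 W c : eq_on W (d 0 (aug M c)) 0.
Proof. by rewrite diff_aug. Qed.

Variables U V P Q A B : set X.
Hypotheses (oU : open U) (oV : open V) (oP : open P) (oQ : open Q)
  (oA : open A) (oB : open B).
Hypotheses (UV : U `|` V = setT) (PQ : P `|` Q = U `&` V) (AB : A `|` B = P `&` Q)
  (AB0 : A `&` B = set0).
Hypotheses (aU : acyclic U) (aV : acyclic V) (aP : acyclic P) (aQ : acyclic Q)
  (aA : acyclic A) (aB : acyclic B).

Let eq_onT n (s t : T n) : eq_on U s t -> eq_on V s t -> s = t.
Proof.
move=> e e'; apply/functional_extensionality_dep => x.
by apply: (eq_onU e e'); rewrite UV.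
Qed.

Let subP : P `<=` U `&` V. Proof. by rewrite -PQ; exact: subsetUl. Qed.
Let subQ : Q `<=` U `&` V. Proof. by rewrite -PQ; exact: subsetUr. Qed.
Let subA : A `<=` P `&` Q. Proof. by rewrite -AB; exact: subsetUl. Qed.
Let subB : B `<=` P `&` Q. Proof. by rewrite -AB; exact: subsetUr. Qed.

(* Mayer-Vietoris for U, V: primitives over U and over V glue as soon as their
   difference is itself a coboundary (or a constant) on the intersection. *)
Let glueUV n (s : T n.+1) (t1 t2 : T n) :
  eq_on U (d n t1) s -> eq_on V (d n t2) s ->
  (exists u : T n, eq_on (U `&` V) (t1 - t2) u /\ d n u = 0) -> exists t, d n t = s.
Proof.
move=> e1 e2 [u [eu du]].
have [t [eU eV]] := eq_on_splice (eq_on_subB eu).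
exists t; apply: eq_onT; apply: eq_on_trans (eq_on_diff _ _) _; try eassumption.
by apply: eq_on_diffD; rewrite ?du.
Qed.

Let exUV n (s : T n.+1) : d n.+1 s = 0 -> exists t1 t2,
  [/\ eq_on U (d n t1) s, eq_on V (d n t2) s & eq_on (U `&` V) (d n (t1 - t2)) 0].
Proof.
move=> ds.
have [t1 e1] : exists t, eq_on U (d n t) s by apply: acyclic_open_exact => //; rewrite ds.
have [t2 e2] : exists t, eq_on V (d n t) s by apply: acyclic_open_exact => //; rewrite ds.
exists t1, t2; split=> //.
by apply: (@eq_on_diffB _ _ _ _ _ _ _ s); [exact: eq_onS e1|exact: eq_onS e2].
Qed.

Lemma sphere_H0 (s : T 0) : d 0 s = 0 -> exists c, s = aug M c.
Proof.
move=> ds.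
have [c1 e1] : exists c, eq_on U s (aug M c) by apply: acyclic_open_aug => //; rewrite ds.
have [c2 e2] : exists c, eq_on V s (aug M c) by apply: acyclic_open_aug => //; rewrite ds.
exists c1; apply: eq_onT => // x Vx; rewrite e2 //; congr (aug M _ x).
have [[y /subP[Uy Vy]] _ _] := aP.
by apply: (@aug_eq _ _ M _ _ y); rewrite -e1 // -e2.
Qed.

(** The two primitives differ by constants on P and on Q; these coincide because P and Q meet, in A
    for instance. *)
Lemma sphere_H1 (s : T 1) : d 1 s = 0 -> exists t, d 0 t = s.
Proof.
move=> /exUV[t1 [t2 [e1 e2 e12]]]; apply: (glueUV e1 e2).
have [a ea] := acyclic_open_aug oP aP (eq_onS subP e12).
have [b eb] := acyclic_open_aug oQ aQ (eq_onS subQ e12).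
have [[y /subA[Py Qy]] _ _] := aA.
have ab : a = b by apply: (@aug_eq _ _ M _ _ y); rewrite -ea // -eb.
exists (aug M a); split; last exact: diff_aug.
by rewrite -PQ; apply: eq_onU => //; rewrite ab.
Qed.

(** The same gluing one level down, for the cover of U [&] V by P and Q. *)
Let bndPQ n (w : T n.+1) (u1 u2 : T n) :
  eq_on P (d n u1) w -> eq_on Q (d n u2) w ->
  (exists v : T n, eq_on (P `&` Q) (u1 - u2) v /\ d n v = 0) ->
  exists u, eq_on (U `&` V) w (d n u).
Proof.
move=> e1 e2 [v [ev dv]].
have [u [eP eQ]] := eq_on_splice (eq_on_subB ev).
exists u; rewrite -PQ; apply: eq_on_sym; apply: eq_onU.
  by apply: eq_on_trans (eq_on_diff _ eP) _.
apply: eq_on_trans (eq_on_diff _ eQ) _ => //.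
by apply: eq_on_diffD; rewrite ?dv.
Qed.

Let exPQ n (w : T n.+1) : eq_on (U `&` V) (d n.+1 w) 0 -> exists u1 u2,
  [/\ eq_on P (d n u1) w, eq_on Q (d n u2) w & eq_on (P `&` Q) (d n (u1 - u2)) 0].
Proof.
move=> dw.
have [t1 e1] := acyclic_open_exact oP aP (eq_onS subP dw).
have [t2 e2] := acyclic_open_exact oQ aQ (eq_onS subQ dw).
exists t1, t2; split=> //.
by apply: (@eq_on_diffB _ _ _ _ _ _ _ w) => x [? ?]; [exact: e1|exact: e2].
Qed.

(** In this degree the last obstruction lives on the disjoint sets A and B and has positive degree
    there, so its two primitives join freely. *)
Lemma sphere_H3 n (s : T n.+3) : d n.+3 s = 0 -> exists t, d n.+2 t = s.
Proof.
move=> /exUV[t1 [t2 [e1 e2 e12]]]; apply: (glueUV e1 e2).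
have [u1 [u2 [h1 h2 h12]]] := exPQ e12.
have [|u eu] := bndPQ h1 h2; last by exists (d n.+1 u); rewrite diffK.
have [v1 k1] := acyclic_open_exact oA aA (eq_onS subA h12).
have [v2 k2] := acyclic_open_exact oB aB (eq_onS subB h12).
have [|v [eA eB]] := @eq_on_splice A B _ v1 v2; first by rewrite AB0.
exists (d n v); rewrite diffK; split=> //; rewrite -AB; apply: eq_on_sym; apply: eq_onU.
  exact: eq_on_trans (eq_on_diff oA eA) k1.
exact: eq_on_trans (eq_on_diff oB eB) k2.
Qed.

(* [periods s a b]: in the double Mayer-Vietoris descent of the 2-cocycle s, the
   resulting locally constant function equals a on A and b on B. *)
Definition periods (s : T 2) (a b : int) := exists t1 t2 u1 u2,
  [/\ eq_on U (d 1 t1) s, eq_on V (d 1 t2) s,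
      eq_on P (d 0 u1) (t1 - t2), eq_on Q (d 0 u2) (t1 - t2) &
      eq_on A (u1 - u2) (aug M a) /\ eq_on B (u1 - u2) (aug M b)].

Lemma periods_ex s : d 2 s = 0 -> exists a b, periods s a b.
Proof.
move=> /exUV[t1 [t2 [e1 e2 e12]]].
have [u1 [u2 [h1 h2 h12]]] := exPQ e12.
have [a ea] := acyclic_open_aug oA aA (eq_onS subA h12).
have [b eb] := acyclic_open_aug oB aB (eq_onS subB h12).
by exists a, b, t1, t2, u1, u2.
Qed.

Lemma periodsB s s' a b a' b' : periods s a b -> periods s' a' b' ->
  periods (s - s') (a - a') (b - b').
Proof.
move=> [t1 [t2 [u1 [u2 [e1 e2 h1 h2 [hA hB]]]]]].
move=> [t1' [t2' [u1' [u2' [e1' e2' h1' h2' [hA' hB']]]]]].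
have E n (x y x' y' : T n) : x - x' - (y - y') = x - y - (x' - y').
  by rewrite !opprD !opprK addrACA.
exists (t1 - t1'), (t2 - t2'), (u1 - u1'), (u2 - u2').
split; last by split; rewrite E; apply: eq_on_augB.
- exact: eq_on_diffBB.
- exact: eq_on_diffBB.
- by rewrite E; exact: eq_on_diffBB.
- by rewrite E; exact: eq_on_diffBB.
Qed.

(** On U and V the given primitives differ from t by coboundaries of g1 and g2. Subtracting g1 - g2
    makes u1 and u2 constant on P and on Q, so their difference takes one value on A and on B. *)
Lemma periods_exact t a b : periods (d 1 t) a b -> a = b.
Proof.
move=> [t1 [t2 [u1 [u2 [e1 e2 h1 h2 [hA hB]]]]]].
have ex W t' : open W -> acyclic W -> eq_on W (d 1 t') (d 1 t) ->
    exists g, eq_on W (d 0 g) (t' - t).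
  by move=> oW aW e; apply: acyclic_open_exact => //; exact: eq_on_diffB e _.
have [g1 k1] := ex _ _ oU aU e1; have [g2 k2] := ex _ _ oV aV e2.
have k12 : eq_on (U `&` V) (d 0 (g1 - g2)) (t1 - t2).
  move=> x [Ux Vx]; rewrite raddfB !dprodE k1 // k2 // !dprodE.
  by rewrite subr_cancel.
have [p ep] : exists c, eq_on P (u1 - (g1 - g2)) (aug M c).
  by apply: acyclic_open_aug => //; apply: eq_on_diffB h1 _; exact: eq_onS k12.
have [q eq] : exists c, eq_on Q (u2 - (g1 - g2)) (aug M c).
  by apply: acyclic_open_aug => //; apply: eq_on_diffB h2 _; exact: eq_onS k12.
have epq x : (P `&` Q) x -> (u1 - u2) x = aug M (p - q) x.
  move=> [Px Qx]; rewrite raddfB !dprodE -ep // -eq // !dprodE.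
  by rewrite subr_cancel.
have [[x Ax] _ _] := aA; have [[y By] _ _] := aB.
transitivity (p - q).
  by apply: (@aug_eq _ _ M _ _ x); rewrite -hA // epq //; exact: subA.
by apply: (@aug_eq _ _ M _ _ y); rewrite -hB // epq //; exact: subB.
Qed.

Lemma periods_eq s a : periods s a a -> exists t, d 1 t = s.
Proof.
move=> [t1 [t2 [u1 [u2 [e1 e2 h1 h2 [hA hB]]]]]].
apply: (glueUV e1 e2); have [|u eu] := bndPQ h1 h2.
  exists (aug M a); split; last exact: diff_aug.
  by rewrite -AB; exact: eq_onU.
by exists (d 0 u); rewrite diffK.
Qed.

(** The descent run backwards: the function m on A and 0 on B is extended arbitrarily, its
    differential on P is joined to 0 on Q, and the differential of the result on U is joined to 0 on
    V. *)
Lemma periods_surj m : exists s, d 2 s = 0 /\ periods s m 0.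
Proof.
pose v : T 0 := splice A (aug M m) 0.
have vA : eq_on A v (aug M m) by exact: spliceT.
have vB : eq_on B v 0 by apply: spliceE; rewrite AB0.
have dv : eq_on (P `&` Q) (d 0 v) 0.
  rewrite -AB; apply: eq_onU.
    by apply: eq_on_trans (eq_on_diff oA vA) _; exact: diff_aug0.
  by apply: eq_on_trans (eq_on_diff oB vB) _; rewrite raddf0.
have [w [wP wQ]] := eq_on_splice dv.
have dw : eq_on (U `&` V) (d 1 w) 0.
  rewrite -PQ; apply: eq_onU.
    by apply: eq_on_trans (eq_on_diff oP wP) _; exact: diff_diff0.
  by apply: eq_on_trans (eq_on_diff oQ wQ) _; rewrite raddf0.
have [s [sU sV]] := eq_on_splice dw.
exists s; split.
  apply: eq_onT.
    by apply: eq_on_trans (eq_on_diff oU sU) _; exact: diff_diff0.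
  by apply: eq_on_trans (eq_on_diff oV sV) _; rewrite raddf0.
exists w, 0, v, 0; rewrite !subr0 !raddf0; split=> //; exact: eq_on_sym.
Qed.

(** The isomorphism is the difference of the two periods: each period depends on choices, and two
    descents of the same cocycle change both by the same integer. Cochains that are not cocycles get
    the value 0. *)
Lemma sphere_H2 : exists f : T 2 -> int,
  [/\ forall s s', d 2 s = 0 -> d 2 s' = 0 -> f (s - s') = f s - f s',
      forall s, d 2 s = 0 -> (f s = 0 <-> exists t, d 1 t = s) &
      forall m, exists2 s, d 2 s = 0 & f s = m].
Proof.
have /choice[f fP] : forall s, exists c, d 2 s = 0 ->
    exists a b, periods s a b /\ c = a - b.
  move=> s; have [ds|nds] := pselect (d 2 s = 0); last by exists 0.
  by have [a [b p]] := periods_ex ds; exists (a - b) => _; exists a, b.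
have uniq s a b a' b' : periods s a b -> periods s a' b' -> a - b = a' - b'.
  move=> p p'; have := periodsB p p'; rewrite subrr -(raddf0 (d 1)).
  by move=> /periods_exact e; lra.
exists f; split.
- move=> s s' ds ds'; have dss : d 2 (s - s') = 0 by rewrite raddfB ds ds' subrr.
  have [a [b [p ->]]] := fP _ ds; have [a' [b' [p' ->]]] := fP _ ds'.
  have [a2 [b2 [p2 ->]]] := fP _ dss.
  by rewrite (uniq _ _ _ _ _ p2 (periodsB p p')) !opprD !opprK addrACA.
- move=> s ds; have [a [b [p ->]]] := fP _ ds; split.
    by move/eqP; rewrite subr_eq0 => /eqP ab; apply: (@periods_eq _ a); rewrite {2}ab.
  by case=> t e; move: p; rewrite -e => /periods_exact->; rewrite subrr.
- move=> m; have [s [ds p]] := periods_surj m; exists s => //.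
  have [a [b [p' ->]]] := fP _ ds; rewrite (uniq _ _ _ _ _ p' p) subr0 //.
Qed.

End SphereCover.

Local Open Scope quotient_scope.

(** * From integer invariants of cocycles to the homology group *)

Section HomologyQuotient.
Variables (A B C : zmodType) (d' : {additive A -> B}) (d : {additive B -> C}).

Let cyc (z : cycle d) : d (cycle_val z) = 0.
Proof. by apply/eqP; exact: (cycleP z). Qed.

Lemma homology_eq0 : (forall s, d s = 0 -> exists x, d' x = s) ->
  forall c : homology d' d, c = 0.
Proof.
move=> ex c; rewrite -[c]reprK -[0]reprK; apply/eqP.
rewrite -Quotient.idealrBE; apply/asboolP.
by apply: ex; exact: cyc.
Qed.

Variable f : B -> int.
Hypothesis fB : forall s t, d s = 0 -> d t = 0 -> f (s - t) = f s - f t.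
Hypothesis f0 : forall s, d s = 0 -> (f s = 0 <-> exists x, d' x = s).
Hypothesis fS : forall m, exists2 s, d s = 0 & f s = m.

(** f is additive on cocycles only, so it is read on the chosen representative; [hmapE] shows that
    the choice does not matter. *)
Let hmap (c : homology d' d) : int := f (cycle_val (repr c)).

Let hmapE (z : cycle d) : hmap (\pi_(homology d' d) z) = f (cycle_val z).
Proof.
rewrite /hmap; set z' := repr _.
have : z' = z %[mod homology d' d] by rewrite /z' reprK.
move=> /eqP; rewrite -Quotient.idealrBE => /asboolP /f0 e.
apply/eqP; rewrite -subr_eq0 -fB //; apply/eqP/e; exact: cyc.
Qed.

Let hmap_additive : zmod_morphism hmap.
Proof.
move=> x y; have e : \pi_(homology d' d) (repr x - repr y) = x - y.
  by rewrite Quotient.pi_add Quotient.pi_opp !reprK.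
by rewrite -e hmapE -fB.
Qed.

HB.instance Definition _ := GRing.isZmodMorphism.Build (homology d' d) int hmap hmap_additive.

Lemma homology_int : exists g : {additive homology d' d -> int}, bijective g.
Proof.
exists hmap; have hS m : exists c, hmap c = m.
  have [s ds fs] := fS m.
  have sC : s \in ker_pred d by apply/eqP.
  by exists (\pi_(homology d' d) (Cycle sC)); rewrite hmapE.
have hI : injective hmap.
  move=> x y; rewrite /hmap => e; rewrite -[x]reprK -[y]reprK; apply/eqP.
  rewrite -Quotient.idealrBE; apply/asboolP/f0; first exact: cyc.
  have -> : cycle_val (repr x - repr y) = cycle_val (repr x) - cycle_val (repr y) by [].
  by rewrite fB ?e ?subrr //; exact: cyc.
have /choice[g gK] := hS; exists g => // x.
by apply: hI; rewrite gK.
Qed.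

End HomologyQuotient.

(** * The Godement resolution of the constant sheaf as a cochain system *)

Section ConstantCochains.
Variable X : topologicalType.
Local Notation F := (constant_sheaf X int).
Local Notation C n := (sec (god_res_sheaf F n) (opensT X)).
Local Notation S := (fun (n : nat) (x : X) => stalk (god_syz F n) x : zmodType).
Local Notation T n := (dprod (S n)).

Let ptT (x : X) : {x | oset (opensT X) x} := exist _ x I.

Definition to_god n (s : T n) : C n := fun u => s (sval u).
Definition of_god n (s : C n) : T n := fun x => s (ptT x).

Lemma to_godK n : cancel (@to_god n) (@of_god n). Proof. by []. Qed.

Lemma of_godK n : cancel (@of_god n) (@to_god n).
Proof.
move=> s; apply/functional_extensionality_dep => -[x p].
by rewrite /to_god /of_god /ptT /= (Prop_irrelevance p I).
Qed.

Definition cdiff n (s : T n) : T n.+1 := of_god (god_diff F n (opensT X) (to_god s)).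

Lemma cdiff_additive n : zmod_morphism (@cdiff n).
Proof.
move=> s t; rewrite /cdiff.
have -> : to_god (s - t) = to_god s - to_god t by [].
by rewrite raddfB.
Qed.

HB.instance Definition _ n := GRing.isZmodMorphism.Build _ _ (@cdiff n) (@cdiff_additive n).

Definition god_coker n (U : opens X) (s : sec (god_res_sheaf F n) U) : sec (god_syz F n.+1) U :=
  coker_pi (app (god_unit (god_syz F n)) U) s.

Lemma cdiffE n (s : T n) x : cdiff s x = germ (U := opensT X) I (god_coker (to_god s)).
Proof. by rewrite /cdiff /of_god /=/god_unit_fun /= (Prop_irrelevance (svalP _) I). Qed.

Definition to_godU n (U : opens X) (s : T n) : sec (god_res_sheaf F n) U := fun u => s (sval u).

(** Computing the germ on an arbitrary neighbourhood instead of the whole space is what makes the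
    differential local. *)
Lemma cdiff_germ n (s : T n) (U : opens X) x (Ux : oset U x) :
  cdiff s x = germ Ux (god_coker (@to_godU n U s)).
Proof.
have h : U `<=` opensT X by [].
rewrite cdiffE -(germ_res h I Ux); congr germ.
exact: psh_coker_resE.
Qed.

Lemma cdiff_local n (s t : T n) W : open W -> eq_on W s t -> eq_on W (cdiff s) (cdiff t).
Proof.
move=> oW e x Wx; rewrite (@cdiff_germ _ s (Opens oW) _ Wx) (@cdiff_germ _ t (Opens oW) _ Wx).
suff -> : @to_godU n (Opens oW) s = @to_godU n (Opens oW) t by [].
by apply/functional_extensionality_dep => -[y Wy]; exact: e.
Qed.

Lemma cdiffK n (s : T n) : cdiff (cdiff s) = 0.
Proof. by rewrite /cdiff of_godK god_diffK. Qed.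

Definition cst_sec (U : opens X) (c : int) : sec F U.
Proof.
apply: (@ConstSec X int U (fun=> c)); apply/asboolP => x.
by apply: nearW.
Defined.

Definition caug (c : int) : T 0 := fun x => germ (F := F) (U := opensT X) I (cst_sec (opensT X) c).

Lemma cst_secB U c c' : cst_sec U (c - c') = cst_sec U c - cst_sec U c'.
Proof. exact/val_inj. Qed.

Lemma caug_additive : zmod_morphism caug.
Proof.
move=> c c'; apply/functional_extensionality_dep => x.
by rewrite /caug cst_secB raddfB.
Qed.

HB.instance Definition _ := GRing.isZmodMorphism.Build _ _ caug caug_additive.

Lemma caug_germ c (U : opens X) x (Ux : oset U x) :
  caug c x = germ (F := F) Ux (cst_sec U c).
Proof.
have h : U `<=` opensT X by [].
by rewrite /caug -(germ_res h I Ux); congr germ; exact/val_inj.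
Qed.

Lemma coker_pi_eq0 (A B : zmodType) (f : {additive A -> B}) y :
  (exists x, f x = y) <-> coker_pi f y = 0.
Proof.
rewrite -[in X in _ <-> X](raddf0 (coker_pi f)); split=> [[x xy]|/coker_piP[x xy]].
  by apply/coker_piP; exists x; rewrite subr0.
by exists x; rewrite xy subr0.
Qed.

Lemma cdiff_aug c : cdiff (caug c) = 0.
Proof.
apply/functional_extensionality_dep => x; rewrite cdiffE.
suff -> : god_coker (to_god (caug c)) = 0 by rewrite raddf0.
apply/coker_pi_eq0; exists (cst_sec (opensT X) c).
apply/functional_extensionality_dep => -[y p].
by rewrite /= /god_unit_fun /to_god /= -caug_germ.
Qed.

Lemma germ_eq0 (G : presheaf X) (U : opens X) x (Ux : oset U x) (s : sec G U) :
  germ Ux s = 0 -> exists (W : opens X), oset W x /\ exists h : W `<=` U, res G h s = 0.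
Proof.
move=> s0; have /germP[W [Wx [hU [hV e]]]] : germ Ux s = germ Ux 0 by rewrite s0 raddf0.
by exists W; split=> //; exists hU; rewrite e raddf0.
Qed.

Lemma caug_inj c x : caug c x = 0 -> c = 0.
Proof.
move=> /germ_eq0[W [Wx [hU e]]].
by have := congr1 (fun s : sec F W => const_fun s (exist _ x Wx)) e.
Qed.

(** Vanishing at the single point x is enough: the class of s in the cokernel has zero germ, hence
    is zero on a neighbourhood, where s is then the family of germs of one section of the syzygy
    presheaf. *)
Lemma cdiff_exact0 n (s : T n) x : cdiff s x = 0 -> exists (V : opens X) (Vx : oset V x)
  (sg : sec (god_syz F n) V), forall y (Vy : oset V y), s y = germ Vy sg.
Proof.
rewrite cdiffE => /germ_eq0[W [Wx [hU e]]].
have {}e : god_coker (@to_godU n W s) = 0.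
  by rewrite -e; apply/esym; exact: psh_coker_resE.
have [sg sgE] : exists sg : sec (god_syz F n) W, god_unit_fun sg = @to_godU n W s.
  exact: (coker_pi_eq0 (app (god_unit (god_syz F n)) W) _).2.
exists W, Wx, sg => y Wy.
have /esym := congr1 (fun t : god_sec (god_syz F n) W => t (exist (fun x => oset W x) y Wy)) sgE.
rewrite /god_unit_fun /to_godU /= => ->.
by congr (germ _ sg); exact: Prop_irrelevance.
Qed.

Lemma cdiff_exact n (s : T n.+1) W x : open W -> W x -> eq_on W (cdiff s) 0 ->
  exists V (t : T n), [/\ open V, V x & eq_on V (cdiff t) s].
Proof.
move=> oW Wx /(_ _ Wx) /cdiff_exact0[V [Vx [sg sgE]]].
pose tau : sec (god_res_sheaf F n) V := repr sg.
have tauE : sg = god_coker tau by rewrite /god_coker /tau /coker_pi reprK.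
(* The syzygy presheaf is a presheaf quotient, so its section lifts to V itself; the lift is
   extended by 0 outside V. *)
pose t : T n := fun y => if pselect (oset V y) is left Vy then tau (exist _ y Vy) else 0.
exists V, t; split; [exact: open_oset|exact: Vx|] => y Vy.
rewrite (cdiff_germ t Vy) (sgE _ Vy) tauE; congr (germ Vy (god_coker _)).
apply/functional_extensionality_dep => -[z Vz]; rewrite /to_godU /t /=.
by case: pselect => // Vz'; rewrite (Prop_irrelevance Vz' Vz).
Qed.

Lemma caug_exact (s : T 0) W x : open W -> W x -> eq_on W (cdiff s) 0 ->
  exists V c, [/\ open V, V x & eq_on V s (caug c)].
Proof.
move=> oW Wx /(_ _ Wx) /cdiff_exact0[V [Vx [sg sgE]]].
have /asboolP/(_ (exist _ x Vx)) /= := const_funP sg.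
set c := const_fun sg _; rewrite /prop_near1 nbhsE => -[N [oN Nx] hN].
have oNV : open (N `&` V) by apply: openI => //; exact: open_oset.
exists (N `&` V), c; split=> // y [Ny Vy].
rewrite (sgE _ Vy) (@caug_germ _ (Opens oNV) _ (conj Ny Vy)).
have h : Opens oNV `<=` V by move=> z [].
rewrite -(germ_res h Vy (conj Ny Vy)); congr germ.
by apply/val_inj/funext => -[z [Nz Vz]]; rewrite /= /const_restr /=; apply: hN.
Qed.

Definition constant_cochains : cochain_system S :=
  @CochainSystem X S (fun n => @cdiff n : {additive T n -> T n.+1})
    (caug : {additive int -> T 0}) cdiff_local cdiffK cdiff_aug
    caug_inj cdiff_exact caug_exact.

Section Sphere.
Variables U V P Q A B : set X.
Hypotheses (oU : open U) (oV : open V) (oP : open P) (oQ : open Q)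
  (oA : open A) (oB : open B).
Hypotheses (UV : U `|` V = setT) (PQ : P `|` Q = U `&` V) (AB : A `|` B = P `&` Q)
  (AB0 : A `&` B = set0).
Local Notation acyclic := (acyclic constant_cochains).
Hypotheses (aU : acyclic U) (aV : acyclic V) (aP : acyclic P) (aQ : acyclic Q)
  (aA : acyclic A) (aB : acyclic B).

Let of_godB n (s t : C n) : of_god (s - t) = of_god s - of_god t. Proof. by []. Qed.

Let of_god_diff n (s : C n) : of_god (god_diff F n (opensT X) s) = cdiff (of_god s).
Proof. by rewrite /cdiff of_godK. Qed.

Let of_god_eq n (s t : C n) : of_god s = of_god t -> s = t.
Proof. by move=> e; rewrite -[s]of_godK e of_godK. Qed.

Let cdiff_of_god n (s : C n) : god_diff F n (opensT X) s = 0 -> cdiff (of_god s) = 0.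
Proof. by move=> ds; rewrite -of_god_diff ds. Qed.

Let bnd_of_god n (s : C n.+1) : (exists t, cdiff t = of_god s) <->
  exists t, god_diff F n (opensT X) t = s.
Proof.
split=> [[t e]|[t <-]]; last by exists (of_god t); rewrite of_god_diff.
by exists (to_god t); apply: of_god_eq; rewrite of_god_diff to_godK.
Qed.

Let exact_homology j : (forall s : T j.+1, cdiff s = 0 -> exists t, cdiff t = s) ->
  forall c : sheaf_cohomology F j.+1, c = 0.
Proof.
move=> ex; apply: homology_eq0 => s ds; apply/bnd_of_god.
by apply: ex; exact: cdiff_of_god.
Qed.

Lemma sphere_cohomology (k : nat) :
  let H : zmodType := sheaf_cohomology F k in
  ((k = 0 \/ k = 2)%N -> exists f : {additive H -> int}, bijective f) /\
  ((k = 1 \/ (3 <= k))%N -> forall c : H, c = 0).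
Proof.
split; last first.
  case: k => [|[|[|k]]] [] // _; [apply: (@exact_homology 0)|apply: (@exact_homology k.+2)].
  - move=> s ds; exact: (sphere_H1 oU oV oP oQ UV PQ AB aU aV aP aQ aA ds).
  - move=> s ds; exact: (sphere_H3 oU oV oP oQ oA oB UV PQ AB AB0 aU aV aP aQ aA aB ds).
case: k => [|[|[|k]]] [] // _.
- have /choice[f fP] : forall s : C 0, exists c, god_diff F 0 (opensT X) s = 0 ->
      of_god s = caug c.
    move=> s; have [ds|nds] := pselect (god_diff F 0 (opensT X) s = 0); last by exists 0.
    have [c e] := sphere_H0 oU oV UV PQ aU aV aP (cdiff_of_god ds).
    by exists c.
  have [[x _] _ _] := aA.
  have caugI : injective caug.
    by move=> c c' e; apply: (@aug_eq _ _ constant_cochains _ _ x); rewrite /= e.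
  apply: (homology_int (f := f)).
  + move=> s t ds dt; apply: caugI.
    rewrite (raddfB (caug : {additive int -> T 0})) /= -!fP // ?of_godB //.
    by rewrite raddfB ds dt subrr.
  + move=> s ds; split=> [f0|[y /= <-]].
      by exists 0; apply: of_god_eq; rewrite (fP _ ds) f0 (raddf0 (caug : {additive int -> T 0})).
    by apply: caugI; rewrite -fP ?raddf0 // (raddf0 (caug : {additive int -> T 0})).
  + move=> m; exists (to_god (caug m)).
      by apply: of_god_eq; rewrite of_god_diff to_godK cdiff_aug.
    apply: caugI; rewrite -fP ?to_godK //.
    by apply: of_god_eq; rewrite of_god_diff to_godK cdiff_aug.
- have [f [fB f0 fS]] := sphere_H2 oU oV oP oQ oA oB UV PQ AB AB0 aU aV aP aQ aA aB.
  apply: (homology_int (f := f \o @of_god 2)).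
  + by move=> s t ds dt; rewrite /= of_godB; apply: fB; exact: cdiff_of_god.
  + by move=> s ds; rewrite -bnd_of_god; apply: f0; exact: cdiff_of_god.
  + move=> m; have [s ds fs] := fS m; exists (to_god s) => //.
    by apply: of_god_eq; rewrite of_god_diff to_godK.
Qed.

End Sphere.

End ConstantCochains.

(** * The Siegel model *)

Section Siegel.
Local Open Scope complex_scope.
Variable R : realType.
Local Notation C := R[i].

Definition o0 : 'I_3 := @Ordinal 3 0 isT.
Definition o1 : 'I_3 := @Ordinal 3 1 isT.
Definition o2 : 'I_3 := @Ordinal 3 2 isT.

Lemma ord3P (P : 'I_3 -> Prop) : P o0 -> P o1 -> P o2 -> forall i, P i.
Proof.
move=> h0 h1 h2 [[|[|[|//]]] h]; [move: h0|move: h1|move: h2];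
  by congr P; apply/val_inj.
Qed.

Lemma sum3 (V : nmodType) (F : 'I_3 -> V) : \sum_i F i = F o0 + F o1 + F o2.
Proof.
rewrite !big_ord_recl big_ord0 addr0 addrA; congr (F _ + F _ + F _); exact/val_inj.
Qed.

Definition col3 (a b c : C) : 'cV[C]_3 := \col_i nth 0 [:: a; b; c] i.
Definition mx3 (a b c d e f g h k : C) : 'M[C]_3 :=
  \matrix_(i, j) nth 0 (nth [::] [:: [:: a; b; c]; [:: d; e; f]; [:: g; h; k]] i) j.

Lemma col3E (u : 'cV[C]_3) : u = col3 (u o0 0) (u o1 0) (u o2 0).
Proof.
apply/matrixP => i j; rewrite (ord1 j) mxE; by move: i; apply: ord3P.
Qed.

Lemma mx3E (g : 'M[C]_3) : g = mx3 (g o0 o0) (g o0 o1) (g o0 o2) (g o1 o0) (g o1 o1) (g o1 o2)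
  (g o2 o0) (g o2 o1) (g o2 o2).
Proof. by apply/matrixP => i j; rewrite mxE; move: i j; apply: ord3P; apply: ord3P. Qed.

Lemma mx3_inj a b c d e f g h k a' b' c' d' e' f' g' h' k' :
  mx3 a b c d e f g h k = mx3 a' b' c' d' e' f' g' h' k' ->
  [/\ a = a', b = b' & c = c'] /\ [/\ d = d', e = e' & f = f'] /\
  [/\ g = g', h = h' & k = k'].
Proof.
move=> eq3; have E i j := congr1 (fun M : 'M[C]_3 => M i j) eq3.
have := E o0 o0; have := E o0 o1; have := E o0 o2; have := E o1 o0; have := E o1 o1.
have := E o1 o2; have := E o2 o0; have := E o2 o1; have := E o2 o2.
by rewrite !mxE /=.
Qed.

Lemma mul_mx3_col a b c d e f g h k x y z :
  mx3 a b c d e f g h k *m col3 x y z =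
  col3 (a * x + b * y + c * z) (d * x + e * y + f * z) (g * x + h * y + k * z).
Proof.
by apply/matrixP => i j; rewrite (ord1 j) !mxE sum3 !mxE; move: i; apply: ord3P.
Qed.

Lemma mul_mx3 a b c d e f g h k a' b' c' d' e' f' g' h' k' :
  mx3 a b c d e f g h k *m mx3 a' b' c' d' e' f' g' h' k' =
  mx3 (a*a'+b*d'+c*g') (a*b'+b*e'+c*h') (a*c'+b*f'+c*k')
      (d*a'+e*d'+f*g') (d*b'+e*e'+f*h') (d*c'+e*f'+f*k')
      (g*a'+h*d'+k*g') (g*b'+h*e'+k*h') (g*c'+h*f'+k*k').
Proof.
apply/matrixP => i j; rewrite mxE sum3 !mxE.
by move: i j; apply: ord3P; apply: ord3P.
Qed.

Lemma adjoint3 a b c d e f g h k : adjoint (mx3 a b c d e f g h k) =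
  mx3 (conjc a) (conjc d) (conjc g) (conjc b) (conjc e) (conjc h) (conjc c) (conjc f) (conjc k).
Proof. by apply/matrixP => i j; rewrite !mxE; move: i j; apply: ord3P; apply: ord3P. Qed.

Lemma hermH3 : hermH R = mx3 0 0 'i 0 (-1) 0 (-'i) 0 0.
Proof. by apply/matrixP => i j; rewrite !mxE; move: i j; apply: ord3P; apply: ord3P. Qed.

Lemma det3 a b c d e f g h k : \det (mx3 a b c d e f g h k) =
  a * (e * k - f * h) - b * (d * k - f * g) + c * (d * h - e * g).
Proof.
have d2 (A : 'M[C]_2) : \det A = A 0 0 * A 1 1 - A 0 1 * A 1 0.
  rewrite (expand_det_row _ 0) big_ord_recl big_ord1 /cofactor !det_mx11 !mxE.
  have e1 : lift (0 : 'I_2) (0 : 'I_1) = 1 by exact/val_inj.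
  have e2 : lift (1 : 'I_2) (0 : 'I_1) = 0 by exact/val_inj.
  by rewrite e1 e2 !add0n expr0 expr1 !mul1r mulN1r mulrN.
have l0 : lift o0 0 = o1 by exact/val_inj.
have l1 : lift o0 1 = o2 by exact/val_inj.
have l2 : lift o1 0 = o0 by exact/val_inj.
have l3 : lift o1 1 = o2 by exact/val_inj.
have l4 : lift o2 0 = o0 by exact/val_inj.
have l5 : lift o2 1 = o1 by exact/val_inj.
rewrite (expand_det_row _ o0) sum3 /cofactor !d2 !mxE l0 l1 l2 l3 l4 l5.
rewrite !add0n expr0 expr1 sqrrN expr1n !mul1r mulN1r /=.
ring.
Qed.

Definition normsq (z : C) : R := complex.Re z ^+ 2 + complex.Im z ^+ 2.

Lemma normsqM z w : normsq (z * w) = normsq z * normsq w.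
Proof. by case: z w => a b [c d]; rewrite /normsq /=; ring. Qed.

Lemma normsq_ge0 z : 0 <= normsq z.
Proof. by rewrite addr_ge0 // sqr_ge0. Qed.

Lemma normsq_eq0 z : normsq z = 0 -> z = 0.
Proof.
case: z => a b /eqP; rewrite /normsq /= paddr_eq0 ?sqr_ge0 // !sqrf_eq0.
by move=> /andP[/eqP-> /eqP->].
Qed.

Lemma normsq_gt0 z : z != 0 -> 0 < normsq z.
Proof. by move=> z0; rewrite lt_def normsq_ge0 andbT; apply: contra_neq z0 => /normsq_eq0. Qed.

Lemma normsq0 : normsq 0 = 0. Proof. by rewrite /normsq /=; ring. Qed.
Lemma normsq1 : normsq 1 = 1. Proof. by rewrite /normsq /=; ring. Qed.

Lemma normsqV z : normsq z^-1 = (normsq z)^-1.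
Proof.
have [->|z0] := eqVneq z 0; first by rewrite invr0 normsq0 invr0.
have n0 : normsq z != 0 by rewrite gt_eqF ?normsq_gt0.
by apply: (mulfI n0); rewrite mulfV // -normsqM mulfV // normsq1.
Qed.

Lemma conjc_normsq z : conjc z * z = (normsq z)%:C.
Proof. by case: z => a b; apply/eqP; rewrite eq_complex /normsq /=; apply/andP; split; apply/eqP; ring. Qed.

Definition hform (u : 'cV[C]_3) : R :=
  2 * (complex.Im (u o0 0) * complex.Re (u o2 0) - complex.Re (u o0 0) * complex.Im (u o2 0))
  - normsq (u o1 0).

Definition cadj m n (A : 'M[C]_(m, n)) : 'M[C]_(n, m) := map_mx Num.conj A^T.

Lemma cadjM m n p (A : 'M[C]_(m, n)) (B : 'M[C]_(n, p)) :
  cadj (A *m B) = cadj B *m cadj A.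
Proof. by rewrite /cadj trmx_mul map_mxM. Qed.

Lemma hform_mx u : (cadj u *m hermH R *m u) 0 0 = (hform u)%:C.
Proof.
rewrite hermH3 -mulmxA {2}(col3E u) mul_mx3_col mxE sum3 !mxE /= /hform /normsq.
case: (u o0 0) => a b; case: (u o1 0) => c d; case: (u o2 0) => e f.
by apply/eqP; rewrite eq_complex /=; apply/andP; split; apply/eqP; ring.
Qed.

Lemma hform_mul g u : SU21 g -> hform (g *m u) = hform u.
Proof.
move=> [_ gH]; have : (hform (g *m u))%:C = (hform u)%:C.
  rewrite -!hform_mx cadjM -!mulmxA; congr (fun_of_matrix _ 0 0); congr (_ *m _).
  by rewrite !mulmxA [cadj g]/(adjoint g) gH.
by case.
Qed.

Lemma hformZ l u : hform (l *: u) = normsq l * hform u.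
Proof.
rewrite /hform !mxE /normsq; case: l => a b; case: (u o0 0) => a1 b1.
by case: (u o1 0) => c d; case: (u o2 0) => e f /=; ring.
Qed.

(* [p] encodes the point [(z, w)] of the Siegel domain with [z = px + i py], [w = (1 + i) (pa + i pb)]. *)
Definition pt4 := (R * R * R * R)%type.
Definition px (p : pt4) := p.1.1.1.
Definition py (p : pt4) := p.1.1.2.
Definition pa (p : pt4) := p.1.2.
Definition pb (p : pt4) := p.2.
Definition zc (p : pt4) : C := px p +i* py p.
Definition wc (p : pt4) : C := pa p +i* pb p.
Definition vec (p : pt4) : 'cV[C]_3 := col3 (zc p) ((1 +i* 1) * wc p) 1.
Definition hgt (p : pt4) := py p - pa p ^+ 2 - pb p ^+ 2.
Definition siegel : set pt4 := [set p | 0 < hgt p].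
Definition ofvec (u : 'cV[C]_3) : pt4 :=
  let z := u o0 0 / u o2 0 in let w := u o1 0 / ((1 +i* 1) * u o2 0) in
  (complex.Re z, complex.Im z, complex.Re w, complex.Im w).
Definition act (g : 'M[C]_3) (p : pt4) := ofvec (g *m vec p).
Definition lam (g : 'M[C]_3) (p : pt4) := (g *m vec p) o2 0.
Definition base : pt4 := (0, 1, 0, 0).

Lemma onei_neq0 : (1 +i* 1 : C) != 0.
Proof. by rewrite eq_complex /= oner_eq0. Qed.

Lemma vec2 p : vec p o2 0 = 1. Proof. by rewrite mxE. Qed.
Lemma vec1 p : vec p o1 0 = (1 +i* 1) * wc p. Proof. by rewrite mxE. Qed.
Lemma vec0 p : vec p o0 0 = zc p. Proof. by rewrite mxE. Qed.

Lemma zc_ofvec (u : 'cV[C]_3) : zc (ofvec u) = u o0 0 / u o2 0.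
Proof. by rewrite /zc /px /py /=; case: (_ / _). Qed.

Lemma wc_ofvec (u : 'cV[C]_3) : wc (ofvec u) = u o1 0 / ((1 +i* 1) * u o2 0).
Proof. by rewrite /wc /pa /pb /=; case: (_ / _). Qed.

Lemma pt4_eq p q : zc p = zc q -> wc p = wc q -> p = q.
Proof.
case: p => [[[a b] c] d]; case: q => [[[a' b'] c'] d'].
by rewrite /zc /wc /px /py /pa /pb /= => -[-> ->] [-> ->].
Qed.

Lemma vec_ofvec (u : 'cV[C]_3) : u o2 0 != 0 -> u = u o2 0 *: vec (ofvec u).
Proof.
move=> u2; apply/matrixP => i j; rewrite (ord1 j); move: i.
apply: ord3P; rewrite mxE ?vec0 ?vec1 ?vec2 ?zc_ofvec ?wc_ofvec ?mulr1 //.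
  by rewrite mulrC divfK.
by have := onei_neq0; set e := _ +i* _ => e0; field; rewrite u2 e0.
Qed.

Lemma ofvecZ l (u : 'cV[C]_3) : l != 0 -> ofvec (l *: u) = ofvec u.
Proof.
move=> l0; apply: pt4_eq; rewrite ?zc_ofvec ?wc_ofvec !mxE.
  by rewrite -mulf_div mulfV // mul1r.
by rewrite mulrCA -mulf_div mulfV // mul1r.
Qed.

Lemma ofvec_vec p : ofvec (vec p) = p.
Proof.
apply: pt4_eq; rewrite ?zc_ofvec ?wc_ofvec vec2 ?vec0 ?vec1 ?divr1 // mulr1 mulrC mulKf //.
exact: onei_neq0.
Qed.

Lemma hform_vec p : hform (vec p) = 2 * hgt p.
Proof. by rewrite /hform vec0 vec1 vec2 /normsq /hgt /zc /wc /=; ring. Qed.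

Lemma hform_gt0 (u : 'cV[C]_3) : 0 < hform u -> u o2 0 != 0.
Proof.
rewrite /hform => h; apply/eqP => u2; move: h; rewrite u2 /= !mulr0 subr0 mulr0 sub0r.
by rewrite oppr_gt0 ltNge normsq_ge0.
Qed.

Lemma lam_neq0 g p : SU21 g -> siegel p -> lam g p != 0.
Proof.
by move=> gG sp; apply: hform_gt0; rewrite hform_mul // hform_vec mulr_gt0.
Qed.

Lemma vec_act g p : SU21 g -> siegel p -> g *m vec p = lam g p *: vec (act g p).
Proof. by move=> gG sp; rewrite {1}[g *m _]vec_ofvec //; exact: lam_neq0. Qed.

Lemma hgt_act g p : SU21 g -> siegel p -> hgt p = normsq (lam g p) * hgt (act g p).
Proof.
move=> gG sp; have := hform_mul (vec p) gG.
rewrite vec_act // hformZ !hform_vec mulrCA => /mulfI e; apply/esym/e.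
by rewrite pnatr_eq0.
Qed.

Lemma act_siegel g p : SU21 g -> siegel p -> siegel (act g p).
Proof.
move=> gG sp; have := hgt_act gG sp; have := sp; rewrite /siegel /= => h e.
by move: h; rewrite e pmulr_rgt0 // normsq_gt0 // lam_neq0.
Qed.

Lemma act_mul g h p : SU21 g -> SU21 h -> siegel p -> act (g *m h) p = act g (act h p).
Proof.
move=> gG hG sp; have e := vec_act hG sp.
rewrite [LHS]/act -mulmxA e -scalemxAr ofvecZ //; exact: lam_neq0.
Qed.

Lemma act_scale g p q l : l != 0 -> g *m vec p = l *: vec q -> act g p = q.
Proof. by move=> l0 e; rewrite /act e ofvecZ // ofvec_vec. Qed.

Lemma act1 p : act 1%:M p = p. Proof. by rewrite /act mul1mx ofvec_vec. Qed.

Lemma actK g p : SU21 g -> siegel p -> act (invmx g) (act g p) = p.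
Proof.
move=> gG sp; rewrite -act_mul ?mulVmx ?act1 ?SU21_unit //; exact: SU21_inv.
Qed.

Lemma siegel_base : siegel base. Proof. by rewrite /siegel /hgt /py /pa /pb /=; lra. Qed.

(** The upper triangular factor of an Iwasawa decomposition: a section, continuous on the Siegel
    domain, of the orbit map of the base point (z, w) = (i, 0). *)
Definition sect (p : pt4) : 'M[C]_3 :=
  let l := Num.sqrt (hgt p) in let w := (1 +i* 1) * wc p in
  mx3 l%:C ('i * conjc w) ((px p +i* (pa p ^+ 2 + pb p ^+ 2)) * (l^-1)%:C)
      0 1 (w * (l^-1)%:C) 0 0 (l^-1)%:C.

Lemma sect_SU21 p : siegel p -> SU21 (sect p).
Proof.
move=> sp; rewrite /sect; set l := Num.sqrt _.
have l0 : l != 0 by rewrite gt_eqF // sqrtr_gt0.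
split.
  rewrite det3 /=; apply/eqP; rewrite eq_complex /=; apply/andP; split; apply/eqP; field => //.
rewrite adjoint3 hermH3 !mul_mx3 /wc; congr mx3; apply/eqP; rewrite eq_complex /=;
  apply/andP; split; apply/eqP; field => //.
Qed.

Lemma sect_act p : siegel p -> act (sect p) base = p.
Proof.
move=> sp; have l0 : 0 < Num.sqrt (hgt p) by rewrite sqrtr_gt0.
have l0' : Num.sqrt (hgt p) != 0 by rewrite gt_eqF.
apply: (@act_scale _ _ _ ((Num.sqrt (hgt p))^-1)%:C).
  by rewrite eq_complex /= negb_and invr_eq0 l0'.
rewrite /sect /vec mul_mx3_col.
have e : Num.sqrt (hgt p) ^+ 2 = hgt p by rewrite sqr_sqrtr // ltW.
set l := Num.sqrt _ in l0 l0' e *.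
have py_e : py p = l ^+ 2 + pa p ^+ 2 + pb p ^+ 2 by rewrite e /hgt; ring.
rewrite /zc /wc /px /py /pa /pb /= -/(py p) -/(px p) -/(pa p) -/(pb p) py_e.
apply/matrixP => i j; rewrite (ord1 j) !mxE; move: i; apply: ord3P => /=;
  apply/eqP; rewrite eq_complex /=; apply/andP; split; apply/eqP; field => //.
Qed.
End Siegel.

Local Open Scope quotient_scope.

(** * The quotient space as a quotient of the Siegel domain *)

Section Model.
Local Open Scope complex_scope.
Variable R : realType.
Local Notation C := R[i].
Local Notation H := (hermH R).
Local Notation v0 := (vec (base R)).
Local Notation pt4 := (pt4 R).

Lemma hermH_v0 : H *m v0 = v0.
Proof.
rewrite hermH3 /vec mul_mx3_col /zc /wc /px /py /pa /pb /=.
congr col3; apply/eqP; rewrite eq_complex /=; apply/andP; split; apply/eqP; ring.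
Qed.

(** H is a self-adjoint involution whose eigenvalue 1 is simple, with eigenvector the base vector,
    and 1 + H is twice the projection onto that line. *)
Lemma hermH_proj : v0 *m cadj v0 = 1%:M + H.
Proof.
rewrite [1%:M](mx3E 1%:M) [H]hermH3; apply/matrixP => i j.
rewrite !mxE big_ord_recl big_ord0 addr0 !mxE /zc /wc /px /py /pa /pb /=.
move: i j; apply: ord3P; apply: ord3P; rewrite ?mxE /=;
  apply/eqP; rewrite eq_complex /=; apply/andP; split; apply/eqP; ring.
Qed.

(** A unitary element of the group commutes with H, hence keeps the line of the base vector, its
    eigenspace for 1. Conversely, an element fixing this line preserves 1 + H as well as H, hence
    the standard form. *)
Lemma maxK_stab (g : 'M[C]_3) : SU21 g -> maxK g <-> act g (base R) = base R.
Proof.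
move=> gG; have gu := SU21_unit gG; have [_ gH] := gG; split.
  move=> [_ eg].
  have g1 : adjoint g *m g = 1%:M by rewrite -{2}eg mulmxV // adjoint_unit.
  have g2 : g *m adjoint g = 1%:M by rewrite -{1}eg mulVmx // adjoint_unit.
  have gHc : H *m g = g *m H by rewrite -{2}gH !mulmxA g2 mul1mx.
  set u := g *m v0.
  have Hu : H *m u = u by rewrite /u mulmxA gHc -mulmxA hermH_v0.
  have u2 : u o2 0 != 0.
    by apply: hform_gt0; rewrite hform_mul // hform_vec mulr_gt0 // siegel_base.
  apply: (act_scale u2); rewrite -/u; clearbody u.
  have := Hu; rewrite hermH3 {1}(col3E u) mul_mx3_col => e.
  have e0 := congr1 (fun u : 'cV[C]_3 => u o0 0) e.
  have e1 := congr1 (fun u : 'cV[C]_3 => u o1 0) e.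
  rewrite !mxE /= in e0 e1.
  rewrite [LHS]col3E -e0 -e1; apply/matrixP => i j; rewrite !mxE /zc /wc /px /py /pa /pb /=.
  have {}e1 : u o1 0 = 0.
    move: e1; rewrite !mul0r add0r addr0 mulN1r => /eqP; rewrite eq_sym -addr_eq0 -mulr2n.
    by rewrite mulrn_eq0 /= => /eqP.
  rewrite e1; move: i; apply: ord3P; rewrite /=;
    case: (u o0 0) (u o2 0) => a b [c d]; apply/eqP; rewrite eq_complex /=;
    apply/andP; split; apply/eqP; ring.
move=> ab; set l := lam g (base R).
have gv : g *m v0 = l *: v0 by rewrite (vec_act gG (siegel_base R)) ab.
have nl : normsq l = 1.
  have := hgt_act gG (siegel_base R); rewrite ab /hgt /py /pa /pb /=.
  by rewrite !expr0n /= !subr0 mulr1.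
have cl : conjc l * l = 1 by rewrite conjc_normsq nl.
have av : adjoint g *m v0 = conjc l *: v0.
  have : adjoint g *m H *m g *m v0 = v0 by rewrite gH hermH_v0.
  rewrite -!mulmxA gv -!scalemxAr hermH_v0 => e.
  by rewrite -{2}e scalerA cl scale1r.
have aV : adjoint g *m (v0 *m cadj v0) *m g = v0 *m cadj v0.
  have e : cadj v0 *m g = l *: cadj v0.
    have := congr1 (@cadj R 3 1) av; rewrite [LHS]cadjM [cadj (adjoint g)](_ : _ = g).
      move=> ->; apply/matrixP => i j; rewrite !mxE rmorphM; congr (_ * _).
      exact: conjcK.
    by apply/matrixP => i j; rewrite !mxE; exact: conjcK.
  by rewrite mulmxA av -mulmxA e -scalemxAl -scalemxAr scalerA cl scale1r.
have g1 : adjoint g *m g = 1%:M.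
  move: aV; rewrite hermH_proj mulmxDr mulmxDl mulmx1 gH => /addIr; exact.
split=> //; rewrite -[LHS]mulmx1 -g1 mulmxA mulVmx ?mul1mx //; exact: adjoint_unit.
Qed.

Definition piD (g : groupG R) : symD R := \pi_(symD R) g.
Definition prX (g : groupG R) : GammaD R := \pi_(GammaD R) (piD g).

Lemma piD_eq g h : piD g = piD h <-> act (\val g) (base R) = act (\val h) (base R).
Proof.
have sb := siegel_base R; have gG := G_valP g; have hG := G_valP h; split.
  move/eqmodP/asboolP => [k kK ->]; have [kG _] := kK.
  by rewrite (act_mul gG kG sb) ((maxK_stab kG).1 kK).
move=> e; apply/eqmodP/asboolP.
have iG := SU21_inv gG.
exists (invmx (\val g) *m \val h); last by rewrite mulKVmx // SU21_unit.
by apply/maxK_stab; [exact: SU21_mul|rewrite (act_mul iG hG sb) -e actK].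
Qed.

Lemma prX_eq g h : prX g = prX h <->
  exists2 c, Gamma c & act c (act (\val g) (base R)) = act (\val h) (base R).
Proof.
have sb := siegel_base R; split.
  move/eqmodP/asboolP => [c cG]; rewrite /piD symD_actE => /piD_eq ->.
  by exists (\val c) => //; rewrite -(act_mul (G_valP c) (G_valP g) sb).
case=> c cG e; apply/eqmodP/asboolP; exists (G_mk (proj1 cG)) => //.
rewrite /piD symD_actE; apply/piD_eq.
by rewrite G_mulE (act_mul (proj1 cG) (G_valP g) sb) e.
Qed.

Definition sectG (p : pt4) : groupG R :=
  if pselect (siegel p) is left sp then G_mk (sect_SU21 sp) else G_mk (SU21_1 R).

(** The topology of X is handled through this map; off the Siegel domain its value is a dummy. *)
Definition prP (p : pt4) : GammaD R := prX (sectG p).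

Lemma sectG_act p : siegel p -> act (\val (sectG p)) (base R) = p.
Proof. by rewrite /sectG; case: pselect => // sp _; exact: sect_act. Qed.

Lemma prP_eq p q : siegel p -> siegel q ->
  prP p = prP q <-> exists2 c, Gamma c & act c p = q.
Proof. by move=> sp sq; rewrite prX_eq !sectG_act. Qed.

Lemma prP_surj x : exists2 p, siegel p & prP p = x.
Proof.
exists (act (\val (repr (repr x))) (base R)).
  exact: act_siegel (G_valP _) (siegel_base R).
rewrite -[RHS]reprK -[in RHS](reprK (repr x)); apply/prX_eq.
exists 1%:M; first exact: Gamma_1.
by rewrite act1 sectG_act //; exact: act_siegel (G_valP _) (siegel_base R).
Qed.

Lemma prX_prP g : prX g = prP (act (\val g) (base R)).
Proof.
apply/prX_eq; exists 1%:M; first exact: Gamma_1.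
by rewrite act1 sectG_act //; exact: act_siegel (G_valP _) (siegel_base R).
Qed.

(** * Continuity through real and imaginary parts *)

Section Continuity.
Variables (T : topologicalType) (x : T).
Implicit Types f g : T -> C.

(** Replaces the complex-valued norm of R[i] by a real quantity, so that real arithmetic applies. *)
Lemma nbhs_complex (c : C) (A : set C) : nbhs c A <->
  exists2 e : R, 0 < e & forall z, normsq (z - c) < e ^+ 2 -> A z.
Proof.
have nE (z : C) (e : R) : 0 < e -> (`|c - z| < e%:C) = (normsq (z - c) < e ^+ 2).
  move=> e0; rewrite normc_def ltcR -ltr_sqr ?nnegrE ?sqrtr_ge0 ?ltW //.
  rewrite sqr_sqrtr ?addr_ge0 ?sqr_ge0 //; congr (_ < _).
  by case: c z => a b [a' b']; rewrite /normsq /=; ring.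
split=> [[e /= e0 eA]|[e e0 eA]].
  have eE : e = (complex.Re e)%:C by rewrite RRe_real // gtr0_real.
  have e0' : 0 < complex.Re e by move: e0; rewrite eE ltcR.
  by exists (complex.Re e) => // z zc; apply: eA; rewrite /= eE nE.
by exists e%:C; [rewrite /= ltcR|move=> z /= h; apply: eA; rewrite -nE].
Qed.

Lemma nbhs2 (A B D : set T) : nbhs x A -> nbhs x B ->
  (forall y, A y -> B y -> D y) -> nbhs x D.
Proof. by move=> hA hB h; apply: filterS (filterI hA hB) => y [] /h; apply. Qed.

Definition ctsR (f : T -> R) := {for x, continuous f}.
Definition ctsC (f : T -> C) :=
  ctsR (fun y => complex.Re (f y)) /\ ctsR (fun y => complex.Im (f y)).

Lemma ctsR_cst (c : R) : ctsR (fun=> c). Proof. exact: cst_continuous. Qed.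
Lemma ctsRD (f g : T -> R) : ctsR f -> ctsR g -> ctsR (fun y => f y + g y).
Proof. exact: continuousD. Qed.
Lemma ctsRN (f : T -> R) : ctsR f -> ctsR (fun y => - f y).
Proof. exact: continuousN. Qed.
Lemma ctsRM (f g : T -> R) : ctsR f -> ctsR g -> ctsR (fun y => f y * g y).
Proof. exact: continuousM. Qed.
Lemma ctsRV (f : T -> R) : f x != 0 -> ctsR f -> ctsR (fun y => (f y)^-1).
Proof. exact: continuousV. Qed.
Lemma ctsRX (f : T -> R) n : ctsR f -> ctsR (fun y => f y ^+ n).
Proof.
move=> cf; elim: n => [|n IH]; first exact: ctsR_cst.
have -> : (fun y => f y ^+ n.+1) = (fun y => f y * f y ^+ n).
  by apply/funext => y; rewrite exprS.
exact: ctsRM.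
Qed.

Lemma ctsC_continuous f : ctsC f -> {for x, continuous f}.
Proof.
move=> [cr ci] A /nbhs_complex[e e0 eA]; rewrite /nbhs /=.
have e2 : 0 < e / 2 by rewrite divr_gt0.
have hr := cr _ (@nbhsx_ballx _ _ (complex.Re (f x)) _ e2).
have hi := ci _ (@nbhsx_ballx _ _ (complex.Im (f x)) _ e2).
apply: (nbhs2 hr hi) => y; rewrite /ball /= => {}hr {}hi; apply: eA; move: hr hi.
case: (f x) (f y) => a b [c d]; rewrite /normsq /= !ltr_norml => /andP[h1 h2] /andP[h3 h4].
have : 0 < (e / 2 - (c - a)) * (e / 2 + (c - a)) by apply: mulr_gt0; lra.
have : 0 < (e / 2 - (d - b)) * (e / 2 + (d - b)) by apply: mulr_gt0; lra.
have : 0 < e ^+ 2 by exact: exprn_gt0.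
by rewrite !expr2; nra.
Qed.

Lemma sqr_ltr_norm (u v e : R) : 0 < e -> u ^+ 2 + v ^+ 2 < e ^+ 2 -> `|u| < e.
Proof.
move=> e0 h; have v0 := sqr_ge0 v; rewrite ltr_norml; apply/andP.
by split; rewrite ltNge; apply/negP => k; nra.
Qed.

Lemma continuous_ctsC f : {for x, continuous f} -> ctsC f.
Proof.
move=> cf; split=> A /nbhs_ballP[e /= e0 eA].
  have h : nbhs (f x) [set z | ball (complex.Re (f x)) e (complex.Re z)].
    apply/nbhs_complex; exists e => // z; case: z (f x) => c d [a b]; rewrite /normsq /ball /=.
    by rewrite distrC; exact: sqr_ltr_norm.
  exact: (nbhs2 (cf _ h) (cf _ h) (fun y hy _ => eA _ hy)).
have h : nbhs (f x) [set z | ball (complex.Im (f x)) e (complex.Im z)].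
  apply/nbhs_complex; exists e => // z; case: z (f x) => c d [a b]; rewrite /normsq /ball /=.
  by rewrite distrC addrC; exact: sqr_ltr_norm.
exact: (nbhs2 (cf _ h) (cf _ h) (fun y hy _ => eA _ hy)).
Qed.

Lemma ctsC_eq f g : (forall y, f y = g y) -> ctsC f -> ctsC g.
Proof. by move=> /funext->. Qed.

Lemma ctsR_eq (f g : T -> R) : (forall y, f y = g y) -> ctsR f -> ctsR g.
Proof. by move=> /funext->. Qed.

Lemma ctsC_cst (c : C) : ctsC (fun=> c).
Proof. by split; exact: ctsR_cst. Qed.

Lemma ctsC_mk (f g : T -> R) : ctsR f -> ctsR g -> ctsC (fun y => f y +i* g y).
Proof. by split. Qed.

Lemma ctsCD f g : ctsC f -> ctsC g -> ctsC (fun y => f y + g y).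
Proof.
move=> [fr fi] [gr gi]; split; [apply: ctsR_eq (ctsRD fr gr)|apply: ctsR_eq (ctsRD fi gi)];
  by move=> y; case: (f y) (g y) => a b [c d].
Qed.

Lemma ctsCM f g : ctsC f -> ctsC g -> ctsC (fun y => f y * g y).
Proof.
move=> [fr fi] [gr gi]; split.
  apply: ctsR_eq (ctsRD (ctsRM fr gr) (ctsRN (ctsRM fi gi))).
  by move=> y; case: (f y) (g y) => a b [c d].
apply: ctsR_eq (ctsRD (ctsRM fr gi) (ctsRM fi gr)).
by move=> y; case: (f y) (g y) => a b [c d].
Qed.

Lemma ctsC_conj f : ctsC f -> ctsC (fun y => conjc (f y)).
Proof.
move=> [fr fi]; split; [apply: ctsR_eq fr|apply: ctsR_eq (ctsRN fi)];
  by move=> y; case: (f y).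
Qed.

Lemma ctsC_V f : f x != 0 -> ctsC f -> ctsC (fun y => (f y)^-1).
Proof.
move=> fx [fr fi].
have cn : ctsR (fun y => normsq (f y)) by apply: ctsRD; apply: ctsRX.
have n0 : normsq (f x) != 0 by rewrite gt_eqF // normsq_gt0.
have h := ctsCM (ctsC_conj (conj fr fi)) (ctsC_mk (ctsRV n0 cn) (@ctsR_cst 0)).
apply: ctsC_eq h => y; case: (f y) => a b; rewrite /normsq.
apply/eqP; rewrite eq_complex /=; apply/andP; split; apply/eqP; ring.
Qed.

End Continuity.

Lemma px_cts (p : pt4) : ctsR p (@px R).
Proof.
apply: (@continuous_comp _ _ _ (fst : pt4 -> R * R * R) (fun q => q.1.1) p); first exact: cvg_fst.
apply: (@continuous_comp _ _ _ (fst : R * R * R -> R * R) (fun q => q.1) _); exact: cvg_fst.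
Qed.

Lemma py_cts (p : pt4) : ctsR p (@py R).
Proof.
apply: (@continuous_comp _ _ _ (fst : pt4 -> R * R * R) (fun q => q.1.2) p); first exact: cvg_fst.
apply: (@continuous_comp _ _ _ (fst : R * R * R -> R * R) (fun q => q.2) _); [exact: cvg_fst|exact: cvg_snd].
Qed.

Lemma pa_cts (p : pt4) : ctsR p (@pa R).
Proof.
apply: (@continuous_comp _ _ _ (fst : pt4 -> R * R * R) (fun q => q.2) p); [exact: cvg_fst|exact: cvg_snd].
Qed.

Lemma pb_cts (p : pt4) : ctsR p (@pb R).
Proof. exact: cvg_snd. Qed.

Lemma zc_cts (p : pt4) : ctsC p (@zc R).
Proof. by split; [exact: px_cts|exact: py_cts]. Qed.

Lemma wc_cts (p : pt4) : ctsC p (@wc R).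
Proof. by split; [exact: pa_cts|exact: pb_cts]. Qed.

Lemma hgt_cts (p : pt4) : ctsR p (@hgt R).
Proof.
by apply: ctsRD; [apply: ctsRD; [exact: py_cts|]|]; apply: ctsRN; apply: ctsRX; [exact: pa_cts|exact: pb_cts].
Qed.

Lemma pt4_cts (T : topologicalType) (x : T) (f : T -> pt4) :
  ctsR x (fun y => px (f y)) -> ctsR x (fun y => py (f y)) ->
  ctsR x (fun y => pa (f y)) -> ctsR x (fun y => pb (f y)) -> {for x, continuous f}.
Proof.
move=> h1 h2 h3 h4.
have -> : f = (fun y => (px (f y), py (f y), pa (f y), pb (f y))).
  by apply/funext => y; case: (f y) => [[[]]].
exact: cvg_pair (cvg_pair (cvg_pair h1 h2) h3) h4.
Qed.

Lemma mx_cts (T : topologicalType) (x : T) (f : T -> 'M[C]_3) :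
  (forall i j, ctsC x (fun y => f y i j)) -> {for x, continuous f}.
Proof.
move=> h A [P Pn PA]; rewrite /nbhs /=.
have hP i j : \forall y \near x, P i j (f y i j).
  by apply: (ctsC_continuous (h i j)); exact: Pn.
have : \forall y \near x, forall i j, P i j (f y i j).
  apply: filter_forall => i; apply: filter_forall => j; exact: hP.
by apply: filterS => y Py; apply: PA.
Qed.

Lemma mx_coord_cts (g : 'M[C]_3) i j : ctsC g (fun h : 'M[C]_3 => h i j).
Proof.
apply: continuous_ctsC => A Ag; rewrite /nbhs /=.
exists (fun i' j' => if (i' == i) && (j' == j) then A else setT).
  by move=> i' j'; case: ifP => [/andP[/eqP-> /eqP->]//|_]; exact: filterT.
by move=> h /(_ i j); rewrite !eqxx.
Qed.

Lemma siegel_open : open (@siegel R).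
Proof.
rewrite openE => p sp; rewrite /interior /=.
have := @hgt_cts p _ (@open_nbhs_nbhs _ _ [set y : R | 0 < y] (conj (@open_gt R 0) sp)).
by [].
Qed.

Lemma sect_cts (p : pt4) : siegel p -> {for p, continuous (@sect R)}.
Proof.
move=> sp; apply: mx_cts.
have cl : ctsR p (fun q => Num.sqrt (hgt q)).
  by apply: (@continuous_comp _ _ _ (@hgt R) Num.sqrt p); [exact: hgt_cts|exact: sqrt_continuous].
have cl1 : ctsR p (fun q => (Num.sqrt (hgt q))^-1).
  by apply: ctsRV => //; rewrite gt_eqF // sqrtr_gt0.
have cl1' := ctsC_mk cl1 (@ctsR_cst _ _ 0).
have cw : ctsC p (fun q => (1 +i* 1) * wc q) by apply: ctsCM; [exact: ctsC_cst|exact: wc_cts].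
apply: ord3P; apply: ord3P; rewrite /sect.
all: under eq_fun do rewrite mxE /=.
- exact: ctsC_mk cl (@ctsR_cst _ _ 0).
- apply: (@ctsC_eq _ _ (fun q => 'i * conjc ((1 +i* 1) * wc q))) => //.
  by apply: ctsCM; [exact: ctsC_cst|exact: ctsC_conj].
- apply: ctsCM => //; apply: ctsC_mk; first exact: px_cts.
  by apply: ctsRD; apply: ctsRX; [exact: pa_cts|exact: pb_cts].
- exact: ctsC_cst.
- exact: ctsC_cst.
- exact: ctsCM.
- exact: ctsC_cst.
- exact: ctsC_cst.
- exact: cl1'.
Qed.

Lemma act_cts_mx (g : 'M[C]_3) : SU21 g -> {for g, continuous (fun h => act h (base R))}.
Proof.
move=> gG; have l0 := lam_neq0 gG (siegel_base R).
have cv i : ctsC g (fun h : 'M[C]_3 => (h *m vec (base R)) i 0).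
  apply: ctsC_eq (ctsCD (ctsCD (ctsCM (mx_coord_cts g i o0) (@ctsC_cst _ _ (vec (base R) o0 0)))
    (ctsCM (mx_coord_cts g i o1) (@ctsC_cst _ _ (vec (base R) o1 0))))
    (ctsCM (mx_coord_cts g i o2) (@ctsC_cst _ _ (vec (base R) o2 0)))) => h.
  by rewrite [RHS]mxE sum3.
have cz := ctsCM (cv o0) (@ctsC_V _ _ (fun q : 'M[C]_3 => (q *m vec (base R)) o2 0) l0 (cv o2)).
have i0 : (1 +i* 1) * lam g (base R) != 0 by rewrite mulf_neq0 ?onei_neq0.
have cw := ctsCM (cv o1) (@ctsC_V _ _ (fun q : 'M[C]_3 => (1 +i* 1) * (q *m vec (base R)) o2 0) i0 (ctsCM (@ctsC_cst _ _ (1 +i* 1)) (cv o2))).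
by apply: pt4_cts; [case: cz|case: cz|case: cw|case: cw].
Qed.

Lemma act_cts (g : 'M[C]_3) (p : pt4) : SU21 g -> siegel p -> {for p, continuous (act g)}.
Proof.
move=> gG sp; have l0 := lam_neq0 gG sp.
have cv i : ctsC p (fun q => (g *m vec q) i 0).
  have c1 : ctsC p (fun q => (1 +i* 1) * wc q) by apply: ctsCM; [exact: ctsC_cst|exact: wc_cts].
  apply: ctsC_eq (ctsCD (ctsCD (ctsCM (@ctsC_cst _ _ (g i o0)) (zc_cts p))
    (ctsCM (@ctsC_cst _ _ (g i o1)) c1)) (@ctsC_cst _ _ (g i o2))) => q.
  by rewrite [RHS]mxE sum3 vec0 vec1 vec2 mulr1.
have cz := ctsCM (cv o0) (@ctsC_V _ _ (fun q => (g *m vec q) o2 0) l0 (cv o2)).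
have i0 : (1 +i* 1) * lam g p != 0 by rewrite mulf_neq0 ?onei_neq0.
have cw := ctsCM (cv o1) (@ctsC_V _ _ (fun q => (1 +i* 1) * (g *m vec q) o2 0) i0 (ctsCM (@ctsC_cst _ _ (1 +i* 1)) (cv o2))).
by apply: pt4_cts; [case: cz|case: cz|case: cw|case: cw].
Qed.

Lemma prP_cts (p : pt4) : siegel p -> {for p, continuous prP}.
Proof.
move=> sp A; rewrite {1}nbhsE => -[U [oU Up] UA].
have oV : open ((\pi_(GammaD R) : symD R -> GammaD R) @^-1` U) by [].
have oV' : open ((\pi_(symD R) : groupG R -> symD R) @^-1` ((\pi_(GammaD R) : symD R -> GammaD R) @^-1` U)) by [].
have [W oW WE] := oV'.
have : W (sect p).
  have : (set_val @^-1` W) (sectG p) by rewrite WE.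
  by rewrite /sectG; case: pselect.
move=> Wp; rewrite /nbhs /=.
have h1 := sect_cts sp (open_nbhs_nbhs (conj oW Wp)).
have h2 := open_nbhs_nbhs (conj siegel_open sp).
apply: (nbhs2 h1 h2) => q Wq sq; apply: UA.
have : (set_val @^-1` W) (sectG q) by rewrite /sectG; case: pselect.
by rewrite WE.
Qed.

(** Both quotient topologies are tested on the group, where the preimage of the image of the
    saturated set O is its preimage under the continuous orbit map of the base point. *)
Lemma open_prP (O : set pt4) : open O -> O `<=` @siegel R ->
  (forall p c, O p -> Gamma c -> O (act c p)) -> open (prP @` O).
Proof.
move=> oO Os OG.
have memO p : siegel p -> (prP @` O) (prP p) -> O p.
  move=> sp [q Oq /(prP_eq (Os _ Oq) sp)[c cG <-]]; exact: OG.
have E : (fun g => prX g) @^-1` (prP @` O) = (fun g => act (\val g) (base R)) @^-1` O.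
  apply/seteqP; split=> g /=; rewrite prX_prP.
    by apply: memO; exact: act_siegel (G_valP _) (siegel_base R).
  by move=> Og; exists (act (\val g) (base R)).
have : open ((fun g : groupG R => act (\val g) (base R)) @^-1` O).
  rewrite openE => g Og; rewrite /interior /=.
  have h : nbhs (\val g) ((fun h => act h (base R)) @^-1` O).
    by apply: (act_cts_mx (G_valP g)); exact: open_nbhs_nbhs.
  exact: (@initial_continuous _ _ set_val g _ h).
by rewrite -E.
Qed.

End Model.

(** * Proper discontinuity *)

Section Discontinuity.
Local Open Scope complex_scope.
Variable R : realType.
Local Notation C := R[i].
Local Notation pt4 := (pt4 R).
Implicit Types (g : 'M[C]_3) (p q : pt4).

(** H is its own inverse, so the adjoint of g satisfies the defining equation too. It makes the
    outer rows isotropic and gives the middle row, the equation of a mirror, norm 1. *)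
Lemma SU21_rows g : SU21 g ->
  [/\ normsq (g o0 o1) + 2 * complex.Im (g o0 o0 * conjc (g o0 o2)) = 0,
      normsq (g o1 o1) + 2 * complex.Im (g o1 o0 * conjc (g o1 o2)) = 1,
      normsq (g o2 o1) + 2 * complex.Im (g o2 o0 * conjc (g o2 o2)) = 0 &
      'i * g o1 o0 * conjc (g o2 o2) - g o1 o1 * conjc (g o2 o1)
        - 'i * g o1 o2 * conjc (g o2 o0) = 0].
Proof.
move=> gG; have gu := SU21_unit gG.
have : g *m hermH R *m adjoint g = hermH R.
  have := mulmxV gu; rewrite (SU21_invE gG) => e.
  have := congr1 (mulmx^~ (hermH R)) e; rewrite /= mul1mx.
  by rewrite -!mulmxA hermHK mulmx1 !mulmxA.
rewrite [in X in X -> _](mx3E g) adjoint3 hermH3 !mul_mx3 => /mx3_inj.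
move=> [[e1 _ _] [[_ e2 e4] [_ _ e3]]].
split; last by rewrite -[RHS]e4 ?complexiE; ring.
- move: e1; case: (g o0 o0) (g o0 o1) (g o0 o2) => a a' [b b'] [c c'].
  by move=> /(congr1 (@complex.Re R)); rewrite /normsq /= => e; lra.
- move: e2; case: (g o1 o0) (g o1 o1) (g o1 o2) => a a' [b b'] [c c'].
  by move=> /(congr1 (@complex.Re R)); rewrite /normsq /= => e; lra.
- move: e3; case: (g o2 o0) (g o2 o1) (g o2 o2) => a a' [b b'] [c c'].
  by move=> /(congr1 (@complex.Re R)); rewrite /normsq /= => e; lra.
Qed.

Definition functional (A B D : C) p : C := A * zc p + B * ((1 +i* 1) * wc p) + D.

Lemma mulmx_vec g p i : (g *m vec p) i 0 = functional (g i o0) (g i o1) (g i o2) p.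
Proof. by rewrite mxE sum3 vec0 vec1 vec2 mulr1. Qed.

(** Completes the square in the norm of the row (A, B, D). As the square is nonnegative, a bound on
    the value of the functional bounds A; all of proper discontinuity rests on this. *)
Lemma functional_form (A B D : C) (nu : R) p :
  normsq B + 2 * complex.Im (A * conjc D) = nu ->
  2 * complex.Im (conjc A * functional A B D p) =
  2 * normsq A * hgt p + normsq (B + 'i * A * conjc ((1 +i* 1) * wc p)) - nu.
Proof.
move=> <-; rewrite /functional /normsq /hgt /zc /wc.
by case: A B D => a a' [b b'] [c c'] /=; ring.
Qed.

Lemma normsqD_le (z w : C) : normsq (z + w) <= 2 * normsq z + 2 * normsq w.
Proof.
case: z w => a b [c d]; rewrite /normsq /=.
have := sqr_ge0 (a - c); have := sqr_ge0 (b - d); rewrite !expr2; nra.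
Qed.

Lemma Im_le_normsq (z w : C) (e : R) : 0 < e ->
  2 * complex.Im (conjc z * w) <= e * normsq z + e^-1 * normsq w.
Proof.
move=> e0; have ie : 0 < e^-1 by rewrite invr_gt0.
have ee : e * e^-1 = 1 by rewrite mulfV // gt_eqF.
case: z w => a b [c d]; rewrite /normsq /=; set f := e^-1 in ie ee *.
have := mulr_ge0 (ltW ie) (sqr_ge0 (e * a - d)); have := mulr_ge0 (ltW ie) (sqr_ge0 (e * b + c)).
have -> : f * (e * a - d) ^+ 2 = e * f * (e * a ^+ 2) - 2 * (e * f) * a * d + f * d ^+ 2 by ring.
have -> : f * (e * b + c) ^+ 2 = e * f * (e * b ^+ 2) + 2 * (e * f) * b * c + f * c ^+ 2 by ring.
by rewrite ee; lra.
Qed.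

(** Weighting the inequality for the imaginary part by the height lets half of the term in |A|^2 be
    absorbed. *)
Lemma functional_bound (A B D : C) (nu e M : R) p :
  normsq B + 2 * complex.Im (A * conjc D) = nu -> nu <= 1 -> 0 < e -> e <= hgt p ->
  normsq (functional A B D p) <= M -> 0 <= M ->
  normsq A <= (1 + M / e) / e /\
  normsq B <= 2 * (1 + M / e) + 4 * ((1 + M / e) / e) * normsq (wc p) * 2.
Proof.
move=> h nu1 e0 eh mM M0; have hf := functional_form p h.
have hI := Im_le_normsq A (functional A B D p) (lt_le_trans e0 eh).
have h0 : 0 < hgt p by exact: lt_le_trans eh.
have ie : (hgt p)^-1 <= e^-1 by rewrite lef_pV2 ?posrE.
have i0 : 0 < (hgt p)^-1 by rewrite invr_gt0.
have iM : (hgt p)^-1 * normsq (functional A B D p) <= M / e.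
  rewrite [M / e]mulrC; apply: ler_pM => //; [exact: ltW|exact: normsq_ge0].
set X := B + _ in hf.
have X0 := normsq_ge0 X; have A0 := normsq_ge0 A.
have hA : normsq A * e <= normsq A * hgt p by apply: ler_wpM2l.
have hA' : normsq A <= (1 + M / e) / e by rewrite ler_pdivlMr //; lra.
split=> //.
have hX : normsq X <= 1 + M / e by nra.
have -> : B = X + - ('i * A * conjc ((1 +i* 1) * wc p)) by rewrite /X addrK.
have h2 := normsqD_le X (- ('i * A * conjc ((1 +i* 1) * wc p))).
have e2 : normsq (- ('i * A * conjc ((1 +i* 1) * wc p))) = 2 * normsq A * normsq (wc p).
  by rewrite /wc; case: (A) => a a'; rewrite /normsq /=; ring.
rewrite e2 in h2.
have h3 : normsq A * normsq (wc p) <= (1 + M / e) / e * normsq (wc p).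
  by apply: ler_wpM2r => //; exact: normsq_ge0.
have h4 : 0 <= (1 + M / e) / e * normsq (wc p) by exact: le_trans (mulr_ge0 A0 (normsq_ge0 _)) h3.
lra.
Qed.

Lemma gaussian_normsq_ge1 (z : C) : gaussian_integer z -> z != 0 -> 1 <= normsq z.
Proof.
move=> [a [b ->]]; rewrite eq_complex /= !intr_eq0 negb_and /normsq /= => h.
rewrite -[1]/(1%:~R) -!rmorphXn -rmorphD /= ler_int.
by case/orP: h => h; nia.
Qed.

(** If A vanishes, isotropy kills B too and the value is the nonzero Gaussian integer D. Otherwise
    |A| is at least 1 and completing the square bounds the value below by the height. *)
Lemma cusp_bound (A B D : C) p : gaussian_integer A -> gaussian_integer D ->
  ~~ [&& A == 0, B == 0 & D == 0] ->
  normsq B + 2 * complex.Im (A * conjc D) = 0 -> 0 < hgt p ->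
  1 <= normsq (functional A B D p) \/ hgt p ^+ 2 <= normsq (functional A B D p).
Proof.
move=> gA gD n0 h h0; have [A0|A0] := eqVneq A 0.
  left; move: n0 h; rewrite A0 eqxx mul0r /= mulr0 addr0 => n0 /normsq_eq0 B0.
  move: n0; rewrite B0 eqxx /= => D0; rewrite /functional !mul0r !add0r.
  exact: gaussian_normsq_ge1.
right; have hf := functional_form p h; have A1 := gaussian_normsq_ge1 gA A0.
have hI := Im_le_normsq A (functional A B D p) h0.
have X0 := normsq_ge0 (B + 'i * A * conjc ((1 +i* 1) * wc p)).
have : normsq A * hgt p <= (hgt p)^-1 * normsq (functional A B D p) by lra.
rewrite [leRHS]mulrC ler_pdivlMr // => hh.
have : hgt p ^+ 2 <= normsq A * hgt p * hgt p by rewrite -mulrA -expr2; apply: ler_peMl => //; exact: sqr_ge0.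
by move/le_trans; apply.
Qed.

Lemma finite_argmin (T : Type) (S : set T) (f : T -> R) x0 : S x0 ->
  finite_set (f @` [set x | S x /\ f x <= f x0]) ->
  exists2 x, S x & forall y, S y -> f x <= f y.
Proof.
move=> Sx0 /finite_seqP[s sE].
have h0 : f x0 \in s.
  by have : [set` s] (f x0) by rewrite -sE; exists x0.
have minl (l : seq R) a : exists2 m, m \in a :: l & forall y, y \in a :: l -> m <= y.
  elim: l a => [|b l IH] a; first by exists a; rewrite ?inE // => y; rewrite inE => /eqP->.
  have [m ms mm] := IH b; have [h|h] := leP a m.
    exists a; rewrite ?inE ?eqxx // => y; rewrite inE => /orP[/eqP->//|/mm]; exact: le_trans.
  exists m; first by rewrite inE ms orbT.
  by move=> y; rewrite inE => /orP[/eqP->|/mm//]; exact: ltW.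
have [m ms mmin] : exists2 m, m \in s & forall y, y \in s -> m <= y.
  by case: s h0 {sE} => // a l _; exact: minl.
have : (f @` [set x | S x /\ f x <= f x0]) m by rewrite sE.
move=> [x [Sx fx] fm]; exists x => // y Sy.
have [h|h] := leP (f y) (f x0); last by apply: le_trans fx (ltW h).
rewrite fm; apply: mmin; have : [set` s] (f y) by rewrite -sE; exists y.
by [].
Qed.

Lemma finite_gaussian (M : R) : finite_set [set z : C | gaussian_integer z /\ normsq z <= M].
Proof.
have [n Mn] : exists n : nat, M <= n%:R.
  by exists (Num.Def.archi_bound `|M|); rewrite (le_trans (ler_norm _)) // ltW // archi_boundP.
have fI : finite_set [set a : int | `|a| <= n%:Z].
  have : finite_set ((fun k : nat => k%:Z - n%:Z) @` `I_(n + n).+1).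
    exact: finite_image (finite_II _).
  apply: sub_finite_set => a; rewrite /= => ha; exists (absz (a + n%:Z)); rewrite /=; lia.
have := finite_image (fun c : int * int => (c.1%:~R +i* c.2%:~R : C)) (finite_setX fI fI).
apply: sub_finite_set => z [[a [b ->]]]; rewrite /normsq /= => h.
have h' : (a ^+ 2 + b ^+ 2)%:~R <= (n%:Z)%:~R :> R.
  by rewrite rmorphD !rmorphXn /=; exact: le_trans h Mn.
rewrite ler_int in h'; exists (a, b) => //; split => /=; nia.
Qed.

Lemma finite_gaussian_mx (M : R) :
  finite_set [set g : 'M[C]_3 | forall i j, gaussian_integer (g i j) /\ normsq (g i j) <= M].
Proof.
have F := finite_gaussian M; set S := [set z | _] in F.
have F3 := finite_setX (finite_setX F F) F.
have := finite_image (fun c => mx3 c.1.1.1.1 c.1.1.1.2 c.1.1.2 c.1.2.1.1 c.1.2.1.2 c.1.2.2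
  c.2.1.1 c.2.1.2 c.2.2) (finite_setX (finite_setX F3 F3) F3).
apply: sub_finite_set => g /= h.
exists ((g o0 o0, g o0 o1, g o0 o2), (g o1 o0, g o1 o1, g o1 o2), (g o2 o0, g o2 o1, g o2 o2)).
  by split; [split|]; (split; [split|]); apply: h.
by rewrite /= -mx3E.
Qed.

Lemma nbhs_seq (T : topologicalType) (I : eqType) (s : seq I) (x : T) (P : I -> set T) :
  (forall i, i \in s -> nbhs x (P i)) -> nbhs x [set y | forall i, i \in s -> P i y].
Proof.
elim: s => [|a s IH] h; first exact: nearW.
have h1 := h a (mem_head _ _).
have h2 : nbhs x [set y | forall i, i \in s -> P i y].
  by apply: IH => i si; apply: h; rewrite inE si orbT.
apply: (nbhs2 h1 h2) => y Pa Ps i; rewrite inE => /orP[/eqP->//|]; exact: Ps.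
Qed.

Lemma ctsR_lt (T : topologicalType) (x : T) (f : T -> R) (M : R) :
  ctsR x f -> f x < M -> nbhs x [set y | f y < M].
Proof. by move=> cf h; apply: (cf [set r | r < M]); exact: lt_nbhsl. Qed.

Lemma ctsR_gt (T : topologicalType) (x : T) (f : T -> R) (M : R) :
  ctsR x f -> M < f x -> nbhs x [set y | M < f y].
Proof. by move=> cf h; apply: (cf [set r | M < r]); exact: lt_nbhsr. Qed.

Lemma normsq_zc_cts p : ctsR p (fun q => normsq (zc q)).
Proof. by apply: ctsRD; apply: ctsRX; [exact: px_cts|exact: py_cts]. Qed.

Lemma normsq_wc_cts p : ctsR p (fun q => normsq (wc q)).
Proof. by apply: ctsRD; apply: ctsRX; [exact: pa_cts|exact: pb_cts]. Qed.

Definition siegel_set (e M : R) : set pt4 :=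
  [set p | [/\ e <= hgt p, px p ^+ 2 <= M & normsq (wc p) <= M]].

Lemma row_entries_bound (e M K : R) : 0 < e -> 0 <= M -> 0 <= K -> exists L,
  forall (A B D : C) (nu : R) p, normsq B + 2 * complex.Im (A * conjc D) = nu -> nu <= 1 ->
    e <= hgt p -> normsq (zc p) <= K -> normsq (wc p) <= K ->
    normsq (functional A B D p) <= M ->
    [/\ normsq A <= L, normsq B <= L & normsq D <= L].
Proof.
move=> e0 M0 K0.
set a := (1 + M / e) / e; set b := 2 * (1 + M / e) + 4 * a * K * 2.
have a0 : 0 <= a by rewrite divr_ge0 ?addr_ge0 ?divr_ge0 // ltW.
have b0 : 0 <= b by rewrite /b; have := divr_ge0 M0 (ltW e0); have := mulr_ge0 a0 K0; lra.
set d := 2 * M + 4 * (a * K) + 4 * (b * (2 * K)).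
have aK := mulr_ge0 a0 K0; have bK := mulr_ge0 b0 K0.
exists (a + b + d) => A B D nu p h nu1 ep zK wK mM.
have [hA hB'] := functional_bound h nu1 e0 ep mM M0.
have hB : normsq B <= b.
  apply: le_trans hB' _; rewrite /b -/a lerD2l.
  have := ler_wpM2l a0 wK; lra.
have hD : normsq D <= d.
  have -> : D = functional A B D p + (- (A * zc p) + - (B * ((1 +i* 1) * wc p))).
    by rewrite /functional; ring.
  apply: le_trans (normsqD_le _ _) _.
  have := normsqD_le (- (A * zc p)) (- (B * ((1 +i* 1) * wc p))).
  have e1 : normsq (- (A * zc p)) = normsq A * normsq (zc p).
    by rewrite -normsqM /normsq; case: (A * zc p) => ? ? /=; ring.
  have e2 : normsq (- (B * ((1 +i* 1) * wc p))) = normsq B * (2 * normsq (wc p)).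
    rewrite -[2 * _](_ : normsq ((1 +i* 1) * wc p) = _); last by rewrite normsqM /normsq /=; ring.
    by rewrite -normsqM /normsq; case: (B * _) => ? ? /=; ring.
  rewrite e1 e2 /d.
  have := ler_pM (normsq_ge0 A) (normsq_ge0 (zc p)) hA zK.
  by have := ler_pM (normsq_ge0 B) (normsq_ge0 (wc p)) hB wK; rewrite -/a; lra.
have d0 : 0 <= d by rewrite /d; lra.
have hA2 : normsq A <= a by []; clearbody a b d; by split; lra.
Qed.

Lemma row_rel g i : SU21 g ->
  exists2 nu : R, nu <= 1 & normsq (g i o1) + 2 * complex.Im (g i o0 * conjc (g i o2)) = nu.
Proof.
move=> /SU21_rows[h0 h1 h2 _].
by move: i; apply: ord3P; [exists 0|exists 1|exists 0]; rewrite ?ler01.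
Qed.

(** The entries of the inverse of g are bounded: it maps the bounded set W to p, and its automorphy
    factor is controlled by the ratio of the heights. A Siegel set is unbounded upwards, so the
    height of p must be bounded before its other coordinates are. *)
Lemma Gamma_finite q (e M : R) : siegel q -> 0 < e -> exists2 W, nbhs q W &
  finite_set [set g | Gamma g /\ exists2 p, siegel_set e M p & W (act g p)].
Proof.
move=> sq e0; set h := hgt q in sq.
have h2 : 0 < h / 2 by rewrite divr_gt0.
set K := 1 + hgt q + normsq (zc q) + normsq (wc q).
have z0 := normsq_ge0 (zc q); have w0 := normsq_ge0 (wc q).
have K0 : 0 < K by rewrite /K -/h; have := sq; rewrite /siegel /= => ?; lra.
have sq' : 0 < h by exact: sq.
pose W := [set n : pt4 | [/\ h / 2 < hgt n, hgt n < K, normsq (zc n) < K & normsq (wc n) < K]].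
exists W.
  have n1 := ctsR_gt (@hgt_cts _ q) (_ : h / 2 < hgt q).
  have n2 := ctsR_lt (@hgt_cts _ q) (_ : hgt q < K).
  have n3 := ctsR_lt (@normsq_zc_cts q) (_ : _ < K).
  have n4 := ctsR_lt (@normsq_wc_cts q) (_ : _ < K).
  have n12 : nbhs q [set n | h / 2 < hgt n /\ hgt n < K].
    by apply: (nbhs2 (n1 _) (n2 _)) => //; rewrite /K -/h; lra.
  have n34 : nbhs q [set n | normsq (zc n) < K /\ normsq (wc n) < K].
    by apply: (nbhs2 (n3 _) (n4 _)) => //; rewrite /K -/h; lra.
  by apply: (nbhs2 n12 n34) => n [? ?] [].
have [M0|M0] := ltP M 0.
  rewrite (_ : [set g | _] = set0) ?finite_set0 // -subset0 => g [_ [p [_ _ hM] _]].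
  by have := le_lt_trans (le_trans (normsq_ge0 _) hM) M0; rewrite ltxx.
(* Bound for the height of p by [cusp_bound] on the bottom row of the inverse: either the automorphy
   factor is at least 1 in modulus, giving K, or at least the height of n, giving the other term. *)
set K2 := K + (h / 2)^-1.
have K20 : 0 < (h / 2)^-1 by rewrite invr_gt0.
set Z := M + (K2 + M) ^+ 2.
have Z0 : 0 <= Z by rewrite addr_ge0 // sqr_ge0.
set M' := K / e * (Z + 2 * M + 1).
have Ke : 0 <= K / e by rewrite divr_ge0 // ltW.
have M'0 : 0 <= M' by rewrite mulr_ge0 //; lra.
have [L HL] := row_entries_bound h2 M'0 (ltW K0).
have := finite_image (@invmx _ 3) (finite_gaussian_mx L); apply: sub_finite_set.
move=> g [gG [p [ep pM wM] [Wh WK Wz Ww]]].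
set n := act g p in Wh WK Wz Ww.
have sp : siegel p by exact: lt_le_trans ep.
have gS : SU21 g := proj1 gG.
have iG := Gamma_inv gG; have iS : SU21 (invmx g) := proj1 iG.
exists (invmx g); last by rewrite invmxK.
have sn : siegel n by exact: act_siegel.
have pE : act (invmx g) n = p by exact: actK.
have hE := hgt_act iS sn; rewrite pE in hE.
have vE := vec_act iS sn; rewrite pE in vE.
set l := lam (invmx g) n in hE vE.
have l0 : 0 < normsq l by rewrite normsq_gt0 // lam_neq0.
have lK : normsq l <= K / e.
  rewrite ler_pdivlMr //; apply: (@le_trans _ _ (normsq l * hgt p)); first by rewrite ler_pM2l.
  by rewrite -hE ltW.
have [_ _ r3 _] := SU21_rows iS.
have hK2 : hgt p <= K2.
  have lE : l = functional (invmx g o2 o0) (invmx g o2 o1) (invmx g o2 o2) n by rewrite -mulmx_vec.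
  have := cusp_bound (proj2 iG o2 o0) (proj2 iG o2 o2) _ r3 sn; rewrite -lE => cb.
  have [|l1|l1] := cb.
  - apply/negP => /and3P[/eqP a0 /eqP b0 /eqP d0]; move: l0.
    by rewrite lE a0 b0 d0 /functional !mul0r !addr0 normsq0 ltxx.
  - have : hgt p <= normsq l * hgt p by apply: ler_peMl => //; exact: ltW.
    by rewrite -hE /K2; lra.
  - have : hgt n ^+ 2 * hgt p <= hgt n by rewrite {2}hE ler_pM2r.
    rewrite expr2 -mulrA -{3}[hgt n]mulr1 ler_pM2l // => h1.
    have : hgt p <= (h / 2)^-1.
      rewrite -[leRHS]mul1r ler_pdivlMr // mulrC; apply: le_trans h1.
      by rewrite ler_pM2r // ltW.
    by rewrite /K2; lra.
have pyE : py p = hgt p + normsq (wc p) by rewrite /hgt /normsq /wc /=; ring.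
have zZ : normsq (zc p) <= Z.
  rewrite {1}/normsq /= /Z lerD // pyE; have hp : 0 < hgt p by [].
  have := normsq_ge0 (wc p) => wp; rewrite ler_sqr ?nnegrE; lra.
have vb i : normsq ((invmx g *m vec n) i 0) <= M'.
  rewrite vE mxE normsqM; apply: ler_pM => //; try exact: normsq_ge0.
  have := normsq_ge0 (zc p); have := normsq_ge0 (wc p) => wp zp.
  move: i; apply: ord3P; rewrite ?vec0 ?vec1 ?vec2 ?normsq1; try lra.
  have -> : normsq ((1 +i* 1) * wc p) = 2 * normsq (wc p) by rewrite normsqM /normsq /=; ring.
  lra.
move=> i j; split; first exact: (proj2 iG).
have [nu nu1 hr] := row_rel i iS.
have := vb i; rewrite mulmx_vec => vbi.
have [ha hb hd] := HL _ _ _ _ _ hr nu1 (ltW Wh) (ltW Wz) (ltW Ww) vbi.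
by move: j; apply: ord3P.
Qed.

(** Applies [open_prP] to the saturation of the interior of V. *)
Lemma nbhs_prP p (V : set pt4) : siegel p -> nbhs p V -> nbhs (prP p) (@prP R @` (V `&` @siegel R)).
Proof.
move=> sp pV; pose V' := interior (V `&` @siegel R).
have Vp : V' p by apply: filterI => //; apply: open_nbhs_nbhs; split=> //; exact: siegel_open.
pose O := [set q | siegel q /\ exists2 g, Gamma g & V' (act g q)].
have Op : O p by split=> //; exists 1%:M; [exact: Gamma_1|rewrite act1].
have oO : open O.
  rewrite openE => q [sq [g gG Vq]]; rewrite /interior /=.
  have h1 := act_cts (proj1 gG) sq (open_nbhs_nbhs (conj (@open_interior _ _) Vq)).
  have h2 := open_nbhs_nbhs (conj (@siegel_open R) sq).
  by apply: (nbhs2 h1 h2) => r Vr sr; split=> //; exists g.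
have : nbhs (prP p) (@prP R @` O).
  apply: open_nbhs_nbhs; split; last by exists p.
  apply: (@open_prP R O oO); first by move=> q [].
  move=> q c [sq [g gG Vq]] cG.
  split; first exact: act_siegel (proj1 cG) sq.
  exists (g *m invmx c); first exact: Gamma_mul gG (Gamma_inv cG).
  rewrite act_mul ?actK //; [exact: (proj1 cG)|exact: (proj1 gG)|exact: (proj1 (Gamma_inv cG))|].
  exact: act_siegel (proj1 cG) sq.
apply: filterS => _ [q [sq [g gG Vq]] <-]; exists (act g q); first exact: interior_subset Vq.
have sgq := act_siegel (proj1 gG) sq.
by apply/esym/prP_eq => //; exists g.
Qed.

Lemma siegel_set_nbhs p : siegel p -> exists e M, 0 < e /\ nbhs p (siegel_set e M).
Proof.
move=> sp; exists (hgt p / 2), (1 + px p ^+ 2 + normsq (wc p)).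
have sp' : 0 < hgt p by exact: sp.
have x0 := sqr_ge0 (px p); have w0 := normsq_ge0 (wc p).
split; first by rewrite divr_gt0.
have n1 := ctsR_gt (@hgt_cts _ p) (_ : hgt p / 2 < hgt p).
have n2 := ctsR_lt (ctsRX (n := 2) (@px_cts _ p)) (_ : px p ^+ 2 < 1 + px p ^+ 2 + normsq (wc p)).
have n3 := ctsR_lt (@normsq_wc_cts p) (_ : _ < 1 + px p ^+ 2 + normsq (wc p)).
have n23 : nbhs p [set q | px q ^+ 2 <= 1 + px p ^+ 2 + normsq (wc p) /\
    normsq (wc q) <= 1 + px p ^+ 2 + normsq (wc p)].
  by apply: (nbhs2 (n2 _) (n3 _)) => [||y /ltW ? /ltW]; [lra|lra|].
by apply: (nbhs2 (n1 _) n23) => [|y /ltW ? []]; [lra|].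
Qed.

(** Only finitely many group elements bring points near p to points near q; their neighbourhoods are
    shrunk for each of these in turn. *)
Lemma hausdorff_GammaD : hausdorff_space (GammaD R).
Proof.
move=> x y; have [p sp <-] := prP_surj x; have [q sq <-] := prP_surj y => clu.
apply: contrapT => npq.
have [e [M [e0 pS]]] := siegel_set_nbhs sp.
have [W qW /finite_seqP[s sE]] := Gamma_finite M sq e0.
have sep g : g \in s -> exists V W', [/\ nbhs p V, nbhs q W' & forall r, V r -> ~ W' (act g r)].
  move=> gs; have : [set` s] g by [].
  rewrite -sE => -[gG _].
  have gq : act g p <> q by move=> e1; apply: npq; apply/prP_eq => //; exists g.
  have := @norm_hausdorff _ pt4; rewrite open_hausdorff => /(_ (act g p) q (introN eqP gq)).
  move=> [[V W'] /= [Vp Wq] [oV oW VW]]; exists (act g @^-1` V), W'; split.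
  - by apply: (act_cts (proj1 gG) sp); apply: open_nbhs_nbhs; split=> //; rewrite inE in Vp.
  - by apply: open_nbhs_nbhs; split=> //; rewrite inE in Wq.
  - by move=> r Vr Wr; have : (V `&` W') (act g r) by []; rewrite (eqP VW).
have /choice[f fP] : forall g, exists VW : set pt4 * set pt4, g \in s ->
   [/\ nbhs p VW.1, nbhs q VW.2 & forall r, VW.1 r -> ~ VW.2 (act g r)].
  move=> g; have [gs|gs] := boolP (g \in s); last by exists (set0, set0).
  by have [V [W' ?]] := sep _ gs; exists (V, W').
have nV : nbhs p [set r | forall g, g \in s -> (f g).1 r] by apply: nbhs_seq => i /fP[].
have nW : nbhs q [set r | forall g, g \in s -> (f g).2 r] by apply: nbhs_seq => i /fP[].
have [_ [[r [[rS rV] sr] <-] [r' [[r'W r'V] sr'] e1]]] :=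
  clu _ _ (nbhs_prP sp (filterI pS nV)) (nbhs_prP sq (filterI qW nW)).
have [g gG gE] := (prP_eq sr sr').1 (esym e1).
have gs : g \in s.
  have : [set` s] g by rewrite -sE; split=> //; exists r => //; rewrite gE.
  by [].
have [_ _ h] := fP _ gs; apply: (h r (rV _ gs)); rewrite gE; exact: r'V.
Qed.

(** Near q only finitely many translates of F can occur, and each of them is closed and avoids q. *)
Lemma closed_prP (F : set pt4) (e M : R) : 0 < e -> F `<=` siegel_set e M -> closed F ->
  closed (@prP R @` F).
Proof.
move=> e0 FS cF x clx; have [q sq xE] := prP_surj x; subst x.
apply: contrapT => nF.
have [W qW /finite_seqP[s sE]] := Gamma_finite M sq e0.
have N g : g \in s -> nbhs q (act (invmx g) @^-1` (~` F)).
  move=> gs; have : [set` s] g by [].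
  rewrite -sE => -[gG _]; have iG := Gamma_inv gG.
  apply: (act_cts (proj1 iG) sq); apply: open_nbhs_nbhs; split; first exact: closed_openC.
  move=> Fg; apply: nF; exists (act (invmx g) q) => //; apply/esym/prP_eq => //.
    exact: act_siegel (proj1 iG) sq.
  by exists (invmx g).
have [_ [[f Ff <-] [r [[rW rN] sr] e1]]] := clx _ (nbhs_prP sq (filterI qW (nbhs_seq N))).
have [ef _ _] := FS _ Ff; have sf : siegel f by exact: lt_le_trans ef.
have [g gG gE] := (prP_eq sf sr).1 (esym e1).
have gs : g \in s.
  have : [set` s] g by rewrite -sE; split=> //; exists f; [exact: FS|rewrite gE].
  by [].
by apply: (rN _ gs); rewrite /= -gE actK //; exact: (proj1 gG).
Qed.

(** The minimum is attained because the row entries are Gaussian integers, and those giving a value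
    below the initial one are bounded. *)
Lemma row_argmin p i : siegel p -> exists2 g, Gamma g &
  forall g', Gamma g' -> normsq ((g *m vec p) i 0) <= normsq ((g' *m vec p) i 0).
Proof.
move=> sp; pose f g := normsq ((g *m vec p) i 0).
have [L HL] := row_entries_bound sp (normsq_ge0 ((1%:M *m vec p) i 0))
  (addr_ge0 (normsq_ge0 (zc p)) (normsq_ge0 (wc p))).
apply: (@finite_argmin _ (@Gamma R) f 1%:M (Gamma_1 R)).
have F := finite_gaussian L.
have := finite_image (fun c : C * C * C => normsq (functional c.1.1 c.1.2 c.2 p))
  (finite_setX (finite_setX F F) F).
apply: sub_finite_set => _ [g [gG fg] <-]; rewrite /f mulmx_vec in fg *.
have [nu nu1 hr] := row_rel i (proj1 gG).
have [||h1 h2 h3] := HL _ _ _ _ _ hr nu1 (lexx (hgt p)) _ _ fg.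
- by have := normsq_ge0 (wc p); lra.
- by have := normsq_ge0 (zc p); lra.
by exists (g i o0, g i o1, g i o2) => //; split; [split|]; split => //=; exact: (proj2 gG _ _).
Qed.

End Discontinuity.

(** * Arithmetic of the middle row and explicit elements of the group *)

Section Elements.
Local Open Scope complex_scope.
Variable R : realType.
Local Notation C := R[i].
Local Notation pt4 := (pt4 R).
Implicit Types (g : 'M[C]_3) (p q : pt4).

Lemma complex_eq (z w : C) : complex.Re z = complex.Re w -> complex.Im z = complex.Im w -> z = w.
Proof. by case: z w => a b [c d] /= -> ->. Qed.

Lemma SU21_rows2 g : SU21 g ->
  [/\ 'i * g o0 o0 * conjc (g o2 o2) - g o0 o1 * conjc (g o2 o1)
        - 'i * g o0 o2 * conjc (g o2 o0) = 'i,
      'i * g o0 o0 * conjc (g o1 o2) - g o0 o1 * conjc (g o1 o1)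
        - 'i * g o0 o2 * conjc (g o1 o0) = 0,
      normsq (g o1 o0) + 2 * complex.Im (conjc (g o0 o0) * g o2 o0) = 0 &
      normsq (g o1 o2) + 2 * complex.Im (conjc (g o0 o2) * g o2 o2) = 0].
Proof.
move=> gG; have [_ gH] := gG; have gu := SU21_unit gG.
have : g *m hermH R *m adjoint g = hermH R.
  have := mulmxV gu; rewrite (SU21_invE gG) => e.
  have := congr1 (mulmx^~ (hermH R)) e; rewrite /= mul1mx.
  by rewrite -!mulmxA hermHK mulmx1 !mulmxA.
rewrite [in X in X -> _](mx3E g) adjoint3 hermH3 !mul_mx3 => /mx3_inj [[_ e3 e4] _].
have := gH; rewrite [in X in X -> _](mx3E g) adjoint3 hermH3 !mul_mx3 => /mx3_inj.
move=> [[e1 _ _] [_ [_ _ e2]]].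
split; [by rewrite -[RHS]e4 ?complexiE; ring|by rewrite -[RHS]e3 ?complexiE; ring| |].
- move: e1; case: (g o0 o0) (g o1 o0) (g o2 o0) => a a' [b b'] [c c'].
  by move=> /(congr1 (@complex.Re R)); rewrite /normsq /= => e; lra.
- move: e2; case: (g o0 o2) (g o1 o2) (g o2 o2) => a a' [b b'] [c c'].
  by move=> /(congr1 (@complex.Re R)); rewrite /normsq /= => e; lra.
Qed.

Lemma intz_parity (d : int) : exists q : int, d = 2 * q \/ d = 2 * q + 1.
Proof. by exists (divz d 2); have := divz_eq d 2; have := ltz_pmod d (isT : 0 < 2 :> int); have := modz_ge0 d (isT : 2 != 0 :> int); lia. Qed.

(** A Gaussian integer of even norm is divisible by 1 + i, the prime above 2. *)
Lemma even_gaussian (d1 d2 n : int) : d1 ^+ 2 + d2 ^+ 2 = 2 * n ->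
  exists e1 e2 : int, d1 = e1 - e2 /\ d2 = e1 + e2.
Proof.
have [q1 h1] := intz_parity d1; have [q2 h2] := intz_parity d2.
case: h1 => ->; case: h2 => -> h.
- by exists (q1 + q2), (q2 - q1); split; lia.
- by exfalso; lia.
- by exfalso; lia.
- by exists (q1 + q2 + 1), (q2 - q1); split; lia.
Qed.

Lemma even_normsq_gaussian (z x y : C) : gaussian_integer z -> gaussian_integer x ->
  gaussian_integer y -> normsq z + 2 * complex.Im (conjc x * y) = 0 ->
  exists e1 e2 : int, z = (1 +i* 1) * (e1%:~R +i* e2%:~R).
Proof.
move=> [z1 [z2 ->]] [x1 [x2 ->]] [y1 [y2 ->]]; rewrite /normsq /= => h.
have hz : z1 ^+ 2 + z2 ^+ 2 = 2 * (x2 * y1 - x1 * y2).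
  apply/eqP; rewrite -(eqr_int R); apply/eqP.
  by rewrite rmorphD !rmorphXn rmorphM rmorphB !rmorphM /=; lra.
have [e1 [e2 [-> ->]]] := even_gaussian hz; exists e1, e2.
by apply: complex_eq; rewrite /= ?rmorphB ?rmorphD /=; ring.
Qed.

(** The outer columns are isotropic, so the outer entries of the middle row have even norm and are
    divisible by 1 + i. This is the origin of the factor 1 + i in the coordinate w: with it every
    mirror is given by Gaussian integers a, b, c with |b|^2 = 1 + 4k, where k = a1 c2 - a2 c1. *)
Lemma Gamma_row2 g : Gamma g -> exists a1 a2 b1 b2 c1 c2 : int,
  [/\ g o1 o0 = (1 +i* 1) * (a1%:~R +i* a2%:~R), g o1 o1 = b1%:~R +i* b2%:~R,
      g o1 o2 = (1 +i* 1) * (c1%:~R +i* c2%:~R) &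
      b1 ^+ 2 + b2 ^+ 2 = 1 + 4 * (a1 * c2 - a2 * c1)].
Proof.
move=> [gG gZ]; have [_ h2 _ _] := SU21_rows gG; have [_ _ k1 k2] := SU21_rows2 gG.
have [a1 [a2 A]] := even_normsq_gaussian (gZ _ _) (gZ _ _) (gZ _ _) k1.
have [c1 [c2 D]] := even_normsq_gaussian (gZ _ _) (gZ _ _) (gZ _ _) k2.
have [b1 [b2 B]] := gZ o1 o1; exists a1, a2, b1, b2, c1, c2; split=> //.
apply/eqP; rewrite -(eqr_int R); apply/eqP.
move: h2; rewrite A B D /normsq /= => h.
by rewrite !rmorphD rmorphM rmorphB !rmorphM /= -!expr2; lra.
Qed.

(** [transM], [rotM], [sl2M] and [tauM] preserve the mirror w = 0, and [rotM] fixes it pointwise.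
    [sigM] sends [wc] to 1 - [wc], so it exchanges that mirror with its rival [wc] = 1. *)
Definition transM (n : int) : 'M[C]_3 := mx3 1 0 n%:~R 0 1 0 0 0 1.
Definition rotM : 'M[C]_3 := mx3 'i 0 0 0 (-1) 0 0 0 'i.
Definition sl2M (a b c d : int) : 'M[C]_3 := mx3 a%:~R 0 b%:~R 0 1 0 c%:~R 0 d%:~R.
Definition sigM : 'M[C]_3 := mx3 (-1) (1 +i* 1) (-'i) 0 1 (- (1 +i* 1)) 0 0 (-1).
Definition tauM : 'M[C]_3 := mx3 0 0 (-'i) 0 (-1) 0 'i 0 0.

Lemma gaussian_int (n : int) : gaussian_integer (n%:~R : C).
Proof. by exists n, 0; apply: complex_eq; rewrite -[n%:~R in LHS](rmorph_int (@real_complex R)). Qed.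

Lemma gaussian_mk (m n : int) : gaussian_integer (m%:~R +i* n%:~R : C).
Proof. by exists m, n. Qed.

Lemma gaussian1 : gaussian_integer (1 : C). Proof. exact: (gaussian_int 1). Qed.
Lemma gaussianN (z : C) : gaussian_integer z -> gaussian_integer (- z).
Proof. by move=> h; rewrite -mulN1r; apply: gaussianM h; exact: (gaussian_int (-1)). Qed.
Lemma gaussian_i : gaussian_integer ('i : C). Proof. exact: (gaussian_mk 0 1). Qed.
Lemma gaussian_1i : gaussian_integer (1 +i* 1 : C). Proof. exact: (gaussian_mk 1 1). Qed.

Lemma mx3_gaussian a b c d e f x y z : [/\ gaussian_integer a, gaussian_integer b & gaussian_integer c] ->
  [/\ gaussian_integer d, gaussian_integer e & gaussian_integer f] ->
  [/\ gaussian_integer x, gaussian_integer y & gaussian_integer z] ->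
  forall i j, gaussian_integer (mx3 a b c d e f x y z i j : C).
Proof. by move=> [? ? ?] [? ? ?] [? ? ?]; apply: ord3P; apply: ord3P; rewrite mxE. Qed.

Lemma transM_Gamma n : Gamma (transM n).
Proof.
split; last first.
  by apply: mx3_gaussian; split; try exact: gaussian1; try exact: (gaussian0 R); exact: gaussian_int.
split; first by rewrite det3; ring.
rewrite adjoint3 hermH3 !mul_mx3; congr mx3; apply: complex_eq;
  rewrite -?[n%:~R](rmorph_int (@real_complex R)) /=; ring.
Qed.

Lemma rotM_Gamma : Gamma rotM.
Proof.
split; last first.
  by apply: mx3_gaussian; split; try exact: (gaussian0 R); try exact: gaussian_i; apply: gaussianN; exact: gaussian1.
split; first by rewrite det3; apply: complex_eq; rewrite /=; ring.
by rewrite adjoint3 hermH3 !mul_mx3; congr mx3; apply: complex_eq; rewrite /=; ring.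
Qed.

Lemma sl2M_Gamma a b c d : a * d - b * c = 1 -> Gamma (sl2M a b c d).
Proof.
move=> e; split; last first.
  by apply: mx3_gaussian; split; try exact: (gaussian0 R); try exact: gaussian1; exact: gaussian_int.
have eR : a%:~R * d%:~R - b%:~R * c%:~R = 1 :> R by rewrite -!intrM -intrB e.
have eC : a%:~R * d%:~R - b%:~R * c%:~R = 1 :> C by rewrite -!intrM -intrB e.
split; first by rewrite det3 -[RHS]eC; ring.
rewrite adjoint3 hermH3 !mul_mx3 -[a%:~R](rmorph_int (@real_complex R)) -[b%:~R](rmorph_int (@real_complex R))
  -[c%:~R](rmorph_int (@real_complex R)) -[d%:~R](rmorph_int (@real_complex R)).
by congr mx3; apply: complex_eq; rewrite /=; lra.
Qed.

Lemma sigM_Gamma : Gamma sigM.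
Proof.
split; last first.
  by apply: mx3_gaussian; split; try exact: (gaussian0 R); try exact: gaussian1; try exact: gaussian_1i;
    apply: gaussianN; try exact: gaussian1; try exact: gaussian_1i; exact: gaussian_i.
split; first by rewrite det3; apply: complex_eq; rewrite /=; ring.
by rewrite adjoint3 hermH3 !mul_mx3; congr mx3; apply: complex_eq; rewrite /=; ring.
Qed.

Lemma tauM_Gamma : Gamma tauM.
Proof.
split; last first.
  by apply: mx3_gaussian; split; try exact: (gaussian0 R); try exact: gaussian_i;
    apply: gaussianN; try exact: gaussian1; exact: gaussian_i.
split; first by rewrite det3; apply: complex_eq; rewrite /=; ring.
by rewrite adjoint3 hermH3 !mul_mx3; congr mx3; apply: complex_eq; rewrite /=; ring.
Qed.

Lemma prP_act g p : Gamma g -> siegel p -> prP (act g p) = prP p.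
Proof.
move=> gG sp; apply/esym/prP_eq => //; last by exists g.
exact: act_siegel (proj1 gG) sp.
Qed.

Lemma col3_scale (l a b c a' b' c' : C) : a = l * a' -> b = l * b' -> c = l * c' ->
  col3 a b c = l *: col3 a' b' c'.
Proof.
by move=> -> -> ->; apply/matrixP => i j; rewrite !mxE; move: i; apply: ord3P.
Qed.

Lemma act_transM n p : act (transM n) p = (px p + n%:~R, py p, pa p, pb p).
Proof.
apply: (@act_scale _ _ _ _ 1); first exact: oner_neq0.
rewrite mul_mx3_col; apply: col3_scale; rewrite /zc /wc /px /py /pa /pb /=;
  rewrite -?[n%:~R](rmorph_int (@real_complex R)); apply: complex_eq; rewrite /=; ring.
Qed.

Lemma complexi_neq0 : ('i : C) != 0. Proof. by rewrite eq_complex /= oner_eq0 andbF. Qed.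

Lemma act_rotM p : act rotM p = (px p, py p, - pb p, pa p).
Proof.
apply: (@act_scale _ _ _ _ 'i); first exact: complexi_neq0.
by rewrite mul_mx3_col; apply: col3_scale; rewrite /zc /wc /px /py /pa /pb /=;
  apply: complex_eq; rewrite /=; ring.
Qed.

Lemma act_sigM p : act sigM p = (px p + 2 * pb p, py p - 2 * pa p + 1, 1 - pa p, - pb p).
Proof.
apply: (@act_scale _ _ _ _ (-1)); first by rewrite oppr_eq0 oner_neq0.
by rewrite mul_mx3_col; apply: col3_scale; rewrite /zc /wc /px /py /pa /pb /=;
  apply: complex_eq; rewrite /=; ring.
Qed.

Lemma act_tauM p q : zc p != 0 -> zc q * zc p = -1 -> wc q * zc p = 'i * wc p ->
  act tauM p = q.
Proof.
move=> z0 hz hw; apply: (@act_scale _ _ _ _ ('i * zc p)).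
  by rewrite mulf_neq0 // complexi_neq0.
rewrite mul_mx3_col; apply: col3_scale; last by rewrite ?complexiE; ring.
  rewrite -mulrA [zc p * _]mulrC hz; ring.
have -> : 'i * zc p * ((1 +i* 1) * wc q) = 'i * (1 +i* 1) * (wc q * zc p) by ring.
by rewrite hw; case: (wc p) => a b; apply: complex_eq; rewrite /=; ring.
Qed.

Lemma act_sl2M a b c d p q : c%:~R * zc p + d%:~R != 0 ->
  zc q * (c%:~R * zc p + d%:~R) = a%:~R * zc p + b%:~R ->
  wc q * (c%:~R * zc p + d%:~R) = wc p -> act (sl2M a b c d) p = q.
Proof.
move=> z0 hz hw; apply: (@act_scale _ _ _ _ (c%:~R * zc p + d%:~R)) => //.
rewrite mul_mx3_col; apply: col3_scale; last by ring.
  by rewrite [RHS]mulrC hz; ring.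
have -> : (c%:~R * zc p + d%:~R) * ((1 +i* 1) * wc q) = (1 +i* 1) * (wc q * (c%:~R * zc p + d%:~R)) by ring.
by rewrite hw; ring.
Qed.

End Elements.

(** * Distances to the mirrors *)

Section Mirrors.
Variable R : realType.
Implicit Types (s x y : R) (m : int).

(** The region in which, at t = 1, no mirror turns out to be nearer than w = 0; the real part of z
    is x + s/2. The disc centred at (0, 1/2) belongs to the mirror w + (i - 1) z = 0. *)
Definition above_floor s x y := [/\ -1 <= s <= 1, - (1 / 2) <= x <= 1 / 2,
  (1 + s) / 2 <= y /\ (1 - s) / 2 <= y & (1 + s ^+ 2) / 4 <= x ^+ 2 + (y - 1 / 2) ^+ 2].

(** Only the central disc may be touched, and only for s and x inside their ranges; this rules out
    ties with all other mirrors whose coefficient of z is nonzero. *)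
Definition generic_floor s x y := [/\ (1 + s) / 2 < y, (1 - s) / 2 < y &
  (1 + s ^+ 2) / 4 < x ^+ 2 + (y - 1 / 2) ^+ 2 \/ (-1 < s < 1 /\ - (1 / 2) < x < 1 / 2)].

Definition disc s x y (cx cy : R) := (x - cx) ^+ 2 + (y - cy) ^+ 2 - (1 + s ^+ 2) / 4.

Lemma above_floor_oppx s x y : above_floor s x y -> above_floor s (- x) y.
Proof. by move=> [h1 /andP[h2 h3] h4 h5]; split=> //; rewrite ?sqrrN //; apply/andP; split; lra. Qed.

Lemma above_floor_opps s x y : above_floor s x y -> above_floor (- s) x y.
Proof.
move=> [/andP[h1 h2] h3 [h4 h5] h6]; split; rewrite ?sqrrN // ?opprK //.
by apply/andP; split; lra.
Qed.

Lemma generic_floor_oppx s x y : generic_floor s x y -> generic_floor s (- x) y.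
Proof.
move=> [h1 h2 h3]; split=> //; rewrite sqrrN; case: h3 => [|[? /andP[? ?]]]; [by left|right].
by split=> //; apply/andP; split; lra.
Qed.

Lemma generic_floor_opps s x y : generic_floor s x y -> generic_floor (- s) x y.
Proof.
move=> [h1 h2 h3]; split; rewrite ?sqrrN ?opprK //; case: h3 => [|[/andP[? ?] ?]]; [by left|right].
by split=> //; apply/andP; split; lra.
Qed.

Lemma int_cases m : [\/ m%:~R <= -2 :> R, m%:~R = -1 :> R, m%:~R = 0 :> R | 1 <= m%:~R :> R].
Proof.
have : [\/ m <= -2, m = -1, m = 0 | 1 <= m].
  have [|] := leP m (-2); first by constructor 1.
  have [->|n1] := eqVneq m (-1); first by constructor 2.
  have [->|n0] := eqVneq m 0; first by constructor 3.
  by constructor 4; lia.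
case=> [h|->|->|h]; [constructor 1|constructor 2|constructor 3|constructor 4] => //.
  have e : (-2 : R) = (-2 : int)%:~R by rewrite rmorphN.
  by rewrite e ler_int.
by rewrite -[1]/(1%:~R) ler_int.
Qed.

(** Moving the centre by m adds m (m - 2x) to the excess over the central disc, and this is
    nonnegative as |x| is at most 1/2. *)
Lemma discA s x y m : above_floor s x y -> 0 <= disc s x y m%:~R (1 / 2) /\
  (generic_floor s x y -> (m = 0 -> (1 + s ^+ 2) / 4 < x ^+ 2 + (y - 1 / 2) ^+ 2) ->
   0 < disc s x y m%:~R (1 / 2)).
Proof.
move=> [/andP[hs1 hs2] /andP[hx1 hx2] [hy1 hy2] hD]; rewrite /disc.
have -> : (x - m%:~R) ^+ 2 + (y - 1 / 2) ^+ 2 - (1 + s ^+ 2) / 4 =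
   m%:~R * (m%:~R - 2 * x) + (x ^+ 2 + (y - 1 / 2) ^+ 2 - (1 + s ^+ 2) / 4) :> R by field.
have hm : 0 <= m%:~R * (m%:~R - 2 * x) /\ (m <> 0 -> -(1/2) < x < 1/2 -> 0 < m%:~R * (m%:~R - 2 * x)).
  have [h|h|h|h] := int_cases m.
  - by split=> [|_ /andP[? ?]]; nra.
  - by rewrite h; split=> [|_ /andP[? ?]]; lra.
  - rewrite h; split=> [|m0]; first by lra.
    by exfalso; apply: m0; apply/eqP; rewrite -(intr_eq0 R) h.
  - by split=> [|_ /andP[? ?]]; nra.
case: hm => hm1 hm2; split; first by lra.
move=> [_ _ [h|[_ h]]] h0; first by lra.
by have [m0|m0] := eqVneq m 0; [have := h0 m0; lra|have := hm2 (elimN eqP m0) h; lra].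
Qed.

Lemma discB s x y m : above_floor s x y -> 0 <= disc s x y (m%:~R + (1 - s) / 2) (s / 2) /\
  (generic_floor s x y -> 0 < disc s x y (m%:~R + (1 - s) / 2) (s / 2)).
Proof.
move=> hA; have [/andP[hs1 hs2] /andP[hx1 hx2] [hy1 hy2] hD] := hA; rewrite /disc.
set d := (1 - s) / 2; have sE : s = 1 - 2 * d by rewrite /d; field.
have d0 : 0 <= d by rewrite /d; lra.
have d1 : d <= 1 by rewrite /d; lra.
(* The excess over the central disc is split off; the remainder is nonnegative for each integer m,
   where m = -1 and m = 0 need both lower bounds on y. *)
have -> : (x - (m%:~R + d)) ^+ 2 + (y - s / 2) ^+ 2 - (1 + s ^+ 2) / 4 =
   (m%:~R + d) * (m%:~R + d - 2 * x) + d * (2 * y - 1 + d) +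
   (x ^+ 2 + (y - 1 / 2) ^+ 2 - (1 + s ^+ 2) / 4) by rewrite /d; field.
clearbody d; have hy1' : 1 - d <= y by rewrite sE in hy1; lra.
have hy2' : d <= y by rewrite sE in hy2; lra.
have hm : 0 <= (m%:~R + d) * (m%:~R + d - 2 * x) + d * (2 * y - 1 + d).
  have [h|h|h|h] := int_cases m.
  - have : 0 <= (- (m%:~R + d)) * (2 * x - (m%:~R + d)) by apply: mulr_ge0; lra.
    have : 0 <= d * (2 * y - 1 + d) by apply: mulr_ge0; lra.
    lra.
  - rewrite h; have : 0 <= (1 - d) * (2 * x + 1) by apply: mulr_ge0; lra.
    have : 0 <= d * (y - d) by apply: mulr_ge0; lra.
    have : 0 <= d * (y - (1 - d)) by apply: mulr_ge0; lra.
    by move=> *; nra.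
  - rewrite h; have : 0 <= d * (1 - 2 * x) by apply: mulr_ge0; lra.
    have : 0 <= d * (y - d) by apply: mulr_ge0; lra.
    have : 0 <= d * (y - (1 - d)) by apply: mulr_ge0; lra.
    by move=> *; nra.
  - have : 0 <= (m%:~R + d) * (m%:~R + d - 2 * x) by apply: mulr_ge0; lra.
    have : 0 <= d * (2 * y - 1 + d) by apply: mulr_ge0; lra.
    lra.
split; first by lra.
move=> [g1 g2 [h|[/andP[h1 h2] /andP[h3 h4]]]]; first by lra.
have d0' : 0 < d by lra.
have d1' : d < 1 by lra.
suff : 0 < (m%:~R + d) * (m%:~R + d - 2 * x) + d * (2 * y - 1 + d) by lra.
have hy1s : 1 - d < y by rewrite sE in g1; lra.
have hy2s : d < y by rewrite sE in g2; lra.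
have P1 : 0 < d * (y - d) by apply: mulr_gt0; lra.
have P2 : 0 < d * (y - (1 - d)) by apply: mulr_gt0; lra.
clear hA hm g1 g2 hD hy1 hy2 hy1' hy2' d0 d1 hs1 hs2 hx1 hx2 h1 h2 sE.
have [h|h|h|h] := int_cases m.
- have : 0 <= (- (m%:~R + d)) * (2 * x - (m%:~R + d)) by apply: mulr_ge0; lra.
  have : 0 < d * (2 * y - 1 + d) by apply: mulr_gt0; lra.
  lra.
- by rewrite h; have : 0 <= (1 - d) * (2 * x + 1) by [apply: mulr_ge0; lra]; move=> *; nra.
- by rewrite h; have : 0 <= d * (1 - 2 * x) by [apply: mulr_ge0; lra]; move=> *; nra.
- have : 0 <= (m%:~R + d) * (m%:~R + d - 2 * x) by apply: mulr_ge0; lra.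
  have : 0 < d * (2 * y - 1 + d) by apply: mulr_gt0; lra.
  lra.
Qed.

Lemma discC s x y m : above_floor s x y -> 0 <= disc s x y m%:~R (s - 1 / 2) /\
  (generic_floor s x y -> 0 < disc s x y m%:~R (s - 1 / 2)).
Proof.
move=> hA; have [/andP[hs1 hs2] /andP[hx1 hx2] [hy1 hy2] hD] := hA.
have [D1 D2] := discA m hA.
have e : disc s x y m%:~R (s - 1 / 2) = disc s x y m%:~R (1 / 2) + (1 - s) * (2 * y - s).
  by rewrite /disc; field.
have : 0 <= (1 - s) * (2 * y - s) by apply: mulr_ge0; lra.
rewrite e; split; first by lra.
move=> g; have [g1 g2 [h|[/andP[h1 h2] h3]]] := g; first by have := D2 g (fun=> h); lra.
suff : 0 < (1 - s) * (2 * y - s) by lra.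
by apply: mulr_gt0; lra.
Qed.

Lemma disc_low s x y cx cy : above_floor s x y -> 1 <= y - cy -> 0 < disc s x y cx cy.
Proof.
move=> [/andP[hs1 hs2] _ _ _] h; rewrite /disc.
have := sqr_ge0 (x - cx); nra.
Qed.

(* The squared moduli of [A z + B wh + C] minus that of [wh = (1 - is)/2], where [z] has real part
   [x + s/2]. *)
Definition mirrorQ s x y (a1 a2 b1 b2 c1 c2 : R) :=
  (a1 * (x + s / 2) - a2 * y + c1 + (b1 + b2 * s) / 2) ^+ 2 +
  (a2 * (x + s / 2) + a1 * y + c2 + (b2 - b1 * s) / 2) ^+ 2 - (1 + s ^+ 2) / 4.

(** [exc] marks the row of the central disc, the one for which a tie with w = 0 is allowed at a
    generic point. *)
Definition mirror_ok s x y (exc : Prop) (q : R) := 0 <= q /\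
  (generic_floor s x y -> (exc -> (1 + s ^+ 2) / 4 < x ^+ 2 + (y - 1 / 2) ^+ 2) -> 0 < q).

Lemma mirror_okS s x y (e : Prop) (q : R) :
  0 <= q /\ (generic_floor s x y -> 0 < q) -> mirror_ok s x y e q.
Proof. by case=> h1 h2; split=> // /h2. Qed.

Lemma mirror_okP s x y (e : Prop) (q : R) : 0 < q -> mirror_ok s x y e q.
Proof. by move=> h; split=> //; exact: ltW. Qed.

Lemma mirror_okD s x y (e1 : Prop) (q1 q2 : R) : mirror_ok s x y e1 q1 ->
  0 <= q2 /\ (generic_floor s x y -> 0 < q2) -> 0 <= q1 + q2 /\ (generic_floor s x y -> 0 < q1 + q2).
Proof. by move=> [h1 _] [h2 h3]; split=> [|/h3]; lra. Qed.

Lemma mirror_ok_eq s x y (e : Prop) (q q' : R) : q = q' -> mirror_ok s x y e q' -> mirror_ok s x y e q.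
Proof. by move=> ->. Qed.

Lemma discA_ok s x y m : above_floor s x y -> mirror_ok s x y (m = 0) (disc s x y m%:~R (1 / 2)).
Proof. exact: discA. Qed.

Lemma discBx s x y m : above_floor s x y -> 0 <= disc s x y (m%:~R - (1 - s) / 2) (s / 2) /\
  (generic_floor s x y -> 0 < disc s x y (m%:~R - (1 - s) / 2) (s / 2)).
Proof.
move=> /above_floor_oppx h; have := discB (- m) h; rewrite rmorphN.
have -> : disc s (- x) y (- m%:~R + (1 - s) / 2) (s / 2) = disc s x y (m%:~R - (1 - s) / 2) (s / 2).
  by rewrite /disc; ring.
by move=> [h1 h2]; split=> // /generic_floor_oppx.
Qed.

Lemma discBs s x y m : above_floor s x y -> 0 <= disc s x y (m%:~R + (1 + s) / 2) (- s / 2) /\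
  (generic_floor s x y -> 0 < disc s x y (m%:~R + (1 + s) / 2) (- s / 2)).
Proof.
move=> /above_floor_opps h; have := discB m h; rewrite opprK.
have -> : disc (- s) x y (m%:~R + (1 + s) / 2) (- s / 2) = disc s x y (m%:~R + (1 + s) / 2) (- s / 2).
  by rewrite /disc; ring.
by move=> [h1 h2]; split=> // /generic_floor_opps.
Qed.

Lemma discCs s x y m : above_floor s x y -> 0 <= disc s x y m%:~R (- s - 1 / 2) /\
  (generic_floor s x y -> 0 < disc s x y m%:~R (- s - 1 / 2)).
Proof.
move=> /above_floor_opps h; have := discC m h.
have -> : disc (- s) x y m%:~R (- s - 1 / 2) = disc s x y m%:~R (- s - 1 / 2).
  by rewrite /disc; ring.
by move=> [h1 h2]; split=> // /generic_floor_opps.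
Qed.

Lemma discBsx s x y m : above_floor s x y -> 0 <= disc s x y (m%:~R - (1 + s) / 2) (- s / 2) /\
  (generic_floor s x y -> 0 < disc s x y (m%:~R - (1 + s) / 2) (- s / 2)).
Proof.
move=> /above_floor_opps h; have := discBx m h; rewrite opprK.
have -> : disc (- s) x y (m%:~R - (1 + s) / 2) (- s / 2) = disc s x y (m%:~R - (1 + s) / 2) (- s / 2).
  by rewrite /disc; ring.
by move=> [h1 h2]; split=> // /generic_floor_opps.
Qed.

Lemma sum_sq1 (b1 b2 : int) : b1 ^+ 2 + b2 ^+ 2 = 1 ->
  [\/ b1 = 1 /\ b2 = 0, b1 = -1 /\ b2 = 0, b1 = 0 /\ b2 = 1 | b1 = 0 /\ b2 = -1].
Proof.
move=> h; have h1 : -1 <= b1 <= 1 by nia.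
have h2 : -1 <= b2 <= 1 by nia.
have [e|[e|e]] : b1 = -1 \/ b1 = 0 \/ b1 = 1 by lia.
- by constructor 2; split=> //; nia.
- have [e'|e'] : b2 = 1 \/ b2 = -1 by nia.
    by constructor 3.
  by constructor 4.
- by constructor 1; split=> //; nia.
Qed.

Lemma sum_sq5 (b1 b2 : int) : b1 ^+ 2 + b2 ^+ 2 = 5 ->
  ([\/ b1 = 1 /\ b2 = 2, b1 = 1 /\ b2 = -2, b1 = -1 /\ b2 = 2 | b1 = -1 /\ b2 = -2] \/
  [\/ b1 = 2 /\ b2 = 1, b1 = 2 /\ b2 = -1, b1 = -2 /\ b2 = 1 | b1 = -2 /\ b2 = -1])%R.
Proof.
move=> h; have h1 : -2 <= b1 <= 2 by nia.
have h2 : -2 <= b2 <= 2 by nia.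
have [e|[e|[e|[e|e]]]] : b1 = -2 \/ b1 = -1 \/ b1 = 0 \/ b1 = 1 \/ b1 = 2 by lia.
- by right; have [e'|e'] : b2 = 1 \/ b2 = -1 by [nia]; [constructor 3|constructor 4].
- by left; have [e'|e'] : b2 = 2 \/ b2 = -2 by [nia]; [constructor 3|constructor 4].
- by exfalso; rewrite e in h; have : [\/ b2 = -2, b2 = -1, b2 = 0 | 1 <= b2] by
    [have [?|[?|[?|?]]] : b2 = -2 \/ b2 = -1 \/ b2 = 0 \/ 1 <= b2 by [lia];
     [constructor 1|constructor 2|constructor 3|constructor 4]]; case=> ?; nia.
- by left; have [e'|e'] : b2 = 2 \/ b2 = -2 by [nia]; [constructor 1|constructor 2].
- by right; have [e'|e'] : b2 = 1 \/ b2 = -1 by [nia]; [constructor 1|constructor 2].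
Qed.

Lemma mirrorQ_rot s x y a1 a2 b1 b2 c1 c2 :
  mirrorQ s x y (- a2) a1 (- b2) b1 (- c2) c1 = mirrorQ s x y a1 a2 b1 b2 c1 c2.
Proof. by rewrite /mirrorQ; field. Qed.

(** For a = 1 the condition is one disc whose centre depends on the unit b; b = -i with m = 0 gives
    the central disc. *)
Lemma mirrorQ_a1_k0 s x y (b1 b2 : int) m : above_floor s x y -> b1 ^+ 2 + b2 ^+ 2 = 1 ->
  mirror_ok s x y [/\ m = 0, b1 = 0 & b2 = -1] (mirrorQ s x y 1 0 b1%:~R b2%:~R m%:~R 0).
Proof.
move=> hA; have low (e' : Prop) cx cy : 1 <= y - cy -> mirror_ok s x y e' (disc s x y cx cy).
  by move=> h; apply: mirror_okP; exact: disc_low.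
move: hA.
move=> hA /sum_sq1[] [-> ->]; rewrite ?rmorphN /=.
- apply: mirror_ok_eq (mirror_okS _ (discB (- m - 1) hA)).
  by rewrite rmorphB rmorphN /mirrorQ /disc; field.
- apply: mirror_ok_eq (mirror_okS _ (discBsx (1 - m) hA)).
  by rewrite rmorphB /mirrorQ /disc; field.
- apply: (mirror_ok_eq _ (low _ (- m%:~R - s) (- (1 / 2)) _)); last first.
    by have [/andP[? ?] _ [? ?] _] := hA; lra.
  by rewrite /mirrorQ /disc; field.
- have [h1 h2] := discA (- m) hA.
  have e : mirrorQ s x y 1 0 0 (- 1) m%:~R 0 = disc s x y (- m)%:~R (1 / 2).
    by rewrite rmorphN /mirrorQ /disc; field.
  rewrite e; split=> // hg he; apply: h2 => // m0; apply: he; split=> //.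
  by apply/eqP; rewrite -oppr_eq0; apply/eqP.
Qed.

Lemma mirrorQ_a1_k1 s x y (b1 b2 : int) m (e : Prop) : above_floor s x y -> b1 ^+ 2 + b2 ^+ 2 = 5 ->
  mirror_ok s x y e (mirrorQ s x y 1 0 b1%:~R b2%:~R m%:~R 1).
Proof.
move=> hA; have low (e' : Prop) cx cy : 1 <= y - cy -> mirror_ok s x y e' (disc s x y cx cy).
  by move=> h; apply: mirror_okP; exact: disc_low.
move: hA.
move=> hA h5; have [/andP[? ?] _ [? ?] _] := hA.
case/sum_sq5: h5 => -[] [-> ->]; rewrite ?rmorphN /=.
- apply: (mirror_ok_eq _ (low _ (- m%:~R - 1 / 2 - 3 * s / 2) (s / 2 - 2) _)); last first.
    by have [/andP[? ?] _ [? ?] _] := hA; lra.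
  by rewrite /mirrorQ /disc; field.
- apply: mirror_ok_eq (mirror_okS _ (discBx (- m) hA)).
  by rewrite rmorphN /mirrorQ /disc; field.
- apply: (mirror_ok_eq _ (low _ (- m%:~R + 1 / 2 - 3 * s / 2) (- s / 2 - 2) _)); last first.
    by have [/andP[? ?] _ [? ?] _] := hA; lra.
  by rewrite /mirrorQ /disc; field.
- apply: mirror_ok_eq (mirror_okS _ (discBs (- m) hA)).
  by rewrite rmorphN /mirrorQ /disc; field.
- apply: (mirror_ok_eq _ (low _ (- m%:~R - 1 - s) (s - 3 / 2) _)); last first.
    by have [/andP[? ?] _ [? ?] _] := hA; lra.
  by rewrite /mirrorQ /disc; field.
- apply: mirror_ok_eq (mirror_okS _ (discC (- m - 1) hA)).
  by rewrite rmorphB rmorphN /mirrorQ /disc; field.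
- apply: (mirror_ok_eq _ (low _ (- m%:~R + 1 - s) (- s - 3 / 2) _)); last first.
    by have [/andP[? ?] _ [? ?] _] := hA; lra.
  by rewrite /mirrorQ /disc; field.
- apply: mirror_ok_eq (mirror_okS _ (discCs (1 - m) hA)).
  by rewrite rmorphB /mirrorQ /disc; field.
Qed.

Lemma okD2 s x y (e e1 : Prop) (q1 q2 : R) : mirror_ok s x y e1 q1 ->
  0 <= q2 /\ (generic_floor s x y -> 0 < q2) -> mirror_ok s x y e (q1 + q2).
Proof. by move=> h1 h2; apply: mirror_okS; exact: mirror_okD h1 h2. Qed.

(** For a = 1 + i the quantity is a sum of two disc excesses already known to be nonnegative. *)
Lemma mirrorQ_a2_k0 s x y (b1 b2 : int) m (e : Prop) : above_floor s x y -> b1 ^+ 2 + b2 ^+ 2 = 1 ->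
  mirror_ok s x y e (mirrorQ s x y 1 1 b1%:~R b2%:~R m%:~R m%:~R).
Proof.
move=> hA h1; have [/andP[? ?] _ [? ?] _] := hA.
have low cx cy : 1 <= y - cy -> 0 <= disc s x y cx cy /\ (generic_floor s x y -> 0 < disc s x y cx cy).
  by move=> /(disc_low cx hA) h; split=> // ; exact: ltW.
case/sum_sq1: h1 => [] [-> ->]; rewrite ?rmorphN /=.
- apply: mirror_ok_eq (okD2 _ (discA_ok (- m) hA) (discB (- m - 1) hA)).
  by rewrite rmorphB rmorphN /mirrorQ /disc; field.
- apply: mirror_ok_eq (okD2 _ (mirror_okS True (discBsx (1 - m) hA)) (low (- m%:~R - s) (- (1 / 2)) _)); last by lra.
  by rewrite rmorphB /mirrorQ /disc; field.
- apply: mirror_ok_eq (okD2 _ (mirror_okS True (discB (- m - 1) hA)) (low (- m%:~R - s) (- (1 / 2)) _)); last by lra.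
  by rewrite rmorphB rmorphN /mirrorQ /disc; field.
- apply: mirror_ok_eq (okD2 _ (discA_ok (- m) hA) (discBsx (1 - m) hA)).
  by rewrite rmorphB rmorphN /mirrorQ /disc; field.
Qed.

(** Keeps only the component of the functional orthogonal to a, that is, the vertical distance:
    enough when the centre of the disc lies far below. *)
Lemma mirrorQ_low s x y a1 a2 b1 b2 c1 c2 (e : Prop) :
  (a1 ^+ 2 + a2 ^+ 2) * (1 + s ^+ 2) / 4 < ((a1 ^+ 2 + a2 ^+ 2) * y + a1 * (c2 + (b2 - b1 * s) / 2)
     - a2 * (c1 + (b1 + b2 * s) / 2)) ^+ 2 -> 0 < a1 ^+ 2 + a2 ^+ 2 ->
  mirror_ok s x y e (mirrorQ s x y a1 a2 b1 b2 c1 c2).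
Proof.
move=> h n0; apply: mirror_okP; rewrite -(pmulr_rgt0 _ n0) /mirrorQ.
set u := a1 * _ - _ + _ + _; set v := a2 * _ + _ + _ + _.
have e1 : (a1 ^+ 2 + a2 ^+ 2) * (u ^+ 2 + v ^+ 2 - (1 + s ^+ 2) / 4) =
  (a1 * u + a2 * v) ^+ 2 + (a1 * v - a2 * u) ^+ 2 - (a1 ^+ 2 + a2 ^+ 2) * (1 + s ^+ 2) / 4 by field.
have e2 : a1 * v - a2 * u = (a1 ^+ 2 + a2 ^+ 2) * y + a1 * (c2 + (b2 - b1 * s) / 2)
     - a2 * (c1 + (b1 + b2 * s) / 2) by rewrite /u /v; field.
by rewrite e1 e2; have := sqr_ge0 (a1 * u + a2 * v); lra.
Qed.

Lemma mirrorQ_a2_k1 s x y (b1 b2 : int) m (e : Prop) : above_floor s x y -> b1 ^+ 2 + b2 ^+ 2 = 5 ->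
  mirror_ok s x y e (mirrorQ s x y 1 1 b1%:~R b2%:~R m%:~R (m%:~R + 1)).
Proof.
move=> hA h1; have [/andP[? ?] _ [? ?] _] := hA.
case/sum_sq5: h1 => -[] [-> ->]; rewrite ?rmorphN /=.
- by apply: mirrorQ_low; nra.
- apply: mirror_ok_eq (okD2 _ (discA_ok (- m) hA) (discBs (- m - 1) hA)).
  by rewrite rmorphB rmorphN /mirrorQ /disc; field.
- by apply: mirrorQ_low; nra.
- apply: mirror_ok_eq (okD2 _ (mirror_okS True (discCs (- m) hA)) (discBsx (1 - m) hA)).
  by rewrite rmorphB rmorphN /mirrorQ /disc; field.
- apply: mirror_ok_eq (okD2 _ (mirror_okS True (discC (- m - 1) hA)) (discB (- m - 2) hA)).
  by rewrite !rmorphB rmorphN /mirrorQ /disc; field.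
- apply: mirror_ok_eq (okD2 _ (discA_ok (- m - 1) hA) (discBx (- m) hA)).
  by rewrite rmorphB rmorphN /mirrorQ /disc; field.
- by apply: mirrorQ_low; nra.
- by apply: mirrorQ_low; nra.
Qed.

(** For a = 2 + i only b = 1 - 2i has a disc coming close; its excess is that of a translate of the
    central disc plus four times a visibly nonnegative term. *)
Lemma mirrorQ_a5_k1 s x y (b1 b2 : int) m (e : Prop) : above_floor s x y -> b1 ^+ 2 + b2 ^+ 2 = 5 ->
  mirror_ok s x y e (mirrorQ s x y 2 1 b1%:~R b2%:~R (2 * m%:~R - 1) m%:~R).
Proof.
move=> hA h1; have [/andP[? ?] _ [? ?] _] := hA.
case/sum_sq5: h1 => -[] [-> ->]; rewrite ?rmorphN /=.
- by apply: mirrorQ_low; nra.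
- have [D1 D2] := discA (- m) hA.
  have E : mirrorQ s x y 2 1 1 (- 2) (2 * m%:~R - 1) m%:~R = disc s x y (- m)%:~R (1 / 2) +
     4 * ((x - (1 / 2 - m%:~R)) ^+ 2 + (y - 1 / 2) * y).
    by rewrite rmorphN /mirrorQ /disc; field.
  rewrite E; have := sqr_ge0 (x - (1 / 2 - m%:~R)); split; first by nra.
  by move=> [? ? _] _; nra.
- by apply: mirrorQ_low; nra.
- by apply: mirrorQ_low; nra.
- by apply: mirrorQ_low; nra.
- by apply: mirrorQ_low; nra.
- by apply: mirrorQ_low; nra.
- by apply: mirrorQ_low; nra.
Qed.

(** With m = a z + c, the imaginary part of m times the conjugate of a is N y + k, which bounds |m|
    from below, while |b|^2 is 1 + 4k. In the cases listed the triangle inequality suffices, and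
    only finitely many values of a are left. *)
Lemma mirrorQ_large s x y a1 a2 b1 b2 c1 c2 (k : R) (e : Prop) : above_floor s x y ->
  let N := a1 ^+ 2 + a2 ^+ 2 in 0 < N -> k = a1 * c2 - a2 * c1 -> b1 ^+ 2 + b2 ^+ 2 = 1 + 4 * k ->
  (k = 0 /\ 4 <= N) \/ (k = 1 /\ 8 <= N) \/ 2 <= k ->
  mirror_ok s x y e (mirrorQ s x y a1 a2 b1 b2 c1 c2).
Proof.
move=> hA N N0 kE bk hk; have [/andP[s1 s2] _ [y1 y2] _] := hA.
set m1 := a1 * (x + s / 2) - a2 * y + c1; set m2 := a2 * (x + s / 2) + a1 * y + c2.
set M := m1 ^+ 2 + m2 ^+ 2; set w := (1 + s ^+ 2) / 4.
have w0 : 0 < w by rewrite /w; nra.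
have NM : (N * y + k) ^+ 2 <= N * M.
  have -> : N * M = (a1 * m1 + a2 * m2) ^+ 2 + (a1 * m2 - a2 * m1) ^+ 2 by rewrite /N /M; ring.
  have -> : N * y + k = a1 * m2 - a2 * m1 by rewrite kE /N /m1 /m2; ring.
  by have := sqr_ge0 (a1 * m1 + a2 * m2); lra.
have M4 : 4 * k * y <= M.
  rewrite -(ler_pM2l N0); apply: le_trans NM; have := sqr_ge0 (N * y - k); rewrite !expr2; lra.
have y0 : 0 < y by lra.
(* [f (M / w) >= 0] for [f t = t^2 - (8k+4) t + 16 k^2], whose larger root is
   [(sqrt (4k+1) + 1)^2]: this is [|m| >= (|B| + 1) |wh|]. *)
have key : 0 <= M + 4 * k * w /\ 0 <= M ^+ 2 - (8 * k + 4) * M * w + 16 * k ^+ 2 * w ^+ 2 /\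
   (generic_floor s x y -> 0 < M ^+ 2 - (8 * k + 4) * M * w + 16 * k ^+ 2 * w ^+ 2).
  case: hk => [[k0 N4]|[[k1 N8]|k2]].
  - rewrite k0 in NM *; have M' : N * y ^+ 2 <= M.
      by rewrite -(ler_pM2l N0) mulrA -expr2 -exprMn; rewrite addr0 in NM.
    have M'' : 4 * y ^+ 2 <= M by have := sqr_ge0 y; nra.
    have h4 : 4 * w <= M by rewrite /w; nra.
    split; first by lra.
    have -> : M ^+ 2 - (8 * 0 + 4) * M * w + 16 * 0 ^+ 2 * w ^+ 2 = M * (M - 4 * w) by ring.
    split; first by apply: mulr_ge0; lra.
    by move=> [g1 g2 _]; apply: mulr_gt0; first lra; rewrite /w; nra.
  - rewrite k1 in NM *.
    have h8 : 21 / 2 * w <= M.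
      rewrite -(ler_pM2l N0); apply: le_trans NM.
      have yy : (1 + s) ^+ 2 / 4 <= y ^+ 2 /\ (1 - s) ^+ 2 / 4 <= y ^+ 2 by split; nra.
      have h3 : 21 / 2 * w <= 8 * y ^+ 2 + 2 * y by rewrite /w; case: yy => ? ?; nra.
      have : N * (21 / 2 * w) <= N * (8 * y ^+ 2 + 2 * y) by rewrite ler_pM2l.
      have : N * 8 * y ^+ 2 <= N * N * y ^+ 2 by apply: ler_wpM2r; rewrite ?sqr_ge0 // ler_pM2l.
      by rewrite !expr2; lra.
    split; first by lra.
    suff : 0 < M ^+ 2 - (8 * 1 + 4) * M * w + 16 * 1 ^+ 2 * w ^+ 2 by move=> h; split=> // ; exact: ltW.
    have -> : M ^+ 2 - (8 * 1 + 4) * M * w + 16 * 1 ^+ 2 * w ^+ 2 =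
      (M - 21 / 2 * w) * (M - 3 / 2 * w) + w ^+ 2 / 4 by field.
    have : 0 <= (M - 21 / 2 * w) * (M - 3 / 2 * w) by apply: mulr_ge0; lra.
    by have := exprn_gt0 2 w0; lra.
  - clear NM N0 kE bk; clearbody M.
    have h8 : 8 * k * w <= M.
      apply: le_trans M4; have -> : 8 * k * w = 2 * k * (1 + s ^+ 2) by rewrite /w; field.
      have h1 : 1 + s ^+ 2 <= 2 * y by nra.
      have k20 : 0 <= 2 * k by lra.
      by have := ler_wpM2l k20 h1; lra.
    have hh : M ^+ 2 - (8 * k + 4) * M * w + 16 * k ^+ 2 * w ^+ 2 =
      (M - 8 * k * w) * (M - 4 * w) + 16 * (k * (k - 2)) * w ^+ 2 by ring.
    have kk : 0 <= 16 * (k * (k - 2)) * w ^+ 2 by rewrite mulr_ge0 ?sqr_ge0 // mulr_ge0 // mulr_ge0 //; lra.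
    have kw : 2 * w <= k * w by rewrite ler_pM2r.
    rewrite hh; split; first by lra.
    split; first by have : 0 <= (M - 8 * k * w) * (M - 4 * w) by [apply: mulr_ge0; lra]; lra.
    move=> [g1 g2 _]; suff h8' : 8 * k * w < M.
      by have : 0 < (M - 8 * k * w) * (M - 4 * w) by [apply: mulr_gt0; lra]; lra.
    apply: lt_le_trans M4; have -> : 8 * k * w = 2 * k * (1 + s ^+ 2) by rewrite /w; field.
    have -> : 4 * k * y = 2 * k * (2 * y) by ring.
    have h1 : 1 + s ^+ 2 < 2 * y by have [s0|s0] := leP 0 s; nra.
    by rewrite ltr_pM2l //; lra.
set n1 := (b1 + b2 * s) / 2; set n2 := (b2 - b1 * s) / 2.
have QE : mirrorQ s x y a1 a2 b1 b2 c1 c2 = M + 4 * k * w + 2 * (m1 * n1 + m2 * n2).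
  have : n1 ^+ 2 + n2 ^+ 2 = (1 + 4 * k) * w by rewrite -bk /n1 /n2 /w; field.
  by rewrite /mirrorQ -/m1 -/m2 -/n1 -/n2 -/w /M; lra.
have CS : (2 * (m1 * n1 + m2 * n2)) ^+ 2 <= (M + 4 * k * w) ^+ 2 -
   (M ^+ 2 - (8 * k + 4) * M * w + 16 * k ^+ 2 * w ^+ 2).
  have nn : n1 ^+ 2 + n2 ^+ 2 = (1 + 4 * k) * w by rewrite -bk /n1 /n2 /w; field.
  have -> : (M + 4 * k * w) ^+ 2 - (M ^+ 2 - (8 * k + 4) * M * w + 16 * k ^+ 2 * w ^+ 2) =
     4 * (M * ((1 + 4 * k) * w)) by ring.
  rewrite -nn /M.
  have -> : 4 * ((m1 ^+ 2 + m2 ^+ 2) * (n1 ^+ 2 + n2 ^+ 2)) =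
    (2 * (m1 * n1 + m2 * n2)) ^+ 2 + 4 * (m1 * n2 - m2 * n1) ^+ 2 by ring.
  by have := sqr_ge0 (m1 * n2 - m2 * n1); lra.
case: key => K1 [K2 K3]; apply: mirror_okS; rewrite QE; move: CS K1 K2 K3.
set T := M + _; set U := 2 * (m1 * _ + _); set F := M ^+ 2 - _ + _ => CS K1 K2 K3; split.
  by rewrite leNgt; apply/negP => h; nra.
by move=> /K3 F0; rewrite ltNge; apply/negP => h; nra.
Qed.

(** What [mirrorQ_large] leaves is a = 1 and 1 + i for k = 0, and a = 1, 1 + i, 1 + 2i, 2, 2 + i for
    k = 1. There a = 2 is excluded because k would be even, and 1 + 2i reduces to 2 + i by reversing
    the signs of s and x. *)
Lemma mirrorQ_pos s x y (a1 a2 b1 b2 c1 c2 : int) : above_floor s x y ->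
  0 < a1 -> 0 <= a2 -> b1 ^+ 2 + b2 ^+ 2 = 1 + 4 * (a1 * c2 - a2 * c1) ->
  mirror_ok s x y [/\ a1 ^+ 2 + a2 ^+ 2 = 1, c1 = 0 /\ c2 = 0, b1 = a2 & b2 = - a1]
    (mirrorQ s x y a1%:~R a2%:~R b1%:~R b2%:~R c1%:~R c2%:~R).
Proof.
move=> hA a10 a20 bk; set k := a1 * c2 - a2 * c1 in bk; set N := a1 ^+ 2 + a2 ^+ 2.
have large : (k = 0 /\ 4 <= N) \/ (k = 1 /\ 8 <= N) \/ 2 <= k ->
   mirror_ok s x y [/\ N = 1, c1 = 0 /\ c2 = 0, b1 = a2 & b2 = - a1]
    (mirrorQ s x y a1%:~R a2%:~R b1%:~R b2%:~R c1%:~R c2%:~R).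
  move=> hk; apply: (@mirrorQ_large _ _ _ _ _ _ _ _ _ k%:~R) => //.
  - by rewrite -!rmorphXn -rmorphD /= ltr0z; nia.
  - by rewrite -!rmorphM -rmorphB.
  - by rewrite -!rmorphXn -rmorphD bk rmorphD rmorphM.
  - rewrite -!rmorphXn -rmorphD /= -/N.
    case: hk => [[-> h]|[[-> h]|h]]; [left|right; left|right; right]; rewrite ?rmorph1.
    + by split=> //; rewrite (_ : 4 = 4%:~R) ?ler_int.
    + by split=> //; rewrite (_ : 8 = 8%:~R) ?ler_int.
    + by rewrite (_ : 2 = 2%:~R) ?ler_int.
have k0 : 0 <= k by nia.
have [k2|] := leP 2 k; first by apply: large; right; right.
move=> k2; have [kE|kE] : k = 0 \/ k = 1 by lia.
  have [N4|N4] := leP 4 N; first by apply: large; left.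
  have a1E : a1 = 1 by nia.
  have [a2E|a2E] : a2 = 0 \/ a2 = 1 by nia.
    have c2E : c2 = 0 by move: kE; rewrite /k a1E a2E; lia.
    have b1E : b1 ^+ 2 + b2 ^+ 2 = 1 by rewrite bk kE.
    have [h1 h2] := mirrorQ_a1_k0 c1 hA b1E; rewrite a1E a2E c2E; split=> // hg he; apply: h2 => //.
    by move=> [c1E b10 b20]; apply: he; split=> //; rewrite /N a1E a2E.
  have c2E : c2 = c1 by move: kE; rewrite /k a1E a2E; lia.
  rewrite a1E a2E c2E; apply: mirrorQ_a2_k0 => //; by rewrite bk kE.
have [N8|N8] := leP 8 N; first by apply: large; right; left.
have b5 : b1 ^+ 2 + b2 ^+ 2 = 5 by rewrite bk kE.
have [a1E|a1E] : a1 = 1 \/ a1 = 2 by nia.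
  have [a2E|[a2E|a2E]] : a2 = 0 \/ a2 = 1 \/ a2 = 2 by nia.
  - have c2E : c2 = 1 by move: kE; rewrite /k a1E a2E; lia.
    rewrite a1E a2E c2E; exact: mirrorQ_a1_k1.
  - have c2E : c2 = c1 + 1 by move: kE; rewrite /k a1E a2E; lia.
    rewrite a1E a2E c2E rmorphD; exact: mirrorQ_a2_k1.
  - have c2E : c2 = 2 * c1 + 1 by move: kE; rewrite /k a1E a2E; lia.
    have b5' : b2 ^+ 2 + b1 ^+ 2 = 5 by rewrite addrC.
    have hb : (- b2) ^+ 2 + (- b1) ^+ 2 = 5 by rewrite !sqrrN.
    have [h1 h2] := mirrorQ_a5_k1 (- c1) False (above_floor_opps (above_floor_oppx hA)) hb.
    have E : mirrorQ s x y a1%:~R a2%:~R b1%:~R b2%:~R c1%:~R c2%:~R =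
      mirrorQ (- s) (- x) y 2 1 (- b2)%:~R (- b1)%:~R (2 * (- c1)%:~R - 1) (- c1)%:~R.
      have c2R : c2%:~R = 2 * c1%:~R + 1 :> R by rewrite c2E [LHS]intrD intrM.
      by rewrite c2R a1E a2E !rmorphN /mirrorQ /=; field.
    rewrite E; split=> // hg _; apply: h2 => //.
    exact: generic_floor_opps (generic_floor_oppx hg).
have a2E : a2 = 0 \/ a2 = 1 by nia.
case: a2E => a2E; first by move: kE; rewrite /k a1E a2E; lia.
have c1E : c1 = 2 * c2 - 1 by move: kE; rewrite /k a1E a2E; lia.
rewrite a1E a2E c1E rmorphB rmorphM; exact: mirrorQ_a5_k1.
Qed.

(** Multiplying the row by a power of i brings a into the quadrant of [mirrorQ_pos]. *)
Lemma mirrorQ_ok s x y (a1 a2 b1 b2 c1 c2 : int) : above_floor s x y ->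
  (a1 != 0) || (a2 != 0) -> b1 ^+ 2 + b2 ^+ 2 = 1 + 4 * (a1 * c2 - a2 * c1) ->
  mirror_ok s x y [/\ a1 ^+ 2 + a2 ^+ 2 = 1, c1 = 0 /\ c2 = 0, b1 = a2 & b2 = - a1]
    (mirrorQ s x y a1%:~R a2%:~R b1%:~R b2%:~R c1%:~R c2%:~R).
Proof.
move=> hA a0 bk; set Q := mirrorQ _ _ _ _ _ _ _ _ _.
have [h|h] := boolP ((0 < a1) && (0 <= a2)).
  by case/andP: h => ? ?; exact: mirrorQ_pos.
have [h1|h1] := boolP ((a1 <= 0) && (0 < a2)).
  case/andP: h1 => h1 h2.
  have [|||Q1 Q2] := @mirrorQ_pos s x y a2 (- a1) b2 (- b1) c2 (- c1) hA; rewrite ?sqrrN; try lia.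
  have E : Q = mirrorQ s x y a2%:~R (- a1)%:~R b2%:~R (- b1)%:~R c2%:~R (- c1)%:~R.
    by rewrite !rmorphN -mirrorQ_rot /mirrorQ !opprK.
  rewrite E; split=> // hg he; apply: Q2 => // -[e1 [e2 e3] e4 e5]; apply: he; split; [lia|split; lia|lia|lia].
have [h2|h2] := boolP ((a1 < 0) && (a2 <= 0)).
  case/andP: h2 => h2 h3.
  have [|||Q1 Q2] := @mirrorQ_pos s x y (- a1) (- a2) (- b1) (- b2) (- c1) (- c2) hA; rewrite ?sqrrN; try lia.
  have E : Q = mirrorQ s x y (- a1)%:~R (- a2)%:~R (- b1)%:~R (- b2)%:~R (- c1)%:~R (- c2)%:~R.
    by rewrite !rmorphN !mirrorQ_rot.
  rewrite E; split=> // hg he; apply: Q2 => // -[e1 [e2 e3] e4 e5]; apply: he; split; [lia|split; lia|lia|lia].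
have [|||Q1 Q2] := @mirrorQ_pos s x y (- a2) a1 (- b2) b1 (- c2) c1 hA; rewrite ?sqrrN; try lia.
have E : Q = mirrorQ s x y (- a2)%:~R a1%:~R (- b2)%:~R b1%:~R (- c2)%:~R c1%:~R.
  by rewrite !rmorphN mirrorQ_rot.
rewrite E; split=> // hg he; apply: Q2 => // -[e1 [e2 e3] e4 e5]; apply: he; split; [lia|split; lia|lia|lia].
Qed.

End Mirrors.

(** * A parametrized fundamental domain *)

Section Phi.
Local Open Scope complex_scope.
Variable R : realType.
Local Notation C := R[i].
Local Notation pt4 := (pt4 R).
Implicit Types (t h s v : R) (g : 'M[C]_3) (p q : pt4).

(* [wc = t (1 - is) / 2] and [z = i (1 - is) / (1 - iv) + ih]. On [t = 1], [h = 0] the forms [w],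
   [w - (1 + i)] and [w + (i - 1) z] have equal moduli, and the halves of their relative phases have
   tangents [s] and [v]. *)
Definition Phi t h s v : pt4 :=
  ((s - v) / (1 + v ^+ 2), (1 + s * v) / (1 + v ^+ 2) + h, t / 2, - (t * s) / 2).

(** If s and v are the tangents of two phases, this says that the two phases and 0 lie pairwise
    within a quarter of pi. *)
Definition hexa s v := [/\ -1 <= s <= 1, -1 <= v <= 1, v - s <= 1 + s * v & s - v <= 1 + s * v].
Definition hexa_int s v := [/\ -1 < s < 1, -1 < v < 1, v - s < 1 + s * v & s - v < 1 + s * v].
(** (xt, eta) is the position of z at h = 0, the real part being measured from s/2: it runs on the
    circle bounding [above_floor], with v as rational parameter. *)
Definition xt s v := (s - v) / (1 + v ^+ 2) - s / 2.
Definition eta s v := (1 + s * v) / (1 + v ^+ 2).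

Lemma onev_gt0 v : 0 < 1 + v ^+ 2. Proof. by have := sqr_ge0 v; lra. Qed.
Lemma onev_neq0 v : 1 + v ^+ 2 != 0. Proof. by rewrite gt_eqF // onev_gt0. Qed.

Lemma xtE s v : xt s v = (2 * (s - v) - s * (1 + v ^+ 2)) / (2 * (1 + v ^+ 2)).
Proof. by rewrite /xt; field; rewrite onev_neq0. Qed.

Lemma floor_circle s v : xt s v ^+ 2 + (eta s v - 1 / 2) ^+ 2 = (1 + s ^+ 2) / 4.
Proof. by rewrite /xt /eta; field; rewrite onev_neq0. Qed.

Lemma v_from_xt s v : 2 * eta s v * v = s - 2 * xt s v.
Proof. by rewrite /xt /eta; field; rewrite onev_neq0. Qed.

Lemma hexa_xt s v : hexa s v -> - (1 / 2) <= xt s v <= 1 / 2.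
Proof.
move=> [/andP[s1 s2] /andP[v1 v2] h1 h2]; have d0 : 0 < 2 * (1 + v ^+ 2) by have := onev_gt0 v; lra.
have k1 : 0 <= (1 - v) * (1 + s - (1 - s) * v) by apply: mulr_ge0; lra.
have k2 : 0 <= (1 + v) * (1 - s + (1 + s) * v) by apply: mulr_ge0; lra.
by rewrite xtE ler_pdivlMr // ler_pdivrMr //; apply/andP; split; lra.
Qed.

Lemma hexa_eta s v : hexa s v -> (1 + s) / 2 <= eta s v /\ (1 - s) / 2 <= eta s v.
Proof.
move=> [/andP[s1 s2] /andP[v1 v2] h1 h2]; have d0 := onev_gt0 v.
have k1 : 0 <= (1 - v) * (1 + v - s + s * v) by apply: mulr_ge0; lra.
have k2 : 0 <= (1 + v) * (1 - v + s + s * v) by apply: mulr_ge0; lra.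
by rewrite /eta !ler_pdivlMr //; split; lra.
Qed.

Lemma hexa_above s v h : hexa s v -> 0 <= h -> above_floor s (xt s v) (eta s v + h).
Proof.
move=> hx h0; have [e1 e2] := hexa_eta hx; have x12 := hexa_xt hx; have c := floor_circle s v.
case: hx => s12 _ _ _; have /andP[s1 s2] := s12; split=> //; first by split; lra.
by have : 0 <= h * (2 * (eta s v - 1 / 2) + h); [apply: mulr_ge0; lra|lra].
Qed.

Lemma hexa_strict s v h : hexa s v -> 0 < h ->
  generic_floor s (xt s v) (eta s v + h) /\
  (1 + s ^+ 2) / 4 < xt s v ^+ 2 + (eta s v + h - 1 / 2) ^+ 2.
Proof.
move=> hx h0; have [e1 e2] := hexa_eta hx; have c := floor_circle s v.
case: hx => /andP[s1 s2] _ _ _.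
have k : (1 + s ^+ 2) / 4 < xt s v ^+ 2 + (eta s v + h - 1 / 2) ^+ 2.
  by have : 0 < h * (2 * (eta s v - 1 / 2) + h); [apply: mulr_gt0; lra|lra].
by split=> //; split; [lra|lra|left].
Qed.

Lemma hexa_intW s v : hexa_int s v -> hexa s v.
Proof.
by move=> [/andP[? ?] /andP[? ?] ? ?]; split; [apply/andP; split; lra|apply/andP; split; lra|lra|lra].
Qed.

Lemma hexa_int_xt s v : hexa_int s v -> - (1 / 2) < xt s v < 1 / 2.
Proof.
move=> [/andP[s1 s2] /andP[v1 v2] h1 h2]; have d0 : 0 < 2 * (1 + v ^+ 2) by have := onev_gt0 v; lra.
have k1 : 0 < (1 - v) * (1 + s - (1 - s) * v) by apply: mulr_gt0; lra.
have k2 : 0 < (1 + v) * (1 - s + (1 + s) * v) by apply: mulr_gt0; lra.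
by rewrite xtE ltr_pdivlMr // ltr_pdivrMr //; apply/andP; split; lra.
Qed.

Lemma hexa_int_generic s v : hexa_int s v -> generic_floor s (xt s v) (eta s v + 0).
Proof.
move=> hx; have x12 := hexa_int_xt hx; case: hx => s12 /andP[v1 v2] h1 h2.
have d0 := onev_gt0 v; rewrite addr0; have /andP[s1 s2] := s12.
have k1 : 0 < (1 - v) * (1 + v - s + s * v) by apply: mulr_gt0; lra.
have k2 : 0 < (1 + v) * (1 - v + s + s * v) by apply: mulr_gt0; lra.
by split; [rewrite /eta ltr_pdivlMr //; lra|rewrite /eta ltr_pdivlMr //; lra|right].
Qed.

Lemma siegel_Phi t h s v : 0 <= t <= 1 -> 0 <= h -> hexa s v -> siegel (Phi t h s v).
Proof.
move=> /andP[t0 t1] h0 hx; have [e1 e2] := hexa_eta hx; case: hx => /andP[s1 s2] _ _ _.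
rewrite /siegel /= /hgt /py /pa /pb /= -/(eta s v).
have t2 : t ^+ 2 <= 1 by nra.
have s3 : s ^+ 2 <= 1 by nra.
have ts : t ^+ 2 * s ^+ 2 <= s ^+ 2 by have := sqr_ge0 s; nra.
have -> : (t / 2) ^+ 2 = t ^+ 2 / 4 by field.
have -> : (- (t * s) / 2) ^+ 2 = t ^+ 2 * s ^+ 2 / 4 by field.
have : 1 + s ^+ 2 <= 2 * eta s v by have [?|?] := leP 0 s; nra.
have := sqr_ge0 s; lra.
Qed.

(** By [functional_Phi], twice this is the excess of the squared value of a mirror equation over
    that of w, when w is scaled by t. *)
Definition mirrorT t s x y (a1 a2 b1 b2 c1 c2 : R) :=
  (a1 * (x + s / 2) - a2 * y + c1 + t * (b1 + b2 * s) / 2) ^+ 2 +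
  (a2 * (x + s / 2) + a1 * y + c2 + t * (b2 - b1 * s) / 2) ^+ 2 - t ^+ 2 * (1 + s ^+ 2) / 4.

Lemma mirrorT1 s x y a1 a2 b1 b2 c1 c2 :
  mirrorT 1 s x y a1 a2 b1 b2 c1 c2 = mirrorQ s x y a1 a2 b1 b2 c1 c2.
Proof. by rewrite /mirrorT /mirrorQ expr1n !mul1r. Qed.

Lemma intz_sign (c : int) : c != 0 -> 1 <= c \/ c <= -1.
Proof. by move=> ?; lia. Qed.

Lemma intz_quadric (c e : int) : c ^+ 2 + c + e ^+ 2 = 0 -> e = 0 /\ (c = 0 \/ c = -1).
Proof. by move=> h; have : e = 0 by [nia]; move=> ->; split=> //; nia. Qed.

Lemma intz_sq_le0 (c e : int) : c ^+ 2 + e ^+ 2 <= 0 -> c = 0 /\ e = 0.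
Proof. by move=> h; split; nia. Qed.

(** With a = 0 the excess is |c|^2 plus a term linear in t that is at least -t |c|^2, since s lies
    in [-1, 1]. A tie therefore needs t = 1 or c = 0. *)
Lemma mirrorT_flat t s x y (b1 b2 c1 c2 : int) : 0 <= t <= 1 -> -1 <= s <= 1 ->
  b1 ^+ 2 + b2 ^+ 2 = 1 ->
  (1 - t) * (c1 ^+ 2 + c2 ^+ 2)%:~R <= mirrorT t s x y 0 0 b1%:~R b2%:~R c1%:~R c2%:~R /\
  (-1 < s < 1 -> mirrorT 1 s x y 0 0 b1%:~R b2%:~R c1%:~R c2%:~R = 0 ->
    (c1 = 0 /\ c2 = 0) \/ (c1 = - b1 /\ c2 = - b2)).
Proof.
move=> /andP[t0 t1] /andP[s1 s2] hb; rewrite rmorphD !rmorphXn /=.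
have sq (c : int) : `|c%:~R| <= c%:~R ^+ 2 :> R.
  by rewrite -intr_norm -rmorphXn ler_int; nia.
have := sq c1; have := sq c2; rewrite !ler_norml => /andP[p1 p2] /andP[p3 p4].
have bR : b1%:~R ^+ 2 + b2%:~R ^+ 2 = 1 :> R by rewrite -!rmorphXn -rmorphD /= hb.
have E tt : mirrorT tt s x y 0 0 b1%:~R b2%:~R c1%:~R c2%:~R =
  c1%:~R ^+ 2 + c2%:~R ^+ 2 + tt * (c1%:~R * (b1%:~R + b2%:~R * s) + c2%:~R * (b2%:~R - b1%:~R * s)).
  rewrite /mirrorT; have -> : tt ^+ 2 * (1 + s ^+ 2) / 4 =
    tt ^+ 2 * ((1 + s ^+ 2) * (b1%:~R ^+ 2 + b2%:~R ^+ 2)) / 4 by rewrite bR mulr1.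
  by field.
rewrite !E.
set c1' := c1%:~R in p3 p4 *; set c2' := c2%:~R in p1 p2 *.
have key : - (c1' ^+ 2 + c2' ^+ 2) <= c1' * (b1%:~R + b2%:~R * s) + c2' * (b2%:~R - b1%:~R * s).
  have a1 : - (c1' ^+ 2) <= c1' * s by have [?|?] := leP 0 c1'; nra.
  have a2 : - (c2' ^+ 2) <= c2' * s by have [?|?] := leP 0 c2'; nra.
  have a3 : c1' * s <= c1' ^+ 2 by have [?|?] := leP 0 c1'; nra.
  have a4 : c2' * s <= c2' ^+ 2 by have [?|?] := leP 0 c2'; nra.
  by case: (sum_sq1 hb) => -[-> ->]; rewrite ?rmorphN /=; lra.
split.
  have := ler_wpM2l t0 key; lra.
move=> /andP[s1' s2']; rewrite mul1r => e0.
have Z (c : int) : (c%:~R : R) != 0 -> 0 < c%:~R ^+ 2 - c%:~R * s /\ 0 < c%:~R ^+ 2 + c%:~R * s.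
  move=> cn; have : 1 <= c%:~R :> R \/ c%:~R <= -1 :> R.
    rewrite intr_eq0 in cn; have [h|h] := intz_sign cn.
      by left; rewrite -[1]/(1%:~R) ler_int.
    by right; rewrite (_ : -1 = (-1)%:~R) ?ler_int // rmorphN.
  by move=> [?|?]; split; nra.
have ZZ (c e : int) : c%:~R ^+ 2 + c%:~R + e%:~R ^+ 2 = 0 :> R ->
   e = 0 /\ (c = 0 \/ c = -1).
  move=> h; have : c ^+ 2 + c + e ^+ 2 = 0.
    by apply/eqP; rewrite -(eqr_int R) !rmorphD !rmorphXn /= h.
  exact: intz_quadric.
case: (sum_sq1 hb) => -[b1E b2E]; rewrite b1E b2E ?rmorphN /= in e0 *.
- have c20 : c2 = 0.
    apply/eqP; rewrite -(intr_eq0 R); apply/negPn/negP => /Z[z1 z2].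
    by move: p3; rewrite -/c2' in z1 z2; lra.
  move: e0; rewrite /c2' c20 /= => e0.
  have [|_ [->|->]] := ZZ c1 0; [rewrite -/c1' /=; lra|by left|by right].
- have c20 : c2 = 0.
    apply/eqP; rewrite -(intr_eq0 R); apply/negPn/negP => /Z[z1 z2].
    by move: p4; rewrite -/c2' in z1 z2; lra.
  move: e0; rewrite /c2' c20 /= => e0.
  have [|_ [h|h]] := ZZ (- c1) 0; first by rewrite rmorphN -/c1' /=; lra.
    by left; split=> //; apply/eqP; rewrite -oppr_eq0 h.
  by right; rewrite -h opprK oppr0.
- have c10 : c1 = 0.
    apply/eqP; rewrite -(intr_eq0 R); apply/negPn/negP => /Z[z1 z2].
    by move: p1; rewrite -/c1' in z1 z2; lra.
  move: e0; rewrite /c1' c10 /= => e0.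
  have [|_ [->|->]] := ZZ c2 0; [rewrite -/c2' /=; lra|by left|by right].
- have c10 : c1 = 0.
    apply/eqP; rewrite -(intr_eq0 R); apply/negPn/negP => /Z[z1 z2].
    by move: p2; rewrite -/c1' in z1 z2; lra.
  move: e0; rewrite /c1' c10 /= => e0.
  have [|_ [h|h]] := ZZ (- c2) 0; first by rewrite rmorphN -/c2' /=; lra.
    by left; split=> //; apply/eqP; rewrite -oppr_eq0 h.
  by right; rewrite -h opprK oppr0.
Qed.

(** The value at t is t times the value at 1 plus (1 - t) times a quantity positive above the floor,
    so mirrors with nonzero a are strictly farther for t < 1. *)
Lemma mirrorT_convex t s x y (a1 a2 b1 b2 c1 c2 k : R) : 0 <= t -> t < 1 ->
  above_floor s x y -> 0 <= k -> k = a1 * c2 - a2 * c1 -> b1 ^+ 2 + b2 ^+ 2 = 1 + 4 * k ->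
  0 < a1 ^+ 2 + a2 ^+ 2 -> 0 <= mirrorQ s x y a1 a2 b1 b2 c1 c2 ->
  0 < mirrorT t s x y a1 a2 b1 b2 c1 c2.
Proof.
move=> t0 t1 [/andP[s1 s2] _ [y1 y2] _] k0 kE bk N0 Q0.
set N := a1 ^+ 2 + a2 ^+ 2 in N0.
set m1 := a1 * (x + s / 2) - a2 * y + c1; set m2 := a2 * (x + s / 2) + a1 * y + c2.
set M := m1 ^+ 2 + m2 ^+ 2; set w := (1 + s ^+ 2) / 4.
have E : mirrorT t s x y a1 a2 b1 b2 c1 c2 = (1 - t) * (M - t * (4 * k * w)) +
   t * mirrorQ s x y a1 a2 b1 b2 c1 c2.
  have e4 : 4 * k * w = (b1 ^+ 2 + b2 ^+ 2) * w - w by rewrite bk; ring.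
  by rewrite e4 /mirrorT /mirrorQ /M /m1 /m2 /w; field.
have NM : (N * y + k) ^+ 2 <= N * M.
  have -> : N * M = (a1 * m1 + a2 * m2) ^+ 2 + (a1 * m2 - a2 * m1) ^+ 2 by rewrite /N /M; ring.
  have -> : N * y + k = a1 * m2 - a2 * m1 by rewrite kE /N /m1 /m2; ring.
  by have := sqr_ge0 (a1 * m1 + a2 * m2); lra.
have y0 : 0 < y by lra.
have M4 : N * y ^+ 2 + 2 * k * y <= M.
  rewrite -(ler_pM2l N0); apply: le_trans NM; have := sqr_ge0 k; rewrite !expr2; lra.
have wy : 2 * w <= y by rewrite /w; have [?|?] := leP 0 s; nra.
have Ny : 0 < N * y ^+ 2 by rewrite mulr_gt0 // exprn_gt0.
have kw : 4 * k * w <= 2 * k * y by have := ler_wpM2l k0 wy; lra.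
have kw0 : 0 <= 4 * k * w by rewrite !mulr_ge0 // /w; have := sqr_ge0 s; lra.
have tk : t * (4 * k * w) <= 4 * k * w by apply: ler_piMl => //; exact: ltW.
have : 0 < (1 - t) * (M - t * (4 * k * w)) by apply: mulr_gt0; lra.
by rewrite E; have := mulr_ge0 t0 Q0; lra.
Qed.

(** Records which mirrors tie with w = 0: none for t < 1, only those with a = 0 on t = 1 strictly
    above the floor, and three at a generic point with t = 1 and h = 0. *)
Lemma mirrorT_nonneg t s x y (a1 a2 b1 b2 c1 c2 : int) : 0 <= t <= 1 -> above_floor s x y ->
  b1 ^+ 2 + b2 ^+ 2 = 1 + 4 * (a1 * c2 - a2 * c1) ->
  [/\ 0 <= mirrorT t s x y a1%:~R a2%:~R b1%:~R b2%:~R c1%:~R c2%:~R,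
      t < 1 -> mirrorT t s x y a1%:~R a2%:~R b1%:~R b2%:~R c1%:~R c2%:~R = 0 ->
        [/\ a1 = 0, a2 = 0, c1 = 0 & c2 = 0],
      generic_floor s x y -> (1 + s ^+ 2) / 4 < x ^+ 2 + (y - 1 / 2) ^+ 2 ->
        mirrorT 1 s x y a1%:~R a2%:~R b1%:~R b2%:~R c1%:~R c2%:~R = 0 -> a1 = 0 /\ a2 = 0 &
      generic_floor s x y -> -1 < s < 1 ->
        mirrorT 1 s x y a1%:~R a2%:~R b1%:~R b2%:~R c1%:~R c2%:~R = 0 ->
        [\/ [/\ a1 = 0, a2 = 0, c1 = 0 & c2 = 0], [/\ a1 = 0, a2 = 0, c1 = - b1 & c2 = - b2] |
            [/\ a1 ^+ 2 + a2 ^+ 2 = 1, c1 = 0 /\ c2 = 0, b1 = a2 & b2 = - a1]]].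
Proof.
move=> t01 hA bk; have [t0 t1] := andP t01; have [a0|a0] := boolP ((a1 != 0) || (a2 != 0)); last first.
  move: a0 bk; rewrite negb_or !negbK => /andP[/eqP-> /eqP->] bk.
  have hb : b1 ^+ 2 + b2 ^+ 2 = 1 by rewrite bk; lia.
  have s12 : -1 <= s <= 1 by case: hA.
  have [F1 F2] := mirrorT_flat x y c1 c2 t01 s12 hb.
  have c0 : 0 <= (c1 ^+ 2 + c2 ^+ 2)%:~R :> R by rewrite ler0z; nia.
  split=> //.
  - by apply: le_trans F1; rewrite mulr_ge0 //; lra.
  - move=> t1' F0; move: F1; rewrite F0 => F1.
    have : (c1 ^+ 2 + c2 ^+ 2)%:~R <= 0 :> R by rewrite -(pmulr_rle0 _ (_ : 0 < 1 - t)) //; lra.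
    by rewrite lerz0 => cc; have [-> ->] := intz_sq_le0 cc.
  - by move=> _ s12' /(F2 s12') [[-> ->]|[-> ->]]; [constructor 1|constructor 2].
have [Q1 Q2] := mirrorQ_ok hA a0 bk.
have cast : (a1 * c2 - a2 * c1)%:~R = a1%:~R * c2%:~R - a2%:~R * c1%:~R :> R by rewrite intrB !intrM.
have N0 : 0 < a1%:~R ^+ 2 + a2%:~R ^+ 2 :> R by rewrite -!rmorphXn -rmorphD /= ltr0z; nia.
have conv : t < 1 -> 0 < mirrorT t s x y a1%:~R a2%:~R b1%:~R b2%:~R c1%:~R c2%:~R.
  move=> t1'; apply: (mirrorT_convex (k := (a1 * c2 - a2 * c1)%:~R)) => //.
  - by rewrite ler0z; nia.
  - by rewrite -!rmorphXn -rmorphD bk rmorphD rmorphM.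
split.
- have [/conv/ltW//|t1'] := ltP t 1; have -> : t = 1 by lra.
  by rewrite mirrorT1.
- by move=> /conv + e; rewrite e ltxx.
- by move=> hg hd; rewrite mirrorT1 => e; have := Q2 hg (fun=> hd); rewrite e ltxx.
- move=> hg s12; rewrite mirrorT1 => e; constructor 3.
  by apply: contrapT => ne; have := Q2 hg (fun ex => False_ind _ (ne ex)); rewrite e ltxx.
Qed.

Lemma functional_Phi t h s v (a1 a2 b1 b2 c1 c2 : R) :
  normsq (functional ((1 +i* 1) * (a1 +i* a2)) (b1 +i* b2) ((1 +i* 1) * (c1 +i* c2)) (Phi t h s v)) =
  normsq (vec (Phi t h s v) o1 0) + 2 * mirrorT t s (xt s v) (eta s v + h) a1 a2 b1 b2 c1 c2.
Proof.
rewrite vec1 /functional /normsq /zc /wc /px /py /pa /pb /mirrorT /xt /eta /=; field.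
by rewrite onev_neq0.
Qed.

Lemma row2_Phi t h s v g : 0 <= t <= 1 -> 0 <= h -> hexa s v -> Gamma g ->
  let p := Phi t h s v in let e := normsq ((g *m vec p) o1 0) = normsq (vec p o1 0) in
  [/\ normsq (vec p o1 0) <= normsq ((g *m vec p) o1 0),
      t < 1 -> e -> g o1 o0 = 0 /\ g o1 o2 = 0,
      t = 1 -> 0 < h -> e -> g o1 o0 = 0 &
      t = 1 -> h = 0 -> hexa_int s v -> e ->
        [\/ g o1 o0 = 0 /\ g o1 o2 = 0, g o1 o0 = 0 /\ g o1 o2 = - (1 +i* 1) * g o1 o1 |
            g o1 o2 = 0 /\ g o1 o0 = 'i * (1 +i* 1) * g o1 o1]].
Proof.
move=> t01 h0 hx gG p e.
have [a1 [a2 [b1 [b2 [c1 [c2 [A B D bk]]]]]]] := Gamma_row2 gG.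
have hA := hexa_above hx h0; have [M1 M2 M3 M4] := mirrorT_nonneg t01 hA bk.
have E : normsq ((g *m vec p) o1 0) = normsq (vec p o1 0) +
    2 * mirrorT t s (xt s v) (eta s v + h) a1%:~R a2%:~R b1%:~R b2%:~R c1%:~R c2%:~R.
  by rewrite mulmx_vec A B D functional_Phi.
have zz : (1 +i* 1) * (0 +i* 0) = 0 :> C by apply: complex_eq; rewrite /=; ring.
have e0 : e -> mirrorT t s (xt s v) (eta s v + h) a1%:~R a2%:~R b1%:~R b2%:~R c1%:~R c2%:~R = 0.
  by rewrite /e E; lra.
split.
- by rewrite E; lra.
- by move=> t1 /e0 /(M2 t1)[a10 a20 c10 c20]; rewrite A D a10 a20 c10 c20 /= zz.
- move=> tE hp /e0; rewrite tE => m0; have [hg hd] := hexa_strict hx hp.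
  by have [a10 a20] := M3 hg hd m0; rewrite A a10 a20 /= zz.
- move=> tE hE hi /e0 m0; have hg := hexa_int_generic hi; rewrite tE hE in m0; rewrite hE in M4.
  have s12 : -1 < s < 1 by case: hi.
  case: (M4 hg s12 m0) => [[a10 a20 c10 c20]|[a10 a20 c10 c20]|[_ [c10 c20] b1E b2E]]; rewrite A B D.
  + by constructor 1; rewrite a10 a20 c10 c20 /= zz.
  + constructor 2; rewrite a10 a20 c10 c20 /= zz; split=> //.
    by apply: complex_eq; rewrite /= ?rmorphN; ring.
  + constructor 3; rewrite c10 c20 /= zz b1E b2E; split=> //.
    by apply: complex_eq; rewrite /= ?rmorphN; ring.
Qed.

(** * Elements identifying two points of the model *)

Lemma vec_inv g p q : Gamma g -> siegel p -> act g p = q ->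
  [/\ lam g p != 0, siegel q & invmx g *m vec q = (lam g p)^-1 *: vec p].
Proof.
move=> gG sp <-; have gS := proj1 gG; have l0 := lam_neq0 gS sp; split=> //.
  exact: act_siegel.
have e := vec_act gS sp; have := congr1 (mulmx (invmx g)) e.
rewrite mulmxA mulVmx ?SU21_unit // mul1mx -scalemxAr => ->.
by rewrite scalerA mulVf // scale1r.
Qed.

Section Relation.
Variables (t h s v t' h' s' v' : R) (g : 'M[C]_3).
Hypotheses (t01 : 0 <= t <= 1) (h0 : 0 <= h) (hx : hexa s v).
Hypotheses (t01' : 0 <= t' <= 1) (h0' : 0 <= h') (hx' : hexa s' v').
Hypotheses (gG : Gamma g) (gE : act g (Phi t h s v) = Phi t' h' s' v').
Let p := Phi t h s v.
Let p' := Phi t' h' s' v'.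
Let sp : siegel p. Proof. exact: siegel_Phi. Qed.
Let sp' : siegel p'. Proof. exact: siegel_Phi. Qed.
Let l := lam g p.

Lemma rel_vec : g *m vec p = l *: vec p'.
Proof. by have := vec_act (proj1 gG) sp; rewrite gE. Qed.

Lemma rel_coord i : functional (g i o0) (g i o1) (g i o2) p = l * vec p' i 0.
Proof. by rewrite -mulmx_vec rel_vec [LHS]mxE. Qed.

Lemma rel_l0 : 0 < normsq l.
Proof. by rewrite normsq_gt0 // (lam_neq0 (proj1 gG) sp). Qed.

(** Both points minimize the distance to the orbit of the mirror: the minimality of p is used for g
    and that of p' for the inverse of g. *)
Lemma rel_row2 : normsq ((g *m vec p) o1 0) = normsq (vec p o1 0).
Proof.
have [r1 _ _ _] := row2_Phi t01 h0 hx gG.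
have [r2 _ _ _] := row2_Phi t01' h0' hx' (Gamma_inv gG).
have [l0 _ iE] := vec_inv gG sp gE.
apply/le_anti/andP; split=> //.
rewrite iE [in X in _ <= X]mxE normsqM normsqV in r2.
rewrite rel_vec [in X in X <= _]mxE normsqM mulrC -ler_pdivlMr ?rel_l0 // mulrC; exact: r2.
Qed.

Lemma rel_norm_w : normsq l * normsq (wc p') = normsq (wc p).
Proof.
have := rel_row2; rewrite rel_vec mxE !vec1 !normsqM => e.
have e2 : normsq (1 +i* 1) = 2 :> R by rewrite /normsq /=; ring.
by rewrite e2 in e; lra.
Qed.

Section Mirror.
Hypotheses (A0 : g o1 o0 = 0) (D0 : g o1 o2 = 0).

Lemma mirror_struct : exists b1 b2 c1 c2 d1 d2 : int,
  [/\ g o1 o1 = b1%:~R +i* b2%:~R, g o2 o0 = c1%:~R +i* c2%:~R, g o2 o2 = d1%:~R +i* d2%:~R,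
      b1 ^+ 2 + b2 ^+ 2 = 1 /\ c1 * d2 - c2 * d1 = 0 & g o2 o1 = 0 /\ g o0 o1 = 0].
Proof.
have [gS gZ] := gG; have [_ r2 r3 r23] := SU21_rows gS; have [_ r12 _ _] := SU21_rows2 gS.
have [b1 [b2 B]] := gZ o1 o1; have [c1 [c2 c]] := gZ o2 o0; have [d1 [d2 d]] := gZ o2 o2.
rewrite A0 D0 in r2 r23 r12; rewrite mul0r /= mulr0 addr0 in r2.
have nB : b1 ^+ 2 + b2 ^+ 2 = 1.
  apply/eqP; rewrite -(eqr_int R) rmorphD !rmorphXn /=; apply/eqP.
  by move: r2; rewrite B /normsq /=.
have B0 : g o1 o1 != 0.
  by apply/eqP => b0; move: r2; rewrite b0 normsq0 => r2; lra.
have g21 : g o2 o1 = 0.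
  move: r23; rewrite !mulr0 !mul0r sub0r subr0 => /eqP; rewrite oppr_eq0 mulf_eq0 (negbTE B0) /=.
  by rewrite conjc_eq0 => /eqP.
have g01 : g o0 o1 = 0.
  move: r12; rewrite conjc0 !mulr0 sub0r subr0 => /eqP; rewrite oppr_eq0 mulf_eq0 conjc_eq0 (negbTE B0) orbF.
  by move/eqP.
exists b1, b2, c1, c2, d1, d2; split=> //; split=> //.
apply/eqP; rewrite -(eqr_int R) rmorphB !rmorphM /=; apply/eqP.
by move: r3; rewrite g21 c d /normsq /= => r3; lra.
Qed.

(** For g preserving the mirror, the bottom row (c, d) together with -b has the shape of a middle
    row with k = 0. The identity turns the mirror inequality for this row into a comparison of t and
    t'. *)
Lemma mirror_gauge b1 b2 c1 c2 d1 d2 : g o1 o1 = b1 +i* b2 -> g o2 o0 = c1 +i* c2 ->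
  g o2 o2 = d1 +i* d2 -> g o2 o1 = 0 -> b1 ^+ 2 + b2 ^+ 2 = 1 ->
  t * mirrorQ s (xt s v) (eta s v + h) c1 c2 (- b1) (- b2) d1 d2 = normsq l * (t - t').
Proof.
move=> B c d g21 nB; have e1 := congr1 (fun u : 'cV[C]_3 => u o1 0) rel_vec.
have lE : l = (c1 +i* c2) * zc p + (d1 +i* d2).
  by rewrite /l /lam mulmx_vec /functional g21 c d mul0r addr0.
rewrite mulmx_vec /functional A0 D0 B mul0r add0r addr0 mxE vec1 in e1.
have {}e1 : (b1 +i* b2) * wc p = l * wc p'.
  by apply: (mulfI (onei_neq0 R)); rewrite mulrCA e1; ring.
have x1 : xt s v + s / 2 = px p by rewrite /xt /px /=; ring.
have y1 : eta s v + h = py p by [].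
have lr : complex.Re l = c1 * px p - c2 * py p + d1 by rewrite lE.
have li : complex.Im l = c2 * px p + c1 * py p + d2 by rewrite lE /=; ring.
have er := congr1 (@complex.Re R) e1; have ei := congr1 (@complex.Im R) e1.
move: er ei; rewrite /mirrorQ x1 y1 -lr -li /normsq; case: (l) => l1 l2.
rewrite /wc /pa /pb /= => er ei.
have n1 : t * (b1 + b2 * s) = t' * (l1 + l2 * s') by lra.
have n2 : t * (b2 - b1 * s) = t' * (l2 - l1 * s') by lra.
have E : t * ((l1 + (- b1 + - b2 * s) / 2) ^+ 2 + (l2 + (- b2 - - b1 * s) / 2) ^+ 2 - (1 + s ^+ 2) / 4) =
   t * (l1 ^+ 2 + l2 ^+ 2) - l1 * (t * (b1 + b2 * s)) - l2 * (t * (b2 - b1 * s)) +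
   t * ((1 + s ^+ 2) * (b1 ^+ 2 + b2 ^+ 2 - 1)) / 4 by field.
by rewrite E n1 n2 nB; ring.
Qed.

Lemma mirror_le : t' <= t /\ (0 < h -> 0 < t -> t' = t -> g o2 o0 = 0) /\
  (h = 0 -> 0 < t -> t' = t -> hexa_int s v -> g o2 o0 = 0 \/
     (g o2 o2 = 0 /\ g o2 o0 = - 'i * g o1 o1)).
Proof.
have [b1 [b2 [c1 [c2 [d1 [d2 [B c d [nB cd] [g21 g01]]]]]]]] := mirror_struct.
have nBR : b1%:~R ^+ 2 + b2%:~R ^+ 2 = 1 :> R by rewrite -!rmorphXn -rmorphD /= nB.
have G := mirror_gauge B c d g21 nBR.
have one01 : 0 <= (1 : R) <= 1 by rewrite ler01 lexx.
have hA := hexa_above hx h0.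
have bk : (- b1) ^+ 2 + (- b2) ^+ 2 = 1 + 4 * (c1 * d2 - c2 * d1) by rewrite !sqrrN nB cd.
have [M1 _ M3 M4] := mirrorT_nonneg one01 hA bk; rewrite !mirrorT1 !rmorphN /= in M1 M3 M4.
have zz : (0%:~R +i* 0%:~R : C) = 0 by [].
split; last split.
- have [t0|t0] := eqVneq t 0.
    move: G; rewrite t0 mul0r sub0r => /esym/eqP; rewrite mulf_eq0 oppr_eq0 gt_eqF ?rel_l0 //=.
    by move=> /eqP->.
  have : 0 <= normsq l * (t - t') by rewrite -G mulr_ge0 //; case/andP: t01.
  by rewrite pmulr_rge0 ?rel_l0 // subr_ge0.
- move=> hp tp tE; have [hg hd] := hexa_strict hx hp; move: G; rewrite tE subrr mulr0 => /eqP.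
  by rewrite mulf_eq0 gt_eqF //= => /eqP e0; have [c10 c20] := M3 hg hd e0; rewrite c c10 c20.
- move=> hE tp tE hi; have hg := hexa_int_generic hi; move: G; rewrite tE subrr mulr0 => /eqP.
  rewrite mulf_eq0 gt_eqF //= => /eqP e0; have s12 : -1 < s < 1 by case: hi.
  rewrite hE in M4 e0.
  case: (M4 hg s12 e0) => [[c10 c20 _ _]|[c10 c20 _ _]|[_ [d10 d20] b1E b2E]].
  + by left; rewrite c c10 c20.
  + by left; rewrite c c10 c20.
  + right; rewrite c d d10 d20 B; split=> //.
    have -> : b1 = - c2 by rewrite -b1E opprK.
    have -> : b2 = c1 by apply: oppr_inj; rewrite b2E.
    by apply: complex_eq; rewrite /= ?rmorphN; ring.
Qed.

End Mirror.

Section Cusp.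
Hypotheses (c0 : g o2 o0 = 0) (tp : 0 < t) (tE : t' = t).

Lemma cusp_struct : [/\ g o2 o1 = 0, g o1 o0 = 0, g o0 o0 = g o2 o2, normsq (g o2 o2) = 1 & l = g o2 o2].
Proof.
have [gS gZ] := gG; have [_ _ r3 r23] := SU21_rows gS; have [r13 _ _ _] := SU21_rows2 gS.
rewrite c0 mul0r /= mulr0 addr0 in r3; have g21 := normsq_eq0 r3.
have lE : l = g o2 o2 by rewrite /l /lam mulmx_vec /functional c0 g21 !mul0r !add0r.
have d0 : g o2 o2 != 0 by rewrite -lE; exact: lam_neq0.
rewrite g21 c0 conjc0 !mulr0 !subr0 in r23 r13.
have g10 : g o1 o0 = 0.
  by move/eqP: r23; rewrite !mulf_eq0 conjc_eq0 (negbTE d0) (negbTE (complexi_neq0 R)) orbF /= => /eqP.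
have ad : g o0 o0 * conjc (g o2 o2) = 1.
  by apply: (mulfI (complexi_neq0 R)); rewrite mulrA r13 mulr1.
have n1 : normsq (g o0 o0) * normsq (g o2 o2) = 1.
  have := congr1 (@normsq R) ad; rewrite normsqM normsq1.
  by rewrite [normsq (conjc _)](_ : _ = normsq (g o2 o2)) //; case: (g o2 o2) => ? ?; rewrite /normsq /= sqrrN.
have a0 : g o0 o0 != 0 by apply/eqP => a0; move: n1; rewrite a0 normsq0 mul0r => e; lra.
have na := gaussian_normsq_ge1 (gZ _ _) a0; have nd := gaussian_normsq_ge1 (gZ _ _) d0.
have nd1 : normsq (g o2 o2) = 1 by nra.
split=> //; rewrite -[LHS]mulr1 -[1](_ : conjc (g o2 o2) * g o2 o2 = 1); last by rewrite conjc_normsq nd1.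
by rewrite mulrA ad mul1r.
Qed.

Lemma gaussian_conj (z : C) : gaussian_integer z -> gaussian_integer (conjc z).
Proof. by move=> [a [b ->]]; exists a, (- b); rewrite /= rmorphN. Qed.

(** An element fixing the cusp acts on [wc] by a unit and a Gaussian translation. Comparing real and
    imaginary parts for each of the four units, with t unchanged, forces s up to sign and moves xt
    by an integer. *)
Lemma cusp_shift : t = 1 \/ g o1 o2 = 0 -> exists n : int, xt s' v' = xt s v + n%:~R /\
  s' ^+ 2 = s ^+ 2 /\ (g o1 o2 = 0 -> s' = s \/ s ^+ 2 = 1).
Proof.
move=> hmu; have [g21 g10 ad nd lE] := cusp_struct.
have [gS gZ] := gG; have [_ r2 _ _] := SU21_rows gS; have [_ r12 _ _] := SU21_rows2 gS.
have s2 : s' ^+ 2 = s ^+ 2.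
  have := rel_norm_w; rewrite lE nd mul1r /p /p' /normsq /wc /pa /pb /= tE => e.
  have : t ^+ 2 * (s' ^+ 2 - s ^+ 2) = 0 by lra.
  by move/eqP; rewrite mulf_eq0 expf_eq0 gt_eqF //= subr_eq0 => /eqP.
rewrite g10 conjc0 mulr0 subr0 in r12; rewrite g10 mul0r /= mulr0 addr0 in r2.
have [a1 [a2 [B1 [B2 [C1 [C2 [_ BE CE _]]]]]]] := Gamma_row2 gG.
set d := g o2 o2 in ad nd lE r12; set B := g o1 o1 in BE r2 r12.
have dd : conjc d * d = 1 by rewrite conjc_normsq nd.
have BB : conjc B * B = 1 by rewrite conjc_normsq r2.
have gD : gaussian_integer d by exact: gZ.
have gcd := gaussian_conj gD.
set C' := C1%:~R +i* C2%:~R in CE.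
have gC' : gaussian_integer C' by exists C1, C2.
have [e1 [e2 eE]] : gaussian_integer (B * conjc d) by apply: gaussianM gcd; exists B1, B2.
have [m1 [m2 mE]] : gaussian_integer (C' * conjc d) by apply: gaussianM gcd.
have [k1 [k2 kE]] : gaussian_integer (g o0 o2 * conjc d) by apply: gaussianM gcd.
have bE : g o0 o1 = 'i * d * conjc (g o1 o2) * B.
  have : g o0 o1 * (conjc B * B) = 'i * g o0 o0 * conjc (g o1 o2) * B.
    move/eqP: r12; rewrite subr_eq0 => /eqP r12; by rewrite mulrA -r12.
  by rewrite BB mulr1 ad.
(* Multiplication by the conjugate of the unit d normalizes the bottom right entry to 1. *)
have vz := congr1 ( *%R (conjc d)) (rel_coord o0).
have vw := congr1 ( *%R (conjc d)) (rel_coord o1).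
rewrite /functional vec0 lE in vz.
rewrite /functional vec1 lE g10 mul0r add0r in vw.
have {}vw : (e1%:~R +i* e2%:~R) * wc p + (m1%:~R +i* m2%:~R) = wc p'.
  apply: (mulfI (onei_neq0 R)); rewrite -eE -mE.
  have -> : (1 +i* 1) * wc p' = conjc d * d * ((1 +i* 1) * wc p') by rewrite dd mul1r.
  by rewrite -[RHS]mulrA -vw CE -/B; ring.
have {}vz : zc p + 2 * 'i * (conjc (m1%:~R +i* m2%:~R) * (e1%:~R +i* e2%:~R)) * wc p +
     (k1%:~R +i* k2%:~R) = zc p'.
  have -> : zc p' = conjc d * d * zc p' by rewrite dd mul1r.
  rewrite -[RHS]mulrA -vz -kE -eE -mE ad bE CE -/d -/B.
  have i2 : 'i * (conjc (1 +i* 1) * (1 +i* 1)) = 2 * 'i :> C by apply: complex_eq; rewrite /=; ring.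
  have cC : conjc (C' * conjc d) * (B * conjc d) = conjc d * d * (conjc C' * B).
    rewrite [conjc (_ * _)](_ : _ = conjc C' * d); first by ring.
    by case: (C') (d) => ? ? [? ?]; apply: complex_eq; rewrite /=; ring.
  have cD : conjc ((1 +i* 1) * C') = conjc (1 +i* 1) * conjc C'.
    by case: (C') => ? ?; apply: complex_eq; rewrite /=; ring.
  rewrite cC cD -i2.
  have -> : conjc d * (d * zc p + 'i * d * (conjc (1 +i* 1) * conjc C') * B * ((1 +i* 1) * wc p) + g o0 o2) =
    conjc d * d * (zc p + 'i * (conjc (1 +i* 1) * (1 +i* 1)) * (conjc C' * B) * wc p) + conjc d * g o0 o2 by ring.
  by rewrite dd; ring.
have ne : e1 ^+ 2 + e2 ^+ 2 = 1.
  apply/eqP; rewrite -(eqr_int R) rmorphD !rmorphXn /=; apply/eqP.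
  have := congr1 (@normsq R) eE; rewrite normsqM r2 mul1r [normsq (conjc _)](_ : _ = normsq d); last first.
    by case: (d) => ? ?; rewrite /normsq /= sqrrN.
  by rewrite nd /normsq /= => <-.
have w1 := congr1 (@complex.Re R) vw; have w2 := congr1 (@complex.Im R) vw.
have z1 := congr1 (@complex.Re R) vz.
rewrite /p /p' /zc /wc /px /py /pa /pb /= tE in w1 w2 z1.
rewrite -!/(xt _ _) /xt.
set x := (s - v) / _ in z1 *; set x' := (s' - v') / _ in z1 *.
have {z1} xE : x' = x - (m1%:~R * (e2%:~R * t - e1%:~R * (t * s)) - m2%:~R * (e1%:~R * t + e2%:~R * (t * s))) + k1%:~R.
  by rewrite -z1; field.
have m0 : g o1 o2 = 0 -> m1 = 0 /\ m2 = 0.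
  move=> C0; have C0' : C' = 0.
    by move/eqP: CE; rewrite C0 eq_sym mulf_eq0 (negbTE (onei_neq0 R)) /= => /eqP.
  move: mE; rewrite C0' mul0r => -[/esym/eqP + /esym/eqP]; rewrite !intr_eq0.
  by move=> /eqP-> /eqP->.
have tS (a b : R) : t * a = t * b -> a = b by apply: mulfI; rewrite gt_eqF.
have Z0 : 0%:~R = 0 :> R by [].
have Z1 : 1%:~R = 1 :> R by [].
case: (sum_sq1 ne) => -[e1E e2E]; rewrite e1E e2E ?rmorphN /= ?Z0 ?Z1 in w1 w2 xE.
- case: hmu => [t1|/m0[m10 m20]].
    exists (2 * m2 + k1); split; last split=> //.
      rewrite rmorphD rmorphM /=; rewrite t1 in w1 w2 xE.
      have m1E : m1%:~R = 0 :> R by lra.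
      by rewrite m1E in xE; lra.
    by move=> /m0[m10 m20]; left; rewrite m20 t1 Z0 in w2; lra.
  exists k1; rewrite m10 m20 Z0 in w1 w2 xE.
  have ss : s' = s by apply: tS; lra.
  by split; [rewrite ss; lra|split=> //; left].
- case: hmu => [t1|/m0[m10 m20]]; last first.
    by exfalso; rewrite m10 Z0 in w1; move: tp; (have -> : t = 0 by lra); rewrite ltxx.
  exists k1; rewrite t1 in w1 w2 xE; split; last split=> //.
    have m1E : m1%:~R = 1 :> R by lra.
    by rewrite m1E in xE; lra.
  by move=> /m0[m10 _]; exfalso; rewrite m10 Z0 in w1; have : (1 : R) = 0 by [lra]; move/eqP; rewrite oner_eq0.
- case: hmu => [t1|/m0[m10 m20]].
    exists (1 + k1 - 2 * m1 + 2 * m2 - 2 * (m1 * m2)); split; last split=> //.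
      rewrite rmorphB rmorphD rmorphB rmorphD !rmorphM /=; rewrite t1 in w1 w2 xE.
      have sE : s = 1 - 2 * m1%:~R by lra.
      have sE' : s' = -1 - 2 * m2%:~R by lra.
      have m2s : m2%:~R * s = m2%:~R - 2 * (m1%:~R * m2%:~R) by rewrite sE; ring.
      lra.
    by move=> /m0[m10 _]; right; rewrite m10 t1 Z0 in w1; have -> : s = 1 by [lra]; rewrite expr1n.
  rewrite m10 m20 Z0 in w1 w2 xE.
  have sE : s = 1 by apply: tS; lra.
  have sE' : s' = -1 by apply: tS; lra.
  exists (k1 + 1); split; last by split=> // _; right; rewrite sE expr1n.
  by rewrite rmorphD /=; lra.
- case: hmu => [t1|/m0[m10 m20]].
    exists (k1 + 2 * m1 + 2 * m2 - 2 * (m1 * m2) - 1); split; last split=> //.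
      rewrite rmorphB rmorphB rmorphD rmorphD !rmorphM /=; rewrite t1 in w1 w2 xE.
      have sE : s = 2 * m1%:~R - 1 by lra.
      have sE' : s' = 1 - 2 * m2%:~R by lra.
      have m2s : m2%:~R * s = 2 * (m1%:~R * m2%:~R) - m2%:~R by rewrite sE; ring.
      lra.
    by move=> /m0[m10 _]; right; rewrite m10 t1 Z0 in w1; have -> : s = -1 by [lra]; rewrite sqrrN expr1n.
  rewrite m10 m20 Z0 in w1 w2 xE.
  have sE : s = -1 by apply: tS; lra.
  have sE' : s' = 1 by apply: tS; lra.
  exists (k1 - 1); split; last by split=> // _; right; rewrite sE sqrrN expr1n.
  by rewrite rmorphB /=; lra.
Qed.

(** Both values of xt lie in [-1/2, 1/2] and differ by an integer, so their squares agree; the floor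
    circle then determines eta, which is at least 1/2 for both. *)
Lemma cusp_eta : t = 1 \/ g o1 o2 = 0 -> eta s' v' = eta s v.
Proof.
move=> hmu; have [n [nE [s2 _]]] := cusp_shift hmu.
have /andP[x1 x2] := hexa_xt hx; have /andP[x1' x2'] := hexa_xt hx'.
have xx : xt s' v' ^+ 2 = xt s v ^+ 2.
  have [h1|h1|h1|h1] := int_cases R n; rewrite nE; try lra.
  - have -> : xt s v = 1 / 2 by lra.
    by rewrite h1; field.
  - by rewrite h1 addr0.
  - have -> : n%:~R = 1 :> R by lra.
    have -> : xt s v = - (1 / 2) by lra.
    by field.
have := floor_circle s v; have := floor_circle s' v'; rewrite s2 xx => f1 f2.
have [e1 e2] := hexa_eta hx; have [e1' e2'] := hexa_eta hx'.
have : (eta s' v' - 1 / 2) ^+ 2 = (eta s v - 1 / 2) ^+ 2 by lra.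
by move/eqP; rewrite eqf_sqr => /orP[] /eqP ?; lra.
Qed.

Lemma cusp_h : t = 1 \/ g o1 o2 = 0 -> h' = h.
Proof.
move=> hmu; have eE := cusp_eta hmu; have [_ _ _ nd lE] := cusp_struct.
have := hgt_act (proj1 gG) sp; rewrite -/l lE nd mul1r gE => hE.
have := rel_norm_w; rewrite lE nd mul1r => wE.
have : hgt p + normsq (wc p) = hgt p' + normsq (wc p') by rewrite hE wE.
by rewrite /hgt /normsq /p /p' /py /wc /pa /pb /= -/(eta s v) -/(eta s' v'); lra.
Qed.

End Cusp.
End Relation.

Definition dom t h s v := [/\ 0 <= t <= 1, 0 <= h & hexa s v].

Definition links g t h s v t' h' s' v' :=
  [/\ Gamma g, act g (Phi t h s v) = Phi t' h' s' v', dom t h s v & dom t' h' s' v'].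

Lemma links_inv g t h s v t' h' s' v' : links g t h s v t' h' s' v' ->
  links (invmx g) t' h' s' v' t h s v.
Proof.
move=> [gG gE d d']; split=> //; first exact: Gamma_inv.
by rewrite -gE actK //; [exact: (proj1 gG)|case: d => *; exact: siegel_Phi].
Qed.

Lemma links_mirror g t h s v t' h' s' v' : links g t h s v t' h' s' v' -> t < 1 ->
  g o1 o0 = 0 /\ g o1 o2 = 0.
Proof.
move=> [gG gE [t01 h0 hx] [t01' h0' hx']] t1; have [_ e _ _] := row2_Phi t01 h0 hx gG.
by apply: e => //; exact: rel_row2 gE.
Qed.

(** [mirror_le] gives one inequality, and the inverse of g gives the other. *)
Lemma links_t g t h s v t' h' s' v' : links g t h s v t' h' s' v' -> t' = t.
Proof.
have le a b c e a' b' c' e' k : links k a b c e a' b' c' e' -> a < 1 -> a' <= a.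
  move=> L a1; have [A0 D0] := links_mirror L a1; case: L => kG kE [? ? ?] [? ? ?].
  by case: (mirror_le _ _ _ kG kE A0 D0).
move=> L; have Li := links_inv L; have [t1|t1] := ltP t 1.
  have h1 := le _ _ _ _ _ _ _ _ _ L t1; have h2 := le _ _ _ _ _ _ _ _ _ Li (le_lt_trans h1 t1).
  by apply/eqP; rewrite eq_le h1 h2.
have [t1'|t1'] := ltP t' 1; first by have := le _ _ _ _ _ _ _ _ _ Li t1'; lra.
by case: L => _ _ [/andP[? ?] _ _] [/andP[? ?] _ _]; lra.
Qed.

(** For t = 1 the image point is equally near to w = 0 and to [wc] = 1, so both g and [sigM] times g
    realize the minimum. Above the floor both middle rows then start with 0, and their difference is
    a multiple of the bottom row. *)
Lemma links_cusp g t h s v t' h' s' v' : links g t h s v t' h' s' v' -> 0 < t -> 0 < h ->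
  g o2 o0 = 0 /\ (t = 1 \/ g o1 o2 = 0).
Proof.
move=> L tp hp; have tE := links_t L; have [t1|t1] := ltP t 1.
  have [A0 D0] := links_mirror L t1; case: L => gG gE [t01 h0 hx] _.
  have [_ [h1 _]] := mirror_le t01 h0 hx gG gE A0 D0.
  by split; [exact: h1|right].
have {}t1 : t = 1 by case: L => _ _ [/andP[? ?] _ _] _; lra.
split; last by left.
case: L => gG gE [t01 h0 hx] [t01' h0' hx'].
have e1 := rel_row2 t01 h0 hx t01' h0' hx' gG gE.
have [_ _ r1 _] := row2_Phi t01 h0 hx gG; have A0 := r1 t1 hp e1.
have [_ _ r2 _] := row2_Phi t01 h0 hx (Gamma_mul (sigM_Gamma R) gG).
have rv := rel_vec t01 h0 hx gG gE.
have := r2 t1 hp; rewrite -mulmxA rv -scalemxAr mxE normsqM.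
have -> : normsq ((sigM R *m vec (Phi t' h' s' v')) o1 0) = normsq (vec (Phi t' h' s' v') o1 0).
  by rewrite mulmx_vec vec1 /functional !mxE /= /normsq /wc /pa /pb /= tE t1; field.
rewrite -normsqM -[lam _ _ * _](_ : (lam g (Phi t h s v) *: vec (Phi t' h' s' v')) o1 0 = _); last by rewrite mxE.
rewrite -rv => /(_ e1); rewrite mxE sum3 A0 !mxE /= => /eqP.
by rewrite mul0r mulr0 !add0r mulf_eq0 oppr_eq0 (negbTE (onei_neq0 R)) /= => /eqP.
Qed.

Lemma links_h g t h s v t' h' s' v' : links g t h s v t' h' s' v' -> 0 < t -> h' = h.
Proof.
have pos a b c e a' b' c' e' k : links k a b c e a' b' c' e' -> 0 < a -> 0 < b -> b' = b.
  move=> L ap bp; have [c0 hm] := links_cusp L ap bp; have aE := links_t L.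
  by case: L => kG kE [? ? ?] [? ? ?]; apply: (cusp_h _ _ _ _ _ _ kG kE c0 ap aE hm).
move=> L tp; have tE := links_t L; have Li := links_inv L.
have [hp|hp] := ltP 0 h; first exact: pos L tp hp.
have [hp'|hp'] := ltP 0 h'; first by apply/esym/(pos _ _ _ _ _ _ _ _ _ Li) => //; rewrite tE.
by case: L => _ _ [_ ? _] [_ ? _]; lra.
Qed.

(** An element preserving the mirror acts on w by an automorphy factor independent of w, so it
    commutes with rescaling w. *)
Lemma mirror_extend g t h s v s' v' u : links g t h s v t h s' v' -> 0 < t -> 0 <= u <= 1 ->
  g o1 o0 = 0 -> g o1 o2 = 0 -> links g u h s v u h s' v'.
Proof.
move=> [gG gE [t01 h0 hx] [t01' h0' hx']] tp u01 A0 D0; split=> //.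
have [b1 [b2 [c1 [c2 [d1 [d2 [_ _ _ _ [g21 g01]]]]]]]] := mirror_struct gG A0 D0.
have rv := rel_vec t01 h0 hx gG gE; set p := Phi t h s v in rv *.
have l0 := lam_neq0 (proj1 gG) (siegel_Phi t01 h0 hx); rewrite -/p in l0.
have zE w a b : zc (Phi w h a b) = zc (Phi t h a b) by [].
have wE a b : wc (Phi u h a b) = (u / t)%:C * wc (Phi t h a b).
  by apply: complex_eq; rewrite /wc /pa /pb /=; field; rewrite gt_eqF.
apply: (act_scale l0); have ri := rel_coord t01 h0 hx gG gE; rewrite -/p in ri.
apply/matrixP => i j; rewrite (ord1 j) mulmx_vec [RHS]mxE; move: i.
have r0 := ri o0; have r1 := ri o1; have r2 := ri o2.
rewrite vec0 /functional g01 mul0r addr0 in r0.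
rewrite vec1 /functional A0 D0 mul0r addr0 add0r in r1.
rewrite vec2 /functional g21 mul0r addr0 in r2.
apply: ord3P; rewrite ?vec0 ?vec1 ?vec2 /functional.
- by rewrite g01 mul0r addr0 !(zE u).
- rewrite A0 D0 mul0r addr0 add0r !wE.
  have -> : lam g p * ((1 +i* 1) * ((u / t)%:C * wc (Phi t h s' v'))) =
    (u / t)%:C * (lam g p * ((1 +i* 1) * wc (Phi t h s' v'))) by ring.
  by rewrite -r1 /p; ring.
- by rewrite g21 mul0r addr0 (zE u).
Qed.

(** An element fixing the cusp commutes with the vertical translations z + i(k - h). *)
Lemma cusp_extend g t h s v s' v' k : links g t h s v t h s' v' -> 0 < t -> 0 <= k ->
  g o2 o0 = 0 -> links g t k s v t k s' v'.
Proof.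
move=> [gG gE [t01 h0 hx] [t01' h0' hx']] tp k0 c0; split=> //.
have [g21 g10 ad nd lE] := cusp_struct t01 h0 hx gG c0.
have rv := rel_vec t01 h0 hx gG gE; set p := Phi t h s v in rv lE *.
have l0 := lam_neq0 (proj1 gG) (siegel_Phi t01 h0 hx); rewrite -/p in l0.
have zE a b : zc (Phi t k a b) = zc (Phi t h a b) + (k - h)%:C * 'i.
  by apply: complex_eq; rewrite /zc /px /py /=; ring.
have wE a b : wc (Phi t k a b) = wc (Phi t h a b) by [].
apply: (act_scale l0); have ri := rel_coord t01 h0 hx gG gE; rewrite -/p in ri.
apply/matrixP => i j; rewrite (ord1 j) mulmx_vec [RHS]mxE; move: i.
have r0 := ri o0; have r1 := ri o1; have r2 := ri o2.
rewrite vec0 /functional in r0.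
rewrite vec1 /functional g10 mul0r add0r in r1.
rewrite vec2 /functional c0 g21 !mul0r !add0r in r2.
apply: ord3P; rewrite ?vec0 ?vec1 ?vec2 /functional.
- rewrite !zE !wE [RHS]mulrDr -r0 lE -ad /p; ring.
- by rewrite g10 mul0r add0r !wE -r1.
- by rewrite c0 g21 !mul0r !add0r r2.
Qed.

Lemma prP_links t h s v t' h' s' v' : dom t h s v -> dom t' h' s' v' ->
  prP (Phi t h s v) = prP (Phi t' h' s' v') <-> exists g, links g t h s v t' h' s' v'.
Proof.
move=> d d'; have sp : siegel (Phi t h s v) by case: d => *; exact: siegel_Phi.
have sp' : siegel (Phi t' h' s' v') by case: d' => *; exact: siegel_Phi.
split; first by move=> /(prP_eq sp sp')[g gG gE]; exists g.
by move=> [g [gG gE _ _]]; apply/prP_eq => //; exists g.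
Qed.

(** Off the sides t = 1 and h = 0 the identifying element fixes both the mirror and the cusp, so t
    and h can be changed freely. On the floor only the mirror is known to be preserved and t is
    free; on the wall t = 1 only the cusp, and h is free. *)
Lemma prP_generic t h s v s' v' t1 h1 : dom t h s v -> dom t h s' v' ->
  prP (Phi t h s v) = prP (Phi t h s' v') -> 0 < t < 1 -> 0 < h -> 0 <= t1 <= 1 -> 0 <= h1 ->
  prP (Phi t1 h1 s v) = prP (Phi t1 h1 s' v').
Proof.
move=> d d' /(prP_links d d')[g L] /andP[tp tl] hp t01 h10.
have [A0 D0] := links_mirror L tl; have [c0 _] := links_cusp L tp hp.
have L' := cusp_extend L tp h10 c0; have L'' := mirror_extend L' tp t01 A0 D0.
by apply/prP_links; [by case: L''|by case: L''|exists g].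
Qed.

Lemma prP_floor t s v s' v' t1 : dom t 0 s v -> dom t 0 s' v' ->
  prP (Phi t 0 s v) = prP (Phi t 0 s' v') -> 0 < t < 1 -> 0 <= t1 <= 1 ->
  prP (Phi t1 0 s v) = prP (Phi t1 0 s' v').
Proof.
move=> d d' /(prP_links d d')[g L] /andP[tp tl] t01.
have [A0 D0] := links_mirror L tl; have L'' := mirror_extend L tp t01 A0 D0.
by apply/prP_links; [by case: L''|by case: L''|exists g].
Qed.

Lemma prP_wall h s v s' v' h1 : dom 1 h s v -> dom 1 h s' v' ->
  prP (Phi 1 h s v) = prP (Phi 1 h s' v') -> 0 < h -> 0 <= h1 ->
  prP (Phi 1 h1 s v) = prP (Phi 1 h1 s' v').
Proof.
move=> d d' /(prP_links d d')[g L] hp h10; have [c0 _] := links_cusp L ltr01 hp.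
have L' := cusp_extend L ltr01 h10 c0.
by apply/prP_links; [by case: L'|by case: L'|exists g].
Qed.

End Phi.

(** * Every orbit meets the parametrized domain *)

Section Reduction.
Local Open Scope complex_scope.
Variable R : realType.
Local Notation C := R[i].
Local Notation pt4 := (pt4 R).
Implicit Types (t h s v : R) (g : 'M[C]_3) (p q : pt4).

(** After a rotation by a power of i, t is twice the gauge of [wc]; hence SL2(Z) is reduced by
    maximizing this norm and not the modulus. *)
Definition gauge (w : C) : R := Num.max `|complex.Re w| `|complex.Im w|.

Lemma gauge_normsq w : gauge w ^+ 2 <= normsq w /\ normsq w <= 2 * gauge w ^+ 2.
Proof.
rewrite /gauge /normsq; case: w => a b /=.
have e1 : `|a| ^+ 2 = a ^+ 2 by rewrite real_normK ?num_real.
have e2 : `|b| ^+ 2 = b ^+ 2 by rewrite real_normK ?num_real.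
have a0 := normr_ge0 a; have b0 := normr_ge0 b; rewrite -e1 -e2.
by have [h|h] := leP `|a| `|b|; split; nra.
Qed.

Lemma gauge_ge0 w : 0 <= gauge w. Proof. by rewrite /gauge le_max normr_ge0. Qed.

Lemma gauge_gt0 w : w != 0 -> 0 < gauge w.
Proof.
move=> /normsq_gt0 w0; rewrite lt_def gauge_ge0 andbT; apply/eqP => g0.
by have [_] := gauge_normsq w; rewrite g0 expr0n /= mulr0 => h; lra.
Qed.

Lemma gauge_i w : gauge ('i * w) = gauge w.
Proof. by case: w => a b; rewrite /gauge /= !mul0r !mul1r sub0r add0r normrN maxC. Qed.

Lemma gauge_argmax (z u : C) : 0 < complex.Im z -> u != 0 -> exists a b c d : int,
  a * d - b * c = 1 /\ forall a' b' c' d' : int, a' * d' - b' * c' = 1 ->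
    gauge (u / (c'%:~R * z + d'%:~R)) <= gauge (u / (c%:~R * z + d%:~R)).
Proof.
move=> z0 u0; pose S := [set k : int * int * int * int | k.1.1.1 * k.2 - k.1.1.2 * k.1.2 = 1].
pose f (k : int * int * int * int) := - gauge (u / (k.1.2%:~R * z + k.2%:~R)).
have S1 : S (1, 0, 0, 1) by [].
have [|k Sk kmin] := @finite_argmin R _ S f _ S1; last first.
  exists k.1.1.1, k.1.1.2, k.1.2, k.2; split=> // a' b' c' d' e.
  by have := kmin (a', b', c', d') e; rewrite /f /= lerN2.
have u1 : 0 < gauge (u / (0%:~R * z + 1%:~R)) by rewrite mul0r add0r divr1 gauge_gt0.
set m := gauge _ in u1; set B := normsq u / m ^+ 2.
have B0 : 0 <= B by rewrite divr_ge0 ?normsq_ge0 ?sqr_ge0.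
set L := B / complex.Im z ^+ 2 + (2 * B + 2 * complex.Re z ^+ 2 * (B / complex.Im z ^+ 2)).
have := finite_image (fun k : C => - gauge (u / ((complex.Re k)%:C * z + (complex.Im k)%:C))) (finite_gaussian L).
apply: sub_finite_set => _ [k [_ kf] <-]; exists (k.1.2%:~R +i* k.2%:~R); last first.
  by rewrite /f /= !rmorph_int.
split; first by exists k.1.2, k.2.
have mk : m <= gauge (u / (k.1.2%:~R * z + k.2%:~R)) by move: kf; rewrite /f /= lerN2.
set l := k.1.2%:~R * z + k.2%:~R in mk.
have l0 : l != 0.
  by apply/eqP => l0; move: mk; rewrite l0 invr0 mulr0 /gauge /= normr0 maxxx => ?; lra.
have lB : normsq l <= B.
  have [g1 _] := gauge_normsq (u / l); rewrite normsqM normsqV in g1.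
  have m2 : m ^+ 2 <= normsq u / normsq l.
    by apply: le_trans g1; rewrite ler_sqr ?nnegrE ?(ltW u1) ?(ltW (lt_le_trans u1 mk)).
  by rewrite /B ler_pdivlMr ?exprn_gt0 // mulrC -ler_pdivlMr ?normsq_gt0.
have lE : normsq l = (k.1.2%:~R * complex.Re z + k.2%:~R) ^+ 2 + k.1.2%:~R ^+ 2 * complex.Im z ^+ 2.
  rewrite /l -(rmorph_int (@real_complex R) k.1.2) -(rmorph_int (@real_complex R) k.2).
  by case: (z) => x y; rewrite /normsq /=; ring.
rewrite lE in lB; rewrite /normsq /= /L; set c := k.1.2%:~R in lB *; set d := k.2%:~R in lB *.
set x := complex.Re z in lB *; set y := complex.Im z in lB z0 *.
have y2 : 0 < y ^+ 2 by exact: exprn_gt0.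
have cB : c ^+ 2 <= B / y ^+ 2 by rewrite ler_pdivlMr //; have := sqr_ge0 (c * x + d); lra.
have dB : d ^+ 2 <= 2 * B + 2 * x ^+ 2 * (B / y ^+ 2).
  have -> : d ^+ 2 = 2 * (c * x + d) ^+ 2 + 2 * x ^+ 2 * c ^+ 2 - (2 * (c * x) + d) ^+ 2 by ring.
  have x2 : 0 <= 2 * x ^+ 2 by rewrite mulr_ge0 // sqr_ge0.
  have := ler_wpM2l x2 cB; have := sqr_ge0 (2 * (c * x) + d).
  have := mulr_ge0 (sqr_ge0 c) (ltW y2); lra.
lra.
Qed.

Definition nearest p := siegel p /\ forall g, Gamma g ->
  normsq (vec p o1 0) <= normsq ((g *m vec p) o1 0).

Lemma nearest_act p k : nearest p -> Gamma k ->
  normsq ((k *m vec p) o1 0) = normsq (vec p o1 0) -> nearest (act k p).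
Proof.
move=> [sp np] kG e; have l0 := lam_neq0 (proj1 kG) sp; have rv := vec_act (proj1 kG) sp.
split=> [|g gG]; first exact: act_siegel (proj1 kG) sp.
have vE : vec (act k p) = (lam k p)^-1 *: (k *m vec p) by rewrite rv scalerA mulVf // scale1r.
rewrite vE -scalemxAr [in X in X <= _]mxE [in X in _ <= X]mxE !normsqM e mulmxA.
by apply: ler_wpM2l; [exact: normsq_ge0|apply: np; exact: Gamma_mul].
Qed.

Lemma nearest_exists x : exists2 p, nearest p & prP p = x.
Proof.
have [p sp <-] := prP_surj x; have [g gG gm] := row_argmin o1 sp.
exists (act g p); last exact: prP_act.
have rv := vec_act (proj1 gG) sp; have l0 := lam_neq0 (proj1 gG) sp.
split=> [|k kG]; first exact: act_siegel (proj1 gG) sp.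
have vE : vec (act g p) = (lam g p)^-1 *: (g *m vec p) by rewrite rv scalerA mulVf // scale1r.
rewrite vE -scalemxAr [in X in X <= _]mxE [in X in _ <= X]mxE !normsqM mulmxA.
by apply: ler_wpM2l; [exact: normsq_ge0|apply: gm; exact: Gamma_mul].
Qed.

(** Comparison with the mirror [wc] = 1, by means of [sigM]; it yields t at most 1. *)
Lemma nearest_pa p : nearest p -> pa p <= 1 / 2.
Proof.
move=> [sp np]; have := np _ (sigM_Gamma R).
have -> : (sigM R *m vec p) o1 0 = (1 +i* 1) * (wc p - 1).
  by rewrite mulmx_vec /functional !mxE /=; ring.
rewrite vec1 !normsqM ler_pM2l; last by rewrite normsq_gt0 // onei_neq0.
by rewrite /normsq /wc /=; lra.
Qed.

Lemma sl2_row2 a b c d p : (sl2M R a b c d *m vec p) o1 0 = vec p o1 0.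
Proof. by rewrite mulmx_vec /functional !mxE /=; ring. Qed.

Lemma zc_act_sl2 (a b c d : int) p : siegel p -> a * d - b * c = 1 ->
  [/\ (c%:~R : C) * zc p + d%:~R != 0,
   zc (act (sl2M R a b c d) p) = (a%:~R * zc p + b%:~R) / (c%:~R * zc p + d%:~R) &
   wc (act (sl2M R a b c d) p) = wc p / (c%:~R * zc p + d%:~R)].
Proof.
move=> sp e; have l0 := lam_neq0 (proj1 (sl2M_Gamma R e)) sp.
have lE : lam (sl2M R a b c d) p = c%:~R * zc p + d%:~R.
  by rewrite /lam mulmx_vec /functional !mxE /=; ring.
rewrite lE in l0; split=> //.
  by rewrite zc_ofvec -/(lam _ p) lE mulmx_vec /functional !mxE /=; congr (_ / _); ring.
rewrite wc_ofvec -/(lam _ p) lE sl2_row2 vec1 -mulf_div mulfV ?onei_neq0 // mul1r //.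
Qed.

(* The case [w = 0] is treated with the fictitious direction [u = 1]. *)
Lemma gauge_reduced p : nearest p -> exists q (u : C) (r : R), [/\ nearest q, prP q = prP p,
  u != 0, 0 <= r & wc q = r%:C * u] /\
  forall m : int, gauge (u / (zc q + m%:~R)) <= gauge u.
Proof.
move=> np; have [sp _] := np.
have [u [r [u0 r0 wE]]] : exists u r, [/\ u != 0, 0 <= r & wc p = r%:C * u].
  have [w0|w0] := eqVneq (wc p) 0.
    by exists 1, 0; split; rewrite ?oner_neq0 // w0 mulr1.
  by exists (wc p), 1; split; rewrite ?ler01 // mul1r.
have z0 : 0 < complex.Im (zc p).
  have := sp; rewrite /siegel /= /hgt => h; rewrite /zc /=.
  by have := sqr_ge0 (pa p); have := sqr_ge0 (pb p); lra.
have [a [b [c [d [e gm]]]]] := gauge_argmax z0 u0.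
have [l0 zE w'E] := zc_act_sl2 sp e; set l := c%:~R * zc p + d%:~R in l0 zE w'E gm.
have G := sl2M_Gamma R e.
exists (act (sl2M R a b c d) p), (u / l), r; split; first split.
- by apply: nearest_act => //; rewrite sl2_row2.
- exact: prP_act.
- by rewrite mulf_neq0 ?invr_eq0.
- by [].
- by rewrite w'E wE mulrA.
move=> m; have := gm (- c) (- d) (a + m * c) (b + m * d) _.
have -> : u / l / (zc (act (sl2M R a b c d) p) + m%:~R) = u / ((a + m * c)%:~R * zc p + (b + m * d)%:~R).
  rewrite zE -mulrA -invfM; congr (_ / _); rewrite mulrDr [l * (_ / l)]mulrC divfK // /l !rmorphD !rmorphM /=; ring.
by apply; rewrite -e; ring.
Qed.

Lemma gauge_rotated p (u : C) (r : R) : nearest p -> u != 0 -> wc p = r%:C * u ->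
  exists q u', [/\ nearest q, prP q = prP p, zc q = zc p & wc q = r%:C * u'] /\
  [/\ 0 < complex.Re u', `|complex.Im u'| <= complex.Re u' &
      exists2 e : C, u' = e * u & forall w, gauge (e * w) = gauge w].
Proof.
have rot k q w : nearest q -> wc q = r%:C * w -> exists q', [/\ nearest q', prP q' = prP q,
    zc q' = zc q & wc q' = r%:C * ('i ^+ k * w)].
  elim: k q w => [|k IH] q w nq wE; first by exists q; rewrite expr0 mul1r.
  have [sq _] := nq; have G := rotM_Gamma R.
  have [||q' [n' p' z' w']] := IH (act (rotM R) q) ('i * w).
  - apply: nearest_act => //; rewrite mulmx_vec vec1 /functional !mxE /= mul0r add0r addr0 mulN1r.
    by case: (_ * _) => ? ?; rewrite /normsq /= !sqrrN.
  - rewrite act_rotM mulrCA -wE /wc /pa /pb /=; apply: complex_eq; rewrite /=; ring.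
  exists q'; split=> //; first by rewrite p' prP_act.
    by rewrite z' act_rotM.
  by rewrite w' exprSr mulrA.
have gk k w : gauge ('i ^+ k * w) = gauge w.
  by elim: k => [|k IH]; rewrite ?expr0 ?mul1r // exprS -mulrA gauge_i.
move=> np u0 wE.
have [k [k1 k2]] : exists k, 0 < complex.Re ('i ^+ k * u) /\ `|complex.Im ('i ^+ k * u)| <= complex.Re ('i ^+ k * u).
  have e2 : 'i ^+ 2 = -1 :> C by rewrite sqr_i.
  have e3 : 'i ^+ 3 = - 'i :> C by rewrite exprS e2 mulrN1.
  case: u u0 {wE} => a b; rewrite eq_complex /= negb_and => ab.
  have [h1|h1] := leP `|b| a; [exists 0|have [h2|h2] := leP `|a| b; [exists 3|have [h3|h3] := leP `|b| (- a); [exists 2|exists 1]]].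
  - rewrite expr0 mul1r /=; split=> //; rewrite lt_def (le_trans (normr_ge0 b) h1) andbT.
    by apply/eqP => a0; move: h1 ab; rewrite a0 normr_le0 eqxx => ->.
  - rewrite e3 /=; rewrite !(mul0r, mulN1r, mul1r, oppr0, sub0r, add0r, addr0, opprK) normrN; split=> //.
    rewrite lt_def (le_trans (normr_ge0 a) h2) andbT.
    by apply/eqP => b0; move: h2 ab; rewrite b0 normr_le0 eqxx orbF => ->.
  - rewrite e2 mulN1r /= normrN; split=> //; rewrite lt_def (le_trans (normr_ge0 b) h3) andbT.
    by apply/eqP => a0; move: h3 ab; rewrite a0 normr_le0 -(oppr_eq0 a) a0 eqxx => ->.
  - rewrite expr1 /= !(mul0r, mul1r, sub0r, add0r).
    move: h1 h2 h3; rewrite !ltNge !ler_norml !negb_and -!ltNge => h1 h2 h3; split.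
      by case/orP: h1 => ?; case/orP: h2 => ?; case/orP: h3 => ?; lra.
    by apply/andP; case/orP: h1 => ?; case/orP: h2 => ?; case/orP: h3 => ?; split; lra.
have [q [n1 n2 n3 n4]] := rot k _ _ np wE.
by exists q, ('i ^+ k * u); split=> //; split=> //; exists ('i ^+ k).
Qed.

(** e is the ordinate of the upper point of the floor circle over x, h the distance down to it, and
    v is forced by [v_from_xt]. *)
Lemma from_floor s x y : -1 <= s <= 1 -> - (1 / 2) <= x <= 1 / 2 -> 1 / 2 <= y ->
  (1 + s ^+ 2) / 4 <= x ^+ 2 + (y - 1 / 2) ^+ 2 ->
  exists v h, [/\ hexa s v, 0 <= h, (s - v) / (1 + v ^+ 2) = x + s / 2 & (1 + s * v) / (1 + v ^+ 2) + h = y].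
Proof.
move=> /andP[s1 s2] /andP[x1 x2] y2 hy; set D := Num.sqrt (1 + s ^+ 2 - 4 * x ^+ 2).
have D0 : 0 <= D by exact: sqrtr_ge0.
have Dr : s ^+ 2 <= 1 + s ^+ 2 - 4 * x ^+ 2 by nra.
have D2 : D ^+ 2 = 1 + s ^+ 2 - 4 * x ^+ 2 by rewrite sqr_sqrtr //; have := sqr_ge0 s; lra.
have Ds : s <= D /\ - s <= D by split; nra.
set e := (1 + D) / 2; have e0 : 0 < e by rewrite /e; lra.
set v := (s - 2 * x) / (2 * e).
have ve : 2 * e * v = s - 2 * x by rewrite /v mulrC divfK //; apply/eqP; lra.
have vE : 1 + s * v = e * (1 + v ^+ 2).
  have : (2 * e) * (1 + s * v) = (2 * e) * (e * (1 + v ^+ 2)).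
    have -> : 2 * e * (e * (1 + v ^+ 2)) = (4 * e ^+ 2 + (2 * e * v) ^+ 2) / 2 by field.
    have -> : 2 * e * (1 + s * v) = 2 * e + s * (2 * e * v) by ring.
    rewrite ve /e; have -> : 4 * ((1 + D) / 2) ^+ 2 = 1 + 2 * D + D ^+ 2 by field.
    by rewrite D2; field.
  by apply: mulfI; apply/eqP; lra.
have d0 := onev_gt0 v; have d0' := onev_neq0 v.
exists v, (y - e).
have e2 : 2 * e = 1 + D by rewrite /e; field.
split.
- have ee : 0 < 2 * e by lra.
  split; first by apply/andP.
  + by rewrite /v ler_pdivlMr // ler_pdivrMr // e2; apply/andP; split; lra.
  + rewrite -(ler_pM2l ee); have -> : 2 * e * (v - s) = 2 * e * v - 2 * e * s by ring.
    have -> : 2 * e * (1 + s * v) = 2 * e + s * (2 * e * v) by ring.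
    rewrite ve e2; case: Ds => ? ?; nra.
  + rewrite -(ler_pM2l ee); have -> : 2 * e * (s - v) = 2 * e * s - 2 * e * v by ring.
    have -> : 2 * e * (1 + s * v) = 2 * e + s * (2 * e * v) by ring.
    rewrite ve e2; case: Ds => ? ?; nra.
- have : (D / 2) ^+ 2 <= (y - 1 / 2) ^+ 2.
    by have -> : (D / 2) ^+ 2 = D ^+ 2 / 4 by [field]; rewrite D2; lra.
  rewrite ler_sqr ?nnegrE; [rewrite /e; lra|lra|lra].
- apply: (mulIf d0'); rewrite divfK //.
  have xE : x + s / 2 = s - e * v by lra.
  rewrite xE; have -> : (s - e * v) * (1 + v ^+ 2) = s * (1 + v ^+ 2) - v * (e * (1 + v ^+ 2)) by ring.
  by rewrite -vE; ring.
- by rewrite vE mulfK //; ring.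
Qed.

Lemma nearest_int (x : R) : exists m : int, - (1 / 2) <= x + m%:~R <= 1 / 2.
Proof.
exists (- Num.floor (x + 1 / 2)); rewrite rmorphN.
have := ge_floor (x + 1 / 2); have := lt_succ_floor (x + 1 / 2).
by rewrite rmorphD /=; move=> h1 h2; apply/andP; split; lra.
Qed.

Lemma Phi_surj x : exists t h s v, dom t h s v /\ prP (Phi t h s v) = x.
Proof.
have [p0 n0 <-] := nearest_exists x.
have [p [u [r [[np <- u0 r0 wE] gm]]]] := gauge_reduced n0.
have [q [u' [[nq <- zE wE'] [u1 u2 [e eE eg]]]]] := gauge_rotated np u0 wE.
set s := - complex.Im u' / complex.Re u'; set a := complex.Re u' in u1 u2 s.
have bE : complex.Im u' = - (a * s) by rewrite /s; field; rewrite gt_eqF.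
have s12 : -1 <= s <= 1.
  move: u2; rewrite bE normrN ler_norml => /andP[h1 h2].
  by apply/andP; split; rewrite -(ler_pM2l u1); lra.
have [m mE] := nearest_int (px q - s / 2).
set x' := px q - s / 2 + m%:~R in mE.
have [sq _] := nq.
have z0 : 0 < py q.
  by have := sq; rewrite /siegel /= /hgt; have := sqr_ge0 (pa q); have := sqr_ge0 (pb q); lra.
have gauge_u : gauge u' = a.
  rewrite /gauge -/a (gtr0_norm u1); apply/max_idPl; exact: u2.
(* Maximality of the gauge against z + n, written out in the two coordinates of the quotient of u'
   by z + n. *)
have gm' (n : int) : let f := px q + n%:~R in
    `|f - s * py q| <= f ^+ 2 + py q ^+ 2 /\ `|py q + s * f| <= f ^+ 2 + py q ^+ 2.
  have := gm n; rewrite -(eg (u / _)) -(eg u) mulrA -eE -zE gauge_u.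
  set l := zc q + n%:~R.
  have lE : l = (px q + n%:~R) +i* py q.
    by rewrite /l -(rmorph_int (@real_complex R) n); apply: complex_eq; rewrite /=; ring.
  have nl : 0 < normsq l by rewrite lE /normsq /=; have := sqr_ge0 (px q + n%:~R); have := exprn_gt0 2 z0; lra.
  have l0 : l != 0 by apply/eqP => l0; move: nl; rewrite l0 normsq0 ltxx.
  have -> : u' / l = (u' * conjc l) * ((normsq l)^-1)%:C.
    rewrite -[u' / l](_ : u' * conjc l * (conjc l * l)^-1 = _).
      by rewrite conjc_normsq; congr (_ * _); rewrite -[RHS]/((real_complex R) _) rmorphV ?unitfE ?gt_eqF.
    have : conjc l != 0 by rewrite conjc_eq0.
    by move: l0; set L := conjc l => ? ?; field; apply/andP.
  rewrite /gauge ge_max lE.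
  have uE : u' = a +i* (- (a * s)) by rewrite -bE /a; case: (u').
  rewrite uE /normsq /=; set f := px q + n%:~R; set N := f ^+ 2 + py q ^+ 2.
  have N0 : 0 < N by move: nl; rewrite lE.
  have nm (b : R) : (`|a * b * N^-1| <= a) = (`|b| <= N).
    rewrite normrM normrM (gtr0_norm u1) [`|N^-1|]gtr0_norm ?invr_gt0 //.
    by rewrite ler_pdivrMr // mulrC [a * N]mulrC ler_pM2r.
  rewrite !mulr0 !subr0 add0r.
  have -> : a * f - - (a * s) * - py q = a * (f - s * py q) by ring.
  have -> : a * - py q + - (a * s) * f = a * (- (py q + s * f)) by ring.
  by rewrite !nm normrN => /andP.
(* For the n with |f| at most 1/2, the sum of the squares of the two inequalities gives |z + n|^2 at
   least 1/2, hence y^2 at least 1/4. *)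
have y12 : 1 / 2 <= py q.
  have [n /andP[n1 n2]] := nearest_int (px q); have [f1 f2] := gm' n.
  set f := px q + n%:~R in n1 n2 f1 f2; set N := f ^+ 2 + py q ^+ 2 in f1 f2.
  have N0 : 0 < N by rewrite /N; have := sqr_ge0 f; have := exprn_gt0 2 z0; lra.
  move: f1 f2; rewrite !ler_norml => /andP[a1 a2] /andP[b1 b2].
  have q1 : (f - s * py q) ^+ 2 <= N ^+ 2 by nra.
  have q2 : (py q + s * f) ^+ 2 <= N ^+ 2 by nra.
  have q3 : (1 + s ^+ 2) * N <= (2 * N) * N by rewrite /N in q1 q2 *; lra.
  rewrite ler_pM2r // in q3.
  have : 1 <= 2 * N by have := sqr_ge0 s; lra.
  by rewrite /N; nra.
(* With f = x' + s/2, the second inequality of [gm'] is exactly the condition of lying outside the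
   floor circle. *)
have hy : (1 + s ^+ 2) / 4 <= x' ^+ 2 + (py q - 1 / 2) ^+ 2.
  have [_] := gm' m; rewrite ler_norml => /andP[_].
  have -> : px q + m%:~R = x' + s / 2 by rewrite /x'; ring.
  by lra.
have [v [h [hx h0 xE yE]]] := from_floor s12 mE y12 hy.
have q'E : act (transM R m) q = Phi (2 * (r * a)) h s v.
  rewrite act_transM /Phi xE yE.
  have paE : pa q = r * a by have := congr1 (@complex.Re R) wE'; rewrite /wc /a; case: (u') => ? ? /= ->; ring.
  have pbE : pb q = - (r * (a * s)).
    have := congr1 (@complex.Im R) wE'; rewrite /wc -mulrN -bE; case: (u') => ? ? /= ->; ring.
  by congr (_, _, _, _); rewrite ?paE ?pbE /x'; field.
exists (2 * (r * a)), h, s, v; split; last by rewrite -q'E prP_act //; exact: transM_Gamma.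
split=> //; have ra : 0 <= r * a by rewrite mulr_ge0 // ltW.
have := nearest_pa nq.
have -> : pa q = r * a by have := congr1 (@complex.Re R) wE'; rewrite /wc /a; case: (u') => ? ? /= ->; ring.
by move=> ?; apply/andP; split; lra.
Qed.

(** * The corner [t = 1], [h = 0] *)

Definition tdiff (a b : R) := (a - b) / (1 + a * b).

(** u1 and u2 are tangents of nonnegative angles whose sum is at most a quarter of pi, and [tsum] is
    the tangent of that sum. *)
Definition triangle (u1 u2 : R) := [/\ 0 <= u1, 0 <= u2 & u1 + u2 + u1 * u2 <= 1].
Definition tsum (u1 u2 : R) := (u1 + u2) / (1 - u1 * u2).

(* The phases of [0, s, v] in increasing order have consecutive differences (as tangents) [u1], [u2]. *)
Definition corner_sector (u1 u2 s v : R) := let g := tsum u1 u2 in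
  [\/ (s = u1 /\ v = g) \/ (s = g /\ v = u1), (s = - u1 /\ v = u2) \/ (s = u2 /\ v = - u1) |
      (s = - g /\ v = - u2) \/ (s = - u2 /\ v = - g)].

Lemma triangle_facts u1 u2 : triangle u1 u2 ->
  [/\ u1 <= 1, u2 <= 1, 0 < 1 - u1 * u2, 0 <= tsum u1 u2 <= 1 & tsum u1 u2 * (1 - u1 * u2) = u1 + u2].
Proof.
move=> [h1 h2 h3]; have p := mulr_ge0 h1 h2.
have d : 0 < 1 - u1 * u2 by nra.
split; rewrite ?/tsum ?divfK ?gt_eqF //; [lra|lra|].
by rewrite divr_ge0 ?(ltW d) ?addr_ge0 //= ler_pdivrMr // mul1r; lra.
Qed.

Lemma sect_swap u1 u2 s v : corner_sector u1 u2 s v -> corner_sector u1 u2 v s.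
Proof.
case=> [[[-> ->]|[-> ->]]|[[-> ->]|[-> ->]]|[[-> ->]|[-> ->]]];
  [constructor 1; right|constructor 1; left|constructor 2; right|constructor 2; left|
   constructor 3; right|constructor 3; left] => //.
Qed.

Lemma divr_eqE (a b c : R) : b != 0 -> a = c * b -> a / b = c.
Proof. by move=> b0 ->; rewrite mulfK. Qed.

(** The substitution subtracts the phase of s from the three phases 0, s, v, so the zero phase
    changes place and the consecutive gaps stay. *)
Lemma sect_sigma u1 u2 s v : triangle u1 u2 -> corner_sector u1 u2 s v -> corner_sector u1 u2 (- s) ((v - s) / (1 + s * v)).
Proof.
move=> T; have [a1 a2 d /andP[g0 g1] gE] := triangle_facts T; case: T => b1 b2 _.
rewrite /corner_sector; set g := tsum _ _ in g0 g1 gE *.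
have p1 := mulr_ge0 b1 g0; have p2 := mulr_ge0 b2 g0.
have nz (b : R) : 0 < b -> b != 0 by move=> ?; rewrite gt_eqF.
case=> [[[-> ->]|[-> ->]]|[[-> ->]|[-> ->]]|[[-> ->]|[-> ->]]].
- by constructor 2; left; split=> //; apply: divr_eqE; [apply: nz|]; lra.
- by constructor 3; left; split=> //; apply: divr_eqE; [apply: nz|]; lra.
- by constructor 1; left; split; [rewrite opprK|apply: divr_eqE; [apply: nz|]; lra].
- by constructor 3; right; split=> //; apply: divr_eqE; [apply: nz|]; lra.
- by constructor 1; right; split; [rewrite opprK|apply: divr_eqE; [apply: nz|]; lra].
- by constructor 2; right; split; [rewrite opprK|apply: divr_eqE; [apply: nz|]; lra].
Qed.

Lemma hexa_swap s v : hexa s v -> hexa v s.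
Proof. by move=> [? ? ? ?]; split=> //; rewrite [v * s]mulrC. Qed.

Lemma hexa_int_swap s v : hexa_int s v -> hexa_int v s.
Proof. by move=> [? ? ? ?]; split=> //; rewrite [v * s]mulrC. Qed.

Lemma hexa_sv s v : hexa s v -> 0 < 1 + s * v.
Proof.
move=> [/andP[s1 s2] /andP[v1 v2] h1 h2]; rewrite lt_def; apply/andP; split; last by lra.
by apply/eqP => h; have e : s = v by [lra]; move: h; rewrite e; have := sqr_ge0 v; rewrite expr2; lra.
Qed.

Lemma hexa_sigma s v : hexa s v -> hexa (- s) ((v - s) / (1 + s * v)).
Proof.
move=> hx; have d := hexa_sv hx; case: hx => /andP[s1 s2] /andP[v1 v2] h1 h2.
set w := (v - s) / _; have wE : w * (1 + s * v) = v - s by rewrite /w divfK ?gt_eqF.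
split.
- by apply/andP; split; lra.
- by rewrite /w ler_pdivlMr // ler_pdivrMr //; apply/andP; split; lra.
- rewrite -(ler_pM2r d) mulrDl wE.
  have -> : (1 + - s * w) * (1 + s * v) = 1 + s * v - s * (w * (1 + s * v)) by ring.
  by rewrite wE; have : 0 <= (1 - v) * (1 + s ^+ 2) by [apply: mulr_ge0; [lra|have := sqr_ge0 s; lra]]; lra.
- rewrite -(ler_pM2r d).
  have -> : (- s - w) * (1 + s * v) = - s * (1 + s * v) - w * (1 + s * v) by ring.
  rewrite wE.
  have -> : (1 + - s * w) * (1 + s * v) = 1 + s * v - s * (w * (1 + s * v)) by ring.
  by rewrite wE; have : 0 <= (1 + v) * (1 + s ^+ 2) by [apply: mulr_ge0; [lra|have := sqr_ge0 s; lra]]; lra.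
Qed.

Lemma hexa_int_sigma s v : hexa_int s v -> hexa_int (- s) ((v - s) / (1 + s * v)).
Proof.
move=> hi; have d := hexa_sv (hexa_intW hi); case: hi => /andP[s1 s2] /andP[v1 v2] h1 h2.
set w := (v - s) / _; have wE : w * (1 + s * v) = v - s by rewrite /w divfK ?gt_eqF.
split.
- by apply/andP; split; lra.
- by rewrite /w ltr_pdivlMr // ltr_pdivrMr //; apply/andP; split; lra.
- rewrite -(ltr_pM2r d) mulrDl wE.
  have -> : (1 + - s * w) * (1 + s * v) = 1 + s * v - s * (w * (1 + s * v)) by ring.
  by rewrite wE; have : 0 < (1 - v) * (1 + s ^+ 2) by [apply: mulr_gt0; [lra|have := sqr_ge0 s; lra]]; lra.
- rewrite -(ltr_pM2r d).
  have -> : (- s - w) * (1 + s * v) = - s * (1 + s * v) - w * (1 + s * v) by ring.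
  rewrite wE.
  have -> : (1 + - s * w) * (1 + s * v) = 1 + s * v - s * (w * (1 + s * v)) by ring.
  by rewrite wE; have : 0 < (1 + v) * (1 + s ^+ 2) by [apply: mulr_gt0; [lra|have := sqr_ge0 s; lra]]; lra.
Qed.

Lemma act_tau_Phi t s v : hexa s v -> act (tauM R) (Phi t 0 s v) = Phi t 0 v s.
Proof.
move=> hx; have d := hexa_sv hx; have d1 := onev_neq0 v; have d2 := onev_neq0 s.
apply: act_tauM.
- apply/eqP => e0; have := congr1 (@complex.Im R) e0; rewrite /zc /py /= addr0 => /eqP.
  by rewrite mulf_eq0 invr_eq0 (negbTE d1) gt_eqF.
- apply: complex_eq; rewrite /zc /px /py /=; field; by rewrite d1 d2.
- apply: complex_eq; rewrite /zc /wc /px /py /pa /pb /=; field; by rewrite ?d1 ?d2.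
Qed.

Lemma act_sigma_Phi s v : hexa s v -> act (sigM R) (Phi 1 0 s v) = Phi 1 0 (- s) ((v - s) / (1 + s * v)).
Proof.
move=> hx; have d := hexa_sv hx; have d1 := onev_neq0 v; have d2 := onev_neq0 ((v - s) / (1 + s * v)).
have d3 : (1 + s * v) ^+ 2 + (v - s) ^+ 2 != 0.
  by rewrite gt_eqF //; have := exprn_gt0 2 d; have := sqr_ge0 (v - s); lra.
rewrite act_sigM /Phi /px /py /pa /pb /=; by congr (_, _, _, _); field; rewrite ?d1 ?d3 ?gt_eqF.
Qed.

Lemma prP_swap t s v : 0 <= t <= 1 -> hexa s v -> prP (Phi t 0 s v) = prP (Phi t 0 v s).
Proof.
by move=> t01 hx; rewrite -(act_tau_Phi t hx) prP_act //; [exact: tauM_Gamma|exact: siegel_Phi].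
Qed.

Lemma one01 : 0 <= (1 : R) <= 1. Proof. by rewrite ler01 lexx. Qed.

Lemma prP_sigma s v : hexa s v -> prP (Phi 1 0 s v) = prP (Phi 1 0 (- s) ((v - s) / (1 + s * v))).
Proof.
by move=> hx; rewrite -act_sigma_Phi // prP_act //; [exact: sigM_Gamma|apply: siegel_Phi => //; exact: one01].
Qed.

(** z and z + 1 identify opposite sides of the strip |xt| at most 1/2, which correspond to edges of
    the hexagon. *)
Lemma prP_translate t h c : 0 <= t <= 1 -> 0 <= h -> 0 <= c <= 1 ->
  prP (Phi t h c 1) = prP (Phi t h c (- ((1 - c) / (1 + c)))).
Proof.
move=> t01 h0 /andP[c0 c1]; have d : 1 + c != 0 by apply/eqP; lra.
have hx : hexa c 1 by split; try (apply/andP; split); lra.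
rewrite -(prP_act (transM_Gamma R 1)); last exact: siegel_Phi.
congr prP; rewrite act_transM /Phi /px /py /pa /pb /=.
have d3 : (1 + c) ^+ 2 + (1 - c) ^+ 2 != 0.
  by rewrite gt_eqF //; have := sqr_ge0 (1 + c); have := sqr_ge0 (1 - c); nra.
have d4 : (1 + c) ^+ 2 + (- (1 - c)) ^+ 2 != 0 by rewrite sqrrN.
by congr (_, _, _, _); field; rewrite ?d ?d4.
Qed.

Lemma sect_hexa u1 u2 s v : triangle u1 u2 -> corner_sector u1 u2 s v -> hexa s v.
Proof.
move=> T; have [a1 a2 d /andP[g0 g1] gE] := triangle_facts T.
have base : hexa u1 (tsum u1 u2).
  have uE : tsum u1 u2 - u1 = u2 * (1 + u1 * tsum u1 u2) by lra.
  case: T => b1 b2 _; have p := mulr_ge0 b1 g0.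
  split; try (by apply/andP; split; lra).
    by rewrite uE; apply: ler_piMl; lra.
  have : 0 <= u2 * (1 + u1 * tsum u1 u2) by apply: mulr_ge0; lra.
  lra.
set g := tsum u1 u2 in base g0 g1 gE.
have b2 := hexa_sigma base; have b3 := hexa_sigma (hexa_swap b2); have b4 := hexa_sigma (hexa_swap base).
have e1 : (g - u1) / (1 + u1 * g) = u2.
  by apply: (mulIf (lt0r_neq0 (hexa_sv base))); rewrite divfK ?gt_eqF ?(hexa_sv base) //; lra.
rewrite e1 in b2 b3.
have e2 : (- u1 - u2) / (1 + u2 * - u1) = - g.
  by apply: divr_eqE; [rewrite gt_eqF|]; lra.
rewrite e2 in b3.
by case=> [[[-> ->]|[-> ->]]|[[-> ->]|[-> ->]]|[[-> ->]|[-> ->]]] //; exact: hexa_swap.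
Qed.

Lemma sect_prP u1 u2 s v : triangle u1 u2 -> corner_sector u1 u2 s v ->
  prP (Phi 1 0 s v) = prP (Phi 1 0 u1 (tsum u1 u2)).
Proof.
move=> T; have [a1 a2 d /andP[g0 g1] gE] := triangle_facts T.
have S0 : corner_sector u1 u2 u1 (tsum u1 u2) by constructor 1; left.
have base := sect_hexa T S0.
set g := tsum u1 u2 in base g0 g1 gE *.
have e1 : (g - u1) / (1 + u1 * g) = u2.
  by apply: (mulIf (lt0r_neq0 (hexa_sv base))); rewrite divfK ?gt_eqF ?(hexa_sv base) //; lra.
have e2 : (- u1 - u2) / (1 + u2 * - u1) = - g.
  by apply: divr_eqE; [rewrite gt_eqF|]; lra.
have p1 : prP (Phi 1 0 (- u1) u2) = prP (Phi 1 0 u1 g) by rewrite (prP_sigma base) e1.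
have hx2 : hexa (- u1) u2 by apply: (sect_hexa T); constructor 2; left.
have hx3 := hexa_swap hx2.
have p2 : prP (Phi 1 0 u2 (- u1)) = prP (Phi 1 0 u1 g) by rewrite -prP_swap ?one01.
have p3 : prP (Phi 1 0 (- u2) (- g)) = prP (Phi 1 0 u1 g) by rewrite -p2 (prP_sigma hx3) e2.
have hx4 : hexa (- u2) (- g) by apply: (sect_hexa T); constructor 3; right.
case=> [[[-> ->]|[-> ->]]|[[-> ->]|[-> ->]]|[[-> ->]|[-> ->]]] //.
- by rewrite -prP_swap ?one01.
- by rewrite -prP_swap ?one01.
Qed.

(** On the outer edge of the triangle the largest phase difference reaches a quarter of pi; the
    translation by 1 then exchanges the two gaps. *)
Lemma sect_fold u1 u2 : triangle u1 u2 -> u1 + u2 + u1 * u2 = 1 ->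
  prP (Phi 1 0 u1 (tsum u1 u2)) = prP (Phi 1 0 u2 (tsum u2 u1)).
Proof.
move=> T e; have [a1 a2 d _ gE] := triangle_facts T; have [b1 b2 _] := T.
have T' : triangle u2 u1 by split=> //; lra.
have d1 : 1 + u1 != 0 by apply/eqP; lra.
have g1 : tsum u1 u2 = 1 by rewrite /tsum; apply: (mulIf (lt0r_neq0 d)); rewrite divfK ?gt_eqF //; lra.
have u2E : (1 - u1) / (1 + u1) = u2 by apply: (mulIf d1); rewrite divfK //; lra.
rewrite g1 prP_translate ?one01 ?b1 ?a1 // u2E; apply: (sect_prP T').
by constructor 2; right.
Qed.

(** Inside the hexagon xt lies strictly between -1/2 and 1/2, so the integer shift is 0; s is
    unchanged since its square is less than 1, and v is recovered from xt and eta. *)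
Lemma links_stab g s v s' v' : links g 1 0 s v 1 0 s' v' -> hexa_int s v ->
  g o2 o0 = 0 -> g o1 o2 = 0 -> s' = s /\ v' = v.
Proof.
move=> [gG gE [t01 h0 hx] [t01' h0' hx']] hi c0 D0.
have [n [nE [s2 sE]]] := cusp_shift t01 h0 hx t01' h0' hx' gG gE c0 ltr01 erefl (or_intror D0).
have eE := cusp_eta t01 h0 hx t01' h0' hx' gG gE c0 ltr01 erefl (or_intror D0).
have /andP[s1 s3] : -1 < s < 1 by case: hi.
have {}sE : s' = s by case: (sE D0) => // s21; nra.
have /andP[x1 x2] := hexa_int_xt hi; have /andP[x1' x2'] := hexa_xt hx'.
have n0 : n%:~R = 0 :> R by have [h|h|h|h] := int_cases R n; lra.
split=> //; have := v_from_xt s' v'; rewrite nE n0 addr0 eE sE -(v_from_xt s v).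
apply: mulfI; have [e1 e2] := hexa_eta hx; apply/eqP; lra.
Qed.

Lemma tauM_prod g : [/\ (g *m tauM R) o2 o0 = 'i * g o2 o2, (g *m tauM R) o1 o0 = 'i * g o1 o2,
  (g *m tauM R) o1 o1 = - g o1 o1 & (g *m tauM R) o1 o2 = - 'i * g o1 o0].
Proof. by split; rewrite mxE sum3 !mxE /= -?complexiE; ring. Qed.

Lemma links_tau g s v s' v' : links g 1 0 s v 1 0 s' v' -> links (g *m tauM R) 1 0 v s 1 0 s' v'.
Proof.
move=> [gG gE [t01 h0 hx] d']; have hx2 := hexa_swap hx; split=> //.
  exact: Gamma_mul gG (tauM_Gamma R).
rewrite act_mul ?act_tau_Phi //; [exact: (proj1 gG)|exact: (proj1 (tauM_Gamma R))|exact: siegel_Phi].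
Qed.

Lemma links_mirror_corner g s v s' v' : links g 1 0 s v 1 0 s' v' -> hexa_int s v ->
  g o1 o0 = 0 -> g o1 o2 = 0 -> (s' = s /\ v' = v) \/ (s' = v /\ v' = s).
Proof.
move=> L hi A0 D0; have [gG gE [t01 h0 hx] _] := L.
have [_ [_ m]] := mirror_le t01 h0 hx gG gE A0 D0.
have [c0|[d0 _]] := m erefl ltr01 erefl hi; first by left; exact: links_stab L hi c0 D0.
have [m1 m2 m3 m4] := tauM_prod g.
right; apply: (links_stab (links_tau L) (hexa_int_swap hi)); rewrite ?m1 ?m4 ?d0 ?A0 mulr0 //.
Qed.

Lemma sigma_invol s v : hexa s v -> ((v - s) / (1 + s * v) - - s) / (1 + - s * ((v - s) / (1 + s * v))) = v.
Proof.
move=> hx; have d := hexa_sv hx; have d' := hexa_sv (hexa_sigma hx).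
apply: divr_eqE; first by rewrite gt_eqF.
by field; rewrite gt_eqF.
Qed.

Lemma links_corner_n2 g s v s' v' u1 u2 : links g 1 0 s v 1 0 s' v' -> hexa_int s v ->
  triangle u1 u2 -> corner_sector u1 u2 s v ->
  g o1 o0 = 0 -> g o1 o2 = - (1 +i* 1) * g o1 o1 -> corner_sector u1 u2 s' v'.
Proof.
move=> [gG gE [t01 h0 hx] d'] hi T S A0 D0; have S2 := sect_sigma T S; have hi2 := hexa_int_sigma hi.
have hx2 := hexa_sigma hx; have inv := sigma_invol hx; set w := (v - s) / _ in S2 hi2 hx2 inv.
have L2 : links (g *m sigM R) 1 0 (- s) w 1 0 s' v'.
  split=> //; first exact: Gamma_mul gG (sigM_Gamma R).
  rewrite act_mul ?act_sigma_Phi ?inv ?opprK //; [exact: (proj1 gG)|exact: (proj1 (sigM_Gamma R))|exact: siegel_Phi].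
have e1 : (g *m sigM R) o1 o0 = 0 by rewrite mxE sum3 !mxE /= A0; ring.
have e2 : (g *m sigM R) o1 o2 = 0 by rewrite mxE sum3 !mxE /= A0 D0; ring.
have [[-> ->]|[-> ->]] := links_mirror_corner L2 hi2 e1 e2; first by [].
exact: sect_swap.
Qed.

(** By [row2_Phi] the middle row of g is one of the three tied mirrors. Composing with [tauM] or
    [sigM], which preserve the sector, reduces to an element preserving w = 0. *)
Lemma links_corner g s v s' v' u1 u2 : links g 1 0 s v 1 0 s' v' -> hexa_int s v ->
  triangle u1 u2 -> corner_sector u1 u2 s v -> corner_sector u1 u2 s' v'.
Proof.
move=> L hi T S; have [gG gE [t01 h0 hx] [t01' h0' hx']] := L.
have e := rel_row2 t01 h0 hx t01' h0' hx' gG gE.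
have [_ _ _ r] := row2_Phi t01 h0 hx gG.
have [[A0 D0]|[A0 D0]|[D0 A0]] := r erefl erefl hi e.
- by have [[-> ->]|[-> ->]] := links_mirror_corner L hi A0 D0; [|exact: sect_swap].
- exact: links_corner_n2 L hi T S A0 D0.
- have [m1 m2 m3 m4] := tauM_prod g.
  apply: (links_corner_n2 (links_tau L) (hexa_int_swap hi) T (sect_swap S)).
    by rewrite m2 D0 mulr0.
  by rewrite m4 m3 A0; apply: complex_eq; case: (g o1 o1) => ? ?; rewrite /=; ring.
Qed.

(** The norm of w and the height scale by the same factor, so their ratio is invariant. It serves on
    the outer edge, where ties with further mirrors prevent the argument of [links_corner]. *)
Lemma corner_invariant g s v s' v' : links g 1 0 s v 1 0 s' v' ->
  (1 + s ^+ 2) * eta s' v' = (1 + s' ^+ 2) * eta s v.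
Proof.
move=> [gG gE [t01 h0 hx] [t01' h0' hx']].
have w := rel_norm_w t01 h0 hx t01' h0' hx' gG gE.
have := hgt_act (proj1 gG) (siegel_Phi t01 h0 hx); rewrite gE.
move: w; rewrite /hgt /normsq /wc /py /pa /pb /= -!/(eta _ _) !addr0 => w h.
set l := lam _ _ in w h; set L := complex.Re l ^+ 2 + complex.Im l ^+ 2 in w h.
have w' : L * (1 + s' ^+ 2) = 1 + s ^+ 2 by lra.
have h' : L * eta s' v' = eta s v by lra.
by rewrite -w' -h'; ring.
Qed.

Definition lo3 (s v : R) := Num.min (Num.min s v) 0.
Definition hi3 (s v : R) := Num.max (Num.max s v) 0.
Definition mid3 (s v : R) := s + v - lo3 s v - hi3 s v.
(** The gaps give a formula, continuous in (s, v), for the u1 and u2 of the sector containing (s,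
    v). *)
Definition gap1 s v := tdiff (mid3 s v) (lo3 s v).
Definition gap2 s v := tdiff (hi3 s v) (mid3 s v).

Lemma lo3E s v m : m <= s -> m <= v -> m <= 0 -> [\/ m = s, m = v | m = 0] -> lo3 s v = m.
Proof.
move=> h1 h2 h3 h; apply/le_anti; rewrite /lo3 !le_min h1 h2 h3 /= andbT !ge_min.
by case: h => <-; rewrite lexx ?orbT.
Qed.

Lemma hi3E s v m : s <= m -> v <= m -> 0 <= m -> [\/ m = s, m = v | m = 0] -> hi3 s v = m.
Proof.
move=> h1 h2 h3 h; apply/le_anti; rewrite /hi3 !ge_max h1 h2 h3 /= !le_max.
by case: h => <-; rewrite lexx ?orbT.
Qed.

Lemma sect_gap u1 u2 s v : triangle u1 u2 -> corner_sector u1 u2 s v -> gap1 s v = u1 /\ gap2 s v = u2.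
Proof.
move=> T; have [a1 a2 d /andP[g0 g1] gE] := triangle_facts T; case: T => b1 b2 _.
rewrite /corner_sector; set g := tsum _ _ in g0 g1 gE *.
have p1 := mulr_ge0 b1 g0; have p2 := mulr_ge0 b2 g0; have p := mulr_ge0 b1 b2.
have q1 : u1 <= g by have := mulr_ge0 p g0; nra.
have q2 : u2 <= g by have := mulr_ge0 p g0; nra.
have nz (b : R) : 0 < b -> b != 0 by move=> ?; rewrite gt_eqF.
have fin lo hi mid : lo3 s v = lo -> hi3 s v = hi -> s + v - lo - hi = mid ->
    0 < 1 + mid * lo -> mid - lo = u1 * (1 + mid * lo) ->
    0 < 1 + hi * mid -> hi - mid = u2 * (1 + hi * mid) -> gap1 s v = u1 /\ gap2 s v = u2.
  move=> h1 h2 h3 n1 e1 n2 e2; rewrite /gap1 /gap2 /mid3 h1 h2 h3 /tdiff.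
  by split; apply: divr_eqE => //; apply: nz.
move=> S; move: S fin; case=> [[[-> ->]|[-> ->]]|[[-> ->]|[-> ->]]|[[-> ->]|[-> ->]]] fin.
- by apply: (fin 0 g u1); [apply: lo3E; clear fin nz p p1 p2; try lra; constructor 3|apply: hi3E; clear fin nz p p1 p2; try lra; constructor 2|rewrite ?mulr0; lra..].
- by apply: (fin 0 g u1); [apply: lo3E; clear fin nz p p1 p2; try lra; constructor 3|apply: hi3E; clear fin nz p p1 p2; try lra; constructor 1|rewrite ?mulr0; lra..].
- by apply: (fin (- u1) u2 0); [apply: lo3E; clear fin nz p p1 p2; try lra; constructor 1|apply: hi3E; clear fin nz p p1 p2; try lra; constructor 2|rewrite ?mulr0; lra..].
- by apply: (fin (- u1) u2 0); [apply: lo3E; clear fin nz p p1 p2; try lra; constructor 2|apply: hi3E; clear fin nz p p1 p2; try lra; constructor 1|rewrite ?mulr0; lra..].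
- by apply: (fin (- g) 0 (- u2)); [apply: lo3E; clear fin nz p p1 p2; try lra; constructor 1|apply: hi3E; clear fin nz p p1 p2; try lra; constructor 3|rewrite ?mul0r; lra..].
- by apply: (fin (- g) 0 (- u2)); [apply: lo3E; clear fin nz p p1 p2; try lra; constructor 2|apply: hi3E; clear fin nz p p1 p2; try lra; constructor 3|rewrite ?mul0r; lra..].
Qed.

Lemma sect_exists s v : hexa s v -> exists u1 u2, triangle u1 u2 /\ corner_sector u1 u2 s v.
Proof.
have pos a b : hexa a b -> 0 <= a -> a <= b -> exists u1 u2, triangle u1 u2 /\ corner_sector u1 u2 a b.
  move=> hx a0 ab; have d := hexa_sv hx; case: hx => /andP[? ?] /andP[b1 b2] h1 h2.
  set w := (b - a) / (1 + a * b); have wE : w * (1 + a * b) = b - a by rewrite divfK ?gt_eqF.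
  have w0 : 0 <= w by apply: divr_ge0; [lra|exact: ltW].
  have T : triangle a w.
    split=> //; have : (a + w + a * w) * (1 + a * b) <= 1 * (1 + a * b).
      have -> : (a + w + a * w) * (1 + a * b) = a * (1 + a * b) + (1 + a) * (w * (1 + a * b)) by ring.
      have a2 := sqr_ge0 a; rewrite wE; have : 0 <= (1 - b) * (1 + a ^+ 2) by [apply: mulr_ge0; lra]; lra.
    by rewrite ler_pM2r.
  exists a, w; split=> //; constructor 1; left; split=> //; have [_ _ d3 _ gE] := triangle_facts T.
  by apply: (mulIf (lt0r_neq0 d3)); rewrite gE; lra.
have neg a b : hexa a b -> a <= b -> b <= 0 -> exists u1 u2, triangle u1 u2 /\ corner_sector u1 u2 a b.
  move=> hx ab b0; have hx' : hexa (- b) (- a).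
    by case: hx => /andP[? ?] /andP[? ?] ? ?; split; try (apply/andP; split); lra.
  have [||u1 [u2 [T S]]] := pos _ _ hx'; try lra.
  have T' : triangle u2 u1 by case: T => *; split=> //; lra.
  have g12 : tsum u2 u1 = tsum u1 u2 by rewrite /tsum addrC [u2 * u1]mulrC.
  exists u2, u1; split=> //; rewrite /corner_sector g12.
  have n1 c : - b = c -> b = - c by move=> <-; rewrite opprK.
  have n2 c : - a = c -> a = - c by move=> <-; rewrite opprK.
  case: S => [[[/n1-> /n2->]|[/n1-> /n2->]]|[[/n1-> /n2->]|[/n1-> /n2->]]|[[/n1-> /n2->]|[/n1-> /n2->]]]; rewrite ?opprK.
  - by constructor 3; left.
  - by constructor 3; right.
  - by constructor 2; left.
  - by constructor 2; right.
  - by constructor 1; left.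
  - by constructor 1; right.
move=> hx; have hx' := hexa_swap hx.
have [s0|s0] := leP 0 s; have [v0|v0] := leP 0 v.
- have [sv|sv] := leP s v; first exact: pos.
  by have [||u1 [u2 [T S]]] := pos _ _ hx'; try lra; exists u1, u2; split=> //; exact: sect_swap.
- exists (- v), s; case: hx => *; split; first by split; lra.
  by constructor 2; right; rewrite opprK.
- exists (- s), v; case: hx => *; split; first by split; lra.
  by constructor 2; left; rewrite opprK.
- have [sv|sv] := leP s v; first by apply: neg => //; lra.
  by have [||u1 [u2 [T S]]] := neg _ _ hx'; try lra; exists u1, u2; split=> //; exact: sect_swap.
Qed.

Lemma sect_int u1 u2 s v : triangle u1 u2 -> corner_sector u1 u2 s v -> u1 + u2 + u1 * u2 < 1 -> hexa_int s v.
Proof.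
move=> T S lt1; have [a1 a2 d /andP[g0 g1] gE] := triangle_facts T; have [b1 b2 _] := T.
have S0 : corner_sector u1 u2 u1 (tsum u1 u2) by constructor 1; left.
have hb := sect_hexa T S0.
set g := tsum u1 u2 in g0 g1 gE S0 hb; have p := mulr_ge0 b1 b2.
have g1' : g < 1 by rewrite -(ltr_pM2r d) gE; lra.
have q1 : u1 <= g by have := mulr_ge0 p g0; nra.
have q2 : u2 <= g by have := mulr_ge0 p g0; nra.
have i1 : hexa_int u1 g.
  have uE : g - u1 = u2 * (1 + u1 * g) by lra.
  have p1 := mulr_ge0 b1 g0.
  split; try (by apply/andP; split; lra); last by lra.
  by rewrite uE; have : 0 < (1 - u2) * (1 + u1 * g) by [apply: mulr_gt0; lra]; lra.
have i2 : hexa_int (- u1) u2 by split; try (by apply/andP; split; lra); lra.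
have i3 : hexa_int (- g) (- u2).
  have uE : g - u2 = u1 * (1 + u2 * g) by lra.
  have p2 := mulr_ge0 b2 g0.
  split; try (by apply/andP; split; lra); last by lra.
  have -> : - u2 - - g = g - u2 by ring.
  by rewrite uE; have : 0 < (1 - u1) * (1 + u2 * g) by [apply: mulr_gt0; lra]; lra.
by case: S => [[[-> ->]|[-> ->]]|[[-> ->]|[-> ->]]|[[-> ->]|[-> ->]]] //; exact: hexa_int_swap.
Qed.

Lemma sect_invariant u1 u2 s v : triangle u1 u2 -> corner_sector u1 u2 s v ->
  u1 + u2 + u1 * u2 = 1 -> 1 + s ^+ 2 = 2 * (u1 + u2) * eta s v.
Proof.
move=> T S e1.
have S0 : corner_sector u1 u2 u1 (tsum u1 u2) by constructor 1; left.
have pp : prP (Phi 1 0 u1 (tsum u1 u2)) = prP (Phi 1 0 s v) by rewrite -(sect_prP T S).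
have D (a b : R) : hexa a b -> dom 1 0 a b by move=> ?; split=> //; rewrite ler01 lexx.
have [g L] := (prP_links (D _ _ (sect_hexa T S0)) (D _ _ (sect_hexa T S))).1 pp.
have := corner_invariant L.
have [a1 a2 d _ gE] := triangle_facts T; have [b1 b2 _] := T.
have g1 : tsum u1 u2 = 1 by apply: (mulIf (lt0r_neq0 d)); rewrite gE; lra.
rewrite g1 {2}/eta expr1n mulr1 => e.
have uu : 1 + u1 ^+ 2 = (u1 + u2) * (1 + u1) by lra.
have d1 : 1 + u1 != 0 by apply/eqP; lra.
by apply: (mulIf d1); move: e; rewrite uu (_ : (1 + 1 : R) = 2) //; lra.
Qed.

(** At the corner the quotient of the hexagon is the triangle with its outer edge folded by
    exchanging u1 and u2. *)
Lemma corner_classes s v s' v' u1 u2 u1' u2' : hexa s v -> hexa s' v' ->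
  prP (Phi 1 0 s v) = prP (Phi 1 0 s' v') ->
  triangle u1 u2 -> corner_sector u1 u2 s v -> triangle u1' u2' -> corner_sector u1' u2' s' v' ->
  (u1' = u1 /\ u2' = u2) \/ [/\ u1 + u2 + u1 * u2 = 1, u1' = u2 & u2' = u1].
Proof.
move=> hx hx' pp T S T' S'.
have D (a b : R) : hexa a b -> dom 1 0 a b by move=> ?; split=> //; rewrite ler01 lexx.
have [g L] := (prP_links (D _ _ hx) (D _ _ hx')).1 pp.
have [gp1 gp2] := sect_gap T S; have [gp1' gp2'] := sect_gap T' S'.
have [b1 b2 le1] := T; have [b1' b2' le1'] := T'.
have [lt1|ge1] := ltP (u1 + u2 + u1 * u2) 1.
  left; have S2 := links_corner L (sect_int T S lt1) T S.
  by have [<- <-] := sect_gap T S2; rewrite gp1' gp2'.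
have [lt1'|ge1'] := ltP (u1' + u2' + u1' * u2') 1.
  left; have S2 := links_corner (links_inv L) (sect_int T' S' lt1') T' S'.
  by have [<- <-] := sect_gap T' S2; rewrite gp1 gp2.
have e1 : u1 + u2 + u1 * u2 = 1 by lra.
have e1' : u1' + u2' + u1' * u2' = 1 by lra.
have I := sect_invariant T S e1; have I' := sect_invariant T' S' e1'.
have := corner_invariant L; rewrite I I'.
have [q1 q2] := hexa_eta hx; have [q1' q2'] := hexa_eta hx'.
have n0 : 0 < eta s v by lra.
have n0' : 0 < eta s' v' by lra.
have -> : 2 * (u1 + u2) * eta s v * eta s' v' = 2 * eta s v * eta s' v' * (u1 + u2) by ring.
have -> : 2 * (u1' + u2') * eta s' v' * eta s v = 2 * eta s v * eta s' v' * (u1' + u2') by ring.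
have nz : 2 * eta s v * eta s' v' != 0 by rewrite gt_eqF // mulr_gt0 // mulr_gt0.
move/(mulfI nz) => sE.
(* On the outer edge equal sums force equal products, so the two pairs are the roots of the same
   quadratic. *)
have : (u1' - u1) * (u1' - u2) = 0.
  have -> : u2 = u1' + u2' - u1 by lra.
  have : u1 * u2 = u1' * u2' by lra.
  by rewrite (_ : u2 = u1' + u2' - u1); [lra|lra].
move/eqP; rewrite mulf_eq0 !subr_eq0 => /orP[] /eqP e.
  by left; split=> //; lra.
by right; split=> //; lra.
Qed.

End Reduction.

(** * The complement of the mirror *)

Section SphericalPart.
Local Open Scope complex_scope.
Variable R : realType.
Local Notation C := R[i].
Local Notation pt4 := (pt4 R).
Local Notation X := (GammaD R).
Implicit Types (t h s v u : R) (p q : pt4).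

(** A parameter (t, h, s, v) is stored as a [pt4]: on parameters [px], [py], [pa], [pb] read t, h, s
    and v. *)
Definition PhiP q := Phi (px q) (py q) (pa q) (pb q).
Definition domP q := dom (px q) (py q) (pa q) (pb q).
Definition phiV q : X := prP (PhiP q).

Lemma PhiP_cts q : {for q, continuous PhiP}.
Proof.
have ca := @pa_cts R q; have cb := @pb_cts R q; have cy := @py_cts R q; have cx := @px_cts R q.
have cd : ctsR q (fun p => (1 + pb p ^+ 2)^-1).
  by apply: ctsRV; [exact: onev_neq0|apply: ctsRD; [exact: ctsR_cst|exact: ctsRX]].
apply: pt4_cts => /=.
- by apply: ctsRM => //; apply: ctsRD => //; exact: ctsRN.
- by apply: ctsRD => //; apply: ctsRM => //; apply: ctsRD; [exact: ctsR_cst|exact: ctsRM].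
- by apply: ctsRM => //; exact: ctsR_cst.
- by apply: ctsRM; [apply: ctsRN; exact: ctsRM|exact: ctsR_cst].
Qed.

Lemma siegel_PhiP q : domP q -> siegel (PhiP q).
Proof. by move=> [? ? ?]; exact: siegel_Phi. Qed.

Lemma phiV_cts q : domP q -> {for q, continuous phiV}.
Proof.
move=> dq; apply: (@continuous_comp _ _ _ PhiP (@prP R)); first exact: PhiP_cts.
by apply: prP_cts; exact: siegel_PhiP.
Qed.

Lemma closed_ge0 (T : topologicalType) (f : T -> R) : (forall x, ctsR x f) -> closed [set x | 0 <= f x].
Proof.
move=> cf; rewrite (_ : [set q | _] = f @^-1` [set r | 0 <= r]) //.
by apply: preimage_closed; [move=> x _; exact: cf|exact: closed_ge].
Qed.

Lemma closed_leR (T : topologicalType) (f g : T -> R) : (forall x, ctsR x f) -> (forall x, ctsR x g) ->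
  closed [set x | f x <= g x].
Proof.
move=> cf cg; have := @closed_ge0 T (fun x => g x - f x) (fun x => ctsRD (cg x) (ctsRN (cf x))).
by congr closed; apply/seteqP; split=> q /=; rewrite subr_ge0.
Qed.

Lemma closed_eqR (T : topologicalType) (f g : T -> R) : (forall x, ctsR x f) -> (forall x, ctsR x g) ->
  closed [set x | f x = g x].
Proof.
move=> cf cg; have := closedI (closed_leR cf cg) (closed_leR cg cf).
by congr closed; apply/seteqP; split=> q /=; [move=> [h1 h2]; apply/le_anti; rewrite h1 h2|move=> ->].
Qed.

Lemma closed_domP : closed domP.
Proof.
have c0 := ctsR_cst; have cx := @px_cts R; have cy := @py_cts R; have ca := @pa_cts R; have cb := @pb_cts R.
rewrite (_ : domP = [set q | 0 <= px q] `&` [set q | px q <= 1] `&` [set q | 0 <= py q] `&`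
  ([set q | -1 <= pa q] `&` [set q | pa q <= 1] `&` ([set q | -1 <= pb q] `&` [set q | pb q <= 1]) `&`
  ([set q | pb q - pa q <= 1 + pa q * pb q] `&` [set q | pa q - pb q <= 1 + pa q * pb q]))).
  have cab q : ctsR q (fun q => 1 + pa q * pb q) by apply: ctsRD => //; exact: ctsRM.
  have cst (t : R) (q : pt4) : ctsR q (fun _ => t) by exact: ctsR_cst.
  apply: closedI; [apply: closedI; [apply: closedI|]|apply: closedI; [apply: closedI; apply: closedI|apply: closedI]].
  - exact: (closed_leR (cst _) cx).
  - exact: (closed_leR cx (cst _)).
  - exact: (closed_leR (cst _) cy).
  - exact: (closed_leR (cst _) ca).
  - exact: (closed_leR ca (cst _)).
  - exact: (closed_leR (cst _) cb).
  - exact: (closed_leR cb (cst _)).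
  - by apply: closed_leR => // q; apply: ctsRD => //; exact: ctsRN.
  - by apply: closed_leR => // q; apply: ctsRD => //; exact: ctsRN.
apply/seteqP; split=> q; first by move=> [/andP[? ?] ? [/andP[? ?] /andP[? ?] ? ?]]; do ![split].
move=> [[[? ?] ?] [[[? ?] [? ?]] [? ?]]].
by split=> //; [apply/andP; split|split=> //; apply/andP; split].
Qed.

Lemma compact_box4 (a0 b0 a1 b1 a2 b2 a3 b3 : R) :
  compact [set q : pt4 | [/\ a0 <= px q <= b0, a1 <= py q <= b1, a2 <= pa q <= b2 & a3 <= pb q <= b3]].
Proof.
have -> : [set q : pt4 | [/\ a0 <= px q <= b0, a1 <= py q <= b1, a2 <= pa q <= b2 & a3 <= pb q <= b3]] =
    `[a0, b0]%classic `*` `[a1, b1]%classic `*` `[a2, b2]%classic `*` `[a3, b3]%classic.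
  apply/seteqP; split=> [[[[x y] a] b]|[[[x y] a] b]]; rewrite /px /py /pa /pb /= !in_itv /=.
    by move=> [? ? ? ?].
  by move=> [[[? ?] ?] ?].
by do ![apply: compact_setX]; exact: segment_compact.
Qed.

Lemma compact_dom (E : set pt4) (H : R) : closed E -> E `<=` domP -> compact (E `&` [set q | py q <= H]).
Proof.
move=> cE Ed; apply: (@subclosed_compact _ _ [set q | [/\ 0 <= px q <= 1, 0 <= py q <= H, -1 <= pa q <= 1 & -1 <= pb q <= 1]]).
- by apply: closedI => //; apply: closed_leR; [exact: py_cts|move=> q; exact: ctsR_cst].
- exact: compact_box4.
- by move=> q [/Ed[? h0 [? ? _ _]] /= hH]; split=> //; rewrite h0.
Qed.

(** The image in the Siegel domain lies in a Siegel set, as the height is at least 1/4, and it is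
    closed because a bound on [py] bounds h while the other parameters stay in a box. *)
Lemma closed_phiV (E : set pt4) : closed E -> E `<=` domP -> closed (phiV @` E).
Proof.
move=> cE Ed.
have -> : phiV @` E = @prP R @` (PhiP @` E).
  by apply/seteqP; split=> [_ [q Eq <-]|_ [_ [q Eq <-] <-]]; [exists (PhiP q) => //|]; exists q.
apply: (@closed_prP R _ (1 / 4) 1); first by lra.
  move=> _ [q /Ed[/andP[t0 t1] h0 hx] <-]; have [e1 e2] := hexa_eta hx.
  have /andP[x1 x2] := hexa_xt hx; have oE := floor_circle (pa q) (pb q).
  case: hx => /andP[s1 s2] _ _ _; rewrite /siegel_set /= /hgt /normsq /wc /PhiP /py /px /pa /pb /=.
  rewrite -/(px q) -/(py q) -/(pa q) -/(pb q) -/(eta _ _).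
  move: (px q) (py q) (pa q) (pb q) t0 t1 h0 e1 e2 x1 x2 oE s1 s2 => t h s v t0 t1 h0 e1 e2 x1 x2 oE s1 s2.
  have t2 : t ^+ 2 <= 1 by nra.
  have s3 : s ^+ 2 <= 1 by nra.
  have ts : t ^+ 2 * s ^+ 2 <= s ^+ 2 by have := sqr_ge0 s; nra.
  have -> : (t / 2) ^+ 2 = t ^+ 2 / 4 by field.
  have -> : (- (t * s) / 2) ^+ 2 = t ^+ 2 * s ^+ 2 / 4 by field.
  have k : 1 + s ^+ 2 <= 2 * eta s v by have [?|?] := leP 0 s; nra.
  have := sqr_ge0 s => s4; split; [lra| |lra].
  move: x1 x2; rewrite /xt; set x := (s - v) / _ => x1 x2.
  have : 0 <= (1 - x) * (1 + x) by apply: mulr_ge0; lra.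
  by rewrite expr2; lra.
move=> x clx; pose M := py x + 1.
have cK : compact (PhiP @` (E `&` [set q | py q <= M])).
  apply: continuous_compact; last exact: compact_dom.
  by apply: continuous_in_subspaceT => q _; exact: PhiP_cts.
have clK : closed (PhiP @` (E `&` [set q | py q <= M])).
  by apply: compact_closed => //; exact: norm_hausdorff.
have xK : closure (PhiP @` (E `&` [set q | py q <= M])) x.
  move=> B Bx; have W : nbhs x [set y | py y < M] by apply: ctsR_lt; [exact: py_cts|rewrite /M; lra].
  have [_ [[q Eq <-] [Bq /= yq]]] := clx _ (filterI Bx W).
  exists (PhiP q); split=> //; exists q => //; split=> //=.
  have [_ _ /hexa_eta[e1 e2]] := Ed _ Eq.
  by move: yq; rewrite /PhiP /py /= -/(py q) -/(eta _ _); lra.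
by have [q [Eq _] <-] := clK _ xK; exists q.
Qed.

(** Collects the extension lemmas in the shape of the hypothesis [ch_spread] of the gluing
    section. *)
Lemma prP_spread t h s v s' v' t1 h1 : dom t h s v -> dom t h s' v' ->
  prP (Phi t h s v) = prP (Phi t h s' v') -> 0 < t -> 0 <= t1 <= 1 -> 0 <= h1 ->
  (t = 1 -> t1 = 1) -> (h = 0 -> h1 = 0) ->
  prP (Phi t1 h1 s v) = prP (Phi t1 h1 s' v').
Proof.
move=> d d' e tp t01 h10 k1 k2; have [/andP[_ t1'] h0 _] := d.
have [hp|hn] := ltP 0 h; last first.
  have h00 : h = 0 by lra.
  rewrite (k2 h00); subst h; have [tl|tg] := ltP t 1; first by apply: prP_floor e _ _ => //; rewrite tp.
  have t1E : t = 1 by lra.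
  by rewrite (k1 t1E) -t1E.
have [tl|tg] := ltP t 1; first by apply: prP_generic e _ _ _ _ => //; rewrite tp.
have t1E : t = 1 by lra.
by rewrite (k1 t1E); subst t; apply: prP_wall e _ _.
Qed.

Lemma prP_disjoint t h s v t' h' s' v' : dom t h s v -> dom t' h' s' v' ->
  prP (Phi t h s v) = prP (Phi t' h' s' v') -> 0 < t -> t' = t /\ h' = h.
Proof.
by move=> d d' /(prP_links d d')[g L] tp; split; [exact: links_t L|exact: links_h L tp].
Qed.

Section Acyclic.
Variables (S : nat -> X -> zmodType) (M : cochain_system S).

Lemma foldr_setU_In (T I : Type) (f : I -> set T) (l : seq I) :
  foldr setU set0 [seq f i | i <- l] = [set x | exists2 i, List.In i l & f i x].
Proof.
elim: l => [|i l IH] /=; first by apply/seteqP; split=> x // [].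
rewrite IH; apply/seteqP; split=> x.
  by case=> [fx|[j jl fx]]; [exists i => //; left|exists j => //; right].
by case=> j [<-|jl] fx; [left|right; exists j].
Qed.

(** Each (s, v) in the list gives a rectangle in (t, h), with sides h = 0 and t = 1. The charts
    agree at the corner by hypothesis and elsewhere according to [prP_spread]. *)
Lemma acyclic_boxes (l : seq (R * R)) (a H : R) : l <> [::] -> 0 < a <= 1 -> 0 <= H ->
  (forall sv, List.In sv l -> hexa sv.1 sv.2) ->
  (forall sv sv', List.In sv l -> List.In sv' l -> prP (Phi 1 0 sv.1 sv.2) = prP (Phi 1 0 sv'.1 sv'.2)) ->
  acyclic M (phiV @` [set q | [/\ domP q, a <= px q, py q <= H & List.In (pa q, pb q) l]]).
Proof.
move=> l0 /andP[a0 a1] H0 hx co.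
pose Q := [set p : R * R | a <= p.1 <= 1 /\ 0 <= p.2 <= H].
pose ch (sv : R * R) (p : R * R) := prP (Phi p.1 p.2 sv.1 sv.2).
have Qdom sv (p : R * R) : List.In sv l -> Q p -> dom p.1 p.2 sv.1 sv.2.
  by move=> /hx ? [/andP[k1 k2] /andP[? ?]]; split=> //; rewrite k2 andbT ltW // (lt_le_trans a0).
have chc sv (p : R * R) : List.In sv l -> Q p -> {for p, continuous (ch sv)}.
  move=> sl Qp; have [? ? ?] := Qdom _ _ sl Qp.
  apply: (@continuous_comp _ _ _ (fun p : R * R => Phi p.1 p.2 sv.1 sv.2) (@prP R)).
    have c1 : ctsR p (fst : R * R -> R) by exact: cvg_fst.
    have c2 : ctsR p (snd : R * R -> R) by exact: cvg_snd.
    apply: pt4_cts => /=.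
    - exact: ctsR_cst.
    - by apply: ctsRD => //; exact: ctsR_cst.
    - by apply: ctsRM => //; exact: ctsR_cst.
    - by apply: ctsRM; [apply: ctsRN; apply: ctsRM => //|]; exact: ctsR_cst.
  by apply: prP_cts; exact: siegel_Phi.
have disj sv sv' (p p' : R * R) : List.In sv l -> List.In sv' l -> Q p -> Q p' -> ch sv p = ch sv' p' -> p = p'.
  move=> sl sl' Qp Qp' e; have tp : 0 < p.1 by case: Qp => /andP[k1 _] _; exact: lt_le_trans a0 k1.
  have [] := prP_disjoint (Qdom _ _ sl Qp) (Qdom _ _ sl' Qp') e tp.
  by case: p p' {Qp Qp' e tp} => ? ? [? ?] /= -> ->.
have boxes sv (b1 c2 : R) : List.In sv l -> a <= b1 <= 1 -> 0 <= c2 <= H ->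
    acyclic M (ch sv @` [set p : R * R | b1 <= p.1 <= 1 /\ 0 <= p.2 <= c2]).
  move=> sl /andP[h1 h2] /andP[h3 h4].
  have sub : [set p : R * R | b1 <= p.1 <= 1 /\ 0 <= p.2 <= c2] `<=` Q.
    by move=> p [/andP[? ?] /andP[? ?]]; split; apply/andP; split=> //; lra.
  refine (@acyclic_box R X S M (@hausdorff_GammaD R) (ch sv) _ b1 1 0 c2 h2 h3 erefl _ _) => [p /sub Qp|p p' /sub Qp /sub Qp' e].
    exact: chc.
  exact: disj Qp Qp' e.
have := @acyclic_cross X S M (@hausdorff_GammaD R) (R * R)%type (R * R)%type l ch Q
  (fun p : R * R => p.2 == 0) (fun p : R * R => p.1 == 1) l0.
rewrite foldr_setU_In.
rewrite (_ : [set x | _] = phiV @` [set q | [/\ domP q, a <= px q, py q <= H & List.In (pa q, pb q) l]]); last first.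
  apply/seteqP; split=> [x [sv sl [p Qp <-]]|_ [q [[/andP[? ?] ? ?] ? ? ql] <-]].
    exists (p.1, p.2, sv.1, sv.2) => //; split; first exact: Qdom sl Qp.
    - by case: Qp => /andP[].
    - by case: Qp => _ /andP[].
    by rewrite /pa /pb /=; case: sv sl.
  by exists (pa q, pb q) => //; exists (px q, py q) => //; split; apply/andP.
apply=> //.
- exact: compact_box.
- have c2 (x : R * R) : ctsR x (snd : R * R -> R) by exact: cvg_snd.
  have := @closed_eqR (R * R)%type snd (fun=> 0) c2 (fun x => @ctsR_cst R _ x 0).
  by congr closed; apply/seteqP; split=> x /=; [move=> ->|move/eqP].
- have c1 (x : R * R) : ctsR x (fst : R * R -> R) by exact: cvg_fst.
  have := @closed_eqR (R * R)%type fst (fun=> 1) c1 (fun x => @ctsR_cst R _ x 1).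
  by congr closed; apply/seteqP; split=> x /=; [move=> ->|move/eqP].
- move=> i j p p' il jl Qp Qp' /implyP k2 /implyP k1 e.
  have tp : 0 < p.1 by case: Qp => /andP[? _] _; exact: lt_le_trans a0 _.
  apply: (prP_spread (Qdom _ _ il Qp) (Qdom _ _ jl Qp) e tp).
  + by case: Qp' => /andP[k3 k4] _; rewrite k4 andbT ltW // (lt_le_trans a0).
  + by case: Qp' => _ /andP[].
  + by move=> /eqP /k1 /eqP.
  + by move=> /eqP /k2 /eqP.
- by move=> i j p il jl Qp /eqP h0 /eqP t1; rewrite /ch h0 t1; exact: co.
- by move=> i il; apply: (boxes i a H) => //; rewrite lexx ?a1 ?H0.
- move=> i il; have := boxes i a 0 il; rewrite !lexx a1 H0 => /(_ isT isT).
  congr (acyclic M (_ @` _)); apply/seteqP; split=> p.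
    move=> [h1 /andP[h2 h3]]; split; last by rewrite /= eq_le h2 h3.
    by split=> //; rewrite h2 (le_trans h3).
  by move=> [[h1 _] /= /eqP h2]; split=> //; rewrite h2 lexx.
- move=> i il; have := boxes i 1 H il; rewrite !lexx a1 H0 => /(_ isT isT).
  congr (acyclic M (_ @` _)); apply/seteqP; split=> p.
    move=> [/andP[h1 h2] h3]; split; last by rewrite /= eq_le h1 h2.
    by split=> //; rewrite h2 (le_trans a1).
  by move=> [[_ h1] /= /eqP h2]; split=> //; rewrite h2 lexx.
- move=> i il; have := boxes i 1 0 il; rewrite !lexx a1 H0 => /(_ isT isT).
  congr (acyclic M (_ @` _)); apply/seteqP; split=> p.
    move=> [/andP[h1 h2] /andP[h3 h4]]; split; first by split; rewrite ?h2 ?h3 ?(le_trans a1) ?(le_trans h4).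
    by rewrite /= !eq_le h1 h2 h3 h4.
  by move=> [_ /= /andP[/eqP h1 /eqP h2]]; rewrite h1 h2 !lexx.
Qed.

Definition sectors u1 u2 : seq (R * R) :=
  [:: (u1, tsum u1 u2); (tsum u1 u2, u1); (- u1, u2); (u2, - u1);
      (- tsum u1 u2, - u2); (- u2, - tsum u1 u2)].

Lemma sectorsP u1 u2 s v : List.In (s, v) (sectors u1 u2) <-> corner_sector u1 u2 s v.
Proof.
rewrite /corner_sector /=; split.
  case=> [[<- <-]|[[<- <-]|[[<- <-]|[[<- <-]|[[<- <-]|[[<- <-]|//]]]]]].
  - by constructor 1; left.
  - by constructor 1; right.
  - by constructor 2; left.
  - by constructor 2; right.
  - by constructor 3; left.
  - by constructor 3; right.
by case=> [[[-> ->]|[-> ->]]|[[-> ->]|[-> ->]]|[[-> ->]|[-> ->]]]; do 6?[by left|right].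
Qed.

Lemma sect_gapP u1 u2 s v : hexa s v -> triangle u1 u2 ->
  corner_sector u1 u2 s v <-> gap1 s v = u1 /\ gap2 s v = u2.
Proof.
move=> hx T; split; first exact: sect_gap.
have [w1 [w2 [T' S']]] := sect_exists hx.
by have [-> ->] := sect_gap T' S' => -[<- <-].
Qed.

Lemma gap_triangle s v : hexa s v -> triangle (gap1 s v) (gap2 s v).
Proof. by move=> /sect_exists[w1 [w2 [T S']]]; have [-> ->] := sect_gap T S'. Qed.

Lemma gap_sect s v : hexa s v -> corner_sector (gap1 s v) (gap2 s v) s v.
Proof. by move=> /sect_exists[w1 [w2 [T S']]]; have [-> ->] := sect_gap T S'. Qed.

Lemma gap_denominators s v : 0 <= mid3 s v * lo3 s v /\ 0 <= hi3 s v * mid3 s v.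
Proof.
rewrite /mid3 /lo3 /hi3 /Num.min /Num.max; case: (ltP s v) => sv; case: (ltP s 0) => s0; case: (ltP v 0) => v0;
  rewrite ?ltxx ?sv ?s0 ?v0 //=; split; nra.
Qed.

Lemma gaps_cts q : ctsR q (fun p => gap1 (pa p) (pb p)) /\ ctsR q (fun p => gap2 (pa p) (pb p)).
Proof.
have cmin (f g : pt4 -> R) : ctsR q f -> ctsR q g -> ctsR q (fun p => Num.min (f p) (g p)).
  exact: continuous_min.
have cmax (f g : pt4 -> R) : ctsR q f -> ctsR q g -> ctsR q (fun p => Num.max (f p) (g p)).
  exact: continuous_max.
have ca := @pa_cts R q; have cb := @pb_cts R q; have c0 := @ctsR_cst R _ q 0; have c1 := @ctsR_cst R _ q 1.
have clo : ctsR q (fun p => lo3 (pa p) (pb p)) by apply: (cmin); [exact: cmin|].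
have chi : ctsR q (fun p => hi3 (pa p) (pb p)) by apply: (cmax); [exact: cmax|].
have cmid : ctsR q (fun p => mid3 (pa p) (pb p)).
  by apply: ctsRD; [apply: ctsRD; [exact: ctsRD|exact: ctsRN]|exact: ctsRN].
have [d1 d2] := gap_denominators (pa q) (pb q).
by split; (apply: ctsRM; [apply: ctsRD => //; exact: ctsRN|apply: ctsRV; [apply/eqP; lra|apply: ctsRD => //; exact: ctsRM]]).
Qed.

(** An identification persists when both points are moved to the corner (1, 0), where the classes
    are known. *)
Lemma gap_invariant q q' : domP q -> domP q' -> phiV q = phiV q' -> 0 < px q ->
  let u1 := gap1 (pa q) (pb q) in let u2 := gap2 (pa q) (pb q) in
  let u1' := gap1 (pa q') (pb q') in let u2' := gap2 (pa q') (pb q') in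
  (u1' = u1 /\ u2' = u2) \/ [/\ u1 + u2 + u1 * u2 = 1, u1' = u2 & u2' = u1].
Proof.
move=> d d' e tp; have [tE hE] := prP_disjoint d d' e tp.
have [_ _ hx] := d; have [_ _ hx'] := d'.
have e1 : prP (Phi 1 0 (pa q) (pb q)) = prP (Phi 1 0 (pa q') (pb q')).
  apply: (@prP_spread (px q) (py q)) => //; last by rewrite ler01 lexx.
    by move: d'; rewrite /domP tE hE.
  by move: e; rewrite /phiV /PhiP tE hE.
exact: (corner_classes hx hx' e1 (gap_triangle hx) (gap_sect hx) (gap_triangle hx') (gap_sect hx')).
Qed.

Section Piece.
Variables (a H : R).
Hypotheses (a01 : 0 < a <= 1) (H0 : 0 <= H).
Let D := [set q | [/\ domP q, a <= px q & py q <= H]].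
Let g1 q := gap1 (pa q) (pb q).
Let g2 q := gap2 (pa q) (pb q).
(** 1 + G is (1 + u1)(1 + u2): G is symmetric, hence compatible with the fold, and equals 1 on the
    outer edge only. *)
Let G q := g1 q + g2 q + g1 q * g2 q.

Let G_cts q : ctsR q G.
Proof.
by have [c1 c2] := gaps_cts q; apply: ctsRD; [exact: ctsRD|exact: ctsRM].
Qed.

Let compactD : compact D.
Proof.
have -> : D = (domP `&` [set q | a <= px q]) `&` [set q | py q <= H].
  by apply/seteqP; split=> q; [case=> ? ? ?; split|case=> [[? ?] ?]; split].
apply: compact_dom; last by move=> q [].
apply: closedI; first exact: closed_domP.
by apply: closed_leR => x; [exact: ctsR_cst|exact: px_cts].
Qed.

Let compactG g : compact (D `&` [set q | G q = g]).
Proof. by apply: compact_closedI => //; apply: closed_eqR => x; [exact: G_cts|exact: ctsR_cst]. Qed.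

Let Dpos q : D q -> 0 < px q.
Proof. by case=> _ ? _; have /andP[? ?] := a01; lra. Qed.

Let inv q q' : D q -> D q' -> phiV q = phiV q' ->
  (g1 q' = g1 q /\ g2 q' = g2 q) \/ [/\ G q = 1, g1 q' = g2 q & g2 q' = g1 q].
Proof. by move=> Dq [d' _ _] e; have [d _ _] := Dq; apply: gap_invariant => //; exact: Dpos. Qed.

Let tri q : D q -> triangle (g1 q) (g2 q).
Proof. by move=> [[_ _ hx] _ _]; exact: gap_triangle. Qed.

Let fibre (l : seq (R * R)) (E : set pt4) : l <> [::] ->
  (forall sv, List.In sv l -> hexa sv.1 sv.2) ->
  (forall sv sv', List.In sv l -> List.In sv' l -> prP (Phi 1 0 sv.1 sv.2) = prP (Phi 1 0 sv'.1 sv'.2)) ->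
  (forall q, D q -> E q <-> List.In (pa q, pb q) l) -> acyclic M (phiV @` (D `&` E)).
Proof.
move=> l0 hx co EP; have := acyclic_boxes l0 a01 H0 hx co.
congr (acyclic M (_ @` _)); apply/seteqP; split=> q.
  by move=> [? ? ? h]; have Dq : D q by []; split=> //; exact/(EP q Dq).
by move=> [Dq /(EP q Dq) h]; case: Dq => ? ? ?; split.
Qed.

Let sector_hexa u1 u2 sv : triangle u1 u2 -> List.In sv (sectors u1 u2) -> hexa sv.1 sv.2.
Proof. by case: sv => s v T /sectorsP; exact: sect_hexa. Qed.

Let sector_prP u1 u2 sv : triangle u1 u2 -> List.In sv (sectors u1 u2) ->
  prP (Phi 1 0 sv.1 sv.2) = prP (Phi 1 0 u1 (tsum u1 u2)).
Proof. by case: sv => s v T /sectorsP; exact: sect_prP. Qed.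

Let sector_gap u1 u2 q : D q -> triangle u1 u2 ->
  List.In (pa q, pb q) (sectors u1 u2) <-> g1 q = u1 /\ g2 q = u2.
Proof. by move=> [[_ _ hx] _ _] T; rewrite sectorsP; exact: sect_gapP. Qed.

Let complement g u : 0 <= u -> forall u2, u + u2 + u * u2 = g <-> u2 = (g - u) / (1 + u).
Proof.
move=> u0 u2; have d : 1 + u != 0 by apply/eqP; lra.
split=> [<-|->]; first by apply: (mulIf d); rewrite divfK //; ring.
by have := divfK d (g - u); lra.
Qed.

(** Off the fold the gaps themselves are invariant; with G fixed, the first one determines the
    second. *)
Let fibre_lt1 g : 0 <= g < 1 -> acyclic M (phiV @` (D `&` [set q | G q = g])).
Proof.
move=> /andP[g0 gl]; apply: (@acyclic_leray R X S M (@hausdorff_GammaD R) pt4 phiV g1 _ 0 g) => //.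
- by move=> q [[? _ _] _]; exact: phiV_cts.
- by move=> q _; have [] := gaps_cts q.
- move=> q [Dq <-]; have [t1 t2 _] := tri Dq; rewrite t1 /G.
  by have := mulr_ge0 t1 t2; lra.
- move=> q q' [Dq /= Gq] [Dq' _] e; have [[->]|[h]] := inv Dq Dq' e => //.
  by exfalso; move: h gl; rewrite Gq => ->; rewrite ltxx.
move=> u /andP[u0 ug]; rewrite -setIA; set u2 := (g - u) / (1 + u).
have uE : u + u2 + u * u2 = g by apply/complement.
have T : triangle u u2 by split=> //; [apply: divr_ge0; lra|lra].
apply: (@fibre (sectors u u2)) => //.
- by move=> sv; exact: sector_hexa.
- by move=> sv sv' i i'; rewrite (sector_prP T i) (sector_prP T i').
move=> q Dq; rewrite sector_gap //; split=> [[/= h1 h2]|[h1 h2]].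
  by split=> //; apply/complement => //; rewrite -h2 -h1.
by split=> //=; rewrite /G h1 h2.
Qed.

(** On the folded edge only the unordered pair of gaps is invariant, so the larger gap is used, and
    the final fibre is the union of the sectors of both orders. *)
Let fibre_1 : acyclic M (phiV @` (D `&` [set q | G q = 1])).
Proof.
(* The tangent of an eighth of pi, the value of both gaps at the fixed point of the fold. *)
pose K : R := Num.sqrt 2 - 1.
have s0 : 0 <= Num.sqrt 2 :> R by exact: sqrtr_ge0.
have s2 : Num.sqrt 2 ^+ 2 = 2 :> R by rewrite sqr_sqrtr // ler0n.
have K1 : K <= 1.
  by rewrite leNgt; apply/negP; rewrite /K => h; have : 0 < (Num.sqrt 2 - 2) * Num.sqrt 2 :> R by [apply: mulr_gt0; lra]; lra.
have K0 : 0 <= K.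
  by rewrite leNgt; apply/negP; rewrite /K => h; have : 0 <= (1 - Num.sqrt 2) * (1 + Num.sqrt 2) :> R by [apply: mulr_ge0; lra]; lra.
have KK : (1 + K) ^+ 2 = 2 by rewrite /K addrC subrK.
apply: (@acyclic_leray R X S M (@hausdorff_GammaD R) pt4 phiV (fun q => Num.max (g1 q) (g2 q)) _ K 1) => //.
- by move=> q [[? _ _] _]; exact: phiV_cts.
- by move=> q _; have [? ?] := gaps_cts q; exact: continuous_max.
- move=> q [Dq /= Gq]; have [t1 t2 _] := tri Dq; have := mulr_ge0 t1 t2; move: Gq; rewrite /G => Gq p0.
  rewrite le_max ge_max; apply/andP; split; last by apply/andP; split; lra.
  apply/orP; have [k1|k1] := leP K (g1 q); [by left|right].
  rewrite leNgt; apply/negP => k2; have : (1 + g1 q) * (1 + g2 q) < (1 + K) ^+ 2.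
    by rewrite expr2; apply: ltr_pM => //; lra.
  by rewrite KK; lra.
- by move=> q q' [Dq _] [Dq' _] e; have [[-> ->]|[_ -> ->]] := inv Dq Dq' e => //; rewrite maxC.
move=> u /andP[uK u1]; rewrite -setIA; set u2 := (1 - u) / (1 + u).
have u0 : 0 <= u by lra.
have uE : u + u2 + u * u2 = 1 by apply/complement.
have u20 : 0 <= u2 by apply: divr_ge0; lra.
have u2u : u2 <= u.
  rewrite leNgt; apply/negP => h.
  have p1 : 0 <= (u - K) * (1 + u2) by apply: mulr_ge0; lra.
  by have : 0 < (1 + K) * (u2 - K) by [apply: mulr_gt0; lra]; lra.
have T : triangle u u2 by split=> //; lra.
have T' : triangle u2 u by split=> //; lra.
have In_cat (sv : R * R) (l1 l2 : seq (R * R)) : List.In sv (l1 ++ l2) <-> List.In sv l1 \/ List.In sv l2.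
  by elim: l1 => [|x l1 IH] /=; [split=> [|[]] //; right|rewrite IH or_assoc].
have fold : forall sv, List.In sv (sectors u u2 ++ sectors u2 u) ->
    prP (Phi 1 0 sv.1 sv.2) = prP (Phi 1 0 u (tsum u u2)).
  by move=> sv /In_cat[i|i]; rewrite ?(sector_prP T i) // (sector_prP T' i) -(sect_fold T).
apply: (@fibre (sectors u u2 ++ sectors u2 u)) => //.
- by move=> sv /In_cat[]; exact: sector_hexa.
- by move=> sv sv' /fold-> /fold->.
move=> q Dq; rewrite In_cat !sector_gap //; have [t1 t2 _] := tri Dq; split=> /=.
  move=> [h1 h2]; have [k|k] := leP (g1 q) (g2 q).
    have e : g2 q = u by rewrite -h2; apply/esym/max_r.
    by right; split=> //; apply/complement => //; move: h1; rewrite /G e; lra.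
  have e : g1 q = u by rewrite -h2; apply/esym/max_l/ltW.
  by left; split=> //; apply/complement => //; move: h1; rewrite /G e; lra.
rewrite /G => -[[-> ->]|[-> ->]]; (split; first lra); by [exact: max_l|exact: max_r].
Qed.

Lemma acyclic_piece : acyclic M (phiV @` D).
Proof.
apply: (@acyclic_leray R X S M (@hausdorff_GammaD R) pt4 phiV G _ 0 1) => //.
- by move=> q [? _ _]; exact: phiV_cts.
- by move=> q _; exact: G_cts.
- by move=> q /tri[t1 t2 t3]; have := mulr_ge0 t1 t2; rewrite /G => ?; apply/andP; split; lra.
- by move=> q q' Dq Dq' e; rewrite /G; have [[-> ->]|[_ -> ->]] := inv Dq Dq' e => //; ring.
by move=> g /andP[g0 gl]; have [lt|ge] := ltP g 1; [apply: fibre_lt1; rewrite g0|have -> : g = 1 by lra; exact: fibre_1].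
Qed.

End Piece.

Definition spherical : set X := ~` (phiV @` [set q | domP q /\ px q <= 0]).

Lemma phiV_surj x : exists2 q, domP q & phiV q = x.
Proof. by have [t [h [s [v [d <-]]]]] := Phi_surj x; exists (t, h, s, v). Qed.

Lemma closed_dom_lt (f : pt4 -> R) c : (forall q, ctsR q f) -> closed (phiV @` [set q | domP q /\ f q <= c]).
Proof.
move=> cf; apply: closed_phiV; last by move=> q [].
apply: (@closedI _ domP [set q | f q <= c]); first exact: closed_domP.
by apply: closed_leR => // x; exact: ctsR_cst.
Qed.

Lemma open_spherical : open spherical.
Proof. by apply: closed_openC; apply: closed_dom_lt; exact: px_cts. Qed.

Lemma sphericalE q : domP q -> spherical (phiV q) <-> 0 < px q.
Proof.
move=> d; split=> [V|tp [q' [d' t0] e]].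
  by rewrite ltNge; apply/negP => t0; apply: V; exists q.
by have [tE _] := prP_disjoint d d' (esym e) tp; lra.
Qed.

(** Exhaustion by the compact pieces t at least 1/(n + 1), h at most n; the open sets between them
    come from closed images of the complementary conditions. *)
Lemma acyclic_spherical : acyclic M spherical.
Proof.
pose b n : R := (n.+1)%:R^-1.
have b0 n : 0 < b n by rewrite invr_gt0.
have b1 n : b n <= 1 by rewrite invf_le1 // ler1n.
have bS n : b n.+1 < b n by rewrite ltf_pV2 ?posrE // ltr_nat.
pose O n : set X := spherical `&` ~` (phiV @` [set q | domP q /\ px q <= b n.+1]) `&`
  ~` (phiV @` [set q | domP q /\ - py q <= - n.+1%:R]).
apply: (@acyclic_exhaust X S M spherical (fun n => phiV @` [set q | [/\ domP q, b n <= px q & py q <= n%:R]]) O).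
- move=> n _ [q [d tq hq] <-]; have tp : 0 < px q by have := b0 n; lra.
  split; first split; first exact/sphericalE.
    by move=> [q' [d' t'] e]; have [tE _] := prP_disjoint d d' (esym e) tp; have := bS n; lra.
  move=> [q' [d' h'] e]; have [_ hE] := prP_disjoint d d' (esym e) tp.
  by have : n%:R < n.+1%:R :> R by [rewrite ltr_nat]; lra.
- move=> n x [[Vx n1] n2]; have [q d qx] := phiV_surj x; subst x; exists q => //; split=> //.
    by rewrite leNgt; apply/negP => h; apply: n1; exists q => //; split=> //; exact: ltW.
  by rewrite leNgt; apply/negP => h; apply: n2; exists q => //; split=> //; lra.
- move=> n; apply: openI; first apply: openI; first exact: open_spherical.
    by apply: closed_openC; apply: closed_dom_lt; exact: px_cts.
  by apply: closed_openC; apply: closed_dom_lt => q; apply: ctsRN; exact: py_cts.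
- apply/seteqP; split=> [x [n _ [q [d tq _] <-]]|x Vx].
    by apply/sphericalE => //; have := b0 n; lra.
  have [q d qx] := phiV_surj x; subst x; have tp := (sphericalE d).1 Vx.
  have [n1 h1] : exists n : nat, (px q)^-1 <= n%:R.
    by exists (Num.Def.archi_bound (px q)^-1); rewrite ltW // archi_boundP // invr_ge0 ltW.
  have [_ h0 _] := d.
  have [n2 h2] : exists n : nat, py q <= n%:R.
    by exists (Num.Def.archi_bound (py q)); rewrite ltW // archi_boundP.
  exists (n1 + n2)%N => //; exists q => //; split=> //.
    rewrite -[px q]invrK /b lef_pV2 ?posrE ?invr_gt0 //; apply: le_trans h1 _.
    by rewrite ler_nat; lia.
  by apply: le_trans h2 _; rewrite ler_nat leq_addl.
- by move=> n; apply: acyclic_piece; [rewrite b0 b1|exact: ler0n].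
Qed.

End Acyclic.
End SphericalPart.

(** * A neighbourhood of the mirror *)

Section MirrorPart.
Local Open Scope complex_scope.
Variable R : realType.
Local Notation C := R[i].
Local Notation pt4 := (pt4 R).
Implicit Types (x y e : R) (g : 'M[C]_3) (p q : pt4).

(** The witness is |cd|: c^2 - |cd| + d^2 bounds |cz + d|^2 from below on the modular domain. The
    last inequality is there to absorb the slack in [lattice_norm]. *)
Lemma lattice_int (c d : int) : (c != 0) || (d != 0) -> exists m : int,
  [/\ - m <= c * d, c * d <= m, 1 <= c ^+ 2 - m + d ^+ 2 &
      c ^+ 2 + 2 * m <= 4 * (c ^+ 2 - m + d ^+ 2)].
Proof.
move=> cd; exists `|c * d|; rewrite normrM.
have ca : `|c| ^+ 2 = c ^+ 2 by rewrite real_normK ?num_real.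
have da : `|d| ^+ 2 = d ^+ 2 by rewrite real_normK ?num_real.
have c0 := normr_ge0 c; have d0 := normr_ge0 d.
have cd' : 0 < `|c| + `|d| by lia.
rewrite -ca -da; split.
- by rewrite -normrM; lia.
- by rewrite -normrM; lia.
- move: `|c| `|d| c0 d0 cd' => a b a0 b0 ab; rewrite !expr2.
  have s0 := sqr_ge0 (2 * a - b); rewrite expr2 in s0.
  have [b1|b1] : b = 0 \/ 1 <= b by lia.
    by have : 0 <= (a - 1) * (a + 1) by [apply: mulr_ge0; lia]; rewrite b1; lia.
  by have : 0 <= (b - 1) * (b + 1) by [apply: mulr_ge0; lia]; lia.
- by have := sqr_ge0 (`|c| - `|d|); have := sqr_ge0 `|d|; rewrite !expr2; lia.
Qed.

(** For e = 0 this is the classical bound on the modular domain; the slack e serves to show that the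
    tube is open. *)
Lemma lattice_norm (c d : int) x y e : (c != 0) || (d != 0) ->
  - (1 / 2 + e) <= x <= 1 / 2 + e -> 1 - e <= x ^+ 2 + y ^+ 2 -> 0 <= e ->
  1 - 4 * e <= (c%:~R * x + d%:~R) ^+ 2 + c%:~R ^+ 2 * y ^+ 2.
Proof.
move=> /lattice_int[m [m1 m2 m3 m4]] /andP[x1 x2] z1 e0.
have k1 : - m%:~R <= c%:~R * d%:~R :> R by rewrite -intrM -rmorphN ler_int.
have k2 : c%:~R * d%:~R <= m%:~R :> R by rewrite -intrM ler_int.
have k3 : 1 <= c%:~R ^+ 2 - m%:~R + d%:~R ^+ 2 :> R.
  by rewrite -!rmorphXn -rmorphB -rmorphD /= -[1]/(1%:~R) ler_int.
have k4 : c%:~R ^+ 2 + 2 * m%:~R <= 4 * (c%:~R ^+ 2 - m%:~R + d%:~R ^+ 2) :> R.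
  by have := m4; rewrite -(ler_int R) !(rmorphD, rmorphM, rmorphXn, rmorphB, rmorphN).
move: (c%:~R : R) (d%:~R : R) (m%:~R : R) k1 k2 k3 k4 => {m1 m2 m3 m4}{}c {}d {}m k1 k2 k3 k4.
have [e4|e4] := leP (1 - 4 * e) 0.
  by have := sqr_ge0 (c * x + d); have := mulr_ge0 (sqr_ge0 c) (sqr_ge0 y); lra.
have p1 : 0 <= (m + c * d) * (1 / 2 + e + x) by apply: mulr_ge0; lra.
have p2 : 0 <= (m - c * d) * (1 / 2 + e - x) by apply: mulr_ge0; lra.
have p3 : 0 <= c ^+ 2 * (x ^+ 2 + y ^+ 2 - (1 - e)) by apply: mulr_ge0; [exact: sqr_ge0|lra].
have p4 : 0 <= e * (4 * (c ^+ 2 - m + d ^+ 2) - (c ^+ 2 + 2 * m)) by apply: mulr_ge0; lra.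
have p5 : 0 <= (1 - 4 * e) * (c ^+ 2 - m + d ^+ 2 - 1) by apply: mulr_ge0; lra.
lra.
Qed.

Lemma normsq_lattice (c d : int) (z : C) : normsq (c%:~R * z + d%:~R) =
  (c%:~R * complex.Re z + d%:~R) ^+ 2 + c%:~R ^+ 2 * complex.Im z ^+ 2.
Proof.
rewrite -(rmorph_int (@real_complex R) c) -(rmorph_int (@real_complex R) d).
by case: z => x y; rewrite /normsq /=; ring.
Qed.

Lemma lattice_argmin (z : C) : 0 < complex.Im z -> exists a b c d : int,
  a * d - b * c = 1 /\ forall a' b' c' d' : int, a' * d' - b' * c' = 1 ->
    normsq (c%:~R * z + d%:~R) <= normsq (c'%:~R * z + d'%:~R).
Proof.
move=> z0; pose S := [set k : int * int * int * int | k.1.1.1 * k.2 - k.1.1.2 * k.1.2 = 1].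
pose f (k : int * int * int * int) := normsq (k.1.2%:~R * z + k.2%:~R).
have S1 : S (1, 0, 0, 1) by [].
have [|k Sk kmin] := @finite_argmin R _ S f _ S1; last first.
  exists k.1.1.1, k.1.1.2, k.1.2, k.2; split=> // a' b' c' d' e.
  exact: kmin (a', b', c', d') e.
have f1 : f (1, 0, 0, 1) = 1 by rewrite /f normsq_lattice /=; ring.
set B := 1 / complex.Im z ^+ 2; set L := B + (2 + 2 * complex.Re z ^+ 2 * B).
have := finite_image (fun k : C => normsq ((complex.Re k)%:C * z + (complex.Im k)%:C)) (finite_gaussian L).
apply: sub_finite_set => _ [k [_ kf] <-]; exists (k.1.2%:~R +i* k.2%:~R); last first.
  by rewrite /f /= !rmorph_int.
split; first by exists k.1.2, k.2.
move: kf; rewrite f1 /f normsq_lattice /normsq /=.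
move: (k.1.2%:~R : R) (k.2%:~R : R) => c d h1.
have z2 : 0 < complex.Im z ^+ 2 by exact: exprn_gt0.
have cB : c ^+ 2 <= B by rewrite /B ler_pdivlMr //; have := sqr_ge0 (c * complex.Re z + d); lra.
have x2 := sqr_ge0 (complex.Re z).
have c2 := sqr_ge0 c.
have q1 : (c * complex.Re z + d) ^+ 2 <= 1 by have := mulr_ge0 c2 (ltW z2); lra.
have q2 : d ^+ 2 <= 2 * (c * complex.Re z + d) ^+ 2 + 2 * (c ^+ 2 * complex.Re z ^+ 2).
  by have := sqr_ge0 (c * complex.Re z + (c * complex.Re z + d)); lra.
have q3 : complex.Re z ^+ 2 * c ^+ 2 <= complex.Re z ^+ 2 * B by exact: ler_wpM2l.
by rewrite /L; lra.
Qed.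

(** Classical reduction of z. The last clause keeps the factor by which w is divided, from which it
    follows that the reduced point is still close to the mirror. *)
Lemma sl2_reduce p : siegel p -> exists q (c d : int), [/\ prP q = prP p, siegel q /\ (c != 0) || (d != 0),
  - (1 / 2) <= px q <= 1 / 2, 1 <= normsq (zc q) &
  normsq (wc q) * normsq (c%:~R * zc p + d%:~R) = normsq (wc p)].
Proof.
move=> sp; have y0 : 0 < complex.Im (zc p).
  by rewrite /zc /=; have := sqr_ge0 (pa p); have := sqr_ge0 (pb p); move: sp; rewrite /siegel /= /hgt; lra.
have [a [b [c [d [e m]]]]] := lattice_argmin y0.
have [l0 zE wE] := zc_act_sl2 sp e; set l := c%:~R * zc p + d%:~R in l0 zE wE m.
set q0 := act (sl2M R a b c d) p in zE wE.
have sq0 : siegel q0 by apply: act_siegel sp; exact: (proj1 (sl2M_Gamma R e)).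
have [n hn] := nearest_int (px q0).
have zq : zc (act (transM R n) q0) = zc q0 + n%:~R.
  by rewrite act_transM -(rmorph_int (@real_complex R)); apply: complex_eq; rewrite /zc /px /py /=; ring.
exists (act (transM R n) q0), c, d; split.
- rewrite !prP_act //; [exact: sl2M_Gamma|exact: transM_Gamma].
- split; first by apply: act_siegel sq0; exact: (proj1 (transM_Gamma R n)).
  by rewrite -negb_and; apply/negP => /andP[/eqP c0 /eqP d0]; move: e; rewrite c0 d0 !mulr0.
- by rewrite act_transM.
- have := m (- c) (- d) (a + n * c) (b + n * d).
  have -> : - c * (b + n * d) - - d * (a + n * c) = 1 by rewrite -e; ring.
  move=> /(_ erefl); rewrite zq zE.
  have -> : (a + n * c)%:~R * zc p + (b + n * d)%:~R =
      l * ((a%:~R * zc p + b%:~R) / l + n%:~R) :> C.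
    by rewrite !intrD !intrM mulrDr mulrCA mulfV // /l; ring.
  by rewrite normsqM -{1}[normsq l]mulr1 ler_pM2l // normsq_gt0.
- rewrite act_transM; have -> : wc (px q0 + n%:~R, py q0, pa q0, pb q0) = wc q0 by [].
  by rewrite wE -normsqM divfK.
Qed.

Lemma normsqN (z : C) : normsq (- z) = normsq z.
Proof. by case: z => a b; rewrite /normsq /=; ring. Qed.

Definition near_mirror p := 3 / 4 <= hgt p /\ normsq (wc p) <= 1 / 16.

(** The ordering of heights bounds the middle functional by |f|^2 at most 1/8. A nonzero outer entry
    is divisible by 1 + i, of norm at least 2, but [functional_form] leaves the first at most 5/4,
    and once it is 0 the last is small too. *)
Lemma mirror_near g p p' : Gamma g -> act g p = p' -> near_mirror p -> near_mirror p' ->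
  hgt p <= hgt p' -> g o1 o0 = 0 /\ g o1 o2 = 0.
Proof.
move=> gG gE [h1 w1] [h2 w2] hh; have sp : siegel p by rewrite /siegel /=; lra.
have l0 := lam_neq0 (proj1 gG) sp.
have hE := hgt_act (proj1 gG) sp; rewrite gE in hE.
set L := normsq (lam g p) in hE.
have L0 : 0 < L by rewrite normsq_gt0.
have L1 : L <= 1.
  rewrite leNgt; apply/negP => L1; have : 0 < (L - 1) * hgt p' by apply: mulr_gt0; lra.
  move: hE; rewrite -/L; lra.
have rv := vec_act (proj1 gG) sp.
have fE : functional (g o1 o0) (g o1 o1) (g o1 o2) p = lam g p * ((1 +i* 1) * wc p').
  rewrite -mulmx_vec -gE -vec1 rv.
  by rewrite mxE.
have n2 : normsq (1 +i* 1 : C) = 2 by rewrite /normsq /=; ring.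
have fb : normsq (functional (g o1 o0) (g o1 o1) (g o1 o2) p) <= 1 / 8.
  rewrite fE !normsqM n2 -/L; have := normsq_ge0 (wc p') => w0.
  have : 0 <= (1 - L) * normsq (wc p') by apply: mulr_ge0; lra.
  lra.
have [a1 [a2 [b1 [b2 [c1 [c2 [A B D nu]]]]]]] := Gamma_row2 gG.
have [_ r2 _ _] := SU21_rows (proj1 gG).
have big (m n : int) : (1 +i* 1 : C) * (m%:~R +i* n%:~R) != 0 -> 2 <= normsq ((1 +i* 1 : C) * (m%:~R +i* n%:~R)).
  rewrite mulf_eq0 negb_or => /andP[_ k0]; rewrite normsqM n2.
  have := gaussian_normsq_ge1 _ k0 => /(_ (gaussian_mk R m n)); lra.
have A0 : g o1 o0 = 0.
  apply/eqP; apply: contraT => A0; have := big a1 a2; rewrite -A => /(_ A0) A2.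
  have f := functional_form p r2; set f0 := functional _ _ _ p in f fb.
  have i := @Im_le_normsq R (g o1 o0) f0 (1 / 2) ltac:(lra).
  have s0 := normsq_ge0 (g o1 o1 + 'i * g o1 o0 * conjc ((1 +i* 1) * wc p)).
  have : 0 <= (hgt p - 3 / 4) * normsq (g o1 o0) by apply: mulr_ge0; [lra|exact: normsq_ge0].
  have i2 : ((1 / 2 : R)^-1) = 2 by field.
  rewrite i2 in i; lra.
split=> //; apply/eqP; apply: contraT => D0; have := big c1 c2; rewrite -D => /(_ D0) D2.
rewrite A0 mul0r /= mulr0 addr0 in r2.
have := normsqD_le (functional (g o1 o0) (g o1 o1) (g o1 o2) p) (- (g o1 o1 * ((1 +i* 1) * wc p))).
rewrite {1}/functional A0 mul0r add0r addrAC subrr add0r normsqN !normsqM r2 n2.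
rewrite A0 in fb; move=> k; suff : (1 : R) = 0 by move/eqP; rewrite oner_eq0.
lra.
Qed.

(** Division by the gcd of c1 and d1 gives a primitive pair, and a Bezout relation supplies the
    second multiplier. *)
Lemma parallel_int (c1 c2 d1 d2 : int) : c1 * d2 = c2 * d1 ->
  exists k l c d : int, [/\ c1 = k * c, c2 = l * c, d1 = k * d & d2 = l * d].
Proof.
move=> e; have [g0|g0] := eqVneq (gcdz c1 d1) 0.
  move/eqP: g0; rewrite gcdz_eq0 => /andP[/eqP-> /eqP->].
  by exists 0, 1, c2, d2; rewrite !mul0r !mul1r.
have /dvdzP[c cE] := dvdz_gcdl c1 d1; have /dvdzP[d dE] := dvdz_gcdr c1 d1.
have [u [v uv]] := Bezoutz c1 d1; set k := gcdz c1 d1 in g0 cE dE uv.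
have uv1 : u * c + v * d = 1.
  by apply: (mulIf g0); rewrite mul1r mulrDl -!mulrA -cE -dE.
have e' : c * d2 = c2 * d by apply: (mulIf g0); rewrite mulrAC -cE e dE; ring.
exists k, (u * c2 + v * d2), c, d; split; rewrite 1?mulrC //.
- have -> : c * (u * c2 + v * d2) = u * c * c2 + v * (c * d2) by ring.
  by rewrite e' -[LHS]mul1r -uv1; ring.
- have -> : d * (u * c2 + v * d2) = u * (c2 * d) + v * d * d2 by ring.
  by rewrite -e' -[LHS]mul1r -uv1; ring.
Qed.

Lemma unit_int (x y : int) : x ^+ 2 + y ^+ 2 = 1 ->
  [\/ x = 1 /\ y = 0, x = -1 /\ y = 0, x = 0 /\ y = 1 | x = 0 /\ y = -1].
Proof.
move=> e; have x1 : -1 <= x <= 1 by nia.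
have [hx|hx|hx] : [\/ x = -1, x = 0 | x = 1].
  by have [] : x = -1 \/ (x = 0 \/ x = 1); [lia|constructor 1|case; [constructor 2|constructor 3]].
- by constructor 2; split=> //; rewrite hx in e; nia.
- have : y = 1 \/ y = -1 by rewrite hx in e; nia.
  by case; [constructor 3|constructor 4].
- by constructor 1; split=> //; rewrite hx in e; nia.
Qed.

Lemma unit_pow4 (x y : int) : x ^+ 2 + y ^+ 2 = 1 -> (x%:~R +i* y%:~R : C) ^+ 4 = 1.
Proof.
by case/unit_int => -[-> ->]; apply: complex_eq; rewrite /= ?rmorphN /=; ring.
Qed.

(** Isotropy makes the real and imaginary parts of each outer row parallel integer vectors. The
    bottom row is thus a Gaussian multiple of a real row; the pairing of the two rows shows that the
    multiplier is a unit, common to both. *)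
Lemma mirror_sl2 g : Gamma g -> g o1 o0 = 0 -> g o1 o2 = 0 ->
  exists (a b c d : int) (v : C), [/\ a * d - b * c = 1, v ^+ 4 = 1, (g o1 o1) ^+ 4 = 1,
    [/\ g o0 o0 = v * a%:~R, g o0 o2 = v * b%:~R, g o2 o0 = v * c%:~R & g o2 o2 = v * d%:~R] &
    g o2 o1 = 0 /\ g o0 o1 = 0].
Proof.
move=> gG A0 D0; have [b1 [b2 [c1 [c2 [d1 [d2 [B gc gd [nB cd] [g21 g01]]]]]]]] := mirror_struct gG A0 D0.
have [gS gZ] := gG; have [r0 _ _ _] := SU21_rows gS; have [rr _ _ _] := SU21_rows2 gS.
have [p1 [p2 gA]] := gZ o0 o0; have [q1 [q2 gQ]] := gZ o0 o2.
have [k [l [c [d [e1 e2 e3 e4]]]]] := @parallel_int c1 c2 d1 d2 ltac:(lia).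
rewrite g01 gA gQ !mul0r subr0 in rr r0 *; rewrite gc gd e1 e2 e3 e4 in rr *.
have i1 := congr1 (@complex.Re R) rr; have i2 := congr1 (@complex.Im R) rr.
rewrite /= in i1 i2.
have E1 : k * (p1 * d - q1 * c) + l * (p2 * d - q2 * c) = 1.
  apply/eqP; rewrite -(eqr_int R); apply/eqP; rewrite !(rmorphD, rmorphM, rmorphB) /=; move: i2.
  by rewrite !intrM; lra.
have E2 : k * (p2 * d - q2 * c) - l * (p1 * d - q1 * c) = 0.
  apply/eqP; rewrite -(eqr_int R); apply/eqP; rewrite !(rmorphD, rmorphM, rmorphB) /=; move: i1.
  by rewrite !intrM; lra.
have E3 : p2 * q1 - p1 * q2 = 0.
  apply/eqP; rewrite -(eqr_int R); apply/eqP; rewrite !(rmorphM, rmorphB) /=; move: r0.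
  by rewrite normsq0 /=; lra.
have kl : k ^+ 2 + l ^+ 2 = 1.
  have : (k ^+ 2 + l ^+ 2) * ((p1 * d - q1 * c) ^+ 2 + (p2 * d - q2 * c) ^+ 2) = 1.
    have -> : (k ^+ 2 + l ^+ 2) * ((p1 * d - q1 * c) ^+ 2 + (p2 * d - q2 * c) ^+ 2) =
      (k * (p1 * d - q1 * c) + l * (p2 * d - q2 * c)) ^+ 2 +
      (k * (p2 * d - q2 * c) - l * (p1 * d - q1 * c)) ^+ 2 by ring.
    by rewrite E1 E2.
  have s0 : 0 <= k ^+ 2 + l ^+ 2 by rewrite addr_ge0 ?sqr_ge0.
  have t0 : 0 <= (p1 * d - q1 * c) ^+ 2 + (p2 * d - q2 * c) ^+ 2 by rewrite addr_ge0 ?sqr_ge0.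
  move: s0 t0; set x := k ^+ 2 + _; set y := _ + _; move: x y => x y; clear => x0 y0 xy.
  have [e|[->|x2]] : x = 0 \/ (x = 1 \/ 2 <= x) by lia.
  - by rewrite e mul0r in xy.
  - by [].
  have [y1|y1] : y = 0 \/ 1 <= y by lia.
    by rewrite y1 mulr0 in xy.
  by have : 2 * 1 <= x * y by [apply: ler_pM]; rewrite xy.
set a := p1 * k + p2 * l; set a' := p2 * k - p1 * l; set b := q1 * k + q2 * l; set b' := q2 * k - q1 * l.
have H1 : a * d - b * c = 1 by rewrite -E1 /a /b; ring.
have H2 : a' * d = b' * c by apply/eqP; rewrite -subr_eq0 -E2 /a' /b'; apply/eqP; ring.
have H3 : a' * b = a * b'.
  apply/eqP; rewrite -subr_eq0; have -> : a' * b - a * b' = (k ^+ 2 + l ^+ 2) * (p2 * q1 - p1 * q2).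
    by rewrite /a /a' /b /b'; ring.
  by rewrite E3 mulr0.
have a0 : a' = 0.
  rewrite -[a']mulr1 -H1; have -> : a' * (a * d - b * c) = a * (a' * d) - c * (a' * b) by ring.
  by rewrite H2 H3; ring.
have b0 : b' = 0.
  rewrite -[b']mulr1 -H1; have -> : b' * (a * d - b * c) = (a * b') * d - b * (b' * c) by ring.
  by rewrite -H2 -H3; ring.
have P1 : p1 = k * a by rewrite -[p1]mulr1 -kl; have -> : k * a = k * a - l * a' by [rewrite a0; ring]; rewrite /a /a'; ring.
have P2 : p2 = l * a by rewrite -[p2]mulr1 -kl; have -> : l * a = l * a + k * a' by [rewrite a0; ring]; rewrite /a /a'; ring.
have Q1 : q1 = k * b by rewrite -[q1]mulr1 -kl; have -> : k * b = k * b - l * b' by [rewrite b0; ring]; rewrite /b /b'; ring.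
have Q2 : q2 = l * b by rewrite -[q2]mulr1 -kl; have -> : l * b = l * b + k * b' by [rewrite b0; ring]; rewrite /b /b'; ring.
have scale (n : int) : ((k * n)%:~R +i* (l * n)%:~R : C) = (k%:~R +i* l%:~R) * n%:~R.
  by rewrite -[n%:~R in RHS](rmorph_int (@real_complex R)) !intrM; apply: complex_eq; rewrite /=; ring.
exists a, b, c, d, (k%:~R +i* l%:~R); split=> //.
- exact: unit_pow4.
- by rewrite B unit_pow4.
by split; rewrite -scale // -?P1 -?P2 -?Q1 -?Q2.
Qed.

Definition funD : set pt4 :=
  [set p | [/\ - (1 / 2) <= px p <= 1 / 2, 0 <= py p, 1 <= normsq (zc p) & normsq (wc p) <= 1 / 16]].

Lemma funD_bounds p : funD p -> [/\ 3 / 4 <= py p ^+ 2, 13 / 16 <= py p & near_mirror p].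
Proof.
move=> [/andP[x1 x2] y0 z1 w1]; have y2 : 3 / 4 <= py p ^+ 2.
  have : 0 <= (1 / 2 - px p) * (1 / 2 + px p) by apply: mulr_ge0; lra.
  by move: z1; rewrite /normsq /zc /=; lra.
have y1 : 13 / 16 <= py p.
  rewrite leNgt; apply/negP => y1; have : 0 <= (13 / 16 - py p) * (13 / 16 + py p) by apply: mulr_ge0; lra.
  lra.
by split=> //; split=> //; move: w1; rewrite /hgt /normsq /wc /=; lra.
Qed.

Lemma siegel_funD p : funD p -> siegel p.
Proof. by move=> /funD_bounds[_ _ [h _]]; rewrite /siegel /=; lra. Qed.

Lemma mirror_rel p p' : funD p -> funD p' -> prP p = prP p' -> hgt p <= hgt p' ->
  exists (a b c d : int) (u : C), [/\ a * d - b * c = 1, u ^+ 4 = 1, c%:~R * zc p + d%:~R != 0,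
    zc p' * (c%:~R * zc p + d%:~R) = a%:~R * zc p + b%:~R &
    wc p' * (c%:~R * zc p + d%:~R) = u * wc p].
Proof.
move=> F F' /(prP_eq (siegel_funD F) (siegel_funD F'))[g gG gE] hh.
have [_ _ n] := funD_bounds F; have [_ _ n'] := funD_bounds F'.
have [A0 D0] := mirror_near gG gE n n' hh.
have [a [b [c [d [v [e v4 B4 [g00 g02 g20 g22] [g21 g01]]]]]]] := mirror_sl2 gG A0 D0.
have l0 := lam_neq0 (proj1 gG) (siegel_funD F).
have rv := vec_act (proj1 gG) (siegel_funD F); rewrite gE in rv.
have v0 : v != 0 by apply/eqP => v0; move: v4; rewrite v0 expr0n /= => /eqP; rewrite eq_sym oner_eq0.
have lE : lam g p = v * (c%:~R * zc p + d%:~R).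
  by rewrite /lam mulmx_vec /functional g21 g20 g22; ring.
rewrite lE in l0 rv.
have r0 := congr1 (fun u : 'cV[C]_3 => u o0 0) rv; have r1 := congr1 (fun u : 'cV[C]_3 => u o1 0) rv.
rewrite /= mulmx_vec /functional mxE vec0 g00 g01 g02 in r0.
rewrite /= mulmx_vec /functional mxE vec1 A0 D0 in r1.
exists a, b, c, d, (g o1 o1 / v); split=> //.
- by rewrite expr_div_n B4 v4 divr1.
- by move: l0; rewrite mulf_eq0 negb_or => /andP[].
- by apply: (mulfI v0); move: r0; rewrite mul0r addr0 => r0; rewrite mulrCA mulrA mulrC [RHS]mulrDr !mulrA r0; ring.
- apply: (mulfI v0); apply: (mulfI (onei_neq0 R)).
  have -> : (1 +i* 1) * (v * (g o1 o1 / v * wc p)) = g o1 o1 * ((1 +i* 1) * wc p) * (v / v) by ring.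
  by rewrite divff // mulr1; move: r1; rewrite mul0r addr0 add0r => ->; ring.
Qed.

(** The identifications of the modular domain: none, the vertical sides, the unit arc, and the
    vertices, where only the twelfth power of w is retained. A rotation of w by a fourth root of
    unity is always allowed. *)
Definition rel_funD p p' := exists2 u : C, u ^+ 4 = 1 &
  [\/ zc p' = zc p /\ wc p' = u * wc p,
      [/\ px p ^+ 2 = 1 / 4, px p' = - px p, py p' = py p & wc p' = u * wc p],
      [/\ normsq (zc p) = 1, px p' = - px p, py p' = py p & wc p' * zc p = u * wc p] |
      [/\ px p ^+ 2 = 1 / 4, px p' ^+ 2 = 1 / 4, normsq (zc p) = 1, py p' = py p & wc p' ^+ 12 = wc p ^+ 12]].

(** The cube of such a v is 1 or -1. *)
Lemma sixth_root (v : C) : complex.Re v ^+ 2 = 1 / 4 -> complex.Im v ^+ 2 = 3 / 4 -> v ^+ 12 = 1.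
Proof.
move=> e1 e2; have v3 : v ^+ 3 = (- (2 * complex.Re v))%:C.
  move: e1 e2; case: v => x y /= e1 e2; rewrite !exprS expr0 mulr1; apply: complex_eq => /=.
    have -> : x * (x * x - y * y) - y * (x * y + y * x) = x * (x ^+ 2 - 3 * y ^+ 2) by ring.
    by rewrite e1 e2; field.
  have -> : x * (x * y + y * x) + y * (x * x - y * y) = y * (3 * x ^+ 2 - y ^+ 2) by ring.
  by rewrite e1 e2; field.
have e4 : (- (2 * complex.Re v)) ^+ 4 = 1.
  by have -> : (- (2 * complex.Re v)) ^+ 4 = 16 * (complex.Re v ^+ 2) ^+ 2 by [ring]; rewrite e1; field.
by rewrite (_ : 12 = 3 * 4)%N // exprM v3 -rmorphXn /= e4.
Qed.

Lemma unit_sq (c : int) y : c%:~R ^+ 2 * y ^+ 2 <= 1 -> 3 / 4 <= y ^+ 2 -> c = 0 \/ c%:~R ^+ 2 = 1 :> R.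
Proof.
move=> h1 h2; have c2 : c%:~R ^+ 2 < 2 :> R.
  rewrite ltNge; apply/negP => c2; have : 0 <= (c%:~R ^+ 2 - 2) * y ^+ 2 by apply: mulr_ge0; lra.
  lra.
have {}c2 : c ^+ 2 < 2 by rewrite -(ltr_int R) rmorphXn.
have [->|[->|->]] : c = 0 \/ (c = 1 \/ c = -1) by nia.
- by left.
- by right; rewrite expr1n.
- by right; rewrite rmorphN /= sqrrN expr1n.
Qed.

Lemma unit_shift (n : int) x x' : -(1 / 2) <= x <= 1 / 2 -> -(1 / 2) <= x' <= 1 / 2 -> x' + x = n%:~R ->
  n = 0 \/ x ^+ 2 = 1 / 4 /\ x' ^+ 2 = 1 / 4 /\ x' = x.
Proof.
move=> /andP[x1 x2] /andP[y1 y2] e.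
have n1 : - 1 <= n by rewrite -(ler_int R) rmorphN /= -e; lra.
have n2 : n <= 1 by rewrite -(ler_int R) /= -e; lra.
have [n0|[n0|n0]] : n = 0 \/ (n = 1 \/ n = -1) by lia.
- by left.
- right; rewrite n0 in e; have -> : x = 1 / 2 by lra.
  by have -> : x' = 1 / 2 by [lra]; do ![split]; field.
- right; rewrite n0 rmorphN /= in e; have -> : x = - (1 / 2) by lra.
  by have -> : x' = - (1 / 2) by [lra]; do ![split]; field.
Qed.

Lemma sqr_half (x : R) : - (1 / 2) <= x <= 1 / 2 -> x ^+ 2 <= 1 / 4.
Proof.
by move=> /andP[? ?]; have : 0 <= (1 / 2 - x) * (1 / 2 + x) by [apply: mulr_ge0; lra]; lra.
Qed.

(** t^2 is at most D and at least D^2. It is applied with D = d^2, t twice the cross term of |cz +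
    d|^2 up to normalization, and x the square of the real part. *)
Lemma vertex_norm (t D x : R) : 0 <= D -> D <= - t -> t ^+ 2 = 4 * D * x -> x <= 1 / 4 -> D <= 1.
Proof.
move=> D0 Dt tE x4; rewrite leNgt; apply/negP => D1.
have : 0 <= (- t - D) * (- t + D) by [apply: mulr_ge0; lra].
have : 0 <= D * (1 / 4 - x) by [apply: mulr_ge0; lra].
have : 0 < D * (D - 1) by [apply: mulr_gt0; lra].
by lra.
Qed.

Lemma vertex_trace (t x : R) : 1 <= - t -> t ^+ 2 = 4 * 1 * x -> x <= 1 / 4 -> t = -1.
Proof.
move=> t1 tE x4; have : 0 <= (- t - 1) * (- t + 1) by [apply: mulr_ge0; lra].
by have := sqr_ge0 (- t - 1); lra.
Qed.

(** Once |cz + d| = 1, c is 0, 1 or -1 because y^2 is at least 3/4. Then c = 0 gives the sides, d =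
    0 the arc, and both nonzero the vertices. *)
Lemma funD_sl2 p p' (a b c d : int) (u : C) : funD p -> funD p' -> a * d - b * c = 1 -> u ^+ 4 = 1 ->
  c%:~R * zc p + d%:~R != 0 -> zc p' * (c%:~R * zc p + d%:~R) = a%:~R * zc p + b%:~R ->
  wc p' * (c%:~R * zc p + d%:~R) = u * wc p -> rel_funD p p'.
Proof.
move=> F F' e u4 l0 zE wE; have [y2 y1 _] := funD_bounds F; have [y2' y1' _] := funD_bounds F'.
have [X Y Z _] := F; have [X' Y' Z' _] := F'.
set l := c%:~R * zc p + d%:~R in l0 zE wE.
have eC : a%:~R * d%:~R - b%:~R * c%:~R = 1 :> C by rewrite -!intrM -intrB e.
have ll : l * ((- c)%:~R * zc p' + a%:~R) = 1.
  have -> : l * ((- c)%:~R * zc p' + a%:~R) = - c%:~R * (zc p' * l) + a%:~R * l by rewrite rmorphN /=; ring.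
  by rewrite zE /l -[RHS]eC; ring.
have nl (m n : int) q : (m != 0) || (n != 0) -> funD q -> 1 <= normsq (m%:~R * zc q + n%:~R).
  move=> mn [hx _ hz _]; rewrite normsq_lattice.
  have := @lattice_norm m n (px q) (py q) 0 mn; rewrite addr0 mulr0 subr0; apply=> //.
have cd : (c != 0) || (d != 0).
  by rewrite -negb_and; apply/negP => /andP[/eqP c0 /eqP d0]; move: e; rewrite c0 d0 !mulr0.
have ca : (- c != 0) || (a != 0).
  by rewrite oppr_eq0 -negb_and; apply/negP => /andP[/eqP c0 /eqP d0]; move: e; rewrite c0 d0 mulr0 mul0r.
have n1 := nl _ _ _ cd F; have n2 := nl _ _ _ ca F'; rewrite -/l in n1.
have nn : normsq l * normsq ((- c)%:~R * zc p' + a%:~R) = 1 by rewrite -normsqM ll /normsq /=; ring.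
(* The factors cz + d and -cz' + a of a transformation and its inverse multiply to 1, and each has
   modulus at least 1. *)
have N1 : normsq l = 1.
  have : 0 <= (normsq l - 1) * normsq ((- c)%:~R * zc p' + a%:~R) by apply: mulr_ge0; [lra|exact: normsq_ge0].
  have : 0 <= normsq l * (normsq ((- c)%:~R * zc p' + a%:~R) - 1) by apply: mulr_ge0; [exact: normsq_ge0|lra].
  lra.
have lc : (- c)%:~R * zc p' + a%:~R = conjc l.
  apply: (mulfI l0); rewrite ll; move: N1; case: (l) => s t; rewrite /normsq /= => N1.
  by apply: complex_eq; rewrite /=; move: N1; clear; lra.
have reZ (m n : int) q : complex.Re (m%:~R * zc q + n%:~R) = m%:~R * px q + n%:~R.
  by rewrite -(rmorph_int (@real_complex R) m) -(rmorph_int (@real_complex R) n) /=; ring.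
have imZ (m n : int) q : complex.Im (m%:~R * zc q + n%:~R) = m%:~R * py q.
  by rewrite -(rmorph_int (@real_complex R) m) -(rmorph_int (@real_complex R) n) /=; ring.
have lr : - c%:~R * px p' + a%:~R = c%:~R * px p + d%:~R.
  have := congr1 (@complex.Re R) lc; rewrite reZ rmorphN /= => ->.
  by rewrite -reZ -/l; case: (l).
have li : c%:~R * py p' = c%:~R * py p.
  have := congr1 (@complex.Im R) lc; rewrite imZ rmorphN /=.
  have -> : complex.Im (conjc l) = - complex.Im l by case: (l).
  by rewrite /l imZ mulNr => /oppr_inj.
have N1' := N1; rewrite normsq_lattice /zc /= in N1'.
have zN q : normsq (zc q) = px q ^+ 2 + py q ^+ 2 by [].
have [c0|c2] := @unit_sq c (py p) ltac:(by have := sqr_ge0 (c%:~R * px p + d%:~R : R); move: N1'; clear; lra) y2.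
  have l_d : l = d%:~R by rewrite /l c0 mul0r add0r.
  have d2 : d%:~R * d%:~R = 1 :> R by move: N1'; rewrite c0; lra.
  have d2C : d%:~R * d%:~R = 1 :> C by rewrite -(rmorph_int (@real_complex R)) -rmorphM /= d2.
  have ad : a%:~R = d%:~R :> R by move: lr; rewrite c0; lra.
  have adC : a%:~R = d%:~R :> C by rewrite -!(rmorph_int (@real_complex R)) ad.
  have zE' : zc p' = zc p + (b * d)%:~R.
    have <- : zc p' * (d%:~R * d%:~R) = zc p' by rewrite d2C mulr1.
    by rewrite mulrA -l_d zE l_d adC intrM mulrDl mulrAC d2C mul1r.
  have wE' : wc p' = (u * d%:~R) * wc p.
    have <- : wc p' * (d%:~R * d%:~R) = wc p' by rewrite d2C mulr1.
    by rewrite mulrA -l_d wE l_d; ring.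
  exists (u * d%:~R).
    have -> : (u * d%:~R) ^+ 4 = u ^+ 4 * ((d%:~R * d%:~R) * (d%:~R * d%:~R)) by ring.
    by rewrite d2C u4 !mulr1.
  have xE : px p' = px p + (b * d)%:~R.
    have := congr1 (@complex.Re R) zE'; rewrite -(rmorph_int (@real_complex R)) /zc /= => ->.
    by [].
  have yE : py p' = py p.
    by have := congr1 (@complex.Im R) zE'; rewrite -(rmorph_int (@real_complex R)) /zc /= addr0.
  have [b0|[h1 [h2 h3]]] := @unit_shift (b * d) (- px p) (px p') ltac:(by rewrite lerN2 lerNl andbC) X' ltac:(by rewrite xE; ring).
    by constructor 1; split=> //; rewrite zE' b0 addr0.
  by constructor 2; split=> //; rewrite -h1 sqrrN.
have yE : py p' = py p.
  have c0 : c%:~R != 0 :> R by apply/eqP => c0; move: c2; rewrite c0 expr0n /= => /eqP; rewrite eq_sym oner_eq0.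
  exact: (mulfI c0).
have d0 : d%:~R ^+ 2 <= - (2 * (c%:~R * d%:~R) * px p) by move: N1' Z; rewrite zN; have : c%:~R ^+ 2 * (px p ^+ 2 + py p ^+ 2) = px p ^+ 2 + py p ^+ 2 by [rewrite c2 mul1r]; clear; lra.
have x2 := sqr_half X.
have D0 := sqr_ge0 (d%:~R : R).
have sq : (2 * (c%:~R * d%:~R) * px p) ^+ 2 = 4 * d%:~R ^+ 2 * px p ^+ 2 :> R.
  by rewrite !exprMn c2; ring.
have vtx : complex.Re l ^+ 2 = 1 / 4 -> complex.Im l ^+ 2 = 3 / 4 -> wc p' ^+ 12 = wc p ^+ 12.
  move=> h1 h2; have l12 := sixth_root h1 h2; have := congr1 (fun w => w ^+ 12) wE.
  by rewrite /= !exprMn l12 mulr1 => ->; rewrite (_ : 12 = 4 * 3)%N // exprM u4 expr1n mul1r.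
have iml : complex.Im l ^+ 2 = py p ^+ 2 by rewrite /l imZ exprMn c2 mul1r.
have [d00|d2] := @unit_sq d 1 ltac:(rewrite expr1n mulr1; exact: vertex_norm D0 d0 sq x2)
    ltac:(rewrite expr1n; clear; lra).
  have z1 : px p ^+ 2 + py p ^+ 2 = 1.
    have this : (c%:~R * px p + d%:~R) ^+ 2 = px p ^+ 2 by rewrite d00 addr0 exprMn c2 mul1r.
    by move: N1' this; rewrite c2; clear; lra.
  have cC : c%:~R * c%:~R = 1 :> C by rewrite -(rmorph_int (@real_complex R)) -rmorphM /= -expr2 c2.
  have xx : px p' + px p = (a * c)%:~R.
    have -> : px p' + px p = c%:~R ^+ 2 * (px p' + px p) by rewrite c2 mul1r.
    rewrite intrM; have := lr; rewrite d00 addr0 => lr'.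
    have -> : c%:~R ^+ 2 * (px p' + px p) = c%:~R * (c%:~R * px p') + c%:~R * (c%:~R * px p) by ring.
    by rewrite -lr'; ring.
  exists (u * c%:~R).
    have -> : (u * c%:~R) ^+ 4 = u ^+ 4 * ((c%:~R * c%:~R) * (c%:~R * c%:~R)) by ring.
    by rewrite cC u4 !mulr1.
  have [n0|[h1 [h2 h3]]] := unit_shift X X' xx.
    constructor 3; split=> //; first by move/eqP: xx; rewrite n0 addr_eq0 => /eqP.
    have -> : u * c%:~R * wc p = c%:~R * (u * wc p) by ring.
    rewrite -wE /l d00 addr0; have -> : c%:~R * (wc p' * (c%:~R * zc p)) = (c%:~R * c%:~R) * (wc p' * zc p) by ring.
    by rewrite cC mul1r.
  constructor 4; split=> //; apply: vtx; last by rewrite iml; move: z1 h1; clear; lra.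
  rewrite /l reZ d00 addr0 exprMn c2.
  by rewrite -[RHS]h1 mul1r.
set t := 2 * (c%:~R * d%:~R) * px p in d0 sq.
have t1 : t = -1 by rewrite d2 in sq d0; exact: vertex_trace d0 sq x2.
have h1 : px p ^+ 2 = 1 / 4 by move: sq; rewrite t1 d2; clear; lra.
have rel : complex.Re l ^+ 2 = 1 / 4.
  rewrite /l reZ; have -> : (c%:~R * px p + d%:~R) ^+ 2 = c%:~R ^+ 2 * px p ^+ 2 + t + d%:~R ^+ 2 by rewrite /t; ring.
  by rewrite c2 d2 t1 h1; field.
have yy : py p ^+ 2 = 3 / 4 by move: N1; rewrite /normsq rel iml; clear; lra.
exists u => //; constructor 4; split=> //.
- by move: (sqr_half X') Z'; rewrite zN yE yy; clear; lra.
- by rewrite zN h1 yy; field.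
- by apply: vtx => //; rewrite iml.
Qed.

Lemma rel_funD_sym p p' : rel_funD p p' -> rel_funD p' p.
Proof.
move=> [u u4]; have u3 : u ^+ 3 * u = 1 by rewrite -exprSr.
have u34 : (u ^+ 3) ^+ 4 = 1 by rewrite -exprM mulnC exprM u4 expr1n.
have back w w' : w' = u * w -> w = u ^+ 3 * w' by move=> ->; rewrite mulrA u3 mul1r.
case=> [[e1 e2]|[e1 e2 e3 e4]|[e1 e2 e3 e4]|[e1 e2 e3 e4 e5]].
- by exists (u ^+ 3) => //; constructor 1; split=> //; exact: back.
- by exists (u ^+ 3) => //; constructor 2; split; rewrite ?e2 ?sqrrN ?opprK //; exact: back.
- exists (- u ^+ 3); first by rewrite exprNn u34 mulr1 (_ : 4 = 2 * 2)%N // exprM sqrrN expr1n expr1n.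
  have zz : zc p * zc p' = - 1.
    move: e1; rewrite /zc e2 e3 /normsq /= => e1; apply: complex_eq; rewrite /=; first by lra.
    by ring.
  constructor 3; split=> //; rewrite ?e2 ?opprK //.
    by rewrite -e1 /zc e2 e3 /normsq /=; ring.
  by rewrite (back _ _ e4) mulNr -mulrN -mulN1r -zz; ring.
- exists 1; first by rewrite expr1n.
  constructor 4; split=> //; first by rewrite -e3 /zc /normsq /= e4 e1 e2.
Qed.

Lemma funD_rel p p' : funD p -> funD p' -> prP p = prP p' -> rel_funD p p'.
Proof.
move=> F F' e; have [hh|hh] := leP (hgt p) (hgt p').
  by have [a [b [c [d [u [? ? ? ? ?]]]]]] := mirror_rel F F' e hh; exact: (@funD_sl2 p p' a b c d u).
have [a [b [c [d [u [? ? ? ? ?]]]]]] := mirror_rel F' F (esym e) (ltW hh).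
by apply: rel_funD_sym; exact: (@funD_sl2 p' p a b c d u).
Qed.

End MirrorPart.

(** * The tube around the mirror and its invariant function *)

Section Tube.
Local Open Scope complex_scope.
Variable R : realType.
Local Notation C := R[i].
Local Notation pt4 := (pt4 R).
Local Notation X := (GammaD R).
Implicit Types (x y e : R) (g : 'M[C]_3) (p q : pt4) (u z w : C).

Definition mk z w : pt4 := (complex.Re z, complex.Im z, complex.Re w, complex.Im w).
Lemma zc_mk z w : zc (mk z w) = z. Proof. by case: z. Qed.
Lemma wc_mk z w : wc (mk z w) = w. Proof. by case: w. Qed.
Lemma mkE p : mk (zc p) (wc p) = p. Proof. by apply: pt4_eq; rewrite ?zc_mk ?wc_mk. Qed.

Lemma hgt_normsq p : hgt p = py p - normsq (wc p).
Proof. by rewrite /hgt /normsq /wc /=; ring. Qed.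

Lemma normsqX z n : normsq (z ^+ n) = normsq z ^+ n.
Proof. by elim: n => [|n IH]; rewrite ?expr0 ?normsq1 // !exprS normsqM IH. Qed.

Lemma normsq_pow_inj z w n : z ^+ n.+1 = w ^+ n.+1 -> normsq z = normsq w.
Proof.
by move=> /(congr1 (@normsq R)); rewrite !normsqX => /pexpIrn; apply; rewrite ?nnegrE ?normsq_ge0.
Qed.

Lemma unit_normsq u n : u ^+ n.+1 = 1 -> normsq u = 1.
Proof. by move=> e; rewrite -[RHS]normsq1; apply: (@normsq_pow_inj _ _ n); rewrite e expr1n. Qed.

Lemma ii : 'i * 'i = -1 :> C.
Proof. by apply: complex_eq; rewrite /=; ring. Qed.

Lemma fourth_root u : u ^+ 4 = 1 -> exists n : nat, u = 'i ^+ n.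
Proof.
move=> u4; have : (u - 1) * ((u + 1) * ((u - 'i) * (u + 'i))) = 0.
  have -> : (u - 1) * ((u + 1) * ((u - 'i) * (u + 'i))) = (u ^+ 2 - 1) * (u ^+ 2 - 'i * 'i) by ring.
  rewrite ii opprK; have -> : (u ^+ 2 - 1) * (u ^+ 2 + 1) = u ^+ 4 - 1 by ring.
  by rewrite u4 subrr.
move/eqP; rewrite !mulf_eq0 !subr_eq0 !addr_eq0 => /or4P[] /eqP ->.
- by exists 0%N; rewrite expr0.
- by exists 2%N; rewrite expr2 ii.
- by exists 1%N; rewrite expr1.
- by exists 3%N; rewrite !exprS expr0 mulr1 ii mulrN1.
Qed.

Lemma prP_rot p q u : siegel p -> u ^+ 4 = 1 -> zc q = zc p -> wc q = u * wc p -> prP q = prP p.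
Proof.
move=> sp /fourth_root[n ->] zE; elim: n q zE => [|n IH] q zE wE.
  by congr prP; apply: pt4_eq; rewrite // wE expr0 mul1r.
pose r := mk (zc p) ('i ^+ n * wc p).
have sr : siegel r.
  move: sp; rewrite /siegel /= !hgt_normsq wc_mk normsqM normsqX.
  have -> : py r = py p by [].
  have -> : normsq ('i : C) = 1 by rewrite /normsq /=; ring.
  by rewrite expr1n mul1r.
rewrite -(IH r) ?zc_mk ?wc_mk // -(prP_act (rotM_Gamma R) sr) act_rotM; congr prP.
apply: pt4_eq; first by rewrite zE.
rewrite wE exprS -mulrA; have <- := wc_mk (zc p) ('i ^+ n * wc p); rewrite -/r.
by apply: complex_eq; rewrite /wc /pa /pb /=; ring.
Qed.

Lemma prP_shift p q : siegel p -> px q = px p + 1 -> py q = py p -> wc q = wc p -> prP q = prP p.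
Proof.
move=> sp xE yE wE; rewrite -(prP_act (transM_Gamma R 1) sp) act_transM; congr prP.
by apply: pt4_eq; [apply: complex_eq|].
Qed.

Lemma prP_inversion p q : siegel p -> zc q * zc p = -1 -> wc q * zc p = wc p -> prP q = prP p.
Proof.
move=> sp zE wE; have e : 0 * 0 - (-1) * 1 = 1 :> int by [].
rewrite -(prP_act (sl2M_Gamma R e) sp); congr prP; apply/esym/act_sl2M; rewrite ?mul1r ?addr0 ?mul0r ?add0r //.
apply/eqP => z0; move: zE; rewrite z0 mulr0 => /eqP; rewrite eq_sym oppr_eq0 oner_eq0 //.
Qed.

Definition arc x : R := Num.sqrt (1 - x ^+ 2).
Definition kb x : C := arc x +i* x.
(* The factor [kb ^+ 6] absorbs the roots of unity by which the identifications of the boundary of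
   [funD] multiply [wc p ^+ 12]. *)
Definition zeta p : C := wc p ^+ 12 * kb (px p) ^+ 6.
Definition hh p : R := py p - arc (px p).

Lemma arcN x : arc (- x) = arc x. Proof. by rewrite /arc sqrrN. Qed.
Lemma arc_ge0 x : 0 <= arc x. Proof. exact: sqrtr_ge0. Qed.
Lemma arc_sq x : x ^+ 2 <= 1 -> arc x ^+ 2 = 1 - x ^+ 2.
Proof. by move=> h; rewrite sqr_sqrtr // subr_ge0. Qed.
Lemma arcE x y : 0 <= y -> x ^+ 2 + y ^+ 2 = 1 -> y = arc x.
Proof. by move=> y0 e; rewrite /arc (_ : 1 - x ^+ 2 = y ^+ 2) ?sqrtr_sqr ?ger0_norm //; lra. Qed.
Lemma kb_normsq x : x ^+ 2 <= 1 -> normsq (kb x) = 1.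
Proof. by move=> h; rewrite /normsq /= arc_sq // subrK. Qed.

(** At both ends of the strip the correcting factor has the same value, so the translation between
    the two sides respects [zeta]. *)
Lemma kb6 x : x ^+ 2 = 1 / 4 -> kb x ^+ 6 = -1.
Proof.
move=> x2; have a2 : arc x ^+ 2 = 3 / 4 by rewrite arc_sq x2; lra.
have k3 : kb x ^+ 3 = 0 +i* (2 * x).
  rewrite !exprS expr0 mulr1; apply: complex_eq => /=.
    have -> : arc x * (arc x * arc x - x * x) - x * (arc x * x + x * arc x) = arc x * (arc x ^+ 2 - 3 * x ^+ 2) by ring.
    by rewrite a2 x2; field.
  have -> : arc x * (arc x * x + x * arc x) + x * (arc x * arc x - x * x) = x * (3 * arc x ^+ 2 - x ^+ 2) by ring.
  by rewrite a2 x2; field.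
rewrite (_ : 6 = 3 * 2)%N // exprM k3 expr2; apply: complex_eq => /=; last by ring.
have -> : 0 * 0 - 2 * x * (2 * x) = - 4 * x ^+ 2 by ring.
by rewrite x2; field.
Qed.

Lemma funD_x2 p : funD p -> px p ^+ 2 <= 1 / 4.
Proof.
by move=> [/andP[? ?] _ _ _]; have : 0 <= (1 / 2 - px p) * (1 / 2 + px p) by [apply: mulr_ge0; lra]; lra.
Qed.

Lemma funD_hh p : funD p -> 0 <= hh p /\ (hh p = 0 <-> normsq (zc p) = 1).
Proof.
move=> F; have x2 := funD_x2 F; have a2 : arc (px p) ^+ 2 = 1 - px p ^+ 2 by rewrite arc_sq //; lra.
have a0 := arc_ge0 (px p); case: F => _ y0 z1 _; rewrite /hh; move: z1; rewrite /normsq /= => z1.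
have h0 : 0 <= py p - arc (px p).
  rewrite leNgt; apply/negP => k; have : 0 < (arc (px p) - py p) * (arc (px p) + py p) by apply: mulr_gt0; lra.
  lra.
split=> //; split=> [k|k]; first by have -> : py p = arc (px p) by [lra]; rewrite a2; ring.
by apply/eqP; rewrite subr_eq0; apply/eqP/arcE.
Qed.

(** The delicate case is the arc: w'^12 z^12 = w^12 there, while [kb] is i times the conjugate of z,
    so exchanging the sign of x in [kb] ^+ 6 supplies exactly the missing twelfth power of z. *)
Lemma funD_invariants p p' : funD p -> funD p' -> prP p = prP p' ->
  [/\ px p' ^+ 2 = px p ^+ 2, py p' = py p, normsq (wc p') = normsq (wc p) & zeta p' = zeta p].
Proof.
move=> F F' /(funD_rel F F')[u u4].
have u12 : u ^+ 12 = 1 by rewrite (_ : 12 = 4 * 3)%N // exprM u4 expr1n.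
have nu := unit_normsq u4.
case=> [[zE wE]|[x2 xE yE wE]|[z1 xE yE wE]|[x2 x2' z1 yE wE]].
- have xE : px p' = px p by have := congr1 (@complex.Re R) zE.
  have yE : py p' = py p by have := congr1 (@complex.Im R) zE.
  by rewrite /zeta xE yE wE normsqM nu mul1r exprMn u12 mul1r.
- rewrite /zeta xE yE wE normsqM nu mul1r exprMn u12 mul1r sqrrN; split=> //.
  by rewrite !kb6 // sqrrN.
- have wn : normsq (wc p') = normsq (wc p).
    by have := congr1 (@normsq R) wE; rewrite !normsqM z1 nu mulr1 mul1r.
  have ya : py p = arc (px p) by apply: arcE; [case: F|move: z1; rewrite /normsq].
  have w12 : wc p' ^+ 12 * zc p ^+ 12 = wc p ^+ 12.
    by rewrite -exprMn wE exprMn u12 mul1r.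
  have zz : zc p * conjc (zc p) = 1.
    by rewrite mulrC conjc_normsq z1.
  rewrite wn yE xE sqrrN /zeta xE; split=> //.
  have -> : kb (px p) = 'i * conjc (zc p) by rewrite /kb -ya /zc; apply: complex_eq; rewrite /=; ring.
  have -> : kb (- px p) = - 'i * zc p by rewrite /kb arcN -ya /zc; apply: complex_eq; rewrite /=; ring.
  have i6 : (- 'i) ^+ 6 = 'i ^+ 6 :> C by rewrite (_ : 6 = 2 * 3)%N // !exprM sqrrN.
  rewrite -w12 !exprMn i6 (_ : 12 = 6 + 6)%N // [zc p ^+ (6 + 6)]exprD.
  have -> : wc p' ^+ (6 + 6) * (zc p ^+ 6 * zc p ^+ 6) * ('i ^+ 6 * (zc p)^*%C ^+ 6) =
    wc p' ^+ (6 + 6) * ('i ^+ 6 * zc p ^+ 6) * (zc p * (zc p)^*%C) ^+ 6 by rewrite exprMn; ring.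
  by rewrite zz expr1n mulr1.
- by rewrite x2 x2' yE (normsq_pow_inj wE) /zeta wE !kb6.
Qed.

Lemma kb_cts p : ctsC p (fun q => kb (px q)).
Proof.
have cx := @px_cts R p; split=> //=.
have k : ctsR p (fun q => 1 - px q ^+ 2).
  by apply: ctsRD; [exact: ctsR_cst|apply: ctsRN; exact: ctsRX].
by apply: (continuous_comp k); exact: sqrt_continuous.
Qed.

Lemma ctsC_X (T : topologicalType) (t : T) (f : T -> C) n : ctsC t f -> ctsC t (fun s => f s ^+ n).
Proof.
move=> cf; elim: n => [|n IH]; first exact: (ctsC_cst t (1 : C)).
by apply: ctsC_eq (ctsCM cf IH) => s; rewrite exprS.
Qed.

Lemma zeta_cts p : ctsC p zeta.
Proof. by apply: ctsCM; apply: ctsC_X; [exact: wc_cts|exact: kb_cts]. Qed.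

Lemma hh_cts p : ctsR p hh.
Proof. by apply: ctsRD; [exact: py_cts|apply: ctsRN; have [] := kb_cts p]. Qed.

Lemma closed_funD : closed (@funD R).
Proof.
rewrite (_ : @funD R = [set p | - (1 / 2) <= px p] `&` [set p | px p <= 1 / 2] `&` [set p | 0 <= py p] `&`
  [set p | 1 <= normsq (zc p)] `&` [set p | normsq (wc p) <= 1 / 16]).
  repeat apply: closedI; apply: closed_leR => r; try exact: ctsR_cst; try exact: px_cts; try exact: py_cts;
    [exact: normsq_zc_cts|exact: normsq_wc_cts].
apply/seteqP; split=> p; first by move=> [/andP[? ?] ? ? ?]; do ![split].
by move=> [[[[? ?] ?] ?] ?]; split=> //; apply/andP.
Qed.

Lemma closed_funD_image (E : set pt4) : closed E -> closed (@prP R @` (@funD R `&` E)).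
Proof.
move=> cE; apply: (@closed_prP R _ (3 / 4) 1); first lra.
  move=> p [F _]; have [_ _ [h _]] := funD_bounds F; have x2 := funD_x2 F.
  by split=> //; [lra|case: F => _ _ _; lra].
by apply: closedI => //; exact: closed_funD.
Qed.

Definition tube : set X := @prP R @` [set p | funD p /\ normsq (wc p) < 1 / 16].

(** A point near p is brought into the domain by [sl2_reduce]. Its |w|^2 gets divided by |cz + d|^2,
    which is at least 1 - 4e by [lattice_norm]. *)
Lemma open_tube : open tube.
Proof.
rewrite openE => _ [p [F w16] <-]; rewrite /interior.
have sp := siegel_funD F; have [/andP[x1 x2] y0 z1 _] := F.
(* 16 m equals 1 - 8e, so |w|^2 stays below 1/16 near p even after division by 1 - 4e. *)
pose m := normsq (wc p); pose e := (1 - 16 * m) / 8; have m0 : 0 <= m by exact: normsq_ge0.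
have e0 : 0 < e by rewrite /e /m; lra.
have W : nbhs p [set q | [/\ - (1 / 2 + e) < px q, px q < 1 / 2 + e, 1 - e < normsq (zc q) &
                            normsq (wc q) < 1 / 16 * (1 - 4 * e)]].
  have n1 : nbhs p [set q | - (1 / 2 + e) < px q] by apply: ctsR_gt; [exact: px_cts|lra].
  have n2 : nbhs p [set q | px q < 1 / 2 + e] by apply: ctsR_lt; [exact: px_cts|lra].
  have n3 : nbhs p [set q | 1 - e < normsq (zc q)] by apply: ctsR_gt; [exact: normsq_zc_cts|lra].
  have n4 : nbhs p [set q | normsq (wc q) < 1 / 16 * (1 - 4 * e)].
    by apply: ctsR_lt; [exact: normsq_wc_cts|rewrite /e /m; lra].
  by apply: filterS (filterI (filterI n1 n2) (filterI n3 n4)) => q [[? ?] [? ?]].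
apply: filterS (nbhs_prP sp W) => _ [q [[h1 h2 h3 h4] sq] <-].
have [r [c [d [rE [sr cd] xr zr wr]]]] := sl2_reduce sq.
have N : 1 - 4 * e <= normsq (c%:~R * zc q + d%:~R).
  rewrite normsq_lattice; apply: lattice_norm => //; [by apply/andP; split; lra| |lra].
  by move: h3; rewrite /normsq /=; lra.
have e4 : 0 < 1 - 4 * e by rewrite /e; lra.
have wr16 : normsq (wc r) < 1 / 16.
  rewrite ltNge; apply/negP => k; have : 0 <= (normsq (wc r) - 1 / 16) * normsq (c%:~R * zc q + d%:~R).
    by apply: mulr_ge0; lra.
  lra.
exists r => //; split=> //; split=> //; last exact: ltW.
by move: sr; rewrite /siegel /= hgt_normsq; have := normsq_ge0 (wc r); lra.
Qed.

Lemma mirror_reduce p : siegel p -> wc p = 0 -> exists2 q, funD q /\ wc q = 0 & prP q = prP p.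
Proof.
move=> sp w0; have [q [c [d [qE [sq cd] xq zq wq]]]] := sl2_reduce sp.
have y0 : 0 < py p by move: sp; rewrite /siegel /= hgt_normsq w0 normsq0 subr0.
have l0 : normsq (c%:~R * zc p + d%:~R) != 0.
  apply/negP => /eqP /normsq_eq0 e; have := congr1 (@normsq R) e; rewrite normsq0 normsq_lattice /= => e'.
  have := sqr_ge0 (c%:~R * px p + d%:~R : R); have cy := mulr_ge0 (sqr_ge0 (c%:~R : R)) (sqr_ge0 (py p)) => k.
  have /eqP : c%:~R ^+ 2 * py p ^+ 2 = 0 :> R by lra.
  rewrite mulf_eq0 !sqrf_eq0 intr_eq0 (gt_eqF y0) orbF => /eqP c0.
  have /eqP : (c%:~R * px p + d%:~R) ^+ 2 = 0 :> R by lra.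
  by rewrite c0 mul0r add0r sqrf_eq0 intr_eq0 => /eqP d0; move: cd; rewrite c0 d0 eqxx.
have wq0 : wc q = 0.
  apply: normsq_eq0; apply: (mulIf l0); by rewrite wq w0 normsq0 mul0r.
exists q => //; split=> //; split=> //; last by rewrite wq0 normsq0; lra.
by move: sq; rewrite /siegel /= hgt_normsq wq0 normsq0 subr0 => /ltW.
Qed.

(** A parameter with t > 0 minimizes |w| in its orbit with a positive value, so no point of that
    orbit is on the mirror; for t = 0 the reduced point has w = 0 and |w| is invariant on the
    domain. *)
Lemma spherical_funD p : funD p -> spherical (prP p) <-> wc p <> 0.
Proof.
move=> F; split=> [V w0|w0 [q [dq tq] e]].
  have [q dq qE] := phiV_surj (prP p); rewrite -qE in V; have tp := (sphericalE dq).1 V.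
  have sq := siegel_PhiP dq; have [t01 h0 hx] := dq.
  have [g gG gE] := (prP_eq sq (siegel_funD F)).1 qE.
  have [le _ _ _] := row2_Phi t01 h0 hx gG.
  have rv := vec_act (proj1 gG) sq; rewrite gE in rv.
  have := le; rewrite -/(PhiP q) rv [X in _ <= normsq X]mxE !vec1 w0 !mulr0 normsq0 normsqM => k.
  have n2 : normsq (1 +i* 1 : C) = 2 by rewrite /normsq /=; ring.
  move: k; rewrite n2 /normsq /wc /PhiP /pa /pb /= -/(px q); have := sqr_ge0 (- (px q * q.1.2) / 2).
  have : 0 < (px q / 2) ^+ 2 by apply: exprn_gt0; lra.
  lra.
have [t01 h0 hx] := dq; have sq := siegel_PhiP dq.
have t0 : px q = 0 by case/andP: t01 => *; lra.
have [|r [Fr wr] rE] := mirror_reduce sq.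
  by apply: complex_eq; rewrite /PhiP /wc /pa /pb /= -/(px q) t0; ring.
have [_ _ n _] := funD_invariants Fr F (etrans rE e).
by apply: w0; apply: normsq_eq0; rewrite n wr normsq0.
Qed.

Lemma tube_cover (x : X) : spherical x \/ tube x.
Proof.
have [V|nV] := pselect (spherical x); [by left|right].
have [q [dq tq] qE] : exists2 q, domP q /\ px q <= 0 & phiV q = x.
  by apply: contrapT => k; apply: nV => -[q [d t] e]; apply: k; exists q.
have [t01 _ _] := dq; have sq := siegel_PhiP dq.
have t0 : px q = 0 by case/andP: t01 => *; lra.
have [|r [Fr wr] rE] := mirror_reduce sq.
  by apply: complex_eq; rewrite /PhiP /wc /pa /pb /= -/(px q) t0; ring.
exists r; last by rewrite rE -qE.
by split=> //; rewrite wr normsq0; lra.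
Qed.

End Tube.

(** * Acyclicity of the tube *)

Section TubeAcyclic.
Local Open Scope complex_scope.
Variable R : realType.
Local Notation C := R[i].
Local Notation pt4 := (pt4 R).
Local Notation X := (GammaD R).
Implicit Types (x y e r : R) (p q : pt4) (u z w : C).

Lemma siegel_mk p w : siegel p -> normsq w = normsq (wc p) -> siegel (mk (zc p) w).
Proof. by rewrite /siegel /= !hgt_normsq wc_mk => sp ->. Qed.

(** At the vertex z - 1 = -1/z, so inversion and translation together fix z and divide w by z. *)
Lemma vertex_rotation p n : siegel p -> px p = 1 / 2 -> py p ^+ 2 = 3 / 4 ->
  prP (mk (zc p) (wc p / zc p ^+ n)) = prP p.
Proof.
move=> sp x2 y2; have z1 : normsq (zc p) = 1 by rewrite /normsq /= x2 y2; field.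
have z0 : zc p != 0 by apply/eqP => z0; move: z1; rewrite z0 normsq0 => /eqP; rewrite eq_sym oner_eq0.
have nw k : normsq (wc p / zc p ^+ k) = normsq (wc p) by rewrite normsqM normsqV normsqX z1 expr1n invr1 mulr1.
elim: n => [|n IH]; first by rewrite expr0 divr1 mkE.
have sq := siegel_mk sp (nw n); rewrite -IH.
have yy : py p * py p = 3 / 4 by rewrite -expr2.
have zE : zc p = (1 / 2) +i* py p by rewrite /zc x2.
pose q := mk (zc p - 1) (wc p / zc p ^+ n.+1).
have e1 : prP q = prP (mk (zc p) (wc p / zc p ^+ n)).
  apply: prP_inversion; rewrite ?zc_mk ?wc_mk //.
    by rewrite zE; apply: complex_eq; rewrite /=; lra.
  by rewrite exprSr invfM mulrA divfK.
rewrite -e1; apply: prP_shift; rewrite /q ?wc_mk //.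
- by move: sq; rewrite /siegel /= !hgt_normsq !wc_mk !nw /py /=; rewrite subr0.
- by rewrite /mk /px /=; ring.
- by rewrite /mk /py /= subr0.
Qed.

(** A twelfth root of unity e is e^9 times e^4: a fourth root, realized by a rotation, times a cube
    root, realized by the stabilizer of the vertex. *)
Lemma prP_vertex p q : siegel p -> px p = 1 / 2 -> py p ^+ 2 = 3 / 4 -> zc q = zc p ->
  wc q ^+ 12 = wc p ^+ 12 -> prP q = prP p.
Proof.
move=> sp x2 y2 zE wE; have [w0|w0] := eqVneq (wc p) 0.
  congr prP; apply: pt4_eq; rewrite // w0; apply/eqP; move/eqP: wE.
  by rewrite w0 expr0n /= expf_eq0.
pose e := wc q / wc p; have qE : wc q = e * wc p by rewrite /e divfK.
have e12 : e ^+ 12 = 1 by rewrite /e expr_div_n wE divff // expf_neq0.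
pose v := e ^+ 4; pose u := e ^+ 9.
have u4 : u ^+ 4 = 1 by rewrite /u -exprM (_ : 9 * 4 = 12 * 3)%N // exprM e12 expr1n.
have v3 : v ^+ 3 = 1 by rewrite /v -exprM (_ : 4 * 3 = 12)%N // e12.
have eE : e = u * v by rewrite /u /v -exprD (_ : 9 + 4 = 12 + 1)%N // exprD e12 mul1r expr1.
pose r := mk (zc p) (v * wc p).
have sr : siegel r by apply: siegel_mk => //; rewrite normsqM (unit_normsq v3) mul1r.
rewrite (@prP_rot _ r q u) ?zc_mk ?wc_mk //; last by rewrite qE eE mulrA.
have yy : py p * py p = 3 / 4 by rewrite -expr2.
have zp : zc p = (1 / 2) +i* py p by rewrite /zc x2.
have z2 : zc p ^+ 2 = (- (1 / 2)) +i* py p by rewrite zp expr2; apply: complex_eq; rewrite /=; lra.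
have z4 : zc p ^+ 4 = (- (1 / 2)) +i* - py p.
  by rewrite (_ : 4 = 2 * 2)%N // exprM z2 expr2; apply: complex_eq; rewrite /=; lra.
have z24 : zc p ^+ 2 * zc p ^+ 4 = 1 by rewrite z2 z4; apply: complex_eq; rewrite /=; lra.
have inv a b : a * b = 1 -> a = b^-1 :> C.
  by move=> ab; have b0 : b != 0 by [apply/eqP => b0; move: ab; rewrite b0 mulr0 => /eqP; rewrite eq_sym oner_eq0]; apply: (mulIf b0); rewrite ab mulVf.
have [n vE] : exists n : nat, v = (zc p ^+ n)^-1.
  have : (v - 1) * ((v - zc p ^+ 2) * (v - zc p ^+ 4)) = 0.
    have -> : (v - zc p ^+ 2) * (v - zc p ^+ 4) = v ^+ 2 - v * (zc p ^+ 2 + zc p ^+ 4) + zc p ^+ 2 * zc p ^+ 4 by ring.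
    rewrite z24 (_ : zc p ^+ 2 + zc p ^+ 4 = -1); last by rewrite z2 z4; apply: complex_eq; rewrite /=; lra.
    have -> : (v - 1) * (v ^+ 2 - v * -1 + 1) = v ^+ 3 - 1 by ring.
    by rewrite v3 subrr.
  move/eqP; rewrite !mulf_eq0 !subr_eq0 => /or3P[] /eqP vE.
  - by exists 0%N; rewrite vE expr0 invr1.
  - by exists 4%N; rewrite vE; exact: inv.
  - by exists 2%N; rewrite vE; apply: inv; rewrite mulrC.
by rewrite /r vE mulrC; exact: vertex_rotation.
Qed.

Section System.
Variables (S : nat -> X -> zmodType) (M : cochain_system S).

Definition cp (ab : R * R) : C := ab.1 +i* ab.2.

Lemma cp_cts (ab : R * R) : ctsC ab cp.
Proof. by split; [exact: cvg_fst|exact: cvg_snd]. Qed.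

(** With N = n + 1, the quotient of the disc is read through the real and imaginary parts of the
    N-th power; a common level of both is a single orbit, that is, one point of X. *)
Lemma acyclic_disc (psi : R * R -> X) r n : 0 <= r ->
  (forall ab, normsq (cp ab) <= r -> {for ab, continuous psi}) ->
  (forall ab ab', normsq (cp ab) <= r -> normsq (cp ab') <= r ->
     psi ab = psi ab' <-> cp ab ^+ n.+1 = cp ab' ^+ n.+1) ->
  acyclic M (psi @` [set ab | normsq (cp ab) <= r]).
Proof.
move=> r0 cpsi psiE; set D := [set ab | _]; set N := n.+1 in psiE *.
pose F1 ab := complex.Re (cp ab ^+ N); pose F2 ab := complex.Im (cp ab ^+ N).
have FE ab : F1 ab ^+ 2 + F2 ab ^+ 2 = normsq (cp ab) ^+ N by rewrite -normsqX.
have Fle ab : D ab -> F1 ab ^+ 2 + F2 ab ^+ 2 <= r ^+ N.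
  by move=> Dab; rewrite FE lerXn2r // nnegrE normsq_ge0.
have cF (ab : R * R) : ctsC ab (fun t => cp t ^+ N) by apply: ctsC_X; exact: cp_cts.
have cn (ab : R * R) : ctsR ab (fun t => normsq (cp t)).
  by have [h1 h2] := cp_cts ab; apply: ctsRD; exact: ctsRX.
have compD : compact D.
  apply: (@subclosed_compact _ _ [set p : R * R | - (1 + r) <= p.1 <= 1 + r /\ - (1 + r) <= p.2 <= 1 + r]).
  - by apply: (@closed_leR R _ (fun t => normsq (cp t)) (fun=> r)) => t; [exact: cn|exact: ctsR_cst].
  - exact: compact_box.
  - move=> [a b]; rewrite /D /normsq /= => k; have a2 := sqr_ge0 a; have b2 := sqr_ge0 b.
    have bd t : t ^+ 2 <= r -> - (1 + r) <= t <= 1 + r.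
      move=> tr; have := sqr_ge0 (t - 1 / 2); have := sqr_ge0 (t + 1 / 2); move: tr; clear => *; apply/andP; split; lra.
    by split; apply: bd; lra.
have rN : 0 <= r ^+ N by rewrite exprn_ge0.
have sqb x y : x ^+ 2 <= y -> - Num.sqrt y <= x <= Num.sqrt y.
  by move=> k; rewrite -ler_norml -sqrtr_sqr ler_wsqrtr.
have bsq x y : 0 <= y -> - Num.sqrt y <= x <= Num.sqrt y -> x ^+ 2 <= y.
  move=> y0 /andP[k1 k2]; have y2 := sqr_sqrtr y0.
  have : 0 <= (Num.sqrt y - x) * (Num.sqrt y + x) by apply: mulr_ge0; lra.
  lra.
apply: (acyclic_leray (@hausdorff_GammaD R) (F := F1) (lo := - Num.sqrt (r ^+ N)) (hi := Num.sqrt (r ^+ N))).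
- exact: cpsi.
- by move=> ab _; have [] := cF ab.
- exact: compD.
- by move=> ab Dab; apply: sqb; have := Fle _ Dab; have := sqr_ge0 (F2 ab); lra.
- by move=> ab ab' Dab Dab' /(psiE _ _ Dab Dab') e; rewrite /F1 e.
- by have := sqrtr_ge0 (r ^+ N); lra.
move=> c /(bsq _ _ rN) c2; have rc : 0 <= r ^+ N - c ^+ 2 by lra.
apply: (acyclic_leray (@hausdorff_GammaD R) (F := F2) (lo := - Num.sqrt (r ^+ N - c ^+ 2)) (hi := Num.sqrt (r ^+ N - c ^+ 2))).
- by move=> ab [Dab _]; exact: cpsi.
- by move=> ab _; have [] := cF ab.
- by apply: compact_closedI => //; apply: closed_eqR => t; [have [] := cF t|exact: ctsR_cst].
- by move=> ab [Dab /= <-]; apply: sqb; have := Fle _ Dab; lra.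
- by move=> ab ab' [Dab _] [Dab' _] /(psiE _ _ Dab Dab') e; rewrite /F2 e.
- by have := sqrtr_ge0 (r ^+ N - c ^+ 2); lra.
move=> d /(bsq _ _ rc) d2.
have [w wE] : exists w : C, w ^+ N = c +i* d by exists (N.-root (c +i* d)); rewrite rootCK.
have cw : cp (complex.Re w, complex.Im w) = w by case: (w).
have nw : normsq w <= r.
  rewrite leNgt; apply/negP => k; have : r ^+ N < normsq w ^+ N by rewrite ltrXn2r ?nnegrE ?normsq_ge0.
  by rewrite -normsqX wE /normsq /=; lra.
rewrite (_ : _ @` _ = [set psi (complex.Re w, complex.Im w)]); first exact: acyclic_point.
apply/seteqP; split=> [_ [ab [[Dab /= e1] /= e2] <-]|_ ->].
  have Dw : D (complex.Re w, complex.Im w) by rewrite /D /= cw.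
  apply/(psiE _ _ Dab Dw).
  by rewrite cw wE -e1 -e2 /F1 /F2; case: (cp ab ^+ N).
by exists (complex.Re w, complex.Im w) => //; split; [split|]; rewrite /D /F1 /F2 /= cw ?wE.
Qed.

(** For fixed z the identifications are rotations of w by twelfth roots of unity at the vertex and
    by fourth roots elsewhere: at z = i inversion again gives a fourth root. *)
Lemma acyclic_slice x0 y0 r : - (1 / 2) < x0 -> x0 <= 1 / 2 -> 0 <= y0 -> 1 <= x0 ^+ 2 + y0 ^+ 2 ->
  0 <= r <= 1 / 16 -> acyclic M (@prP R @` [set p | [/\ px p = x0, py p = y0 & normsq (wc p) <= r]]).
Proof.
move=> x1 x2 y00 z1 /andP[r0 r1].
pose psi (ab : R * R) : X := prP (x0, y0, ab.1, ab.2).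
have wE (ab : R * R) : wc (x0, y0, ab.1, ab.2) = cp ab by [].
have FD (ab : R * R) : normsq (cp ab) <= r -> funD (x0, y0, ab.1, ab.2).
  by move=> k; split=> //; [apply/andP; split; rewrite /px /=; lra|rewrite wE; lra].
have -> : @prP R @` [set p | [/\ px p = x0, py p = y0 & normsq (wc p) <= r]] = psi @` [set ab | normsq (cp ab) <= r].
  apply/seteqP; split=> [_ [p [/= e1 e2 k] <-]|_ [p /= k <-]].
    by exists (pa p, pb p) => //; rewrite /psi -e1 -e2; case: (p) => [[[]]].
  by exists (x0, y0, p.1, p.2).
have psic (ab : R * R) : normsq (cp ab) <= r -> {for ab, continuous psi}.
  move=> k; apply: (@continuous_comp _ _ _ (fun t : R * R => (x0, y0, t.1, t.2) : pt4) (@prP R)).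
    apply: pt4_cts; [exact: ctsR_cst|exact: ctsR_cst|exact: cvg_fst|exact: cvg_snd].
  by apply: prP_cts; apply: siegel_funD; exact: FD.
have pow12 u n : u ^+ 4 = 1 -> u ^+ (4 * n) = 1 by move=> u4; rewrite exprM u4 expr1n.
have [vtx|nvtx] := pselect (x0 = 1 / 2 /\ y0 ^+ 2 = 3 / 4).
  apply: (@acyclic_disc psi r 11) => // ab ab' k k'; split=> [e|e]; last first.
    by apply/esym/prP_vertex => //; [exact: siegel_funD (FD _ k)|case: vtx|case: vtx].
  have [u u4] := funD_rel (FD _ k) (FD _ k') e; rewrite !wE.
  case=> [[_ ->]|[_ xE _ _]|[_ xE _ _]|[_ _ _ _ ->] //].
  - by rewrite exprMn (pow12 u 3%N u4) mul1r.
  - have x00 : x0 = 0 by move: xE; rewrite /px /=; lra.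
    by have [k1 _] := vtx; have /eqP : (1 : R) = 0 by [lra]; rewrite oner_eq0.
  - have x00 : x0 = 0 by move: xE; rewrite /px /=; lra.
    by have [k1 _] := vtx; have /eqP : (1 : R) = 0 by [lra]; rewrite oner_eq0.
apply: (@acyclic_disc psi r 3) => // ab ab' k k'; split=> [e|e]; last first.
  have [w0|w0] := eqVneq (cp ab) 0.
    move/esym/eqP: e; rewrite w0 expr0n /= expf_eq0 /= => /eqP w0'.
    by congr prP; apply: pt4_eq; rewrite // !wE w0 w0'.
  apply/esym/(@prP_rot _ _ _ (cp ab' / cp ab)) => //; first exact: siegel_funD (FD _ k).
    by rewrite expr_div_n e divff // -e expf_neq0.
  by rewrite !wE divfK.
have [u u4] := funD_rel (FD _ k) (FD _ k') e; rewrite !wE.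
have zN : normsq (zc ((x0, y0, ab.1, ab.2) : pt4)) = x0 ^+ 2 + y0 ^+ 2 by [].
case=> [[_ ->]|[xx xE _ _]|[zz xE _ zwE]|[xx _ zz _ _]].
- by rewrite exprMn u4 mul1r.
- have x00 : x0 = 0 by move: xE; rewrite /px /=; lra.
  by move: xx; rewrite /px /= x00 => xx; have /eqP : (1 : R) = 0 by [lra]; rewrite oner_eq0.
- have x00 : x0 = 0 by move: xE; rewrite /px /=; lra.
  have y01 : y0 = 1.
    rewrite zN x00 in zz; have /eqP : (y0 - 1) * (y0 + 1) = 0 by lra.
    by rewrite mulf_eq0 subr_eq0 addr_eq0 => /orP[] /eqP //; lra.
  have zi : zc ((x0, y0, ab.1, ab.2) : pt4) = 'i by rewrite /zc /px /py /= x00 y01.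
  have := congr1 (fun w => w ^+ 4) zwE; rewrite zi /= !exprMn u4 mul1r => <-.
  by rewrite (_ : 'i ^+ 4 = 1) ?mulr1 // !exprS expr0 mulr1 !ii mulrA ii; ring.
- exfalso; apply: nvtx; rewrite zN in zz; have x0h : x0 = 1 / 2.
    have /eqP : (x0 - 1 / 2) * (x0 + 1 / 2) = 0 by move: xx; rewrite /px /=; lra.
    by rewrite mulf_eq0 => /orP[] /eqP; lra.
  by split=> //; rewrite x0h in zz; lra.
Qed.

(** Inversion on the arc and translation on the side x = -1/2 carry boundary points to x > 0. *)
Lemma tube_fold p : funD p -> px p < 0 -> hh p = 0 \/ px p ^+ 2 = 1 / 4 ->
  exists2 q, funD q & [/\ prP q = prP p, px q = - px p, py q = py p & normsq (wc q) = normsq (wc p)].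
Proof.
move=> F x0 c; have [/andP[x1 x2] y0 z1 w1] := F; have sp := siegel_funD F.
have [hE|xE] := c.
  have zz := ((funD_hh F).2).1 hE.
  have z0 : zc p != 0 by apply/eqP => z0; move: zz; rewrite z0 normsq0 => /eqP; rewrite eq_sym oner_eq0.
  have nw : normsq (wc p / zc p) = normsq (wc p) by rewrite normsqM normsqV zz invr1 mulr1.
  exists (mk (- px p +i* py p) (wc p / zc p)).
    split; rewrite ?zc_mk ?wc_mk ?nw //; first by rewrite /mk /px /=; apply/andP; split; lra.
    by move: z1; rewrite /normsq /= sqrrN.
  split; rewrite ?wc_mk //; apply: prP_inversion; rewrite ?zc_mk ?wc_mk ?divfK //.
  by move: zz; rewrite /normsq /zc /= => zz; apply: complex_eq; rewrite /=; lra.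
have xh : px p = - (1 / 2).
  have /eqP : (px p - 1 / 2) * (px p + 1 / 2) = 0 by lra.
  by rewrite mulf_eq0 => /orP[] /eqP; lra.
exists (mk (- px p +i* py p) (wc p)).
  split; rewrite ?zc_mk ?wc_mk //; first by rewrite /mk /px /=; apply/andP; split; lra.
  by move: z1; rewrite /normsq /= sqrrN.
split; rewrite ?wc_mk //; apply: prP_shift; rewrite ?wc_mk // /mk {1}/px /= xh; lra.
Qed.

Definition tube_box r H : set pt4 := [set p | [/\ funD p, hh p <= H & normsq (wc p) <= r]].

Lemma compact_tube_box r H : compact (tube_box r H).
Proof.
apply: (@subclosed_compact _ _ [set q : pt4 | [/\ - 1 <= px q <= 1, 0 <= py q <= H + 1, -1 <= pa q <= 1 & -1 <= pb q <= 1]]).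
- rewrite (_ : tube_box r H = @funD R `&` [set p | hh p <= H] `&` [set p | normsq (wc p) <= r]).
    apply: closedI; first apply: closedI; first exact: closed_funD.
      by apply: closed_leR => t; [exact: hh_cts|exact: ctsR_cst].
    by apply: closed_leR => t; [exact: normsq_wc_cts|exact: ctsR_cst].
  by apply/seteqP; split=> p; [move=> [? ? ?]; split=> //; split|move=> [[? ?] ?]; split].
- exact: compact_box4.
- move=> p [F hp wr]; have x2 := funD_x2 F; have a0 := arc_ge0 (px p).
  have a2 : arc (px p) ^+ 2 = 1 - px p ^+ 2 by rewrite arc_sq //; lra.
  have a1 : arc (px p) <= 1.
    rewrite leNgt; apply/negP => k; have : 0 < (arc (px p) - 1) * (arc (px p) + 1) by apply: mulr_gt0; lra.
    by have := sqr_ge0 (px p); lra.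
  have [/andP[? ?] y0 _ w16] := F; move: w16; rewrite /normsq /= => w16.
  have sq1 (t : R) : t ^+ 2 <= 1 -> -1 <= t <= 1.
    by move=> k; have := sqr_ge0 (t - 1); have := sqr_ge0 (t + 1) => *; apply/andP; split; lra.
  have := sqr_ge0 (pa p); have := sqr_ge0 (pb p) => s1 s2.
  move: hp; rewrite /hh => hp.
  split; [apply/andP; split; lra|apply/andP; split; lra| |];
    by apply: sq1; move: s1 s2 w16; clear; lra.
Qed.

Lemma le_half (x c : R) : x ^+ 2 = c -> c <= 1 / 4 -> 0 <= x -> x <= 1 / 2.
Proof.
move=> e c4 x0; rewrite leNgt; apply/negP => k.
by have : 0 < (x - 1 / 2) * (x + 1 / 2) by [apply: mulr_gt0; lra]; lra.
Qed.

Lemma opp_half_lt (x : R) : 0 < x -> x ^+ 2 < 1 / 4 -> - (1 / 2) < - x <= 1 / 2.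
Proof. by move=> *; apply/andP; split; nra. Qed.

(** Leray along x^2, then along a second function chosen so that the last fibres are single slices.
    On x = 0 there is one slice per height, and on x^2 = 1/4 the two are identified. *)
Lemma acyclic_tube_box r H : 0 <= r <= 1 / 16 -> 0 <= H -> acyclic M (@prP R @` tube_box r H).
Proof.
move=> r01 H0; set D := tube_box r H.
have cD : compact D by exact: compact_tube_box.
have cprP p : D p -> {for p, continuous (@prP R)} by move=> [F _ _]; apply: prP_cts; exact: siegel_funD.
have cx2 p : ctsR p (fun q => px q ^+ 2) by apply: ctsRX; exact: px_cts.
have inv p p' : D p -> D p' -> prP p = prP p' -> [/\ px p' ^+ 2 = px p ^+ 2, py p' = py p & hh p' = hh p].
  move=> [F _ _] [F' _ _] e; have [e1 e2 _ _] := funD_invariants F F' e; split=> //.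
  by rewrite /hh e2 /arc e1.
(* [E] is the slice [px = x0], [hh = k] together with points folded onto it by [tube_fold]. *)
have slice x0 k (E : set pt4) : - (1 / 2) < x0 <= 1 / 2 -> 0 <= k <= H ->
    (forall p, px p = x0 -> hh p = k -> E p) ->
    (forall p, D p -> E p -> hh p = k /\ (px p = x0 \/ [/\ px p = - x0, px p < 0 & hh p = 0 \/ px p ^+ 2 = 1 / 4])) ->
    acyclic M (@prP R @` (D `&` E)).
  move=> /andP[x1 x2] /andP[k0 kH] E1 E2.
  have xx : x0 ^+ 2 <= 1 / 4 by apply: sqr_half; rewrite ltW.
  have a2 : arc x0 ^+ 2 = 1 - x0 ^+ 2 by rewrite arc_sq //; lra.
  have a0 := arc_ge0 x0.
  have y0 : 1 <= x0 ^+ 2 + (arc x0 + k) ^+ 2.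
    by have := mulr_ge0 a0 k0; have := sqr_ge0 k; lra.
  have := acyclic_slice x1 x2 (addr_ge0 a0 k0) y0 r01.
  congr (acyclic M _); apply/seteqP; split=> [_ [p [xE yE wr] <-]|_ [p [Dp Ep] <-]].
    have hE : hh p = k by rewrite /hh xE yE; ring.
    exists p => //; split; last exact: E1.
    split=> //; [split|by rewrite hE].
    - by rewrite xE ltW.
    - by rewrite yE addr_ge0.
    - by rewrite /normsq /= xE yE.
    - by case/andP: r01 => *; lra.
  have [hE [xE|[xE xn c]]] := E2 p Dp Ep; have [F _ wr] := Dp.
    by exists p => //; split=> //; rewrite -hE -xE /hh; ring.
  have [q Fq [qE xq yq wq]] := tube_fold F xn c.
  exists q => //; split; rewrite ?wq //; first by rewrite xq xE opprK.
  by rewrite yq -hE /hh xE arcN; ring.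
apply: (acyclic_leray (@hausdorff_GammaD R) (F := fun q => px q ^+ 2) (lo := 0) (hi := 1 / 4)) => //.
- by move=> p _; exact: cx2.
- by move=> p [F _ _]; rewrite sqr_ge0 funD_x2.
- by move=> p p' Dp Dp' e; have [-> _ _] := inv _ _ Dp Dp' e.
move=> c /andP[c0 c4]; pose xi := Num.sqrt c; have xi0 : 0 <= xi by exact: sqrtr_ge0.
have xi2 : xi ^+ 2 = c by rewrite sqr_sqrtr.
have xi4 : xi <= 1 / 2.
  by move: xi2 c4 xi0; clear; exact: le_half.
have pm p : px p ^+ 2 = c -> px p = xi \/ px p = - xi.
  move=> e; have /eqP : (px p - xi) * (px p + xi) = 0 by rewrite -e in xi2; lra.
  by rewrite mulf_eq0 subr_eq0 addr_eq0 => /orP[] /eqP; [left|right].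
have cDc : compact (D `&` [set q | px q ^+ 2 = c]).
  by apply: compact_closedI => //; apply: closed_eqR => t; [exact: cx2|exact: ctsR_cst].
have hhr p : D p -> 0 <= hh p <= H by move=> [F k _]; have [-> _] := funD_hh F.
have [cE|[cp0 cp4]] : (c = 0 \/ c = 1 / 4) \/ (0 < xi /\ c < 1 / 4).
  have [e|n] := eqVneq c 0; first by left; left.
  have [e|n'] := eqVneq c (1 / 4); first by left; right.
  right; split; last by rewrite lt_neqAle n' c4.
  by rewrite lt_def xi0 andbT; apply/eqP => z; move: n; rewrite -xi2 z expr0n eqxx.
- apply: (acyclic_leray (@hausdorff_GammaD R) (F := @hh R) (lo := 0) (hi := H)) => //.
  + by move=> p [Dp _]; exact: cprP.
  + by move=> p _; exact: hh_cts.
  + by move=> p [Dp _]; exact: hhr.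
  + by move=> p p' [Dp _] [Dp' _] e; have [_ _ ->] := inv _ _ Dp Dp' e.
  move=> k kH; rewrite -setIA; apply: (slice xi k) => //.
  + by move: xi0 xi4; clear => *; apply/andP; split; lra.
  + by move=> p e1 e2; split=> //=; rewrite e1.
  + move=> p Dp [/= e1 e2]; split=> //; have [xE|xE] := pm p e1; first by left.
    have [z|n] := eqVneq xi 0; first by left; rewrite xE z oppr0.
    right; split=> //; first by rewrite xE oppr_lt0 lt_def n.
    right; case: cE => cE; rewrite e1 //.
    by exfalso; move/eqP: n; apply; apply/eqP; rewrite -sqrf_eq0 xi2 cE.
(* For 0 < x^2 < 1/4 the columns at x and -x are glued only at their feet on the arc, so they form
   one interval, parametrized by the signed height. *)
- apply: (acyclic_leray (@hausdorff_GammaD R) (F := fun q => px q * hh q) (lo := - (xi * H)) (hi := xi * H)) => //.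
  + by move=> p [Dp _]; exact: cprP.
  + by move=> p _; apply: ctsRM; [exact: px_cts|exact: hh_cts].
  + move=> p [Dp /= e1]; have /andP[h0 hH] := hhr _ Dp; have k := ler_wpM2l xi0 hH.
    have k0 := mulr_ge0 xi0 h0.
    by have [->|->] := pm p e1; move: k k0; clear => *; apply/andP; split; lra.
  + move=> p p' [Dp /= e1] [Dp' /= e1'] e; have [_ _ hE] := inv _ _ Dp Dp' e; rewrite hE.
    have [F _ _] := Dp; have [F' _ _] := Dp'.
    have [u u4] := funD_rel F F' e; case=> [[zE _]|[x4 _ _ _]|[z1 xE _ _]|[x4 _ _ _ _]].
    * by have -> : px p' = px p by exact: (congr1 (@complex.Re R) zE).
    * by move: cp4; rewrite -e1 x4 ltxx.
    * by rewrite ((funD_hh F).2.2 z1) !mulr0.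
    * by move: cp4; rewrite -e1 x4 ltxx.
  + by have := mulr_ge0 xi0 H0; lra.
  move=> e /andP[e1 e2]; rewrite -setIA.
  have ub (t : R) : 0 <= t -> t <= xi * H -> 0 <= t / xi <= H.
    by move=> t0 tH; rewrite divr_ge0 //= ler_pdivrMr // mulrC.
  have [en|ep] := ltP e 0.
    apply: (slice (- xi) (- e / xi)).
    * by move: cp0 cp4; rewrite -xi2; clear; exact: opp_half_lt.
    * by apply: ub; [rewrite oppr_ge0 ltW|rewrite lerNl].
    * by move=> p k1 k2; split; rewrite /= k1 ?k2 ?sqrrN //; field; rewrite gt_eqF.
    move=> p Dp [/= c1 c2]; have /andP[h0 _] := hhr _ Dp; have [xE|xE] := pm p c1.
      by move: c2 (mulr_ge0 xi0 h0) en; rewrite xE => <-; rewrite leNgt => /negPf->.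
    by split; [rewrite -c2 xE; field; rewrite gt_eqF|left].
  apply: (slice xi (e / xi)); first by move: xi0 xi4; clear => *; apply/andP; split; lra.
  * exact: ub.
  * by move=> p k1 k2; split; rewrite /= k1 ?k2 //; field; rewrite gt_eqF.
  move=> p Dp [/= c1 c2]; have /andP[h0 _] := hhr _ Dp; have [xE|xE] := pm p c1.
    by split; [rewrite -c2 xE; field; rewrite gt_eqF|left].
  have hz : hh p = 0.
    apply/eqP; rewrite eq_le h0 andbT leNgt; apply/negP => hp.
    by have := mulr_gt0 cp0 hp; move: c2 ep; rewrite xE mulNr => <-; rewrite oppr_ge0 leNgt => /negPf->.
  have ez : e = 0 by rewrite -c2 hz mulr0.
  by rewrite ez mul0r; split=> //; right; split; [|rewrite xE oppr_lt0|left].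
Qed.

Lemma acyclic_tube : acyclic M (@tube R).
Proof.
pose b n : R := 1 / 16 * (1 - (n.+2)%:R^-1).
have i0 n : 0 < (n.+2)%:R^-1 :> R by rewrite invr_gt0.
have i1 n : (n.+2)%:R^-1 <= 1 :> R by rewrite invf_le1 // ler1n.
have bS n : b n < b n.+1.
  have : (n.+3)%:R^-1 < (n.+2)%:R^-1 :> R by rewrite ltf_pV2 ?posrE // ltr_nat.
  by move=> k; rewrite /b ltr_pM2l; [rewrite ltrD2l ltrN2|lra].
have b01 n : 0 <= b n <= 1 / 16.
  by have k0 := i0 n; have k1 := i1 n; rewrite /b; move: (_^-1) k0 k1 => t k0 k1; apply/andP; split; lra.
have blt n : b n < 1 / 16.
  by have k0 := i0 n; rewrite /b; move: (_^-1) k0 => t k0; lra.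
have invw p p' : funD p -> funD p' -> prP p = prP p' -> normsq (wc p') = normsq (wc p) /\ hh p' = hh p.
  by move=> F F' e; have [e1 e2 e3 _] := funD_invariants F F' e; rewrite /hh e2 /arc e1.
pose O n : set X := @tube R `&` ~` (@prP R @` (@funD R `&` [set p | b n.+1 <= normsq (wc p)])) `&`
  ~` (@prP R @` (@funD R `&` [set p | n.+1%:R <= hh p])).
apply: (@acyclic_exhaust X S M _ (fun n => @prP R @` tube_box (b n) n%:R) O).
- move=> n _ [p [F hp wp] <-]; split; first split.
  + by exists p => //; split=> //; have := blt n; lra.
  + by move=> [q [Fq /= wq] e]; have [wE _] := invw _ _ Fq F e; have := bS n; lra.
  + move=> [q [Fq /= hq] e]; have [_ hE] := invw _ _ Fq F e.
    by have : n%:R < n.+1%:R :> R by [rewrite ltr_nat]; lra.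
- move=> n _ [[[p [F w16] <-] n1] n2]; exists p => //; split=> //.
    by rewrite leNgt; apply/negP => k; apply: n2; exists p => //; split=> //; exact: ltW.
  by rewrite leNgt; apply/negP => k; apply: n1; exists p => //; split=> //; exact: ltW.
- move=> n; apply: openI; first apply: openI; first exact: open_tube.
    apply: closed_openC; apply: closed_funD_image.
    by apply: closed_leR => t; [exact: ctsR_cst|exact: normsq_wc_cts].
  apply: closed_openC; apply: closed_funD_image.
  by apply: closed_leR => t; [exact: ctsR_cst|exact: hh_cts].
- apply/seteqP; split=> [_ [n _ [p [F hp wp] <-]]|_ [p [F w16] <-]].
    by exists p => //; split=> //; have := blt n; lra.
  have [h0 _] := funD_hh F.
  have [n1 k1] : exists n : nat, hh p <= n%:R.
    by exists (Num.Def.archi_bound (hh p)); rewrite ltW // archi_boundP.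
  have m0 : 0 < 1 - 16 * normsq (wc p) by lra.
  have [n2 k2] : exists n : nat, (1 - 16 * normsq (wc p))^-1 <= n%:R.
    by exists (Num.Def.archi_bound (1 - 16 * normsq (wc p))^-1); rewrite ltW // archi_boundP // invr_ge0 ltW.
  exists (n1 + n2)%N => //; exists p => //; split=> //.
    by apply: le_trans k1 _; rewrite ler_nat leq_addr.
  have k3 : ((n1 + n2).+2)%:R^-1 <= 1 - 16 * normsq (wc p).
    rewrite -[X in _ <= X]invrK lef_pV2 ?posrE ?invr_gt0 //; apply: le_trans k2 _.
    by rewrite ler_nat; lia.
  by rewrite /b; move: (_^-1) k3 => t k3; lra.
- by move=> n; apply: acyclic_tube_box => //; exact: ler0n.
Qed.

End System.
End TubeAcyclic.

(** * Sectors around the mirror *)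

Section ZetaFibre.
Local Open Scope complex_scope.
Variable R : realType.
Local Notation C := R[i].
Local Notation pt4 := (pt4 R).
Local Notation X := (GammaD R).
Implicit Types (x y e : R) (p : R * R) (u z w : C) (b : bool).

(** Real part, by the half-angle formula, of the square root [kap] of the inverse of [kb] having
    positive real part. *)
Definition ckap x : R := Num.sqrt ((1 + arc x) / 2).
Definition kap x : C := ckap x +i* (- x / (2 * ckap x)).

Lemma ckap_gt0 x : 0 < ckap x.
Proof. by rewrite sqrtr_gt0; have := arc_ge0 x; lra. Qed.

Lemma ckap_sq x : ckap x ^+ 2 = (1 + arc x) / 2.
Proof. by rewrite sqr_sqrtr //; have := arc_ge0 x; lra. Qed.

Lemma kap_sq x : x ^+ 2 <= 1 -> kap x ^+ 2 = arc x +i* - x.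
Proof.
move=> x2; have c0 := ckap_gt0 x; have c2 := ckap_sq x; have a2 := arc_sq x2; have a0 := arc_ge0 x.
have n0 : ckap x != 0 by rewrite gt_eqF.
rewrite expr2; apply: complex_eq => /=; last by field.
have -> : ckap x * ckap x - - x / (2 * ckap x) * (- x / (2 * ckap x)) =
  ckap x ^+ 2 - x ^+ 2 / (4 * ckap x ^+ 2) by field.
rewrite c2; have -> : x ^+ 2 = (1 - arc x) * (1 + arc x) by lra.
by field; rewrite gt_eqF //; lra.
Qed.

Lemma kapN x : x ^+ 2 <= 1 -> kap x * kap (- x) = 1.
Proof.
move=> x2; have c0 := ckap_gt0 x; have c2 := ckap_sq x; have a2 := arc_sq x2; have a0 := arc_ge0 x.
have n0 : ckap x != 0 by rewrite gt_eqF.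
rewrite /kap /ckap arcN -/(ckap x); apply: complex_eq => /=; last by field.
have -> : ckap x * ckap x - - x / (2 * ckap x) * (- - x / (2 * ckap x)) =
  ckap x ^+ 2 + x ^+ 2 / (4 * ckap x ^+ 2) by field.
rewrite c2; have -> : x ^+ 2 = (1 - arc x) * (1 + arc x) by lra.
by field; rewrite gt_eqF //; lra.
Qed.

Lemma kap_neq0 x : kap x != 0.
Proof. by rewrite eq_complex /= gt_eqF // ckap_gt0. Qed.

Lemma kap_kb x : x ^+ 2 <= 1 -> kap x ^+ 2 * kb x = 1.
Proof.
move=> x2; rewrite kap_sq // /kb; have a2 := arc_sq x2.
by apply: complex_eq; rewrite /=; lra.
Qed.

Lemma normsq_kap x : x ^+ 2 <= 1 -> normsq (kap x) = 1.
Proof.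
move=> x2; have := congr1 (@normsq R) (kap_kb x2); rewrite normsqM normsqX kb_normsq // mulr1 normsq1 => e.
have n0 := normsq_ge0 (kap x); have /eqP : (normsq (kap x) - 1) * (normsq (kap x) + 1) = 0 by lra.
by rewrite mulf_eq0 subr_eq0 => /orP[/eqP|/eqP]; lra.
Qed.

Lemma kap_cts (T : topologicalType) (t : T) (f : T -> R) : ctsR t f -> ctsC t (fun s => kap (f s)).
Proof.
move=> cf; have ca : ctsR t (fun s => arc (f s)).
  have k : ctsR t (fun s => 1 - f s ^+ 2) by apply: ctsRD; [exact: ctsR_cst|apply: ctsRN; exact: ctsRX].
  by apply: (continuous_comp k); exact: sqrt_continuous.
have cc : ctsR t (fun s => ckap (f s)).
  have k : ctsR t (fun s => (1 + arc (f s)) / 2) by apply: ctsRM; [apply: ctsRD => //; exact: ctsR_cst|exact: ctsR_cst].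
  by apply: (continuous_comp k); exact: sqrt_continuous.
split => //=; apply: ctsRM; first exact: ctsRN.
apply: ctsRV; last by apply: ctsRM => //; exact: ctsR_cst.
by rewrite mulf_neq0 ?pnatr_eq0 // gt_eqF // ckap_gt0.
Qed.

Definition sg b x : R := if b then x else - x.
Lemma sg_sq b x : sg b x ^+ 2 = x ^+ 2. Proof. by case: b; rewrite //= sqrrN. Qed.
Lemma arc_sg b x : arc (sg b x) = arc x. Proof. by case: b; rewrite //= arcN. Qed.
Lemma sgC b x : sg (~~ b) x = - sg b x. Proof. by case: b; rewrite //= opprK. Qed.

(** An index is a twelfth root of the value of [zeta] together with a sign for x. The factor [kap]
    cancels [kb], so [zeta] is constant along a chart. *)
Definition chart (i : C * bool) (p : R * R) : pt4 :=
  mk (sg i.2 p.1 +i* (arc p.1 + p.2)) (i.1 * kap (sg i.2 p.1)).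

Lemma zc_chart i p : zc (chart i p) = sg i.2 p.1 +i* (arc p.1 + p.2). Proof. exact: zc_mk. Qed.
Lemma wc_chart i p : wc (chart i p) = i.1 * kap (sg i.2 p.1). Proof. exact: wc_mk. Qed.
Lemma px_chart i p : px (chart i p) = sg i.2 p.1. Proof. by []. Qed.
Lemma py_chart i p : py (chart i p) = arc p.1 + p.2. Proof. by []. Qed.

Section Fibre.
Variables (z0 : C) (r H : R).
Hypotheses (r01 : 0 <= r <= 1 / 16) (z0r : normsq z0 = r ^+ 12) (H0 : 0 <= H).
Let Q : set (R * R) := [set p | 0 <= p.1 <= 1 / 2 /\ 0 <= p.2 <= H].
Let rt (i : C * bool) := i.1 ^+ 12 = z0.

Let Qx (p : R * R) : Q p -> p.1 ^+ 2 <= 1 / 4.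
Proof.
by move=> [/andP[? ?] _]; have : 0 <= (1 / 2 - p.1) * (1 / 2 + p.1) by [apply: mulr_ge0; lra]; lra.
Qed.

Let Qx1 b (p : R * R) : Q p -> sg b p.1 ^+ 2 <= 1.
Proof. by move=> /Qx; rewrite sg_sq; lra. Qed.

Let root_normsq i : rt i -> normsq i.1 = r.
Proof.
move=> ri; have : normsq i.1 ^+ 12 = r ^+ 12 by rewrite -normsqX ri.
by move=> /pexpIrn; apply; rewrite ?nnegrE ?normsq_ge0 //; case/andP: r01.
Qed.

Let chart_funD i p : rt i -> Q p -> funD (chart i p).
Proof.
move=> ri Qp; have [/andP[x0 x1] /andP[h0 h1]] := Qp; have a0 := arc_ge0 p.1; have x2 := Qx Qp.
have a2 : arc p.1 ^+ 2 = 1 - p.1 ^+ 2 by rewrite arc_sq //; lra.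
split.
- by rewrite px_chart; case: i.2 => /=; apply/andP; split; lra.
- by rewrite py_chart addr_ge0.
- rewrite zc_chart /normsq /= sg_sq; have := mulr_ge0 a0 h0; have := sqr_ge0 p.2; lra.
- by rewrite wc_chart normsqM normsq_kap ?Qx1 // mulr1 root_normsq //; case/andP: r01.
Qed.

Let chart_hh i p : hh (chart i p) = p.2.
Proof. by rewrite /hh px_chart py_chart arc_sg; ring. Qed.

Let chart_zeta i p : rt i -> Q p -> zeta (chart i p) = z0.
Proof.
move=> ri Qp; rewrite /zeta wc_chart px_chart exprMn ri -mulrA.
have -> : kap (sg i.2 p.1) ^+ 12 * kb (sg i.2 p.1) ^+ 6 = (kap (sg i.2 p.1) ^+ 2 * kb (sg i.2 p.1)) ^+ 6.
  by rewrite exprMn -exprM.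
by rewrite kap_kb ?Qx1 // expr1n mulr1.
Qed.

Let ch i p : X := prP (chart i p).

Let same_side i j (p : R * R) u : rt i -> Q p -> u ^+ 4 = 1 -> j.1 = u * i.1 -> sg j.2 p.1 = sg i.2 p.1 ->
  ch i p = ch j p.
Proof.
move=> ri Qp u4 jE sE; apply/esym/(prP_rot _ u4); first exact: siegel_funD (chart_funD ri Qp).
  by rewrite !zc_chart sE.
by rewrite !wc_chart sE jE mulrA.
Qed.

Let floor_flip i x : rt i -> Q (x, 0) -> ch i (x, 0) = ch (- 'i * i.1, ~~ i.2) (x, 0).
Proof.
move=> ri Qp; have x2 := Qx1 i.2 Qp; rewrite /= in x2; apply/esym/prP_inversion.
- exact: siegel_funD (chart_funD ri Qp).
- rewrite !zc_chart /= !addr0 sgC; have := arc_sq x2; rewrite arc_sg => a2.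
  by apply: complex_eq; rewrite /=; lra.
rewrite !wc_chart zc_chart /= addr0 sgC.
have -> : sg i.2 x +i* arc x = 'i * kap (sg i.2 x) ^+ 2.
  by rewrite kap_sq // arc_sg; apply: complex_eq; rewrite /=; ring.
have -> : - 'i * i.1 * kap (- sg i.2 x) * ('i * kap (sg i.2 x) ^+ 2) =
  - ('i * 'i) * i.1 * (kap (sg i.2 x) * kap (- sg i.2 x)) * kap (sg i.2 x) by ring.
by rewrite ii kapN // opprK mul1r mulr1.
Qed.

Let rootM i u b : rt i -> u ^+ 12 = 1 -> rt (u * i.1, b).
Proof. by move=> ri u12; rewrite /rt /= exprMn u12 mul1r. Qed.

Let i12 : (- 'i : C) ^+ 12 = 1.
Proof. by rewrite (_ : 12 = 2 * 6)%N // exprM sqrrN expr2 ii (_ : 6 = 2 * 3)%N // exprM sqrrN !expr1n. Qed.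

Let i4 : ('i : C) ^+ 4 = 1.
Proof. by rewrite (_ : 4 = 2 * 2)%N // exprM [in X in X ^+ 2]expr2 ii sqrrN expr1n. Qed.

(** Along x = 0 or the arc the sign of the chart is immaterial, up to a power of i on the root;
    along x = 1/2, the side [beta], a translation joins charts of opposite signs; at the vertex all
    charts agree. *)
Let alpha (p : R * R) := (p.1 == 0) || (p.2 == 0).
Let beta (p : R * R) := p.1 == 1 / 2.

Let on_alpha i j (p : R * R) u : rt i -> rt j -> Q p -> u ^+ 4 = 1 -> j.1 = u * i.1 -> alpha p ->
  ch i p = ch j p.
Proof.
move=> ri rj Qp u4 jE; rewrite /alpha => /orP[/eqP x0|/eqP h0].
  by apply: (same_side ri Qp u4 jE); rewrite x0; case: j.2; case: i.2; rewrite /= ?oppr0.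
have pE : p = (p.1, 0) by rewrite -h0; case: (p).
rewrite pE in Qp *; have [bE|bE] := eqVneq j.2 i.2; first by apply: (same_side ri Qp u4 jE); rewrite bE.
rewrite floor_flip //; apply: (@same_side _ _ _ (u * 'i)) => //.
- exact: rootM.
- by rewrite exprMn u4 i4 mul1r.
- by rewrite /= jE; have -> : u * 'i * (- 'i * i.1) = - ('i * 'i) * (u * i.1) by [ring]; rewrite ii opprK mul1r.
- by move: bE; rewrite /=; case: j.2; case: i.2.
Qed.

Let on_beta i j (p : R * R) u : rt i -> rt j -> Q p -> u ^+ 4 = 1 -> beta p -> j.2 != i.2 ->
  wc (chart j p) = u * wc (chart i p) -> ch i p = ch j p.
Proof.
have half k l (w : C) : rt k -> rt l -> Q p -> w ^+ 4 = 1 -> beta p -> k.2 = false -> l.2 = true ->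
    wc (chart l p) = w * wc (chart k p) -> ch k p = ch l p.
  move=> rk rl Qp w4 /eqP x2 kf lt wE; have sk := siegel_funD (chart_funD rk Qp).
  have sl := siegel_funD (chart_funD rl Qp).
  pose q := mk (zc (chart l p)) (wc (chart k p)).
  have px_q : px q = px (chart l p) by [].
  have py_q : py q = py (chart l p) by [].
  have e1 : prP q = ch k p.
    apply: (prP_shift sk); [|by rewrite py_q !py_chart|exact: wc_mk].
    by rewrite px_q !px_chart kf lt /= x2; lra.
  have sq : siegel q by apply: siegel_mk => //; rewrite wE normsqM (unit_normsq w4) mul1r.
  by rewrite -e1; apply/esym/(prP_rot sq w4); [exact: esym (zc_mk _ _)|rewrite wE; congr (_ * _); exact: esym (wc_mk _ _)].
move=> ri rj Qp u4 bp; case jt : j.2; case it : i.2 => // _ wE.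
  exact: half wE.
apply/esym/(@half _ _ (u ^+ 3)) => //; first by rewrite -exprM mulnC exprM u4 expr1n.
by rewrite wE mulrA -exprSr u4 mul1r.
Qed.

Let Qhalf : Q (1 / 2, 0).
Proof. by split; rewrite /= ?lexx ?H0 // andbT; lra. Qed.

Let corner i j : rt i -> rt j -> ch i (1 / 2, 0) = ch j (1 / 2, 0).
Proof.
have up k : rt k -> exists l, [/\ rt l, l.2 = true & ch k (1 / 2, 0) = ch l (1 / 2, 0)].
  move=> rk; case kt : k.2; first by exists k.
  exists (- 'i * k.1, ~~ k.2); split; [exact: rootM|by rewrite kt|exact: floor_flip].
move=> /up[k [rk kt ->]] /up[l [rl lt ->]]; apply/esym/prP_vertex.
- exact: siegel_funD (chart_funD rk Qhalf).
- by rewrite px_chart kt.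
- by rewrite py_chart /= addr0 arc_sq; [field|lra].
- by rewrite !zc_chart kt lt.
- by rewrite !wc_chart kt lt !exprMn rk rl.
Qed.

Let disjoint i j p p' : rt i -> rt j -> Q p -> Q p' -> ch i p = ch j p' -> p = p'.
Proof.
move=> ri rj Qp Qp' e; have [xE yE _ _] := funD_invariants (chart_funD ri Qp) (chart_funD rj Qp') e.
rewrite !px_chart !sg_sq in xE; rewrite !py_chart in yE.
have [/andP[x0 _] _] := Qp; have [/andP[x0' _] _] := Qp'.
have x1 : p'.1 = p.1 by apply/eqP; rewrite -(eqrXn2 (ltn0Sn 1)) ?xE.
have x2 : p'.2 = p.2 by move: yE; rewrite x1; lra.
by case: p p' x1 x2 {Qp Qp' e xE yE x0 x0'} => ? ? [? ?] /= -> ->.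
Qed.

(** Each case of [rel_funD] names a side on which p must lie; p' lies on it as well, and the same
    group element identifies the charts there. *)
Let spread i j p p' : rt i -> rt j -> Q p -> Q p' -> (alpha p ==> alpha p') -> (beta p ==> beta p') ->
  ch i p = ch j p -> ch i p' = ch j p'.
Proof.
move=> ri rj Qp Qp' /implyP ka /implyP kb e.
have x2 := Qx1 i.2 Qp; have x2' := Qx1 j.2 Qp.
have [u u4] := funD_rel (chart_funD ri Qp) (chart_funD rj Qp) e.
rewrite !zc_chart !wc_chart !px_chart !py_chart => -[[zE wE]|[xx xE _ wE]|[zz xE _ wE]|[xx _ zz _ _]].
- have sE : sg j.2 p.1 = sg i.2 p.1 by exact: (congr1 (@complex.Re R) zE).
  have jE : j.1 = u * i.1 by rewrite sE mulrA in wE; exact: (mulIf (kap_neq0 _) wE).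
  have [bE|bE] := eqVneq j.2 i.2; first by apply: (same_side ri Qp' u4 jE); rewrite bE.
  apply: (on_alpha ri rj Qp' u4 jE); apply: ka; apply/orP; left; apply/eqP.
  by move: sE bE; case: j.2; case: i.2 => //= sE _; lra.
- have [/andP[x0 _] _] := Qp.
  have xh : p.1 = 1 / 2.
    have /eqP : (p.1 - 1 / 2) * (p.1 + 1 / 2) = 0 by move: xx; rewrite sg_sq; lra.
    by rewrite mulf_eq0 => /orP[] /eqP; lra.
  have bp' : beta p' by apply: kb; rewrite /beta xh.
  apply: (on_beta ri rj Qp' u4 bp'); last by rewrite !wc_chart (eqP bp') -xh.
  by move: xE; rewrite xh; case: j.2; case: i.2 => //= k; have /eqP : (1 : R) = 0 by [lra]; rewrite oner_eq0.
- have hE : p.2 = 0.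
    by rewrite -(chart_hh i p); apply/((funD_hh (chart_funD ri Qp)).2); rewrite zc_chart.
  have ap' : alpha p' by apply: ka; rewrite /alpha hE eqxx orbT.
  rewrite xE hE addr0 in wE.
  have zk : sg i.2 p.1 +i* arc p.1 = 'i * kap (sg i.2 p.1) ^+ 2.
    by rewrite kap_sq // arc_sg; apply: complex_eq; rewrite /=; ring.
  have jE : j.1 = (- 'i * u) * i.1.
    rewrite zk in wE; apply: (mulIf (kap_neq0 (sg i.2 p.1))).
    have -> : - 'i * u * i.1 * kap (sg i.2 p.1) = - 'i * (u * (i.1 * kap (sg i.2 p.1))) by ring.
    rewrite -wE; have -> : - 'i * (j.1 * kap (- sg i.2 p.1) * ('i * kap (sg i.2 p.1) ^+ 2)) =
      - ('i * 'i) * j.1 * (kap (sg i.2 p.1) * kap (- sg i.2 p.1)) * kap (sg i.2 p.1) by ring.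
    by rewrite ii kapN // opprK mul1r mulr1.
  apply: (on_alpha ri rj Qp' _ jE ap').
  by rewrite exprMn u4 mulr1 (_ : 4 = 2 * 2)%N // exprM sqrrN [in X in X ^+ 2]expr2 ii sqrrN expr1n.
- have [/andP[x0 _] _] := Qp.
  have xh : p.1 = 1 / 2.
    have /eqP : (p.1 - 1 / 2) * (p.1 + 1 / 2) = 0 by move: xx; rewrite sg_sq; lra.
    by rewrite mulf_eq0 => /orP[] /eqP; lra.
  have hE : p.2 = 0.
    by rewrite -(chart_hh i p); apply/((funD_hh (chart_funD ri Qp)).2); rewrite zc_chart.
  have bp' : beta p' by apply: kb; rewrite /beta xh.
  have ap' : alpha p' by apply: ka; rewrite /alpha hE eqxx orbT.
  have -> : p' = (1 / 2, 0).
    rewrite -(eqP bp'); have : p'.2 = 0.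
      by move: ap'; rewrite /alpha (eqP bp') => /orP[/eqP|/eqP //]; lra.
    by case: (p') => ? ? /= ->.
  exact: corner.
Qed.

Let chart_cts i (p : R * R) : rt i -> Q p -> {for p, continuous (ch i)}.
Proof.
move=> ri Qp; apply: (@continuous_comp _ _ _ (chart i) (@prP R)); last first.
  by apply: prP_cts; exact: siegel_funD (chart_funD ri Qp).
have c1 : ctsR p (fst : R * R -> R) by exact: cvg_fst.
have c2 : ctsR p (snd : R * R -> R) by exact: cvg_snd.
have cs : ctsR p (fun t : R * R => sg i.2 t.1) by case: i.2 => //=; exact: ctsRN.
have [k1 k2] := ctsCM (ctsC_cst p i.1) (kap_cts cs).
apply: pt4_cts => //=.
apply: ctsRD => //.
have k : ctsR p (fun t : R * R => 1 - t.1 ^+ 2) by apply: ctsRD; [exact: ctsR_cst|apply: ctsRN; exact: ctsRX].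
by apply: (continuous_comp k); exact: sqrt_continuous.
Qed.

Let roots : exists l : seq (C * bool), forall i, List.In i l <-> rt i.
Proof.
have [l lE] := closed_field_poly_normal ('X^12 - z0%:P : {poly C}).
rewrite lead_coefXnsubC // scale1r in lE.
have wl w : w \in l = (w ^+ 12 == z0) by rewrite -root_prod_XsubC -lE /root !hornerE subr_eq0.
exists (flatten [seq [:: (w, true); (w, false)] | w <- l]) => -[w b].
rewrite /rt /=; have -> : (w ^+ 12 = z0) <-> w \in l by rewrite wl; split=> /eqP.
elim: l {lE wl} => [|v l IH] //=; rewrite in_cons; split.
  by case=> [[-> _]|[[-> _]|/IH->]]; rewrite ?eqxx ?orbT.
by case/orP=> [/eqP->|/IH k]; [case: (b); [left|right; left]|right; right].
Qed.

(** The charts for all twelfth roots of z0 and both signs cover the fibre, and [acyclic_cross]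
    applies with [alpha] and [beta] as sides. *)
Lemma acyclic_zeta_fibre (S : nat -> X -> zmodType) (M : cochain_system S) :
  acyclic M (@prP R @` [set p | [/\ funD p, hh p <= H & zeta p = z0]]).
Proof.
have [l lE] := roots; have hX := @hausdorff_GammaD R.
have boxes i (b1 c1 d1 : R) : rt i -> 0 <= b1 -> b1 <= c1 -> c1 <= 1 / 2 -> 0 <= d1 <= H ->
    acyclic M (ch i @` [set p | b1 <= p.1 <= c1 /\ 0 <= p.2 <= d1]).
  move=> ri b0 bc c2 /andP[d0 dH].
  have sub : [set p | b1 <= p.1 <= c1 /\ 0 <= p.2 <= d1] `<=` Q.
    move=> p [/andP[p1 p2] /andP[p3 p4]]; split; apply/andP; split=> //.
    - exact: le_trans b0 p1.
    - exact: le_trans p2 c2.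
    - exact: le_trans p4 dH.
  refine (@acyclic_box R X S M hX (ch i) _ b1 c1 0 d1 bc d0 erefl _ _) => [p /sub Qp|p p' /sub Qp /sub Qp' e].
    exact: chart_cts.
  exact: disjoint Qp Qp' e.
have half_gt0 : 0 < 1 / 2 :> R by rewrite divr_gt0.
have half0 := ltW half_gt0.
have eqs (f : R * R -> R) c : (forall p, ctsR p f) -> closed [set p | f p == c].
  move=> cf; have := @closed_eqR R (R * R)%type f (fun=> c) cf (fun t => @ctsR_cst R _ t c).
  by congr closed; apply/seteqP; split=> t /=; [move=> ->|move/eqP].
have c1 p : ctsR p (fst : R * R -> R) by exact: cvg_fst.
have c2 p : ctsR p (snd : R * R -> R) by exact: cvg_snd.
have [w0 w0E] : exists w : C, w ^+ 12 = z0 by exists (12.-root z0); rewrite rootCK.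
have l0 : l <> [::] by move=> l0; have := (lE (w0, true)).2 w0E; rewrite l0.
have := @acyclic_cross X S M hX (R * R)%type (C * bool)%type l ch Q alpha beta l0.
rewrite foldr_setU_In.
rewrite (_ : [set x | _] = @prP R @` [set p | [/\ funD p, hh p <= H & zeta p = z0]]); last first.
  apply/seteqP; split=> [x [i /lE ri [p Qp <-]]|_ [q [F hq zq] <-]].
    exists (chart i p) => //; split; [exact: chart_funD| |exact: chart_zeta].
    by rewrite chart_hh; case: Qp => _ /andP[].
  have x2 := funD_x2 F; have [h0 _] := funD_hh F; have [/andP[x0 x1] _ _ _] := F.
  pose b := 0 <= px q; pose xi := sg b (px q).
  have xiE : sg b xi = px q by rewrite /xi /b; case: (0 <= px q); rewrite /= ?opprK.
  have xi0 : 0 <= xi <= 1 / 2.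
    by rewrite /xi /b; case: (leP 0 (px q)) => k /=; rewrite ?k ?x1 // oppr_ge0 (ltW k) lerNl.
  exists (wc q * kap (- px q), b).
    apply/lE; rewrite /rt /= -zq /zeta exprMn; congr (_ * _).
    rewrite (_ : 12 = 2 * 6)%N // exprM kap_sq; last by rewrite sqrrN; lra.
    by rewrite opprK arcN.
  exists (xi, hh q); first by split=> //; apply/andP; split.
  congr prP; apply: pt4_eq.
    rewrite zc_chart /= xiE /zc; congr (_ +i* _).
    by rewrite -[arc xi](arc_sg b) xiE /hh; ring.
  by rewrite wc_chart /= xiE -mulrA [kap _ * _]mulrC kapN ?mulr1 //; lra.
apply.
- exact: compact_box.
- have := closedU (eqs fst 0 c1) (eqs snd 0 c2); congr closed.
  by apply/seteqP; split=> p /=; rewrite /alpha; [case=> ->; rewrite ?orbT|move/orP].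
- exact: eqs.
- by move=> i p /lE ri Qp; exact: chart_cts.
- by move=> i j p p' /lE ri /lE rj Qp Qp'; exact: disjoint.
- by move=> i j p p' /lE ri /lE rj; exact: spread.
- move=> i j p /lE ri /lE rj Qp ap bp; have -> : p = (1 / 2, 0); last exact: corner.
  move: ap bp; rewrite /alpha /beta => ap /eqP bp; rewrite -bp.
  have : p.2 = 0 by move: ap; rewrite bp (gt_eqF half_gt0) => /eqP.
  by case: (p) => ? ? /= ->.
- by move=> i /lE ri; apply: boxes; rewrite ?H0 ?lexx.
- move=> i /lE ri.
  (* This side is a union of two edges sharing the end (0, 0), so its acyclicity needs one more
     gluing. *)
  have -> : Q `&` [set p | alpha p] = [set p | 0 <= p.1 <= 0 /\ 0 <= p.2 <= H] `|`
      [set p | 0 <= p.1 <= 1 / 2 /\ 0 <= p.2 <= 0].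
    apply/seteqP; split=> p.
      by move=> [[k1 k2] /= /orP[/eqP k|/eqP k]]; [left|right]; split=> //=; rewrite k lexx.
    case=> -[/andP[k1 k2] /andP[k3 k4]]; split.
    + by split; apply/andP; split=> //; exact: le_trans k2 half0.
    + by apply/orP; left; rewrite eq_le k1 k2.
    + by split; apply/andP; split=> //; exact: le_trans k4 H0.
    + by apply/orP; right; rewrite eq_le k3 k4.
  have Q1 : [set p : R * R | 0 <= p.1 <= 0 /\ 0 <= p.2 <= H] `<=` Q.
    by move=> p [/andP[k1 k2] k3]; split=> //; apply/andP; split=> //; exact: le_trans k2 half0.
  have Q2 : [set p : R * R | 0 <= p.1 <= 1 / 2 /\ 0 <= p.2 <= 0] `<=` Q.
    by move=> p [k1 /andP[k2 k3]]; split=> //; apply/andP; split=> //; exact: le_trans k3 H0.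
  rewrite image_setU; apply: acyclicU.
  + apply: compact_separated_near => //; apply: continuous_image_compact => //; try exact: compact_box.
      by move=> p ?; apply: chart_cts => //; exact: Q1.
    by move=> p ?; apply: chart_cts => //; exact: Q2.
  + by apply: boxes; rewrite ?H0 ?lexx.
  + by apply: boxes; rewrite ?H0 ?lexx.
  rewrite (_ : _ `&` _ = ch i @` [set p | 0 <= p.1 <= 0 /\ 0 <= p.2 <= 0]).
    by apply: boxes; rewrite ?H0 ?lexx.
  apply/seteqP; split=> [x [[p Qp <-] [q Qq e]]|_ [p [k1 k2] <-]].
    have qp := disjoint ri ri (Q2 _ Qq) (Q1 _ Qp) e; rewrite qp in Qq.
    by exists p => //; case: Qp => ? _; case: Qq => _ ?; split.
  case/andP: (k1) => p10 p11; case/andP: (k2) => p20 p21.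
  split; exists p => //; split=> //; apply/andP; split=> //.
    exact: le_trans p21 H0.
  exact: le_trans p11 half0.
- move=> i /lE ri; have := boxes i (1 / 2) (1 / 2) H ri; rewrite !lexx H0 => k.
  have := k half0 isT isT isT; congr (acyclic M (_ @` _)); apply/seteqP; split=> p.
    move=> [/andP[p1 p1'] p2]; split; last by rewrite /= /beta eq_le p1 p1'.
    by split=> //; apply/andP; split=> //; exact: le_trans half0 p1.
  by move=> [[_ ?] /= /eqP ->]; rewrite lexx.
- move=> i /lE ri; have := boxes i (1 / 2) (1 / 2) 0 ri; rewrite !lexx H0 => k.
  have := k half0 isT isT isT; congr (acyclic M (_ @` _)); apply/seteqP; split=> p.
      move=> [/andP[p1 p1'] /andP[p2 p2']]; split.
      by split; apply/andP; split=> //; [exact: le_trans half0 p1|exact: le_trans p2' H0].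
    by apply/andP; split; [apply/orP; right; rewrite eq_le p2 p2'|rewrite /beta eq_le p1 p1'].
  move=> [[_ ?] /= /andP[ap /eqP bp]]; rewrite bp lexx; split=> //.
  by move: ap; rewrite /alpha bp (gt_eqF half_gt0) => /eqP ->; rewrite lexx.
Qed.

End Fibre.

Section Sectors.
Variables (S : nat -> X -> zmodType) (M : cochain_system S).
Implicit Types (s : R) (q : pt4).

Definition rho q : R := normsq (wc q) ^+ 6.
(* [rho q] is the modulus of [zeta q], so that [complex.Im (zeta q) / den s q] is, up to the sign [s],
   the tangent of half the argument of [s * zeta q]. *)
Definition den s q : R := rho q + s * complex.Re (zeta q).

Lemma rho_cts q : ctsR q rho.
Proof. by apply: ctsRX; exact: normsq_wc_cts. Qed.

Lemma den_cts s q : ctsR q (den s).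
Proof. by have [k _] := zeta_cts q; apply: ctsRD; [exact: rho_cts|apply: ctsRM => //; exact: ctsR_cst]. Qed.

Lemma zeta_norm q : funD q -> complex.Re (zeta q) ^+ 2 + complex.Im (zeta q) ^+ 2 = rho q ^+ 2.
Proof.
move=> F; rewrite -[LHS]/(normsq (zeta q)) /zeta normsqM !normsqX kb_normsq ?expr1n ?mulr1.
  by rewrite /rho -exprM.
by have := funD_x2 F; lra.
Qed.

Lemma sector_invariants s q q' : funD q -> funD q' -> prP q = prP q' ->
  [/\ hh q' = hh q, normsq (wc q') = normsq (wc q), zeta q' = zeta q & den s q' = den s q].
Proof.
move=> F F' e; have [xE yE wE zE] := funD_invariants F F' e.
by rewrite /den /rho wE zE /hh yE /arc xE.
Qed.

Lemma den0 s q : wc q = 0 -> den s q = 0.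
Proof.
move=> w0; have z : zeta q = 0 by rewrite /zeta w0 expr0n mul0r.
by rewrite /den /rho z w0 normsq0 expr0n /= mulr0 addr0.
Qed.

(** For the tangent T of the half-argument it reads [den] (1 + T^2) = 2 [rho]. *)
Lemma den_identity s q : s ^+ 2 = 1 -> funD q ->
  den s q ^+ 2 + complex.Im (zeta q) ^+ 2 = 2 * rho q * den s q.
Proof.
move=> s2 /zeta_norm zn; rewrite /den; move: zn; move: (complex.Re _) (complex.Im _) (rho q) => x y k zn.
have -> : (k + s * x) ^+ 2 + y ^+ 2 = k ^+ 2 + 2 * k * s * x + (s ^+ 2 * x ^+ 2 + y ^+ 2) by ring.
by rewrite s2 mul1r zn; ring.
Qed.

(** By [den_identity] the last condition bounds the tangent by N in absolute value. In this form it
    is closed and, as |w|^2 is at least r1 > 0, keeps [den] positive. *)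
Definition sector_box s r1 r2 (a b N H : R) : set pt4 := [set q | [/\ funD q, hh q <= H, r1 <= normsq (wc q) <= r2,
  a * den s q <= complex.Im (zeta q) <= b * den s q & 2 * rho q <= (1 + N ^+ 2) * den s q]].

Lemma sector_box_den s r1 r2 (a b N H : R) q : 0 < r1 -> sector_box s r1 r2 a b N H q -> 0 < den s q.
Proof.
move=> r10 [_ _ /andP[w1 _] _ d2]; have r0 : 0 < rho q by rewrite exprn_gt0 // (lt_le_trans r10).
have n0 : 0 < 1 + N ^+ 2 by have := sqr_ge0 N; lra.
by rewrite -(pmulr_rgt0 _ n0); lra.
Qed.

Lemma compact_sector_box s r1 r2 (a b N H : R) : compact (sector_box s r1 r2 a b N H).
Proof.
apply: (@subclosed_compact _ _ (tube_box r2 H)); [|exact: compact_tube_box|by move=> q [F k /andP[_ ?] _ _]].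
have cw := @normsq_wc_cts R; have ci q : ctsR q (fun q => complex.Im (zeta q)).
  by have [_ k] := zeta_cts q.
have cd (t : R) q : ctsR q (fun q => t * den s q).
  by apply: ctsRM; [exact: ctsR_cst|exact: den_cts].
have cr q : ctsR q (fun q => 2 * rho q) by apply: ctsRM; [exact: ctsR_cst|exact: rho_cts].
have cst (t : R) q : ctsR q (fun _ => t) by exact: ctsR_cst.
rewrite (_ : sector_box s r1 r2 a b N H = @funD R `&` [set q | hh q <= H] `&`
  ([set q | r1 <= normsq (wc q)] `&` [set q | normsq (wc q) <= r2]) `&`
  ([set q | a * den s q <= complex.Im (zeta q)] `&` [set q | complex.Im (zeta q) <= b * den s q]) `&`
  [set q | 2 * rho q <= (1 + N ^+ 2) * den s q]).
  apply: closedI; [apply: closedI; [apply: closedI; [apply: closedI|apply: closedI]|apply: closedI]|].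
  - exact: closed_funD.
  - exact: (@closed_leR R _ _ _ (@hh_cts R) (cst H)).
  - exact: (@closed_leR R _ _ _ (cst r1) cw).
  - exact: (@closed_leR R _ _ _ cw (cst r2)).
  - exact: (@closed_leR R _ _ _ (cd a) ci).
  - exact: (@closed_leR R _ _ _ ci (cd b)).
  - exact: (@closed_leR R _ _ _ cr (cd _)).
apply/seteqP; split=> q; first by move=> [? ? /andP[? ?] /andP[? ?] ?]; do 5?[split=> //].
by move=> [[[[? ?] [? ?]] [? ?]] ?]; split=> //; apply/andP.
Qed.

Lemma ler_sqr_norm (t N : R) : - N <= t -> t <= N -> t ^+ 2 <= N ^+ 2.
Proof. by move=> *; have : 0 <= (N - t) * (N + t) by [apply: mulr_ge0; lra]; lra. Qed.

(** Leray along |w|^2 and then along the tangent of the half-argument; fixing both fixes [zeta]. *)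
Lemma acyclic_sector_box s r1 r2 (a b N H : R) : s ^+ 2 = 1 -> 0 < r1 -> r1 <= r2 -> r2 <= 1 / 16 ->
  - N <= a -> a <= b -> b <= N -> 0 <= H ->
  acyclic M (@prP R @` sector_box s r1 r2 a b N H).
Proof.
move=> s2 r10 r12 r2h aN ab bN H0; set D := sector_box s r1 r2 a b N H; have hX := @hausdorff_GammaD R.
have cD : compact D by exact: compact_sector_box.
have cprP q : D q -> {for q, continuous (@prP R)} by move=> [F _ _ _ _]; apply: prP_cts; exact: siegel_funD.
have dpos q : D q -> 0 < den s q by exact: sector_box_den.
have inv q q' : D q -> D q' -> prP q = prP q' -> [/\ hh q' = hh q, normsq (wc q') = normsq (wc q),
  zeta q' = zeta q & den s q' = den s q] by move=> [F _ _ _ _] [F' _ _ _ _]; exact: sector_invariants.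
apply: (acyclic_leray hX (F := fun q => normsq (wc q)) (lo := r1) (hi := r2)) => //.
- by move=> q _; exact: normsq_wc_cts.
- by move=> q [_ _ ? _ _].
- by move=> q q' Dq Dq' /(inv _ _ Dq Dq')[_ -> _ _].
move=> r /andP[r1r rr2]; have r0 : 0 < r by lra.
apply: (acyclic_leray hX (F := fun q => complex.Im (zeta q) / den s q) (lo := a) (hi := b)) => //.
- by move=> q [Dq _]; exact: cprP.
- move=> q [Dq _]; have [_ k] := zeta_cts q.
  have kd : ctsR q (fun q => (den s q)^-1) by apply: ctsRV; [rewrite gt_eqF // dpos|exact: den_cts].
  exact: (ctsRM k kd).
- by apply: compact_closedI => //; apply: closed_eqR => t; [exact: normsq_wc_cts|exact: ctsR_cst].
- by move=> q [Dq _]; rewrite ler_pdivlMr ?ler_pdivrMr ?dpos //; case: Dq.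
- by move=> q q' [Dq _] [Dq' _] /(inv _ _ Dq Dq')[_ _ -> ->].
move=> t /andP[at1 tb]; have t2 := sqr_ge0 t; have n0 : 0 < 1 + t ^+ 2 by lra.
have tN : t ^+ 2 <= N ^+ 2.
  by apply: ler_sqr_norm; [exact: le_trans aN at1|exact: le_trans tb bN].
set k := r ^+ 6; have k0 : 0 < k by exact: exprn_gt0.
(* The value of [den] forced by [den_identity] when the tangent is t and [rho] is k. *)
pose e := 2 * k / (1 + t ^+ 2); have e0 : 0 < e by rewrite divr_gt0 // mulr_gt0.
have eE : e * (1 + t ^+ 2) = 2 * k by rewrite divfK // gt_eqF.
pose z0 : C := (s * (e - k)) +i* (t * e).
have nz : normsq z0 = r ^+ 12.
  rewrite /normsq /= exprMn s2 mul1r (_ : 12 = 6 * 2)%N // exprM -/k.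
  have -> : (e - k) ^+ 2 + (t * e) ^+ 2 = e * (e * (1 + t ^+ 2)) - 2 * k * e + k ^+ 2 by ring.
  by rewrite eE; ring.
have r01 : 0 <= r <= 1 / 16 by rewrite ltW //=; exact: le_trans rr2 r2h.
have := acyclic_zeta_fibre r01 nz H0 M.
congr (acyclic M (_ @` _)); apply/seteqP; split=> q.
  move=> [F hq zq].
  have wr : normsq (wc q) = r.
    have x2 := funD_x2 F; have : normsq (wc q) ^+ 12 = r ^+ 12.
      by rewrite -nz -zq /zeta normsqM !normsqX kb_normsq ?expr1n ?mulr1 //; move: x2; clear; lra.
    by move=> /pexpIrn; apply; rewrite ?nnegrE ?normsq_ge0 // ltW.
  have dE : den s q = e.
    rewrite /den /rho wr zq /= -/k; have -> : k + s * (s * (e - k)) = k + s ^+ 2 * (e - k) by ring.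
    by rewrite s2; ring.
  have iE : complex.Im (zeta q) = t * e by rewrite zq.
  have tE : complex.Im (zeta q) / den s q = t by rewrite iE dE mulfK // gt_eqF.
  split; [split; [|exact: wr]|exact: tE].
  split=> //; rewrite ?wr ?r1r //.
    by rewrite iE dE !ler_pM2r // at1.
  by rewrite dE /rho wr -/k -eE mulrC ler_pM2r // lerD2l.
move=> [[Dq wr'] tE']; have wr : normsq (wc q) = r := wr'.
have tE : complex.Im (zeta q) / den s q = t := tE'; have d0 := dpos _ Dq; have [F hq _ _ _] := Dq; split=> //.
have id := den_identity s2 F.
have iE : complex.Im (zeta q) = t * den s q by rewrite -tE divfK // gt_eqF.
have rE : rho q = k by rewrite /rho wr.
have dE : den s q = e.
  apply: (mulIf (lt0r_neq0 n0)); rewrite eE; apply: (mulIf (lt0r_neq0 d0)).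
  by move: id; rewrite iE rE => <-; ring.
have xE : s * complex.Re (zeta q) = e - k by rewrite -dE /den rE addrC addKr.
apply: complex_eq; last by rewrite iE dE.
by rewrite [RHS]/= -xE mulrA -expr2 s2 mul1r.
Qed.

Lemma nat_bounds (n0 n1 n2 n3 : nat) :
  let n := (n0 + n1 + n2 + n3)%N in [/\ (n0 <= n)%N, (n1 <= n)%N, (n2 <= n)%N & (n3 <= n)%N].
Proof. by split; lia. Qed.

Definition sector s (a_ b_ : nat -> R) : set X := @prP R @` [set q | [/\ funD q, normsq (wc q) < 1 / 16,
  0 < den s q & exists n, a_ n * den s q <= complex.Im (zeta q) <= b_ n * den s q]].

(** Sectors are exhausted by sector boxes with radii tending to 0 and 1/16, tangent bounds a_n and
    b_n, and growing height. *)
Lemma acyclic_sector s (a_ b_ : nat -> R) : s ^+ 2 = 1 -> (forall n, a_ n.+1 < a_ n) ->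
  (forall n, b_ n < b_ n.+1) -> (forall n, - n.+1%:R <= a_ n) -> (forall n, a_ n <= b_ n) ->
  (forall n, b_ n <= n.+1%:R) -> acyclic M (sector s a_ b_).
Proof.
move=> s2 aS bS aN ab bN.
pose c n : R := 1 / 16 * (n.+2)%:R^-1; pose d n : R := 1 / 16 * (1 - (n.+2)%:R^-1).
have i0 n : 0 < (n.+2)%:R^-1 :> R by rewrite invr_gt0.
have i2 n : (n.+2)%:R^-1 <= 1 / 2 :> R.
  by rewrite mul1r lef_pV2 ?posrE ?ltr0n // ler_nat.
have iS n : (n.+3)%:R^-1 < (n.+2)%:R^-1 :> R by rewrite ltf_pV2 ?posrE // ltr_nat.
have c0 n : 0 < c n by rewrite /c mulr_gt0 //; lra.
have cS n : c n.+1 < c n by rewrite /c ltr_pM2l //; lra.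
have dS n : d n < d n.+1 by rewrite /d ltr_pM2l; [rewrite ltrD2l ltrN2|lra].
have cd n : c n <= d n by rewrite /c /d ler_pM2l; [have := i2 n; move: (_^-1) => t ?; lra|lra].
have d16 n : d n < 1 / 16 by rewrite /d; have := i0 n; move: (_^-1) => t ?; lra.
have amono m n : (m <= n)%N -> a_ n <= a_ m.
  elim: n => [|n IH]; first by rewrite leqn0 => /eqP->.
  by rewrite leq_eqVlt => /orP[/eqP->|/IH k] //; apply: le_trans (ltW (aS n)) k.
have bmono m n : (m <= n)%N -> b_ m <= b_ n.
  elim: n => [|n IH]; first by rewrite leqn0 => /eqP->.
  by rewrite leq_eqVlt => /orP[/eqP->|/IH k] //; apply: le_trans k (ltW (bS n)).
pose K n := sector_box s (c n) (d n) (a_ n) (b_ n) n.+1%:R n%:R.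
(* Negations of the strict inequalities for stage n + 1; removing them from the tube gives an open
   set between two consecutive boxes. *)
pose bad n : set pt4 := [set q | normsq (wc q) <= c n.+1] `|` [set q | d n.+1 <= normsq (wc q)] `|`
  [set q | n.+1%:R <= hh q] `|` [set q | complex.Im (zeta q) <= a_ n.+1 * den s q] `|`
  [set q | b_ n.+1 * den s q <= complex.Im (zeta q)] `|` [set q | (1 + n.+2%:R ^+ 2) * den s q <= 2 * rho q].
have cbad n : closed (bad n).
  have cw := @normsq_wc_cts R; have ci q : ctsR q (fun q => complex.Im (zeta q)).
    by have [_ k] := zeta_cts q.
  have cd' (t : R) q : ctsR q (fun q => t * den s q).
    by apply: ctsRM; [exact: ctsR_cst|exact: den_cts].
  have cr q : ctsR q (fun q => 2 * rho q) by apply: ctsRM; [exact: ctsR_cst|exact: rho_cts].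
  have cst (t : R) q : ctsR q (fun _ => t) by exact: ctsR_cst.
  apply: closedU; [apply: closedU; [apply: closedU; [apply: closedU; [apply: closedU|]|]|]|].
  - exact: (@closed_leR R _ _ _ cw (cst _)).
  - exact: (@closed_leR R _ _ _ (cst _) cw).
  - exact: (@closed_leR R _ _ _ (cst _) (@hh_cts R)).
  - exact: (@closed_leR R _ _ _ ci (cd' _)).
  - exact: (@closed_leR R _ _ _ (cd' _) ci).
  - exact: (@closed_leR R _ _ _ (cd' _) cr).
pose O n : set X := @tube R `&` ~` (@prP R @` (@funD R `&` bad n)).
apply: (@acyclic_exhaust X S M _ (fun n => @prP R @` K n) O).
- move=> n _ [q Dq <-]; have d0 := sector_box_den (c0 n) Dq; have [F hq /andP[w1 w2] /andP[z1 z2] dq] := Dq.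
  split; first by exists q => //; split=> //; have := d16 n; lra.
  move=> [q' [F' b'] /esym e]; have [hE wE zE dE] := sector_invariants s F F' e.
  have rE : rho q' = rho q by rewrite /rho wE.
  have ka : a_ n.+1 * den s q < a_ n * den s q by rewrite ltr_pM2r.
  have kb' : b_ n * den s q < b_ n.+1 * den s q by rewrite ltr_pM2r.
  have kn : (1 + n.+1%:R ^+ 2) * den s q < (1 + n.+2%:R ^+ 2) * den s q.
    by rewrite ltr_pM2r // ltrD2l ltrXn2r ?nnegrE ?ler0n // ltr_nat.
  have nn : n%:R < n.+1%:R :> R by rewrite ltr_nat.
  have := cS n; have := dS n.
  move=> dn cn; case: b' => [[[[[|]|]|]|]|] k.
  - have : normsq (wc q') <= c n.+1 := k.
    by apply/negP; rewrite -ltNge wE; apply: lt_le_trans w1.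
  - have : d n.+1 <= normsq (wc q') := k.
    by apply/negP; rewrite -ltNge wE; apply: le_lt_trans dn.
  - have : n.+1%:R <= hh q' := k.
    by apply/negP; rewrite -ltNge hE; apply: le_lt_trans nn.
  - have : complex.Im (zeta q') <= a_ n.+1 * den s q' := k.
    by apply/negP; rewrite -ltNge zE dE; apply: lt_le_trans z1.
  - have : b_ n.+1 * den s q' <= complex.Im (zeta q') := k.
    by apply/negP; rewrite -ltNge zE dE; apply: le_lt_trans kb'.
  - have : (1 + n.+2%:R ^+ 2) * den s q' <= 2 * rho q' := k.
    by apply/negP; rewrite -ltNge rE dE; apply: le_lt_trans kn.
- move=> n _ [[q [F w16] <-] nb].
  have g (E : bool) : (E -> bad n q) -> ~~ E by move=> h; apply/negP => /h k; apply: nb; exists q.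
  have g1 : c n.+1 < normsq (wc q) by rewrite ltNge; apply: g => k; do 5!left.
  have g2 : normsq (wc q) < d n.+1 by rewrite ltNge; apply: g => k; do 4!left; right.
  have g3 : hh q < n.+1%:R by rewrite ltNge; apply: g => k; do 3!left; right.
  have g4 : a_ n.+1 * den s q < complex.Im (zeta q) by rewrite ltNge; apply: g => k; do 2!left; right.
  have g5 : complex.Im (zeta q) < b_ n.+1 * den s q by rewrite ltNge; apply: g => k; left; right.
  have g6 : 2 * rho q < (1 + n.+2%:R ^+ 2) * den s q by rewrite ltNge; apply: g => k; right.
  by exists q => //; split=> //; rewrite ?(ltW g1) ?(ltW g2) ?(ltW g3) ?(ltW g4) ?(ltW g5) ?(ltW g6).
- move=> n; apply: openI; first exact: open_tube.
  by apply: closed_openC; apply: closed_funD_image.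
- apply/seteqP; split=> [_ [n _ [q Dq <-]]|_ [q [F w16 d0 [n0 /andP[z1 z2]]] <-]].
    have d0 := sector_box_den (c0 n) Dq; have [F hq /andP[w1 w2] zz dq] := Dq.
    by exists q => //; split=> //; [have := d16 n; lra|exists n].
  have w0 : 0 < normsq (wc q).
    by rewrite lt_def normsq_ge0 andbT; apply/eqP => w0; move: d0; rewrite den0 ?ltxx //; exact: normsq_eq0.
  have [h0 _] := funD_hh F.
  have arch (t : R) : 0 < t -> exists n : nat, t^-1 <= n%:R.
    by move=> t0; exists (Num.Def.archi_bound t^-1); rewrite ltW // archi_boundP // invr_ge0 ltW.
  have [n1 k1] : exists n : nat, hh q <= n%:R.
    by exists (Num.Def.archi_bound (hh q)); rewrite ltW // archi_boundP.
  have m1 : 0 < 1 - 16 * normsq (wc q) by lra.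
  have m2 : 0 < 16 * normsq (wc q) by rewrite mulr_gt0.
  have [n2 k2] := arch _ m1; have [n3 k3] := arch _ m2.
  have inv (t : R) (m : nat) : 0 < t -> t^-1 <= m%:R -> forall n, (m <= n)%N -> (n.+2)%:R^-1 <= t.
    move=> t0 tm n mn; rewrite -[X in _ <= X]invrK lef_pV2 ?posrE ?invr_gt0 //; apply: le_trans tm _.
    by rewrite ler_nat (leq_trans mn) // leqW // leqW.
  have [] := nat_bounds n0 n1 n2 n3; move: (_ + _)%N => n l0 l1 l2 l3.
  have i1 := inv _ _ m1 k2 n l2; have i3 := inv _ _ m2 k3 n l3.
  have za : a_ n * den s q <= complex.Im (zeta q).
    by apply: le_trans z1; rewrite ler_pM2r // amono.
  have zb : complex.Im (zeta q) <= b_ n * den s q.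
    by apply: le_trans z2 _; rewrite ler_pM2r // bmono.
  exists n => //; exists q => //; split=> //.
  + by apply: le_trans k1 _; rewrite ler_nat.
  + by rewrite /c /d; move: (_^-1) i1 i3; clear => t i1 i3; apply/andP; split; lra.
  + by rewrite za zb.
  rewrite -(ler_pM2r d0) -(den_identity s2 F).
  have u1 : - n.+1%:R * den s q <= complex.Im (zeta q) by apply: le_trans za; rewrite ler_pM2r.
  have u2 : complex.Im (zeta q) <= n.+1%:R * den s q by apply: le_trans zb _; rewrite ler_pM2r.
  have : 0 <= (n.+1%:R * den s q - complex.Im (zeta q)) * (n.+1%:R * den s q + complex.Im (zeta q)).
    by apply: mulr_ge0; [rewrite subr_ge0|rewrite -[leLHS](addNr (n.+1%:R * den s q)) addrC lerD2l -mulNr].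
  by clear; lra.
- by move=> n; apply: acyclic_sector_box => //; exact: ltW (d16 n).
Qed.

End Sectors.
End ZetaFibre.

(** * The covering *)

Section Assembly.
Local Open Scope complex_scope.
Variable R : realType.
Local Notation pt4 := (pt4 R).
Local Notation X := (GammaD R).
Implicit Types (s : R) (q : pt4) (x : X).

Definition invariant (E : set pt4) := forall q q', funD q -> funD q' -> prP q = prP q' -> E q -> E q'.

Definition tube_part (E : set pt4) : set X :=
  @prP R @` [set q | [/\ funD q, normsq (wc q) < 1 / 16 & E q]].

Lemma tube_partE (E : set pt4) q : invariant E -> funD q -> tube_part E (prP q) -> E q.
Proof. by move=> iE F [q' [F' _ Eq'] /iE]; apply. Qed.

Lemma open_tube_part (E : set pt4) : invariant E -> closed (~` E) -> open (tube_part E).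
Proof.
move=> iE cE; have -> : tube_part E = @tube R `&` ~` (@prP R @` (@funD R `&` ~` E)).
  apply/seteqP; split=> [_ [q [F w16 Eq] <-]|_ [[q [F w16] <-] nE]].
    by split; [exists q|move=> [q' [F' nE'] /esym e]; apply: nE'; exact: iE e Eq].
  by exists q => //; split=> //; apply: contrapT => nEq; apply: nE; exists q.
apply: openI; first exact: open_tube.
by apply: closed_openC; exact: closed_funD_image.
Qed.

(** On [funD], [den s] vanishes exactly where s times [zeta] is real and nonpositive: this is the
    plane slit along the ray opposite to s, zero included. *)
Definition denpos s : set pt4 := [set q | 0 < den s q].
Definition impos s : set pt4 := [set q | 0 < s * complex.Im (zeta q)].

Lemma denposE s q : denpos s q = (0 < den s q) :> Prop. Proof. by []. Qed.
Lemma imposE s q : impos s q = (0 < s * complex.Im (zeta q)) :> Prop. Proof. by []. Qed.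

Lemma invariant_denpos s : invariant (denpos s).
Proof.
move=> q q' F F' e; have [_ _ _ dE] := sector_invariants s F F' e.
by rewrite !denposE dE.
Qed.

Lemma invariant_impos s : invariant (impos s).
Proof.
move=> q q' F F' e; have [_ _ zE _] := sector_invariants s F F' e.
by rewrite !imposE zE.
Qed.

Lemma closed_lt_compl (f : pt4 -> R) : (forall q, ctsR q f) -> closed (~` [set q | 0 < f q]).
Proof.
move=> cf; have cst q : ctsR q (fun _ => 0 : R) by exact: ctsR_cst.
have := @closed_leR R _ _ _ cf cst; congr closed.
by apply/seteqP; split=> q; [move=> k; apply/negP; rewrite -leNgt|move/negP; rewrite -leNgt].
Qed.

Lemma open_denpos s : open (tube_part (denpos s)).
Proof. by apply: open_tube_part; [exact: invariant_denpos|exact: closed_lt_compl (@den_cts R s)]. Qed.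

Lemma open_impos s : open (tube_part (impos s)).
Proof.
apply: open_tube_part; first exact: invariant_impos.
apply: (@closed_lt_compl (fun q => s * complex.Im (zeta q))) => q.
by have [_ k] := zeta_cts q; apply: ctsRM => //; exact: ctsR_cst.
Qed.

Lemma den_ge0 s q : s ^+ 2 = 1 -> funD q -> 0 <= den s q.
Proof.
move=> s2 F; rewrite leNgt; apply/negP => d0.
have id := den_identity s2 F; have y2 := sqr_ge0 (complex.Im (zeta q)).
have r0 : 0 <= rho q by rewrite exprn_ge0 // normsq_ge0.
have d2 : 0 < den s q * den s q by rewrite nmulr_rgt0.
have rd : 0 <= rho q * - den s q by rewrite mulr_ge0 //; lra.
have : (1 : R) = 0 by lra.
by move/eqP; rewrite oner_eq0.
Qed.

Lemma den_gt0 s q : s ^+ 2 = 1 -> funD q -> complex.Im (zeta q) != 0 -> 0 < den s q.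
Proof.
move=> s2 F y0; rewrite lt_def den_ge0 // andbT; apply/eqP => d0.
move: (den_identity s2 F); rewrite d0 expr0n mulr0 /= add0r => /eqP.
by rewrite sqrf_eq0 (negPf y0).
Qed.

(** Both slit planes contain [zeta] exactly when it is not real, so their intersection is the union
    of the two half planes. *)
Lemma den_mul q : funD q -> den 1 q * den (-1) q = complex.Im (zeta q) ^+ 2.
Proof. by move=> /zeta_norm zn; rewrite /den; lra. Qed.

Lemma den_add q : den 1 q + den (-1) q = 2 * rho q.
Proof. by rewrite /den; ring. Qed.

Lemma archi_pos (d y : R) : 0 < d -> exists n : nat, y <= n.+1%:R * d.
Proof.
move=> d0; exists (Num.Def.archi_bound `|y / d|); rewrite -ler_pdivrMr //.
apply: le_trans (ler_norm _) _; apply/ltW/(lt_trans (archi_boundP _)) => //.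
by rewrite ltr_nat.
Qed.

Lemma archi_both (d y : R) : 0 < d -> exists n : nat, - n.+1%:R * d <= y <= n.+1%:R * d.
Proof.
move=> d0; have [n k] := archi_pos `|y| d0; exists n.
by rewrite mulNr -ler_norml.
Qed.

Lemma archi_inv (d y : R) : 0 < d -> 0 < y -> exists n : nat, n.+1%:R^-1 * d <= y <= n.+1%:R * d.
Proof.
move=> d0 y0; have [n k] := archi_pos d y0; have [m l] := archi_pos y d0.
exists (maxn n m); apply/andP; split.
  rewrite mulrC ler_pdivrMr ?ltr0n // mulrC; apply: le_trans k _.
  by rewrite ler_pM2r // ler_nat ltnS leq_maxl.
by apply: le_trans l _; rewrite ler_pM2r // ler_nat ltnS leq_maxr.
Qed.

Lemma denpos_sector s :
  tube_part (denpos s) = sector s (fun n => - n.+1%:R) (fun n => n.+1%:R).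
Proof.
apply/seteqP; split=> [_ [q [F w d] <-]|_ [q [F w d _] <-]]; exists q => //; split=> //.
exact: archi_both.
Qed.

Lemma impos_sector1 :
  tube_part (impos 1) = sector 1 (fun n => n.+1%:R^-1) (fun n => n.+1%:R).
Proof.
apply/seteqP; split=> [_ [q [F w y] <-]|_ [q [F w d [n /andP[k _]]] <-]]; exists q => //; split=> //.
- by apply: den_gt0; rewrite ?expr1n //; move: y; rewrite imposE mul1r => /lt0r_neq0.
- have y' : 0 < complex.Im (zeta q) by move: y; rewrite imposE mul1r.
  by apply: archi_inv => //; apply: den_gt0; rewrite ?expr1n // lt0r_neq0.
rewrite imposE mul1r; apply: lt_le_trans k.
by rewrite mulr_gt0 // invr_gt0.
Qed.

Lemma impos_sectorN1 :
  tube_part (impos (-1)) = sector 1 (fun n => - n.+1%:R) (fun n => - n.+1%:R^-1).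
Proof.
have iE q : impos (-1) q = (0 < - complex.Im (zeta q)) :> Prop.
  by rewrite imposE mulN1r.
apply/seteqP; split=> [z [q [F w y <-]]|_ [q [F w d [n /andP[_ k]]] <-]]; last first.
  exists q => //; split=> //; rewrite iE oppr_gt0; apply: le_lt_trans k _.
  by rewrite mulNr oppr_lt0 mulr_gt0 // invr_gt0.
rewrite iE in y; have d : 0 < den 1 q.
  by apply: den_gt0; rewrite ?expr1n // -oppr_eq0 lt0r_neq0.
exists q => //; split=> //; have [n /andP[k l]] := archi_inv d y; exists n.
by rewrite !mulNr lerNl l lerNr k.
Qed.

Section System.
Variables (S : nat -> X -> zmodType) (M : cochain_system S).

Let natS n : n.+1%:R < n.+2%:R :> R. Proof. by rewrite ltr_nat. Qed.
Let nat0 n : 0 < n.+1%:R :> R. Proof. by rewrite ltr0n. Qed.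
Let nat1 n : 1 <= n.+1%:R :> R. Proof. by rewrite ler1n. Qed.
Let invS n : n.+2%:R^-1 < n.+1%:R^-1 :> R. Proof. by rewrite ltf_pV2 ?posrE. Qed.
Let inv1 n : n.+1%:R^-1 <= 1 :> R. Proof. by rewrite invf_le1. Qed.
Let inv0 n : 0 < n.+1%:R^-1 :> R. Proof. by rewrite invr_gt0. Qed.
Let inv_nat n : n.+1%:R^-1 <= n.+1%:R :> R. Proof. exact: le_trans (inv1 n) (nat1 n). Qed.

Lemma acyclic_denpos s : s ^+ 2 = 1 -> acyclic M (tube_part (denpos s)).
Proof.
move=> s2; rewrite denpos_sector; apply: acyclic_sector => // n; first by rewrite ltrN2.
by apply: le_trans (ltW (nat0 n)); rewrite oppr_le0 ltW.
Qed.

Lemma acyclic_impos1 : acyclic M (tube_part (impos 1)).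
Proof.
rewrite impos_sector1; apply: acyclic_sector => //; first by rewrite expr1n.
by move=> n; apply: le_trans (ltW (inv0 n)); rewrite oppr_le0 ltW.
Qed.

Lemma acyclic_imposN1 : acyclic M (tube_part (impos (-1))).
Proof.
rewrite impos_sectorN1; apply: acyclic_sector => //; first by rewrite expr1n.
- by move=> n; rewrite ltrN2.
- by move=> n; rewrite ltrN2.
- by move=> n; rewrite lerN2.
by move=> n; apply: le_trans (ltW (nat0 n)); rewrite oppr_le0 ltW.
Qed.

End System.

Lemma tube_spherical : tube_part (denpos 1) `|` tube_part (denpos (-1)) = @tube R `&` @spherical R.
Proof.
apply/seteqP; split=> [z|_ [[q [F w16] <-]]].
  have part s : tube_part (denpos s) `<=` @tube R `&` @spherical R.
    move=> _ [q [F w16 d] <-]; split; first by exists q.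
    by apply/spherical_funD => // w0; move: d; rewrite denposE den0 // ltxx.
  by case; exact: part.
move=> /(spherical_funD F) w0.
have r0 : 0 < rho q.
  rewrite exprn_gt0 // lt_def normsq_ge0 andbT; apply/eqP => e; apply: w0; exact: normsq_eq0.
have [d|d] := ltP 0 (den 1 q); first by left; exists q.
right; exists q => //; split=> //; rewrite denposE.
by have := den_add q; lra.
Qed.

Lemma impos_union : tube_part (impos 1) `|` tube_part (impos (-1)) =
  tube_part (denpos 1) `&` tube_part (denpos (-1)).
Proof.
have s1 : (1 : R) ^+ 2 = 1 by rewrite expr1n.
have s2 : (-1 : R) ^+ 2 = 1 by rewrite sqrrN expr1n.
apply/seteqP; split=> [z|_ [[q [F w16 d] <-] k]].
  have part s : tube_part (impos s) `<=` tube_part (denpos 1) `&` tube_part (denpos (-1)).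
    move=> _ [q [F w16 y] <-]; have y0 : complex.Im (zeta q) != 0.
      by apply/eqP => y0; move: y; rewrite imposE y0 mulr0 ltxx.
    by split; exists q => //; split=> //; exact: den_gt0.
  by case; exact: part.
have d' : 0 < den (-1) q := tube_partE (@invariant_denpos (-1)) F k.
have dd : 0 < complex.Im (zeta q) ^+ 2 by rewrite -den_mul // mulr_gt0.
have [y|y] := ltP 0 (complex.Im (zeta q)).
  by left; exists q => //; split=> //; rewrite imposE mul1r.
right; exists q => //; split=> //; rewrite imposE mulN1r oppr_gt0.
by rewrite lt_def y andbT; apply/eqP => e; move: dd; rewrite -e expr0n ltxx.
Qed.

Lemma impos_disjoint : tube_part (impos 1) `&` tube_part (impos (-1)) = set0.
Proof.
apply/seteqP; split=> // _ [[q [F w16 y] <-] k].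
have z : 0 < -1 * complex.Im (zeta q) := tube_partE (@invariant_impos (-1)) F k.
have y' : 0 < 1 * complex.Im (zeta q) := y.
have : (1 : R) = 0 by lra.
by move/eqP; rewrite oner_eq0.
Qed.

End Assembly.

Theorem theorem11p6 (R : realType) (k : nat) :
  let H : zmodType := sheaf_cohomology (constant_sheaf (GammaD R) int) k in
  ((k = 0 \/ k = 2)%N -> exists f : {additive H -> int}, bijective f) /\
  ((k = 1 \/ (3 <= k))%N -> forall c : H, c = 0).
Proof.
have UV : @tube R `|` @spherical R = setT.
  by apply/seteqP; split=> // x _; have [V|U] := tube_cover x; [right|left].
have s1 : (1 : R) ^+ 2 = 1 by rewrite expr1n.
have s2 : (-1 : R) ^+ 2 = 1 by rewrite sqrrN expr1n.
exact: (sphere_cohomology (@open_tube R) (@open_spherical R) (@open_denpos R 1) (@open_denpos R (-1))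
  (@open_impos R 1) (@open_impos R (-1)) UV (@tube_spherical R) (@impos_union R) (@impos_disjoint R)
  (acyclic_tube _) (acyclic_spherical _) (acyclic_denpos _ s1) (acyclic_denpos _ s2)
  (acyclic_impos1 _) (acyclic_imposN1 _)).
Qed.
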